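(* Let $X$ be a complex manifold (with a countable basis) and $X'\subset X$ an open set. For all $p,q$ there is a canonical isomorphism $$H^{p,q}_{\bar\vartheta}(X,X')\simeq H^{q}(X,X';\mathscr{O}^{(p)}).$$
   Context: $\mathscr{O}^{(p)}$ is the sheaf of holomorphic $p$-forms on $X$ and $\mathscr{E}^{(p,q)}$ the sheaf of $C^\infty$ $(p,q)$-forms on $X$, with $\bar\partial:\mathscr{E}^{(p,q)}\to\mathscr{E}^{(p,q+1)}$. $H^q(X,X';\mathscr{O}^{(p)})$ is the relative (local) sheaf cohomology: the $q$-th cohomology of the complex of sections over $X$ vanishing on $X'$ of a flabby (e.g. Godement) resolution of $\mathscr{O}^{(p)}$. The relative Dolbeault cohomology $H^{p,q}_{\bar\vartheta}(X,X')$ is the $q$-th cohomology of the complex with $q$-cochains the pairs $(\xi_1,\xi_{01})\in\mathscr{E}^{(p,q)}(X)\oplus\mathscr{E}^{(p,q-1)}(X')$ and differential $\bar\vartheta(\xi_1,\xi_{01})=(\bar\partial\xi_1,\ \xi_1|_{X'}-\bar\partial\xi_{01})$. *)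

(* Defs.v *)
From mathcomp Require Import all_boot all_order all_algebra.
From mathcomp Require Import complex.
From mathcomp Require Import boolp classical_sets functions reals.
From mathcomp Require Import topology normedtype derive.

Set Implicit Arguments.
Unset Strict Implicit.
Unset Printing Implicit Defensive.

Import Order.TTheory GRing.Theory Num.Theory.
Import numFieldNormedType.Exports.

Local Open Scope classical_set_scope.
Local Open Scope ring_scope.

(* R[i] packed as a number field, so that the normed topology that
   MathComp-Analysis puts on every numFieldType is inferred on it. *)
Definition Cplx (R : realType) : numClosedFieldType := R[i].

Section Calculus.
Variables (R : realType) (n : nat).
Local Notation C := (Cplx R).
Implicit Types (f : 'rV[C]_n -> C) (v w z : 'rV[C]_n) (D : set 'rV[C]_n).

Definition re_line f v z (t : R) : R := complex.Re (f (z + (t%:C)%C *: v)).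
Definition im_line f v z (t : R) : R := complex.Im (f (z + (t%:C)%C *: v)).

(* Derivative of f at z in the direction v for the underlying REAL structure:
   f need not be complex differentiable. *)
Definition real_derivable f v z : Prop :=
  derivable (re_line f v z) 0 1 /\ derivable (im_line f v z) 0 1.

Definition real_derive v f z : C :=
  Complex (derive1 (re_line f v z) 0) (derive1 (im_line f v z) 0).

(* C^k on an open set D; conditions at points of D only. *)
Fixpoint Cn_on (k : nat) D f : Prop :=
  (forall z, D z -> {for z, continuous f}) /\
  if k is k'.+1 then
    forall v, (forall z, D z -> real_derivable f v z) /\
              Cn_on k' D (real_derive v f)
  else True.

Definition smooth_on D f : Prop := forall k, Cn_on k D f.

(* The conjugate-linear part, in w, of the real differential of f at z:
   \sum_j (conj w_j) * (df / d zbar_j). *)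
Definition dbar_derive w f z : C :=
  2^-1 * (real_derive w f z + 'i * real_derive ('i *: w) f z).

(* Functions of the rows of a matrix that are alternating and s-semilinear in
   each row; the multilinearity clause has the shape of
   [determinant_multilinear]. *)
Definition alternating_for (s : C -> C) m (g : 'M[C]_(m, n) -> C) : Prop :=
  (forall M N P i b c, row i M = b *: row i N + c *: row i P ->
     row' i N = row' i M -> row' i P = row' i M ->
     g M = s b * g N + s c * g P) /\
  (forall M i j, i != j -> row i M = row j M -> g M = 0).

End Calculus.

(* An atlas of complex dimension n. [chart_inv i] is only meaningful on the
   image of [chart_dom i]. *)
Record complex_atlas (R : realType) (n : nat) (X : topologicalType) := {
  chart_idx : Type ;
  chart_dom : chart_idx -> set X ;
  chart : chart_idx -> X -> 'rV[Cplx R]_n ;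
  chart_inv : chart_idx -> 'rV[Cplx R]_n -> X ;
  open_chart_dom : forall i, open (chart_dom i) ;
  chart_cover : \bigcup_i chart_dom i = [set: X] ;
  open_chart_cod : forall i, open (chart i @` chart_dom i) ;
  chartK : forall i x, chart_dom i x -> chart_inv i (chart i x) = x ;
  chart_continuous : forall i x, chart_dom i x -> {for x, continuous (chart i)} ;
  chart_inv_continuous : forall i z, (chart i @` chart_dom i) z ->
    {for z, continuous (chart_inv i)} ;
  transition_holomorphic : forall i j z,
    (chart i @` (chart_dom i `&` chart_dom j)) z ->
    differentiable (chart j \o chart_inv i) z
}.

Section Forms.
Variables (R : realType) (n : nat) (X : topologicalType).
Variable A : complex_atlas R n X.
Local Notation C := (Cplx R).
Implicit Types (U V : set X) (i j : chart_idx A) (z : 'rV[C]_n).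

(* The part of U seen in the chart i, as a subset of C^n. *)
Definition chart_image i U : set 'rV[C]_n := chart i @` (chart_dom i `&` U).

Definition transition i j : 'rV[C]_n -> 'rV[C]_n := chart j \o chart_inv i.

(* Local expressions, one per chart. The expression of a (p,q)-form omega at z
   is the value of omega on p holomorphic tangent vectors (rows of v) and q
   antiholomorphic ones: row w_k of w stands for \sum_j (conj w_kj) d/d zbar_j,
   so that dz_I /\ dzbar_J has value det (v_I) * det (conj w_J). *)
Definition form p q : lmodType C :=
  chart_idx A -> 'rV[C]_n -> 'M[C]_(p, n) -> 'M[C]_(q, n) -> C^o.

(* (p,q)-forms on U without regularity: they vanish outside U by convention, so
   that forms equal on U are equal terms, and the local expressions agree on
   the overlaps of charts. *)
Definition raw_form U p q (omega : form p q) : Prop :=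
  [/\ forall i z, ~ chart_image i U z -> omega i z = 0,
      forall i z w, alternating_for idfun (fun v => omega i z v w),
      forall i z v, alternating_for Num.conj (omega i z v) &
      forall i j z v w, chart_image i (U `&` chart_dom j) z ->
        omega i z v w = omega j (transition i j z)
          (v *m 'J (transition i j) z) (w *m 'J (transition i j) z)].

Definition smooth_forms p q U : set (form p q) :=
  [set omega | raw_form U omega /\
    forall i v w, smooth_on (chart_image i U) (fun z => omega i z v w)].

Definition holo_forms p U : set (form p 0) :=
  [set omega | raw_form U omega /\
    forall i v w z, chart_image i U z ->
      differentiable (fun y => omega i y v w : C) z].

Definition form_res p q V (omega : form p q) : form p q :=
  fun i => patch (fun=> 0) (chart_image i V) (omega i).

(* (dbar omega)(v; w_0,..,w_q) =
   (-1)^p \sum_k (-1)^k (dbar_(w_k) omega)(v; w_0,..,^w_k,..,w_q) *)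
Definition dbar p q U (omega : form p q) : form p q.+1 :=
  form_res U (fun i z v w => (-1) ^+ p * \sum_(k < q.+1) (-1) ^+ k *
    dbar_derive (row k w) (fun y => omega i y v (row' k w)) z).

End Forms.

(* Cochain complexes whose cochains form a subspace of an ambient module. *)
Record complex_in (K : pzRingType) := {
  ambient : nat -> lmodType K ;
  cochains : forall q, set (ambient q) ;
  coboundary : forall q, ambient q -> ambient q.+1
}.

Section Cohomology.
Variables (K : pzRingType) (E F : complex_in K).

Definition cocycles (G : complex_in K) q : set (ambient G q) :=
  [set c | cochains c /\ coboundary c = 0].

Definition coboundaries (G : complex_in K) q : set (ambient G q) :=
  match q with
  | 0 => [set 0]
  | q'.+1 => @coboundary _ G q' @` @cochains _ G q'
  end.

Definition coh_class (G : complex_in K) q (c : ambient G q) :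
    set (ambient G q) :=
  [set c + b | b in @coboundaries G q].

(* The quotient cocycles / coboundaries, as a set of cosets. *)
Definition cohomology (G : complex_in K) q : set (set (ambient G q)) :=
  @coh_class G q @` @cocycles G q.

Definition coh_iso q (Phi : set (ambient E q) -> set (ambient F q)) : Prop :=
  set_bij (@cohomology E q) (@cohomology F q) Phi /\
  forall a c c' s s', @cocycles E q c -> @cocycles E q c' ->
    @cocycles F q s -> @cocycles F q s' ->
    Phi (coh_class c) = coh_class s -> Phi (coh_class c') = coh_class s' ->
    Phi (coh_class (a *: c + c')) = coh_class (a *: s + s').

End Cohomology.

Section RelativeDolbeault.
Variables (R : realType) (n : nat) (X : topologicalType).
Variables (A : complex_atlas R n X) (p : nat) (X' : set X).

(* Forms of type (p,-1) are zero; the ambient second component in degree 0 is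
   the placeholder form A p 0. *)
Definition rdolb_ambient q : lmodType (Cplx R) :=
  (form A p q * form A p q.-1)%type.

Definition rdolb_cochains q : set (rdolb_ambient q) :=
  match q return set (rdolb_ambient q) with
  | 0 => [set xi | smooth_forms setT xi.1 /\ xi.2 = 0]
  | q'.+1 => [set xi | smooth_forms setT xi.1 /\ smooth_forms X' xi.2]
  end.

Definition vartheta q : rdolb_ambient q -> rdolb_ambient q.+1 :=
  match q return rdolb_ambient q -> rdolb_ambient q.+1 with
  | 0 => fun xi => (dbar setT xi.1, form_res X' xi.1)
  | q'.+1 => fun xi => (dbar setT xi.1, form_res X' xi.1 - dbar X' xi.2)
  end.

Definition relative_dolbeault : complex_in (Cplx R) :=
  {| ambient := rdolb_ambient;
     cochains := rdolb_cochains;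
     coboundary := vartheta |}.

End RelativeDolbeault.

(* Only the values on open sets, and restrictions to smaller open sets, are
   meaningful. *)
Record sheaf (K : pzRingType) (X : topologicalType) := {
  sec :> set X -> lmodType K ;
  rst : forall U V, {linear sec U -> sec V} ;
  rst_id : forall U s, open U -> rst U U s = s ;
  rst_comp : forall U V W s, open U -> open V -> open W ->
    V `<=` U -> W `<=` V -> rst V W (rst U V s) = rst U W s ;
  sheaf_glue : forall (I : Type) (V : I -> set X) (s : forall i, sec (V i)),
    (forall i, open (V i)) ->
    (forall i j, rst (V i) (V i `&` V j) (s i) =
                 rst (V j) (V i `&` V j) (s j)) ->
    exists! t : sec (\bigcup_i V i), forall i, rst _ (V i) t = s i
}.

Definition flabby (K : pzRingType) (X : topologicalType) (F : sheaf K X) :=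
  forall U (s : F U), open U -> exists t : F setT, rst F setT U t = s.

Section Resolutions.
Variables (R : realType) (n : nat) (X : topologicalType).
Variables (A : complex_atlas R n X) (p : nat).
Local Notation C := (Cplx R).

(* 0 -> O^(p) -> F^0 -> F^1 -> ... exact as a sequence of sheaves, every F^q
   being flabby. *)
Record flabby_resolution := {
  res_sheaf : nat -> sheaf C X ;
  res_flabby : forall q, flabby (res_sheaf q) ;
  res_d : forall q U, {linear res_sheaf q U -> res_sheaf q.+1 U} ;
  res_aug : forall U, form A p 0 -> res_sheaf 0 U ;
  res_d_rst : forall q U V s, open U -> open V -> V `<=` U ->
    rst (res_sheaf q.+1) U V (res_d q U s) = res_d q V (rst (res_sheaf q) U V s) ;
  res_aug_linear : forall U a omega eta, open U ->
    holo_forms U omega -> holo_forms U eta ->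
    res_aug U (a *: omega + eta) = a *: res_aug U omega + res_aug U eta ;
  res_aug_rst : forall U V omega, open U -> open V -> V `<=` U ->
    holo_forms U omega ->
    rst (res_sheaf 0) U V (res_aug U omega) = res_aug V (form_res V omega) ;
  res_aug_inj : forall U omega, open U -> holo_forms U omega ->
    res_aug U omega = 0 -> omega = 0 ;
  res_d_aug : forall U omega, open U -> holo_forms U omega ->
    res_d 0 U (res_aug U omega) = 0 ;
  res_d_d : forall q U s, open U -> res_d q.+1 U (res_d q U s) = 0 ;
  res_exact0 : forall U s, open U -> res_d 0 U s = 0 ->
    forall x, U x -> exists V omega, [/\ open V, V x, V `<=` U,
      holo_forms V omega & rst (res_sheaf 0) U V s = res_aug V omega] ;
  res_exactS : forall q U s, open U -> res_d q.+1 U s = 0 ->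
    forall x, U x -> exists V t, [/\ open V, V x, V `<=` U &
      rst (res_sheaf q.+1) U V s = res_d q V t]
}.

(* Sections over X of the resolution that vanish on X'; its cohomology is
   H^q(X, X'; O^(p)). *)
Definition relative_sections (F : flabby_resolution) (X' : set X) :
    complex_in C :=
  {| ambient := fun q => res_sheaf F q setT ;
     cochains := fun q => [set s | rst (res_sheaf F q) setT X' s = 0] ;
     coboundary := fun q s => res_d F q setT s |}.

(* Morphisms, over the identity of O^(p), from the Dolbeault resolution
   E^(p,0) -> E^(p,1) -> ... and from F to a common flabby resolution. They
   exist, e.g. with values in the total complex of a Godement resolution. *)
Record comparison (F J : flabby_resolution) := {
  cmp_dolb : forall q U, form A p q -> res_sheaf J q U ;
  cmp_res : forall q U, {linear res_sheaf F q U -> res_sheaf J q U} ;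
  cmp_dolb_linear : forall q U a (xi eta : form A p q), open U ->
    smooth_forms U xi -> smooth_forms U eta ->
    cmp_dolb U (a *: xi + eta) = a *: cmp_dolb U xi + cmp_dolb U eta ;
  cmp_dolb_rst : forall q U V (xi : form A p q), open U -> open V ->
    V `<=` U -> smooth_forms U xi ->
    rst (res_sheaf J q) U V (cmp_dolb U xi) = cmp_dolb V (form_res V xi) ;
  cmp_dolb_d : forall q U (xi : form A p q), open U -> smooth_forms U xi ->
    cmp_dolb U (dbar U xi) = res_d J q U (cmp_dolb U xi) ;
  cmp_dolb_aug : forall U omega, open U -> holo_forms U omega ->
    cmp_dolb U omega = res_aug J U omega ;
  cmp_res_rst : forall q U V s, open U -> open V -> V `<=` U ->
    rst (res_sheaf J q) U V (cmp_res q U s) =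
    cmp_res q V (rst (res_sheaf F q) U V s) ;
  cmp_res_d : forall q U s, open U ->
    cmp_res q.+1 U (res_d F q U s) = res_d J q U (cmp_res q U s) ;
  cmp_res_aug : forall U omega, open U -> holo_forms U omega ->
    cmp_res 0 U (res_aug F U omega) = res_aug J U omega
}.

(* The images of (xi_1, xi_01) and of (s, 0) in the cone of J(X) -> J(X') are
   cohomologous. The primitive (t, u) of their difference is normalized to
   u = 0, which is possible as J is flabby. *)
Definition cohomologous_in (F J : flabby_resolution) (c : comparison F J)
    (X' : set X) q : rdolb_ambient A p q -> res_sheaf F q setT -> Prop :=
  match q return rdolb_ambient A p q -> res_sheaf F q setT -> Prop with
  | 0 => fun xi s => cmp_dolb c setT xi.1 = cmp_res c 0 setT s
  | q'.+1 => fun xi s => exists t : res_sheaf J q' setT,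
      rst (res_sheaf J q') setT X' t = cmp_dolb c X' xi.2 /\
      cmp_dolb c setT xi.1 - cmp_res c q'.+1 setT s = res_d J q' setT t
  end.

(* The correspondence between relative Dolbeault cocycles and cocycles of F
   that induces the canonical map in cohomology. *)
Definition canonically_related (F : flabby_resolution) (X' : set X) q
    (xi : rdolb_ambient A p q) (s : res_sheaf F q setT) : Prop :=
  exists (J : flabby_resolution) (c : comparison F J),
    @cohomologous_in F J c X' q xi s.

End Resolutions.

(* Main.v *)
Require Import Defs.
From HB Require Import structures.
From mathcomp Require Import all_boot all_order all_algebra.
From mathcomp Require Import complex ring lra zify.
From mathcomp Require Import boolp classical_sets functions cardinality reals.
From mathcomp Require Import topology normedtype landau derive realfun sequences exp trigo constructive_ereal ereal measure lebesgue_measure lebesgue_integral ftc.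

(** Both cohomologies are compared with that of an auxiliary resolution [L] of
    [O^(p)] built from sheaves of arbitrary functions, which is injective for
    maps between soft sheaves: a map into it is determined by linear maps on
    the stalks, and these extend by Zorn's lemma.  Hence every resolution by
    soft or flabby sheaves maps to [L], uniquely up to homotopy.  The cone of
    such a map is an exact complex of soft sheaves on a locally compact,
    second countable Hausdorff space, so it stays exact after taking sections
    over any open set; a diagram chase with [X] and [X'] then gives the
    isomorphism, and the homotopies show that every comparison of the two
    resolutions induces the same map.

    The Dolbeault complex is a soft resolution of [O^(p)]: softness comes from
    smooth cutoffs, and local exactness from the Cauchy transform in one
    variable, removing the differentials [dzbar_j] one index at a time.  That
    holomorphic functions are smooth comes from Goursat's lemma and Cauchy's
    formula for the derivative. *)

Set Implicit Arguments.
Unset Strict Implicit.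
Unset Printing Implicit Defensive.

Import Order.TTheory GRing.Theory Num.Theory.
Import numFieldNormedType.Exports.

Local Open Scope classical_set_scope.
Local Open Scope ring_scope.

(** [canonically_related] admits every common flabby resolution [J] with every pair of comparison
    maps, so all such [J] must be compared with one fixed target. Sheaves of arbitrary functions
    serve for this: a map into one is a family of linear maps on stalks without any continuity
    condition. If the source is soft, each germ is represented by a global section, so a linear map
    on a stalk can be given on the module of global sections, and Zorn's lemma is applied to plain
    modules only.

    The obstacle on the Dolbeault side is that a smooth form on [X'] need not extend to [X];
    softness extends only from neighbourhoods of compact sets. Hence exactness of the cones is used
    over [X] and over [X'] separately, and what cannot be extended stays in the component on [X'].
    No cochain map between the two complexes is chosen: the isomorphism comes from a linear relation
    between cocycles, total on both sides, that matches coboundaries with coboundaries.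

    Passing from compact sets to open sets is where the topology of [X] enters: Hausdorff makes
    compact sets closed, and the countable basis exhausts an open set by compact ones. *)

Local Notation re := complex.Re.
Local Notation im := complex.Im.

(** * Real and imaginary parts *)

Section ReIm.
Variable R : realType.
Local Notation C := (Cplx R).
Implicit Types (x y : C) (t : R).

Lemma reD x y : re (x + y) = re x + re y. Proof. by case: x; case: y. Qed.
Lemma imD x y : im (x + y) = im x + im y. Proof. by case: x; case: y. Qed.
Lemma reN x : re (- x) = - re x. Proof. by case: x. Qed.
Lemma imN x : im (- x) = - im x. Proof. by case: x. Qed.
Lemma reB x y : re (x - y) = re x - re y. Proof. by rewrite reD reN. Qed.
Lemma imB x y : im (x - y) = im x - im y. Proof. by rewrite imD imN. Qed.
Lemma reM x y : re (x * y) = re x * re y - im x * im y.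
Proof. by case: x; case: y. Qed.
Lemma imM x y : im (x * y) = re x * im y + im x * re y.
Proof. by case: x => a b; case: y => c d /=. Qed.
Lemma re_i : re ('i : C) = 0. Proof. by []. Qed.
Lemma im_i : im ('i : C) = 1. Proof. by []. Qed.
Lemma eq_reim x y : re x = re y -> im x = im y -> x = y.
Proof. by case: x => a b; case: y => c d /= -> ->. Qed.
Lemma rc0 : ((0 : R)%:C)%C = 0 :> C. Proof. by []. Qed.
Lemma rc1 : ((1 : R)%:C)%C = 1 :> C. Proof. by []. Qed.
Lemma rcD t s : ((t + s)%:C)%C = (t%:C)%C + (s%:C)%C :> C.
Proof. by apply: eq_reim; rewrite ?reD ?imD //= addr0. Qed.
Lemma rcN t : ((- t)%:C)%C = - (t%:C)%C :> C.
Proof. by apply: eq_reim; rewrite ?reN ?imN //= oppr0. Qed.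
Lemma rcM t s : ((t * s)%:C)%C = (t%:C)%C * (s%:C)%C :> C.
Proof. by apply: eq_reim; rewrite ?reM ?imM /= ?mulr0 ?subr0 ?mul0r ?addr0. Qed.
Lemma re_rcM t x : re ((t%:C)%C * x) = t * re x.
Proof. by rewrite reM /= mul0r subr0. Qed.
Lemma im_rcM t x : im ((t%:C)%C * x) = t * im x.
Proof. by rewrite imM /= mul0r addr0. Qed.
Lemma re_conj x : re (Num.conj x) = re x. Proof. by case: x. Qed.
Lemma im_conj x : im (Num.conj x) = - im x. Proof. by case: x. Qed.
(** The norm of a complex number is itself an element of [C]; nearness is expressed by real
    inequalities so that ordered-field reasoning over [R] applies. *)
Definition cnear (e : R) x y : Prop := `|re y - re x| < e /\ `|im y - im x| < e.

Lemma ler_norm_re x : ((`|re x|)%:C)%C <= `|x|.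
Proof. exact: normc_ge_Re. Qed.

Lemma norm_im x : `|x| = `|x * 'i| :> C.
Proof. by rewrite normrM normCi mulr1. Qed.

Lemma ler_norm_im x : ((`|im x|)%:C)%C <= `|x|.
Proof.
rewrite norm_im; apply: le_trans (ler_norm_re _).
by rewrite reM re_i im_i mulr0 mulr1 sub0r normrN.
Qed.

Lemma norm_le_reim x : `|x| <= ((`|re x| + `|im x|)%:C)%C.
Proof.
rewrite {1}(_ : x = ((re x)%:C)%C + 'i * ((im x)%:C)%C); last first.
  by apply: eq_reim; rewrite ?reD ?imD ?reM ?imM re_i im_i /=; ring.
rewrite rcD; apply: le_trans (ler_normD _ _) _.
rewrite normrM normCi mul1r; apply: lerD.
- by rewrite normc_def /= expr0n /= addr0 sqrtr_sqr.
- by rewrite normc_def /= expr0n /= addr0 sqrtr_sqr.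
Qed.

Lemma ltcR (a b : R) : ((a%:C)%C < (b%:C)%C :> C) = (a < b).
Proof. exact: ltcR. Qed.

Lemma lecR (a b : R) : ((a%:C)%C <= (b%:C)%C :> C) = (a <= b).
Proof. exact: lecR. Qed.

Lemma gt0_real (e : C) : 0 < e -> exists2 r : R, 0 < r & e = (r%:C)%C.
Proof.
move=> e0; exists (re e); first by move: e0; rewrite ltcE /= => /andP[].
by move: e0; rewrite ltcE /= => /andP[/eqP h _]; apply: eq_reim => //=; rewrite h.
Qed.

Lemma cnear_norm (e : R) x y : cnear (e / 2) x y -> `|x - y| < (e%:C)%C.
Proof.
move=> [h1 h2]; apply: le_lt_trans (norm_le_reim _) _.
rewrite ltcR reB imB distrC [X in _ + X]distrC; lra.
Qed.

Lemma norm_cnear (e : R) x y : `|x - y| < (e%:C)%C -> cnear e x y.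
Proof.
move=> h; split; rewrite distrC -?reB -?imB -ltcR.
- exact: le_lt_trans (ler_norm_re _) h.
- exact: le_lt_trans (ler_norm_im _) h.
Qed.

Lemma nbhs_cnear (x : C) (P : set C) :
  nbhs x P <-> exists2 e : R, 0 < e & forall y, cnear e x y -> P y.
Proof.
split.
- move=> /nbhs_ballP[e /= /gt0_real[r r0 ->] h]; exists (r / 2); first lra.
  by move=> y /cnear_norm hy; apply: h.
- move=> [e e0 h]; apply/nbhs_ballP; exists ((e%:C)%C); first by rewrite /= ltcR.
  by move=> y hy; apply/h/norm_cnear.
Qed.

Section Continuity.
Variables (T : topologicalType) (x : T).

Lemma continuousR_eps (f : T -> R) :
  {for x, continuous f} <->
  forall e : R, 0 < e -> \forall y \near x, `|f y - f x| < e.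
Proof.
split.
- move=> h e e0; have /cvgrPdist_lt/(_ e e0) := h; apply: filterS => y.
  by rewrite distrC.
- move=> h; apply/cvgrPdist_lt => e e0; have := h e e0; apply: filterS => y.
  by rewrite distrC.
Qed.

Lemma continuousC_reim (f : T -> C) :
  {for x, continuous f} <->
  {for x, continuous (fun y : T => re (f y) : R)} /\
  {for x, continuous (fun y : T => im (f y) : R)}.
Proof.
split.
- move=> h; split; apply/continuousR_eps => e e0.
  + have /h : nbhs (f x) [set y : C | `|re y - re (f x)| < e]; last by [].
    apply/nbhs_cnear.
    by exists e => // y [].
  + have /h : nbhs (f x) [set y : C | `|im y - im (f x)| < e]; last by [].
    apply/nbhs_cnear.
    by exists e => // y [].
- move=> [/continuousR_eps h1 /continuousR_eps h2] P /nbhs_cnear[e e0 h].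
  change (\forall y \near x, P (f y)).
  apply: (filterS _ (filterI (h1 e e0) (h2 e e0))) => y [? ?].
  exact: h.
Qed.
End Continuity.

Section Box.
Variable n : nat.
Implicit Types (z w h : 'rV[C]_n).

Definition box (e : R) z w : Prop := forall j, cnear e (z 0 j) (w 0 j).

Lemma nbhs_box z (A : set 'rV[C]_n) :
  nbhs z A <-> exists2 e : R, 0 < e & forall w, box e z w -> A w.
Proof.
split.
- move=> /nbhs_ballP[e /= /gt0_real[r r0 ->] h]; exists (r / 2); first lra.
  move=> w hw; apply: h; split; first by rewrite ltcR.
  by move=> i j; rewrite (ord1 i); apply/cnear_norm/hw.
- move=> [e e0 h]; apply/nbhs_ballP; exists ((e%:C)%C); first by rewrite /= ltcR.
  move=> w [_ hw]; apply: h => j; exact/norm_cnear/hw.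
Qed.

End Box.
End ReIm.

Section OneVariable.
Variable R : realType.

(** Free of quotients and valid at [t = 0] too, so that sums, chains and mean value estimates reduce
    to the triangle inequality. *)
Lemma is_derive_eps (f : R -> R) (a d : R) :
  is_derive a 1 f d <->
  forall e : R, 0 < e -> exists2 r : R, 0 < r &
    forall t, `|t| < r -> `|f (a + t) - f a - t * d| <= e * `|t|.
Proof.
split.
- move=> [df <-] e e0.
  have /cvgrPdist_le/(_ e e0) := df.
  rewrite near_withinE => /nbhs_ballP[r /= r0 h].
  exists r => // t tr; have [->|t0] := eqVneq t 0.
    by rewrite addr0 subrr mul0r subr0 normr0 mulr0.
  have := h t; rewrite /ball /= sub0r normrN => /(_ tr t0).
  rewrite -/(derive f a 1) /= [t *: 1]mulr1 (addrC t) [_ *: _]mulrC.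
  rewrite -(ler_pM2r (_ : 0 < `|t|)) ?normr_gt0// -normrM distrC mulrBl.
  by rewrite mulfVK // ['D_1 f a * t]mulrC.
- move=> h.
  have cv : h^-1 *: (f (h *: (1 : R) + a) - f a) @[h --> (0 : R)^'] --> d.
    apply/cvgrPdist_le => e e0; have [r r0 hr] := h e e0.
    rewrite near_withinE; apply/nbhs_ballP; exists r => //= t.
    rewrite /ball /= sub0r normrN => tr t0.
    rewrite [t *: 1]mulr1 (addrC t) [_ *: (_ - _)]mulrC.
    rewrite distrC -(ler_pM2r (_ : 0 < `|t|)) ?normr_gt0// -normrM mulrBl.
    by rewrite mulfVK // [d * t]mulrC; exact: hr.
  split; last exact: (cvg_lim _ cv).
  by apply/cvg_ex; exists d.
Qed.
End OneVariable.

(** * Real directional derivatives on complex coordinate space *)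

Section RealCalculus.
Variables (R : realType) (n : nat).
Local Notation C := (Cplx R).
Local Notation E := 'rV[C]_n.
Implicit Types (u g : E -> R) (z w v h : E) (D : set E) (t s e : R).

Definition rline z v t : E := z + (t%:C)%C *: v.
Definition is_rder u v z (d : R) := is_derive (0 : R) 1 (fun t => u (rline z v t)) d.
Definition rder v u z : R := derive1 (fun t => u (rline z v t)) 0.
Definition rdiff u v z := derivable (fun t => u (rline z v t)) (0 : R) 1.

(** The real-valued counterpart of [Cn_on]. The calculus is developed here and transferred to
    complex functions through their real and imaginary parts. *)
Fixpoint RCn (k : nat) D u : Prop :=
  (forall z, D z -> {for z, continuous u}) /\
  if k is k'.+1 then
    forall v, (forall z, D z -> rdiff u v z) /\ RCn k' D (rder v u)
  else True.

Lemma rline0 z v : rline z v 0 = z.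
Proof. by rewrite /rline rc0 scale0r addr0. Qed.

Lemma rline_add z v s t : rline (rline z v s) v t = rline z v (s + t).
Proof. by rewrite /rline rcD scalerDl addrA. Qed.

Lemma is_rderE u v z d : is_rder u v z d <-> rdiff u v z /\ rder v u z = d.
Proof.
rewrite /is_rder /rdiff /rder derive1E; split; first by move=> h; split; case: h.
by move=> [h1 h2]; split.
Qed.

Lemma rdiffP u v z : rdiff u v z -> is_rder u v z (rder v u z).
Proof. by move=> h; apply/is_rderE. Qed.

Lemma is_rder_val u v z d : is_rder u v z d -> rder v u z = d.
Proof. by move/is_rderE => []. Qed.

Lemma is_rder_eps u v z d : is_rder u v z d <->
  forall e, 0 < e -> exists2 r : R, 0 < r &
    forall t, `|t| < r -> `|u (rline z v t) - u z - t * d| <= e * `|t|.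
Proof.
rewrite /is_rder is_derive_eps; split => h e e0; have [r r0 hr] := h e e0;
  by exists r => // t /hr; rewrite add0r rline0.
Qed.

Lemma is_rder_line u v z t d : is_rder u v (rline z v t) d <->
  is_derive t 1 (fun s => u (rline z v s)) d.
Proof.
split.
- move=> /is_rder_eps h; apply/is_derive_eps => e e0; have [r r0 hr] := h e e0.
  exists r => [//|s sr]; rewrite -(rline_add z v t s); exact: hr.
- move=> /is_derive_eps h; apply/is_rder_eps => e e0; have [r r0 hr] := h e e0.
  exists r => [//|s sr]; rewrite (rline_add z v t s); exact: hr.
Qed.

(** The l^1 norm of the [2n] real coordinates. Unlike the norm on matrices over [C], it takes real
    values. *)
Definition vnorm v : R := \sum_j (`|re (v 0 j)| + `|im (v 0 j)|).

Lemma vnorm_ge0 v : 0 <= vnorm v.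
Proof. by apply: sumr_ge0 => j _; apply: addr_ge0. Qed.

Lemma vnorm_box v j : `|re (v 0 j)| + `|im (v 0 j)| <= vnorm v.
Proof.
rewrite /vnorm (bigD1 j) //= lerDl; apply: sumr_ge0 => i _; exact: addr_ge0.
Qed.

Lemma box_vnorm e z w : vnorm (w - z) < e -> box e z w.
Proof.
move=> h j; have := vnorm_box (w - z) j; rewrite !mxE reB imB.
have := normr_ge0 (re (w 0 j) - re (z 0 j)).
by have := normr_ge0 (im (w 0 j) - im (z 0 j)); split; lra.
Qed.

Lemma vnormD v w : vnorm (v + w) <= vnorm v + vnorm w.
Proof.
rewrite /vnorm -big_split /=; apply: ler_sum => j _; rewrite !mxE reD imD.
have := ler_normD (re (v 0 j)) (re (w 0 j)).
have := ler_normD (im (v 0 j)) (im (w 0 j)); lra.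
Qed.

Lemma vnormZ t v : vnorm ((t%:C)%C *: v) = `|t| * vnorm v.
Proof.
rewrite /vnorm mulr_sumr; apply: eq_bigr => j _.
by rewrite !mxE re_rcM im_rcM !normrM mulrDr.
Qed.

Lemma vnorm0 : vnorm 0 = 0.
Proof. by rewrite /vnorm big1 // => j _; rewrite !mxE /= normr0 addr0. Qed.

Lemma vnorm_rline z v t : vnorm (rline z v t - z) = `|t| * vnorm v.
Proof. by rewrite /rline addrC addKr vnormZ. Qed.

Lemma vnorm_sum I (r : seq I) (F : I -> E) :
  vnorm (\sum_(i <- r) F i) <= \sum_(i <- r) vnorm (F i).
Proof.
elim: r => [|i r ih]; first by rewrite !big_nil vnorm0.
by rewrite !big_cons; apply: le_trans (vnormD _ _) _; rewrite lerD2l.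
Qed.

Lemma nbhs_vnorm z (A : set E) :
  nbhs z A <-> exists2 e : R, 0 < e & forall w, vnorm (w - z) < e -> A w.
Proof.
split.
- move=> /nbhs_box[e e0 h]; exists e => // w hw; exact/h/box_vnorm.
- move=> [e e0 h]; apply/nbhs_box.
  (* [n.+1] keeps the divisor positive when [n = 0]. *)
  pose K : R := (n.+1)%:R.
  have K0 : 0 < K by rewrite ltr0n.
  have nK : n%:R < K by rewrite ltr_nat.
  pose d := e / (K * 2).
  have dK : d * (K * 2) = e by rewrite divfK // gt_eqF // mulr_gt0.
  have d0 : 0 < d by rewrite divr_gt0 // mulr_gt0.
  exists d => // w hw; apply: h; rewrite /vnorm.
  apply: (@le_lt_trans _ _ (\sum_(j < n) (d * 2))).
    apply: ler_sum => j _; rewrite !mxE reB imB; have [h1 h2] := hw j; lra.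
  rewrite sumr_const card_ord -(mulr_natr (d * 2)).
  have : 0 < d * (K - n%:R) by rewrite mulr_gt0 // subr_gt0.
  lra.
Qed.

Lemma continuous_vnorm u z : {for z, continuous u} <->
  forall e : R, 0 < e -> exists2 d : R, 0 < d &
    forall w, vnorm (w - z) < d -> `|u w - u z| < e.
Proof.
rewrite continuousR_eps; split => h e e0.
- by have /nbhs_vnorm := h e e0.
- exact/nbhs_vnorm/h.
Qed.

(* The point [c] of the mean value theorem, for steps of either sign. *)
Lemma mvt_line u v z t : (forall s, `|s| <= `|t| -> rdiff u v (rline z v s)) ->
  exists2 c, `|c| <= `|t| &
    u (rline z v t) - u z = t * rder v u (rline z v c).
Proof.
move=> h; pose f s := u (rline z v s).
have hd s : `|s| <= `|t| -> is_derive s 1 f (rder v u (rline z v s)).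
  by move=> st; apply/is_rder_line/rdiffP/h.
have hc s : `|s| <= `|t| -> {for s, continuous f}.
  by move=> st; have [d _] := hd s st; apply: differentiable_continuous; apply/derivable1_diffP.
have key a b : a <= b -> `|a| <= `|t| -> `|b| <= `|t| ->
    exists2 c, `|c| <= `|t| & f b - f a = rder v u (rline z v c) * (b - a).
  move=> ab ha hb.
  have hin s : s \in `[a, b] -> `|s| <= `|t|.
    rewrite in_itv /= => /andP[h1 h2].
    by move: ha hb; rewrite !ler_norml => /andP[? ?] /andP[? ?]; apply/andP; split; lra.
  have [|||c cab ->] := @MVT_segment _ f (fun s => rder v u (rline z v s)) a b.
  - exact: ab.
  - by move=> s /subset_itv_oo_cc/hin; apply: hd.
  - apply: continuous_in_subspaceT => s /set_mem /= hs; exact/hc/hin.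
  by exists c => //; exact: hin.
have u0 : u z = f 0 by rewrite /f rline0.
rewrite u0 -/(f t); have [t0|t0] := leP 0 t.
- by have [|||c hc' ->] := key 0 t; rewrite ?normr0 //; exists c => //; rewrite subr0 mulrC.
- have [|||c hc' e] := key t 0; rewrite ?normr0 ?(ltW t0) //; exists c => //.
  by rewrite -opprB e sub0r mulrN opprK mulrC.
Qed.

Lemma RCn_cont k D u z : RCn k D u -> D z -> {for z, continuous u}.
Proof. by case: k => [|k] [h _]; apply: h. Qed.
Lemma RCn_diff k D u v z : RCn k.+1 D u -> D z -> rdiff u v z.
Proof. by move=> [_ h] /(proj1 (h v)). Qed.
Lemma RCn_der k D u v : RCn k.+1 D u -> RCn k D (rder v u).
Proof. by move=> [_ h]; apply: (proj2 (h v)). Qed.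

Lemma RCnS k D u : RCn k.+1 D u -> RCn k D u.
Proof.
elim: k u => [|k ih] u [h1 h2]; first by split.
by split => // v; have [h3 h4] := h2 v; split => //; exact: ih.
Qed.

(** Each clause speaks of the behaviour of [u] and its iterated derivatives at a point inside the
    ambient space, never of the shape of [D]. This is what later allows smoothness to be glued from
    different local expressions. *)
Lemma RCn_pointwise k D u : RCn k D u <-> forall z, D z -> RCn k [set z] u.
Proof.
elim: k u => [|k ih] u.
  split=> [[h _] z Dz|h]; first by split => // w ->; exact: h.
  by split => // z Dz; have [h' _] := h z Dz; exact: h'.
split=> [[h1 h2] z Dz|h].
  split; first by move=> w ->; exact: h1.
  move=> v; have [h3 /ih h4] := h2 v; split; last exact: h4.
  by move=> w ->; exact: h3.
split; first by move=> z Dz; have [h' _] := h z Dz; exact: h'.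
move=> v; split.
  by move=> z Dz; have [_ /(_ v)[h' _]] := h z Dz; exact: h'.
by apply/ih => z Dz; have [_ /(_ v)[]] := h z Dz.
Qed.

Lemma rline_nbhs z v (A : set E) : nbhs z A ->
  exists2 r : R, 0 < r & forall t, `|t| < r -> A (rline z v t).
Proof.
move=> /nbhs_vnorm[e e0 h].
have v1 : 0 < vnorm v + 1 by have := vnorm_ge0 v; lra.
exists (e / (vnorm v + 1)); first by rewrite divr_gt0.
move=> t; rewrite ltr_pdivlMr // => tr; apply: h; rewrite vnorm_rline.
apply: le_lt_trans tr; apply: ler_wpM2l => //; lra.
Qed.

Lemma is_rder_near u g v z d : (\forall w \near z, u w = g w) ->
  is_rder u v z d -> is_rder g v z d.
Proof.
move=> eqn /is_rder_eps h; apply/is_rder_eps => e /h[r r0 hr].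
have [r' r'0 hr'] := rline_nbhs v eqn.
exists (Num.min r r'); first by rewrite lt_min r0.
move=> t; rewrite lt_min => /andP[t1 t2].
by rewrite -(nbhs_singleton eqn) -(hr' t t2); exact: hr.
Qed.

(** The equality also covers points where the derivative fails to exist: it then fails for both
    functions, and both limits take the same default value. *)
Lemma rder_near u g v z : (\forall w \near z, u w = g w) ->
  rder v u z = rder v g z.
Proof.
move=> eqn; have [h|h] := pselect (rdiff u v z).
  by rewrite (is_rder_val (is_rder_near eqn (rdiffP h))).
have h' : ~ rdiff g v z.
  move=> /rdiffP hg; apply: h; have eqn' : \forall w \near z, g w = u w.
    by apply: filterS eqn.
  by have /is_rderE[] := is_rder_near eqn' hg.
rewrite /rder !derive1E /derive.
by rewrite (dvgP h) (dvgP h').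
Qed.

Lemma RCn_near k D u g : (forall z, D z -> \forall w \near z, u w = g w) ->
  RCn k D u -> RCn k D g.
Proof.
elim: k D u g => [|k ih] D u g eqn [h1 h2].
  split=> // z Dz; have eqz := eqn z Dz.
  have := h1 z Dz => /continuousR_eps c; apply/continuousR_eps => e /c.
  rewrite -(nbhs_singleton eqz) => c'.
  by apply: filterS (filterI eqz c') => w [<-].
split.
  move=> z Dz; have eqz := eqn z Dz.
  have := h1 z Dz => /continuousR_eps c; apply/continuousR_eps => e /c.
  rewrite -(nbhs_singleton eqz) => c'.
  by apply: filterS (filterI eqz c') => w [<-].
move=> v; have [h3 h4] := h2 v; split.
  by move=> z Dz; have /is_rderE[] := is_rder_near (eqn z Dz) (rdiffP (h3 z Dz)).
apply: ih h4 => z Dz; have := nbhs_interior (eqn z Dz).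
by apply: filterS => w hw; exact: rder_near.
Qed.

Lemma RCn_eq k D u g : open D -> (forall z, D z -> u z = g z) ->
  RCn k D u -> RCn k D g.
Proof.
move=> oD eqD; apply: RCn_near => z Dz.
by have := open_nbhs_nbhs (conj oD Dz); apply: filterS.
Qed.

End RealCalculus.

(** * Real differentiability of functions with continuous directional derivatives *)

Section RealInequalities.
Variable R : realType.

Lemma eps_sub (A B A' B' a a' e t : R) :
  `|A - B - t * a| <= e / 2 * `|t| -> `|A' - B' - t * a'| <= e / 2 * `|t| ->
  `|(A - A') - (B - B') - t * (a - a')| <= e * `|t|.
Proof.
move=> h1 h2.
rewrite (_ : _ - _ = (A - B - t * a) - (A' - B' - t * a')); last by ring.
apply: le_trans (ler_normB _ _) _; lra.
Qed.

Lemma eps_sub2 (A B B' D a a' e t : R) :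
  `|A - B - B' + D - t * a| <= e / 2 * t ->
  `|A - B' - B + D - t * a'| <= e / 2 * t -> `|t * (a - a')| <= e * t.
Proof.
move=> h1 h2.
rewrite (_ : t * _ = (A - B' - B + D - t * a') - (A - B - B' + D - t * a)); last by ring.
apply: le_trans (ler_normB _ _) _; lra.
Qed.

End RealInequalities.

Section Frechet.
Variables (R : realType) (n : nat).
Local Notation C := (Cplx R).
Local Notation E := 'rV[C]_n.
Implicit Types (u g : E -> R) (z w v h : E) (D : set E) (t s e : R).

Lemma C1_sum I (r : seq I) (d : I -> E) D u z : RCn 1 D u -> nbhs z D ->
  forall e, 0 < e -> exists2 a : R, 0 < a & forall c : I -> R,
    (forall i, `|c i| < a) ->
    `|u (z + \sum_(i <- r) ((c i)%:C)%C *: d i) - u z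
      - \sum_(i <- r) c i * rder (d i) u z| <= e * \sum_(i <- r) `|c i|.
Proof.
move=> C1 zD; elim: r => [|i r ih] e e0.
  by exists 1 => // c _; rewrite !big_nil addr0 subrr subr0 normr0 mulr0.
have [a a0 ha] := ih e e0.
have cd : {for z, continuous (rder (d i) u)}.
  by apply: RCn_cont (RCn_der _ C1) (nbhs_singleton zD).
have /continuous_vnorm/(_ e e0)[b b0 hb] := cd.
have /nbhs_vnorm[b' b'0 hb'] := zD.
pose K := \sum_(j <- i :: r) vnorm (d j) + 1.
have K0 : 0 < K.
  by rewrite ltr_wpDl // sumr_ge0 // => j _; exact: vnorm_ge0.
(* With all coefficients below [min b b' / K], every intermediate point is within [min b b'] of [z]:
   inside [D] by [b'], and where the derivative is controlled by [b]. The summand 1 in [K] keeps it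
   positive. *)
pose a' := Num.min a (Num.min b b' / K).
have a'0 : 0 < a' by rewrite lt_min a0 divr_gt0 // lt_min b0.
exists a' => // c hc; rewrite !big_cons.
have hca j : `|c j| < a by apply: lt_le_trans (hc j) _; rewrite ge_min lexx.
have hcb j : `|c j| < Num.min b b' / K.
  by apply: lt_le_trans (hc j) _; rewrite ge_min lexx orbT.
set y := z + \sum_(j <- r) ((c j)%:C)%C *: d j.
have hy t : `|t| <= `|c i| -> vnorm (rline y (d i) t - z) < Num.min b b'.
  move=> tc.
  have -> : rline y (d i) t - z =
      (t%:C)%C *: d i + \sum_(j <- r) ((c j)%:C)%C *: d j.
    by rewrite /rline /y addrAC [z + _]addrC addrK addrC.
  apply: le_lt_trans (vnormD _ _) _; rewrite vnormZ.
  have mb : 0 < Num.min b b' by rewrite lt_min b0.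
  apply: (@le_lt_trans _ _ (Num.min b b' / K * \sum_(j <- i :: r) vnorm (d j))).
    rewrite big_cons mulrDr; apply: lerD.
      apply: ler_wpM2r; first exact: vnorm_ge0.
      exact/(le_trans tc)/ltW.
    apply: le_trans (vnorm_sum _ _) _; rewrite mulr_sumr.
    apply: ler_sum => j _; rewrite vnormZ.
    by apply: ler_wpM2r; [exact: vnorm_ge0|exact/ltW].
  rewrite -mulrA gtr_pMr // mulrC ltr_pdivrMr // mul1r /K ltrDl; exact: ltr01.
have [t tc mv] : exists2 t, `|t| <= `|c i| & u (rline y (d i) (c i)) - u y =
    c i * rder (d i) u (rline y (d i) t).
  apply: mvt_line => t tc; apply: (RCn_diff C1); apply: hb'.
  by have := hy t tc; rewrite lt_min => /andP[].
have -> : z + ((((c i)%:C)%C *: d i) + \sum_(j <- r) ((c j)%:C)%C *: d j) =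
    rline y (d i) (c i) by rewrite /rline /y -addrA [_ + \sum_(_ <- _) _]addrC.
have h1 : `|rder (d i) u (rline y (d i) t) - rder (d i) u z| <= e.
  by apply/ltW/hb; have := hy t tc; rewrite lt_min => /andP[].
have h2 := ha c hca; rewrite -/y in h2.
have -> : u (rline y (d i) (c i)) - u z -
    (c i * rder (d i) u z + \sum_(j <- r) c j * rder (d j) u z) =
  c i * (rder (d i) u (rline y (d i) t) - rder (d i) u z) +
  (u y - u z - \sum_(j <- r) c j * rder (d j) u z).
  rewrite mulrBr -mv; ring.
apply: le_trans (ler_normD _ _) _; rewrite [leRHS]mulrDr; apply: lerD; last exact: h2.
by rewrite normrM mulrC ler_wpM2r.
Qed.

(* The real basis of [C^n]: the j-th unit vector and its multiple by i. *)
Definition rbasis (i : 'I_n * bool) : E :=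
  if i.2 then 'i *: delta_mx 0 i.1 else delta_mx 0 i.1.
Definition rcoord (i : 'I_n * bool) v : R :=
  if i.2 then im (v 0 i.1) else re (v 0 i.1).

Lemma rcoordD i v w : rcoord i (v + w) = rcoord i v + rcoord i w.
Proof. by rewrite /rcoord !mxE; case: i.2; rewrite ?reD ?imD. Qed.
Lemma rcoordN i v : rcoord i (- v) = - rcoord i v.
Proof. by rewrite /rcoord !mxE; case: i.2; rewrite ?reN ?imN. Qed.
Lemma rcoordB i v w : rcoord i (v - w) = rcoord i v - rcoord i w.
Proof. by rewrite rcoordD rcoordN. Qed.
Lemma rcoordZ i t v : rcoord i ((t%:C)%C *: v) = t * rcoord i v.
Proof. by rewrite /rcoord !mxE; case: i.2; rewrite ?re_rcM ?im_rcM. Qed.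

Lemma sum_pair_bool (V : nmodType) (F : 'I_n * bool -> V) :
  \sum_i F i = \sum_j (F (j, false) + F (j, true)).
Proof.
rewrite (eq_bigr (fun i => F (i.1, i.2))) => [|[] //].
rewrite -(pair_big xpredT xpredT (fun i j => F (i, j))) /=.
by apply: eq_bigr => j _; rewrite big_bool addrC.
Qed.

Lemma rbasis_sum v : v = \sum_i ((rcoord i v)%:C)%C *: rbasis i.
Proof.
rewrite sum_pair_bool; apply/rowP => k; rewrite summxE (bigD1 k) //=.
rewrite big1 ?addr0 => [|j jk].
  rewrite !mxE !eqxx /= !mulr1 /rcoord /=.
  apply: eq_reim; rewrite ?reD ?imD ?re_rcM ?im_rcM ?re_i ?im_i /=.
    by rewrite mulr0 addr0.
  by rewrite mulr1 add0r.
by rewrite !mxE eqxx eq_sym (negbTE jk) /= !mulr0 addr0.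
Qed.

Lemma vnorm_rcoord v : vnorm v = \sum_i `|rcoord i v|.
Proof. by rewrite sum_pair_bool. Qed.

Lemma rcoord_le i v : `|rcoord i v| <= vnorm v.
Proof.
rewrite vnorm_rcoord (bigD1 i) //= lerDl; apply: sumr_ge0 => j _.
exact: normr_ge0.
Qed.

(** The candidate for the total differential, real-linear in [h] by construction; [rder_lin]
    identifies it with all the directional derivatives. *)
Definition rdiffl u z h := \sum_i rcoord i h * rder (rbasis i) u z.

Lemma rdifflD u z v w : rdiffl u z (v + w) = rdiffl u z v + rdiffl u z w.
Proof.
rewrite /rdiffl -big_split /=; apply: eq_bigr => i _.
by rewrite rcoordD mulrDl.
Qed.

Lemma rdifflZ u z t v : rdiffl u z ((t%:C)%C *: v) = t * rdiffl u z v.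
Proof.
rewrite /rdiffl mulr_sumr; apply: eq_bigr => i _; by rewrite rcoordZ mulrA.
Qed.

Lemma rdiffl_bound u z h :
  `|rdiffl u z h| <= (\sum_i `|rder (rbasis i) u z|) * vnorm h.
Proof.
apply: le_trans (ler_norm_sum _ _ _) _; rewrite mulr_suml.
apply: ler_sum => i _; rewrite normrM mulrC; apply: ler_wpM2l => //.
exact: rcoord_le.
Qed.

Lemma C1_frechet D u z : RCn 1 D u -> nbhs z D ->
  forall e, 0 < e -> exists2 a : R, 0 < a & forall h, vnorm h < a ->
    `|u (z + h) - u z - rdiffl u z h| <= e * vnorm h.
Proof.
move=> C1 zD e e0.
have [a a0 ha] := C1_sum (index_enum _) rbasis C1 zD e0.
exists a => // h hh; rewrite {1}(rbasis_sum h) vnorm_rcoord; apply: ha => i.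
exact: le_lt_trans (rcoord_le _ _) hh.
Qed.

Lemma C1_chain D u (f : R -> E) w : RCn 1 D u -> nbhs (f 0) D ->
  (forall i, is_derive (0 : R) 1 (fun t => rcoord i (f t)) (rcoord i w)) ->
  is_derive (0 : R) 1 (fun t => u (f t)) (rdiffl u (f 0) w).
Proof.
move=> C1 zD hf; apply/is_derive_eps => e e0.
pose N : R := (#|{: 'I_n * bool}|)%:R.
have N0 : 0 <= N by rewrite ler0n.
pose S := \sum_i `|rder (rbasis i) u (f 0)|.
have S0 : 0 <= S by apply: sumr_ge0 => i _; exact: normr_ge0.
have W0 := vnorm_ge0 w.
(* The first bound makes the [N] coordinate errors add up to at most [|t|], hence
   [vnorm h <= |t| (vnorm w + 1)]. The second makes their effect through the partial derivatives at
   most [e / 2 * |t|]. *)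
pose d := Num.min (N + 1)^-1 (e / 2 / (S + 1)).
have d0 : 0 < d by rewrite lt_min invr_gt0 !divr_gt0 //; lra.
have dN : d * N <= 1.
  apply: (@le_trans _ _ ((N + 1)^-1 * N)).
    by apply: ler_wpM2r => //; rewrite ge_min lexx.
  rewrite mulrC ler_pdivrMr; lra.
have dS : d * S <= e / 2.
  apply: (@le_trans _ _ (e / 2 / (S + 1) * S)).
    by apply: ler_wpM2r => //; rewrite ge_min lexx orbT.
  rewrite mulrAC ler_pdivrMr; last lra.
  by apply: ler_wpM2l; lra.
have e1 : 0 < e / 2 / (vnorm w + 1) by rewrite !divr_gt0 //; lra.
have [a a0 ha] := C1_frechet C1 zD e1.
have : forall i, \forall t \near (0 : R),
    `|rcoord i (f t - f 0) - t * rcoord i w| <= d * `|t|.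
  move=> i.
  have /is_derive_eps/(_ d d0)[r r0 hr] := hf i.
  apply/nbhs_ballP; exists r => //= t; rewrite /ball /= sub0r normrN => tr.
  by have := hr t tr; rewrite add0r rcoordB.
move=> /filter_forall/nbhs_ballP[r /= r0 hr].
exists (Num.min r (a / (vnorm w + 2))).
  by rewrite lt_min r0 divr_gt0 //; lra.
move=> t; rewrite lt_min => /andP[tr ta]; rewrite add0r.
have {}hr i : `|rcoord i (f t - f 0) - t * rcoord i w| <= d * `|t|.
  by apply: hr; rewrite /ball /= sub0r normrN.
set h := f t - f 0 in hr.
have sumd : \sum_(i : 'I_n * bool) d * `|t| <= `|t|.
  rewrite sumr_const -mulr_natr mulrAC -/N -[leRHS]mul1r.
  by apply: ler_wpM2r.
have hv : vnorm h <= `|t| * (vnorm w + 1).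
  rewrite mulrDr mulr1; apply: le_trans (lerD (lexx _) sumd).
  rewrite !vnorm_rcoord mulr_sumr -big_split /=; apply: ler_sum => i _.
  have -> : rcoord i h = t * rcoord i w + (rcoord i h - t * rcoord i w) by ring.
  by apply: le_trans (ler_normD _ _) _; rewrite normrM lerD2l.
have ha' : vnorm h < a.
  apply: le_lt_trans hv _; move: ta; rewrite ltr_pdivlMr; last lra.
  by apply: le_lt_trans; apply: ler_wpM2l => //; lra.
have fh : f 0 + h = f t by rewrite /h addrC subrK.
have := ha h ha'; rewrite fh => h1.
have h2 : `|rdiffl u (f 0) h - t * rdiffl u (f 0) w| <= e / 2 * `|t|.
  rewrite /rdiffl mulr_sumr -sumrB; apply: le_trans (ler_norm_sum _ _ _) _.
  apply: (@le_trans _ _ (d * S * `|t|)); last by apply: ler_wpM2r.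
  rewrite mulrAC /S mulr_sumr; apply: ler_sum => i _.
  by rewrite mulrA -mulrBl normrM; apply: ler_wpM2r.
have h3 : e / 2 / (vnorm w + 1) * vnorm h <= e / 2 * `|t|.
  apply: (@le_trans _ _ (e / 2 / (vnorm w + 1) * (`|t| * (vnorm w + 1)))).
    by apply: ler_wpM2l => //; exact: ltW.
  by rewrite mulrCA mulrC divfK // gt_eqF //; lra.
have -> : u (f t) - u (f 0) - t * rdiffl u (f 0) w =
    (u (f t) - u (f 0) - rdiffl u (f 0) h) +
    (rdiffl u (f 0) h - t * rdiffl u (f 0) w) by ring.
apply: le_trans (ler_normD _ _) _; lra.
Qed.

Lemma is_derive_affine (a b t0 : R) : is_derive t0 1 (fun t => a + t * b) b.
Proof.
apply/is_derive_eps => e e0; exists 1 => // t _.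
rewrite (_ : a + (t0 + t) * b - (a + t0 * b) - t * b = 0); last by ring.
by rewrite normr0 mulr_ge0 // ltW.
Qed.

Lemma rder_lin D u z v : RCn 1 D u -> nbhs z D -> rder v u z = rdiffl u z v.
Proof.
move=> C1 zD; apply: is_rder_val; rewrite /is_rder.
have := @C1_chain D u (rline z v) v C1; rewrite rline0; apply=> //.
move=> i; rewrite (_ : (fun t => _) = (fun t => rcoord i z + t * rcoord i v)).
  exact: is_derive_affine.
by apply/funext => t; rewrite rcoordD rcoordZ.
Qed.

Lemma rderD D u z v w : RCn 1 D u -> nbhs z D ->
  rder (v + w) u z = rder v u z + rder w u z.
Proof. by move=> C1 zD; rewrite !(rder_lin _ C1 zD) rdifflD. Qed.

Lemma rderZ D u z t v : RCn 1 D u -> nbhs z D ->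
  rder ((t%:C)%C *: v) u z = t * rder v u z.
Proof. by move=> C1 zD; rewrite !(rder_lin _ C1 zD) rdifflZ. Qed.

(** Two mean value theorems: one along [v] for [y |-> u (y + s w) - u y], then one along [w] for
    [rder v u]. The second difference itself is symmetric in [v] and [w], and this yields the
    symmetry of second derivatives. *)
Lemma second_difference D u z v w : RCn 2 D u -> nbhs z D ->
  forall e, 0 < e -> exists2 r : R, 0 < r & forall s, 0 < s -> s < r ->
    `|(u (rline (rline z v s) w s) - u (rline z v s) - u (rline z w s) + u z)
      - s * s * rder w (rder v u) z| <= e * (s * s).
Proof.
move=> C2 /nbhs_vnorm[b b0 hb] e e0.
have zD : D z by apply: hb; rewrite subrr vnorm0.
have /continuous_vnorm/(_ e e0)[b' b'0 hb'] : {for z, continuous (rder w (rder v u))}.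
  exact: RCn_cont (RCn_der _ (RCn_der _ C2)) zD.
have V0 := vnorm_ge0 v; have W0 := vnorm_ge0 w.
exists (Num.min b b' / (vnorm v + vnorm w + 1)).
  by rewrite divr_gt0 // ?lt_min ?b0 //; lra.
move=> s s0; rewrite ltr_pdivlMr; last lra.
move=> sb.
have hv c c' : `|c| <= s -> `|c'| <= s ->
    vnorm (rline (rline z v c) w c' - z) < Num.min b b'.
  move=> cs cs'; apply: le_lt_trans sb.
  have -> : rline (rline z v c) w c' - z = (c%:C)%C *: v + (c'%:C)%C *: w.
    by rewrite /rline addrAC [z + _]addrC addrK.
  apply: le_trans (vnormD _ _) _; rewrite !vnormZ.
  have h1 : `|c| * vnorm v <= s * vnorm v by apply: ler_wpM2r.
  have h2 : `|c'| * vnorm w <= s * vnorm w by apply: ler_wpM2r.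
  rewrite !mulrDr; lra.
have s_ge0 : `|0 : R| <= s by rewrite normr0 ltW.
have ss : `|s| <= s by rewrite ger0_norm // ltW.
have hD c c' : `|c| <= s -> `|c'| <= s -> D (rline (rline z v c) w c').
  by move=> c1 c2; apply: hb; have := hv c c' c1 c2; rewrite lt_min => /andP[].
pose g y := u (rline y w s) - u y.
have der_shift y c : rline (rline y w s) v c = rline (rline y v c) w s.
  by rewrite /rline addrAC.
have gder c : `|c| <= s -> is_rder g v (rline z v c)
    (rder v u (rline (rline z v c) w s) - rder v u (rline z v c)).
  move=> cs; apply/is_rder_eps => e1 e10.
  have d1 : is_rder u v (rline (rline z v c) w s) (rder v u (rline (rline z v c) w s)).
    by apply/rdiffP/(RCn_diff C2)/hD.
  have d2 : is_rder u v (rline z v c) (rder v u (rline z v c)).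
    by apply/rdiffP/(RCn_diff C2); rewrite -(rline0 (rline z v c) w); exact: hD.
  have e2 : 0 < e1 / 2 by lra.
  have [r1 r10 h1] := (is_rder_eps _ _ _ _).1 d1 _ e2.
  have [r2 r20 h2] := (is_rder_eps _ _ _ _).1 d2 _ e2.
  exists (Num.min r1 r2); first by rewrite lt_min r10.
  move=> t; rewrite lt_min => /andP[t1 t2].
  have {}h1 := h1 t t1; have {}h2 := h2 t t2; rewrite der_shift in h1.
  exact: eps_sub h1 h2.
have [c cs hc] : exists2 c, `|c| <= `|s| & g (rline z v s) - g z =
    s * rder v g (rline z v c).
  apply: mvt_line => c cs.
  by have /is_rderE[] := gder c (le_trans cs ss).
have cs' := le_trans cs ss.
rewrite (is_rder_val (gder c cs')) in hc.
have [c' cs'' hc'] : exists2 c', `|c'| <= `|s| &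
    rder v u (rline (rline z v c) w s) - rder v u (rline z v c) =
    s * rder w (rder v u) (rline (rline z v c) w c').
  apply: mvt_line => t ts; apply: (RCn_diff (RCn_der v C2)); apply: hD => //.
  exact: le_trans ss.
rewrite hc' in hc.
have -> : u (rline (rline z v s) w s) - u (rline z v s) - u (rline z w s) + u z =
    g (rline z v s) - g z by rewrite /g; ring.
rewrite hc mulrA -mulrBr normrM (ger0_norm (mulr_ge0 (ltW s0) (ltW s0))) [leLHS]mulrC.
apply: ler_wpM2r; first by rewrite mulr_ge0 // ltW.
apply/ltW/hb'; have := hv c c' cs' (le_trans cs'' ss).
by rewrite lt_min => /andP[].
Qed.

Lemma rder_sym D u z v w : RCn 2 D u -> nbhs z D ->
  rder w (rder v u) z = rder v (rder w u) z.
Proof.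
move=> C2 zD; apply/eqP; rewrite -subr_eq0 -normr_le0; apply/ler_addgt0Pl => e e0.
rewrite addr0; have e2 : 0 < e / 2 by lra.
have [r1 r10 h1] := second_difference v w C2 zD e2.
have [r2 r20 h2] := second_difference w v C2 zD e2.
pose s := Num.min r1 r2 / 2.
have m0 : 0 < Num.min r1 r2 by rewrite lt_min r10.
have s0 : 0 < s by rewrite divr_gt0.
have sm : s < Num.min r1 r2 by rewrite /s; lra.
have {}h1 := h1 s s0 (lt_le_trans sm _); have {}h2 := h2 s s0 (lt_le_trans sm _).
have := h1 _; rewrite ge_min lexx => /(_ isT) {}h1.
have := h2 _; rewrite ge_min lexx orbT => /(_ isT) {}h2.
have sw : rline (rline z w s) v s = rline (rline z v s) w s by rewrite /rline addrAC.
rewrite sw in h2.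
have ss : 0 < s * s by rewrite mulr_gt0.
rewrite -(ler_pM2l ss) -[X in X * `|_|](ger0_norm (ltW ss)) -normrM.
rewrite [_ * e]mulrC; exact: eps_sub2 h1 h2.
Qed.

End Frechet.

(** * Closure properties of smooth functions *)

Section RealSmooth.
Variables (R : realType) (n : nat).
Local Notation C := (Cplx R).
Local Notation E := 'rV[C]_n.
Implicit Types (u g : E -> R) (z w v h : E) (D : set E) (t s e c : R) (k : nat).

Lemma is_rder_cst c v z : is_rder (fun=> c) v z 0.
Proof. exact: is_derive_cst. Qed.

Lemma is_rderD u g v z a b : is_rder u v z a -> is_rder g v z b ->
  is_rder (fun w => u w + g w) v z (a + b).
Proof. by move=> h1 h2; apply: is_deriveD. Qed.

Lemma is_rderN u v z a : is_rder u v z a -> is_rder (fun w => - u w) v z (- a).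
Proof. by move=> h1; apply: is_deriveN. Qed.

Lemma is_rderM u g v z a b : is_rder u v z a -> is_rder g v z b ->
  is_rder (fun w => u w * g w) v z (a * g z + u z * b).
Proof.
move=> h1 h2; have := @is_deriveM _ _ _ _ _ _ _ _ h1 h2.
by rewrite rline0 /= => h; apply: is_derive_eq h _; rewrite [g z *: a]mulrC addrC.
Qed.

Lemma is_rderV u v z a : u z != 0 -> is_rder u v z a ->
  is_rder (fun w => (u w)^-1) v z (- a * ((u z)^-1 * (u z)^-1)).
Proof.
move=> u0 h; have := @is_deriveV R (fun t => u (rline z v t)) 0 a 1.
rewrite rline0 => /(_ u0 h) h'; apply: is_derive_eq h' _.
by rewrite -[_ *: _]/(_ * _) !mulNr mulrC -exprVn expr2.
Qed.

Lemma is_rder_comp1 (f : R -> R) u v z a b : is_derive (u z) 1 f b ->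
  is_rder u v z a -> is_rder (fun w => f (u w)) v z (b * a).
Proof.
move=> h1 h2; apply: (@is_derive1_comp _ f (fun t => u (rline z v t))) => //.
by rewrite rline0.
Qed.

(** The rule by which the order is raised: any formula for the derivative on [D] may stand for
    [rder], whose values elsewhere do not matter because [D] is open. *)
Lemma RCnI k D u (du : E -> E -> R) : open D ->
  (forall z, D z -> {for z, continuous u}) ->
  (forall v z, D z -> is_rder u v z (du v z)) ->
  (forall v, RCn k D (du v)) -> RCn k.+1 D u.
Proof.
move=> oD uc ud duC; split => // v; split.
  by move=> z Dz; have /is_rderE[] := ud v z Dz.
by apply: (RCn_eq oD _ (duC v)) => z Dz; rewrite (is_rder_val (ud v z Dz)).
Qed.

Lemma RCn0I D u : (forall z, D z -> {for z, continuous u}) -> RCn 0 D u.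
Proof. by []. Qed.

Lemma RCn_cst k D c : open D -> RCn k D (fun=> c).
Proof.
elim: k c => [|k ih] c oD; first by apply: RCn0I => z _; exact: cst_continuous.
apply: (@RCnI k D _ (fun _ _ => 0)) => //.
- by move=> z _; exact: cst_continuous.
- by move=> v z _; exact: is_rder_cst.
- by move=> v; exact: ih.
Qed.

Lemma RCn_is_rder k D u v z : RCn k.+1 D u -> D z -> is_rder u v z (rder v u z).
Proof. by move=> h Dz; apply/rdiffP/(RCn_diff h). Qed.

Lemma RCnD k D u g : open D -> RCn k D u -> RCn k D g ->
  RCn k D (fun w => u w + g w).
Proof.
elim: k u g => [|k ih] u g oD hu hg.
  apply: RCn0I => z Dz; apply: (@continuousD _ _ _ u g); first exact: RCn_cont hu Dz.
  exact: RCn_cont hg Dz.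
apply: (@RCnI k D _ (fun v z => rder v u z + rder v g z)) => //.
- move=> z Dz; apply: (@continuousD _ _ _ u g); first exact: RCn_cont hu Dz.
  exact: RCn_cont hg Dz.
- by move=> v z Dz; apply: is_rderD; apply: RCn_is_rder Dz; eassumption.
- by move=> v; apply: ih => //; exact: RCn_der.
Qed.

Lemma RCnM k D u g : open D -> RCn k D u -> RCn k D g ->
  RCn k D (fun w => u w * g w).
Proof.
elim: k u g => [|k ih] u g oD hu hg.
  apply: RCn0I => z Dz; apply: (@continuousM _ _ u g); first exact: RCn_cont hu Dz.
  exact: RCn_cont hg Dz.
apply: (@RCnI k D _ (fun v z => rder v u z * g z + u z * rder v g z)) => //.
- move=> z Dz; apply: (@continuousM _ _ u g); first exact: RCn_cont hu Dz.
  exact: RCn_cont hg Dz.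
- by move=> v z Dz; apply: is_rderM; apply: RCn_is_rder Dz; eassumption.
- move=> v; apply: RCnD => //; apply: ih => //; try exact: RCn_der; exact: RCnS.
Qed.

Lemma RCnZ k D c u : open D -> RCn k D u -> RCn k D (fun w => c * u w).
Proof. by move=> oD; apply: RCnM => //; exact: RCn_cst. Qed.

Lemma RCnN k D u : open D -> RCn k D u -> RCn k D (fun w => - u w).
Proof.
move=> oD hu; have := RCnZ (-1) oD hu; congr (RCn k D).
by apply/funext => w; rewrite mulN1r.
Qed.

Lemma RCn_sum k D I (r : seq I) (F : I -> E -> R) : open D ->
  (forall i, RCn k D (F i)) -> RCn k D (fun w => \sum_(i <- r) F i w).
Proof.
move=> oD hF; elim: r => [|i r ih].
  by rewrite (_ : (fun w => _) = fun=> 0); [exact: RCn_cst|apply/funext => w; rewrite big_nil].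
rewrite (_ : (fun w => _) = fun w => F i w + \sum_(j <- r) F j w); first exact: RCnD.
by apply/funext => w; rewrite big_cons.
Qed.

Lemma RCnV k D u : open D -> (forall z, D z -> u z != 0) -> RCn k D u ->
  RCn k D (fun w => (u w)^-1).
Proof.
move=> oD u0; elim: k => [|k ih] hu.
  by apply: RCn0I => z Dz; apply: (@continuousV _ _ u); [exact: u0|exact: RCn_cont hu Dz].
apply: (@RCnI k D _ (fun v z => - rder v u z * ((u z)^-1 * (u z)^-1))) => //.
- by move=> z Dz; apply: (@continuousV _ _ u); [exact: u0|exact: RCn_cont hu Dz].
- by move=> v z Dz; apply: is_rderV; [exact: u0|exact: RCn_is_rder hu Dz].
- move=> v; apply: RCnM => //; first by apply: RCnN => //; exact: RCn_der.
  by apply: RCnM => //; apply: ih; exact: RCnS.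
Qed.

(** The outer function comes with the whole sequence of its derivatives, because the induction on
    [k] passes from [f i] to [f i.+1]. *)
Lemma RCn_comp1 k D (f : nat -> R -> R) u : open D ->
  (forall i (x : R), is_derive x (1 : R) (f i) (f i.+1 x)) -> RCn k D u ->
  forall i, RCn k D (fun w => f i (u w)).
Proof.
move=> oD hf; have fc i x : {for x, continuous (f i)}.
  apply: differentiable_continuous; apply/derivable1_diffP.
  by have [] := hf i x.
have cc i z : RCn k D u -> D z -> {for z, continuous (fun w => f i (u w))}.
  move=> hu Dz; apply: (@continuous_comp _ _ _ u (f i)); last exact: fc.
  exact: RCn_cont hu Dz.
elim: k cc => [|k ih] cc hu i; first by apply: RCn0I => z; exact: cc.
apply: (@RCnI k D _ (fun v z => f i.+1 (u z) * rder v u z)) => //.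
- by move=> z; exact: cc.
- by move=> v z Dz; exact: (is_rder_comp1 (hf i (u z)) (RCn_is_rder v hu Dz)).
- move=> v; apply: RCnM => //; last exact: RCn_der.
  apply: ih; last exact: RCnS.
  move=> j z h Dz; exact: cc hu Dz.
Qed.

Lemma rcoord_continuous i z : {for z, continuous (@rcoord R n i)}.
Proof.
apply/continuous_vnorm => e e0; exists e => // w; apply: le_lt_trans.
by rewrite -rcoordB; exact: rcoord_le.
Qed.

Lemma is_rder_rcoord i v z : is_rder (@rcoord R n i) v z (rcoord i v).
Proof.
rewrite /is_rder (_ : (fun t => _) = (fun t => rcoord i z + t * rcoord i v)).
  exact: is_derive_affine.
by apply/funext => t; rewrite rcoordD rcoordZ.
Qed.

Lemma RCn_rcoord k D i : open D -> RCn k D (@rcoord R n i).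
Proof.
case: k => [|k] oD; first by apply: RCn0I => z _; exact: rcoord_continuous.
apply: (@RCnI k D _ (fun v z => rcoord i v)) => //.
- by move=> z _; exact: rcoord_continuous.
- by move=> v z _; exact: is_rder_rcoord.
- by move=> v; exact: RCn_cst.
Qed.

Definition of_rcoord (c : 'I_n * bool -> R) : E :=
  \row_j Complex (c (j, false)) (c (j, true)).

Lemma of_rcoordK (c : _ -> R) i : rcoord i (of_rcoord c) = c i.
Proof. by case: i => j []; rewrite /rcoord /= mxE. Qed.

Lemma continuous_rcoord (T : topologicalType) (x : T) (f : T -> E) :
  (forall i, {for x, continuous (fun y => rcoord i (f y) : R)}) ->
  {for x, continuous f}.
Proof.
move=> h P /nbhs_box[e e0 hP]; change (\forall y \near x, P (f y)).
have : forall i, \forall y \near x, `|rcoord i (f y) - rcoord i (f x)| < e.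
  by move=> i; have /continuousR_eps := h i; apply.
move=> /filter_forall; apply: filterS => y hy; apply: hP => j.
by have := hy (j, false); have := hy (j, true).
Qed.

End RealSmooth.

Section Composition.
Variables (R : realType) (m n : nat).
Local Notation C := (Cplx R).
Variable f : 'rV[C]_m -> 'rV[C]_n.
Variables (D : set 'rV[C]_m) (D' : set 'rV[C]_n).
Hypothesis oD : open D.
Hypothesis fD : forall z, D z -> D' (f z).
Hypothesis oD' : open D'.

Lemma is_rder_comp u v z (c : 'I_n * bool -> R) : RCn 1 D' u -> D z ->
  (forall i, is_rder (fun y => rcoord i (f y)) v z (c i)) ->
  is_rder (fun y => u (f y)) v z (\sum_i c i * rder (@rbasis R n i) u (f z)).
Proof.
move=> hu Dz hc.
have := @C1_chain _ _ D' u (fun t => f (rline z v t)) (of_rcoord c) hu.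
rewrite rline0 /rdiffl; under eq_bigr do rewrite of_rcoordK.
apply; first by apply: open_nbhs_nbhs; split => //; exact: fD.
by move=> i; rewrite of_rcoordK; exact: hc.
Qed.

Lemma RCn_comp k u : RCn k D' u -> (forall i, RCn k D (fun y => rcoord i (f y))) ->
  RCn k D (fun y => u (f y)).
Proof.
elim: k u => [|k ih] u hu hf.
  apply: RCn0I => z Dz; apply: (@continuous_comp _ _ _ f u); last first.
    exact: RCn_cont hu (fD Dz).
  by apply: continuous_rcoord => i; exact: RCn_cont (hf i) Dz.
have C1 : RCn 1 D' u.
  by elim: (k) hu => // j ihj /RCnS/ihj.
apply: (@RCnI _ _ k D _ (fun v z => \sum_i rder v (fun y => rcoord i (f y)) z *
    rder (rbasis R i) u (f z))) => //.
- move=> z Dz; apply: (@continuous_comp _ _ _ f u); last first.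
    exact: RCn_cont hu (fD Dz).
  by apply: continuous_rcoord => i; exact: RCn_cont (hf i) Dz.
- move=> v z Dz; apply: (is_rder_comp C1 Dz) => i.
  exact: (RCn_is_rder v (hf i) Dz).
- move=> v; apply: RCn_sum => // i; apply: RCnM => //; first exact: RCn_der.
  by apply: ih; [exact: RCn_der|move=> j; exact: RCnS].
Qed.

End Composition.

(** * Smooth complex-valued functions *)

Section HalfSums.
Variable R : realType.
Implicit Types a b c d f g i : Cplx R.

Lemma half_add a b c d i :
  2^-1 * ((a + c) + i * (b + d)) = 2^-1 * (a + i * b) + 2^-1 * (c + i * d).
Proof. ring. Qed.

Lemma half_mul a b c d f g i :
  2^-1 * ((a * g + f * c) + i * (b * g + f * d)) =
  2^-1 * (a + i * b) * g + f * (2^-1 * (c + i * d)).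
Proof. ring. Qed.

Lemma half_sym a b c d i :
  2^-1 * (2^-1 * (a + i * b) + i * (2^-1 * (c + i * d))) =
  2^-1 * (2^-1 * (a + i * c) + i * (2^-1 * (b + i * d))).
Proof. ring. Qed.

Lemma half_conj a b c d i : i * i = -1 ->
  2^-1 * (c * a + d * b + i * (c * b - d * a)) = (c - d * i) * (2^-1 * (a + i * b)).
Proof.
move=> i2; rewrite [RHS](_ : _ = 2^-1 * (c * a + i * c * b - i * d * a - (i * i) * d * b)).
  by rewrite i2; ring.
by ring.
Qed.

End HalfSums.

Section ComplexSmooth.
Variables (R : realType) (n : nat).
Local Notation C := (Cplx R).
Local Notation E := 'rV[C]_n.
Implicit Types (f g : E -> C) (z w v h : E) (D : set E) (t s e : R) (k : nat).

Definition ref f : E -> R := fun z => re (f z).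
Definition imf f : E -> R := fun z => im (f z).

(** The bridge over which the closure properties of [RCn] reach complex functions. *)
Lemma Cn_onE k D f : Cn_on k D f <-> RCn k D (ref f) /\ RCn k D (imf f).
Proof.
elim: k f => [|k ih] f.
  split=> [[h _]|[[h1 _] [h2 _]]].
    by split; split => // z /h/continuousC_reim[].
  by split=> // z Dz; apply/continuousC_reim; split; [exact: h1|exact: h2].
split=> [[h h']|[[h1 h1'] [h2 h2']]].
  split; (split; first by move=> z /h/continuousC_reim[]); move=> v;
    have [hd /ih[hr hi]] := h' v; split => // z /hd[] //.
split; first by move=> z Dz; apply/continuousC_reim; split; [exact: h1|exact: h2].
move=> v; have [a1 b1] := h1' v; have [a2 b2] := h2' v; split.
  by move=> z Dz; split; [exact: a1|exact: a2].
by apply/ih.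
Qed.

Definition is_cder f v z (d : C) :=
  is_rder (ref f) v z (re d) /\ is_rder (imf f) v z (im d).

Lemma is_cder_val f v z d : is_cder f v z d -> real_derive v f z = d.
Proof. by move=> [h1 h2]; apply: eq_reim; [exact: is_rder_val h1|exact: is_rder_val h2]. Qed.

Lemma is_cder_eq f v z d d' : is_cder f v z d -> d = d' -> is_cder f v z d'.
Proof. by move=> h <-. Qed.

Lemma Cn_is_cder k D f v z : Cn_on k.+1 D f -> D z -> is_cder f v z (real_derive v f z).
Proof. by move=> /Cn_onE[h1 h2] Dz; split; [exact: (RCn_is_rder v h1 Dz)|exact: (RCn_is_rder v h2 Dz)]. Qed.

Lemma is_cder_cst (c : C) v z : is_cder (fun=> c) v z 0.
Proof. by split; exact: is_rder_cst. Qed.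

Lemma is_cderD f g v z a b : is_cder f v z a -> is_cder g v z b ->
  is_cder (fun w => f w + g w) v z (a + b).
Proof.
move=> [h1 h2] [h3 h4]; split; rewrite ?reD ?imD.
- rewrite (_ : ref _ = fun w => ref f w + ref g w); first exact: is_rderD.
  by apply/funext => w; rewrite /ref reD.
- rewrite (_ : imf _ = fun w => imf f w + imf g w); first exact: is_rderD.
  by apply/funext => w; rewrite /imf imD.
Qed.

Lemma is_rderB (u g : E -> R) v z a b : is_rder u v z a -> is_rder g v z b ->
  is_rder (fun w => u w - g w) v z (a - b).
Proof. by move=> h1 h2; apply: is_rderD h1 (is_rderN h2). Qed.

Lemma is_cderM f g v z a b : is_cder f v z a -> is_cder g v z b ->
  is_cder (fun w => f w * g w) v z (a * g z + f z * b).
Proof.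
move=> [h1 h2] [h3 h4]; split.
- rewrite (_ : ref _ = fun w => ref f w * ref g w - imf f w * imf g w); last first.
    by apply/funext => w; rewrite /ref reM.
  rewrite (_ : re _ = (re a * ref g z + ref f z * re b) -
    (im a * imf g z + imf f z * im b)); last by rewrite reD !reM /ref /imf; ring.
  by apply: is_rderB; exact: is_rderM.
- rewrite (_ : imf _ = fun w => ref f w * imf g w + imf f w * ref g w); last first.
    by apply/funext => w; rewrite /imf imM.
  rewrite (_ : im _ = (re a * imf g z + ref f z * im b) +
    (im a * ref g z + imf f z * re b)); last by rewrite imD !imM /ref /imf; ring.
  by apply: is_rderD; exact: is_rderM.
Qed.

Lemma is_cderZ (c : C) f v z a : is_cder f v z a -> is_cder (fun w => c * f w) v z (c * a).
Proof.
move=> h; apply: is_cder_eq (is_cderM (is_cder_cst c v z) h) _.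
by rewrite mul0r add0r.
Qed.

Lemma is_cder_conj f v z a : is_cder f v z a ->
  is_cder (fun w => Num.conj (f w)) v z (Num.conj a).
Proof.
move=> [h1 h2]; split; rewrite ?re_conj ?im_conj.
- rewrite (_ : ref _ = ref f) //; by apply/funext => w; rewrite /ref re_conj.
- rewrite (_ : imf _ = fun w => - imf f w); first exact: is_rderN.
  by apply/funext => w; rewrite /imf im_conj.
Qed.

Lemma is_cder_sum I (r : seq I) (F : I -> E -> C) (d : I -> C) v z :
  (forall i, is_cder (F i) v z (d i)) ->
  is_cder (fun w => \sum_(i <- r) F i w) v z (\sum_(i <- r) d i).
Proof.
move=> h; elim: r => [|i r ih].
  rewrite big_nil (_ : (fun w => _) = fun=> 0); first exact: is_cder_cst.
  by apply/funext => w; rewrite big_nil.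
rewrite big_cons (_ : (fun w => _) = fun w => F i w + \sum_(j <- r) F j w).
  exact: is_cderD.
by apply/funext => w; rewrite big_cons.
Qed.

Lemma Cn_cst k D (c : C) : open D -> Cn_on k D (fun=> c).
Proof. by move=> oD; apply/Cn_onE; split; exact: RCn_cst. Qed.

Lemma CnD k D f g : open D -> Cn_on k D f -> Cn_on k D g ->
  Cn_on k D (fun w => f w + g w).
Proof.
move=> oD /Cn_onE[h1 h2] /Cn_onE[h3 h4]; apply/Cn_onE; split.
- rewrite (_ : ref _ = fun w => ref f w + ref g w); first exact: RCnD.
  by apply/funext => w; rewrite /ref reD.
- rewrite (_ : imf _ = fun w => imf f w + imf g w); first exact: RCnD.
  by apply/funext => w; rewrite /imf imD.
Qed.

Lemma CnM k D f g : open D -> Cn_on k D f -> Cn_on k D g ->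
  Cn_on k D (fun w => f w * g w).
Proof.
move=> oD /Cn_onE[h1 h2] /Cn_onE[h3 h4]; apply/Cn_onE; split.
- rewrite (_ : ref _ = fun w => ref f w * ref g w + - (imf f w * imf g w)); last first.
    by apply/funext => w; rewrite /ref reM.
  by apply: RCnD => //; [exact: RCnM|apply: RCnN => //; exact: RCnM].
- rewrite (_ : imf _ = fun w => ref f w * imf g w + imf f w * ref g w); last first.
    by apply/funext => w; rewrite /imf imM.
  by apply: RCnD => //; exact: RCnM.
Qed.

Lemma CnZ k D (c : C) f : open D -> Cn_on k D f -> Cn_on k D (fun w => c * f w).
Proof. by move=> oD; apply: CnM => //; exact: Cn_cst. Qed.

Lemma Cn_conj k D f : open D -> Cn_on k D f -> Cn_on k D (fun w => Num.conj (f w)).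
Proof.
move=> oD /Cn_onE[h1 h2]; apply/Cn_onE; split.
- rewrite (_ : ref _ = ref f) //; by apply/funext => w; rewrite /ref re_conj.
- rewrite (_ : imf _ = fun w => - imf f w); first exact: RCnN.
  by apply/funext => w; rewrite /imf im_conj.
Qed.

Lemma Cn_sum k D I (r : seq I) (P : pred I) (F : I -> E -> C) : open D ->
  (forall i, P i -> Cn_on k D (F i)) ->
  Cn_on k D (fun w => \sum_(i <- r | P i) F i w).
Proof.
move=> oD hF; elim: r => [|i r ih].
  by rewrite (_ : (fun w => _) = fun=> 0);
    [exact: Cn_cst|apply/funext => w; rewrite big_nil].
have [Pi|Pi] := boolP (P i).
  rewrite (_ : (fun w => _) = fun w => F i w + \sum_(j <- r | P j) F j w).
    by apply: CnD => //; exact: hF.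
  by apply/funext => w; rewrite big_cons Pi.
rewrite (_ : (fun w => _) = fun w => \sum_(j <- r | P j) F j w) //.
by apply/funext => w; rewrite big_cons (negbTE Pi).
Qed.

Lemma Cn_prod k D I (r : seq I) (F : I -> E -> C) : open D ->
  (forall i, Cn_on k D (F i)) -> Cn_on k D (fun w => \prod_(i <- r) F i w).
Proof.
move=> oD hF; elim: r => [|i r ih].
  by rewrite (_ : (fun w => _) = fun=> 1);
    [exact: Cn_cst|apply/funext => w; rewrite big_nil].
rewrite (_ : (fun w => _) = fun w => F i w * \prod_(j <- r) F j w); first exact: CnM.
by apply/funext => w; rewrite big_cons.
Qed.

Lemma Cn_eq k D f g : open D -> (forall z, D z -> f z = g z) ->
  Cn_on k D f -> Cn_on k D g.
Proof.
move=> oD h /Cn_onE[h1 h2]; apply/Cn_onE; split.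
- by apply: RCn_eq h1 => // z Dz; rewrite /ref h.
- by apply: RCn_eq h2 => // z Dz; rewrite /imf h.
Qed.

Lemma Cn_near k D f g : (forall z, D z -> \forall w \near z, f w = g w) ->
  Cn_on k D f -> Cn_on k D g.
Proof.
move=> h /Cn_onE[h1 h2]; apply/Cn_onE; split.
- by apply: RCn_near h1 => // z /h; apply: filterS => w; rewrite /ref => ->.
- by apply: RCn_near h2 => // z /h; apply: filterS => w; rewrite /imf => ->.
Qed.

Lemma real_derive_near f g v z : (\forall w \near z, f w = g w) ->
  real_derive v f z = real_derive v g z.
Proof.
move=> h; apply: eq_reim.
- by apply: (@rder_near _ _ (ref f) (ref g) v z); apply: (filterS _ h) => w; rewrite /ref => ->.
- by apply: (@rder_near _ _ (imf f) (imf g) v z); apply: (filterS _ h) => w; rewrite /imf => ->.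
Qed.

Lemma Cn_pointwise k D f : Cn_on k D f <-> forall z, D z -> Cn_on k [set z] f.
Proof.
split=> [/Cn_onE[/RCn_pointwise h1 /RCn_pointwise h2] z Dz|h].
  by apply/Cn_onE; split; [exact: h1|exact: h2].
by apply/Cn_onE; split; apply/RCn_pointwise => z /h/Cn_onE[].
Qed.

Lemma Cn_subset k D D' f : D `<=` D' -> Cn_on k D' f -> Cn_on k D f.
Proof. by move=> s /Cn_pointwise h; apply/Cn_pointwise => z /s/h. Qed.

Lemma Cn_der k D f v : Cn_on k.+1 D f -> Cn_on k D (real_derive v f).
Proof. by move=> [_ h]; exact: (proj2 (h v)). Qed.

Lemma Cn_cont k D f z : Cn_on k D f -> D z -> {for z, continuous f}.
Proof. by case: k => [|k] [h _]; exact: h. Qed.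

Lemma CnS k D f : Cn_on k.+1 D f -> Cn_on k D f.
Proof. by move=> /Cn_onE[h1 h2]; apply/Cn_onE; split; exact: RCnS. Qed.

Lemma CnI k D f (df : E -> E -> C) : open D ->
  (forall z, D z -> {for z, continuous f}) ->
  (forall v z, D z -> is_cder f v z (df v z)) ->
  (forall v, Cn_on k D (df v)) -> Cn_on k.+1 D f.
Proof.
move=> oD fc fd dfC; split=> // v; split.
  by move=> z Dz; have [/is_rderE[a _] /is_rderE[b _]] := fd v z Dz; exact: (conj a b).
by apply: (Cn_eq oD _ (dfC v)) => z Dz; rewrite (is_cder_val (fd v z Dz)).
Qed.

Lemma real_deriveD D f v w z : Cn_on 1 D f -> nbhs z D ->
  real_derive (v + w) f z = real_derive v f z + real_derive w f z.
Proof.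
move=> /Cn_onE[h1 h2] zD; apply: eq_reim; rewrite ?reD ?imD.
- exact: rderD h1 zD.
- exact: rderD h2 zD.
Qed.

Lemma real_deriveZ D f t v z : Cn_on 1 D f -> nbhs z D ->
  real_derive ((t%:C)%C *: v) f z = (t%:C)%C * real_derive v f z.
Proof.
move=> /Cn_onE[h1 h2] zD; apply: eq_reim; rewrite ?re_rcM ?im_rcM.
- exact: rderZ h1 zD.
- exact: rderZ h2 zD.
Qed.

Lemma real_derive_sym D f v w z : Cn_on 2 D f -> nbhs z D ->
  real_derive w (real_derive v f) z = real_derive v (real_derive w f) z.
Proof.
move=> /Cn_onE[h1 h2] zD; apply: eq_reim.
- exact: rder_sym h1 zD.
- exact: rder_sym h2 zD.
Qed.

Lemma complex_split (c : C) : c = ((re c)%:C)%C + ((im c)%:C)%C * 'i.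
Proof.
apply: eq_reim; rewrite ?reD ?imD ?reM ?imM ?re_i ?im_i /=; ring.
Qed.

Lemma scale_complex (c : C) v : c *: v = ((re c)%:C)%C *: v + ((im c)%:C)%C *: ('i *: v).
Proof. by rewrite scalerA -scalerDl -complex_split. Qed.

Lemma conj_split (c : C) : Num.conj c = ((re c)%:C)%C - ((im c)%:C)%C * 'i.
Proof.
by apply: eq_reim; rewrite ?reB ?imB ?reM ?imM ?re_conj ?im_conj ?re_i ?im_i /=; ring.
Qed.

Lemma ii : 'i * 'i = -1 :> C.
Proof. by rewrite -expr2 sqrCi. Qed.

Lemma real_derive_c D f (c : C) v z : Cn_on 1 D f -> nbhs z D ->
  real_derive (c *: v) f z =
    ((re c)%:C)%C * real_derive v f z + ((im c)%:C)%C * real_derive ('i *: v) f z.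
Proof.
move=> hf zD; rewrite {1}scale_complex (real_deriveD _ _ hf zD).
by rewrite !(real_deriveZ _ _ hf zD).
Qed.

Lemma dbar_deriveD D f v w z : Cn_on 1 D f -> nbhs z D ->
  dbar_derive (v + w) f z = dbar_derive v f z + dbar_derive w f z.
Proof.
by move=> hf zD; rewrite /dbar_derive scalerDr !(real_deriveD _ _ hf zD) half_add.
Qed.

Lemma real_deriveN D f v z : Cn_on 1 D f -> nbhs z D ->
  real_derive (- v) f z = - real_derive v f z.
Proof.
move=> hf zD; have := real_deriveZ (-1) v hf zD.
by rewrite rcN rc1 scaleN1r mulN1r.
Qed.

(** Real linearity of the differential reduces [c *: v] to the directions [v] and ['i *: v]; since
    ['i *: ('i *: v) = - v], the average defining [dbar_derive] picks up the conjugate of [c]. *)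
Lemma dbar_deriveZ D f (c : C) v z : Cn_on 1 D f -> nbhs z D ->
  dbar_derive (c *: v) f z = Num.conj c * dbar_derive v f z.
Proof.
move=> hf zD; rewrite /dbar_derive.
have e1 := real_derive_c c v hf zD.
have e2 := real_derive_c c ('i *: v) hf zD.
have iv : 'i *: ('i *: v) = - v by rewrite scalerA ii scaleN1r.
rewrite iv (real_deriveN v hf zD) in e2.
have ic : 'i *: (c *: v) = c *: ('i *: v) by rewrite !scalerA mulrC.
rewrite ic e1 e2 conj_split mulrN.
exact: half_conj ii.
Qed.

Lemma is_cder_dbar f w z a b : is_cder f w z a -> is_cder f ('i *: w) z b ->
  dbar_derive w f z = 2^-1 * (a + 'i * b).
Proof. by move=> /is_cder_val ha /is_cder_val hb; rewrite /dbar_derive ha hb. Qed.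

(** Existence of all real directional derivatives at one point. It is weaker than differentiability,
    but it is what the sum and product rules for [dbar_derive] use. *)
Definition pdiff f z := forall v, real_derivable f v z.

Lemma pdiffP f v z : pdiff f z -> is_cder f v z (real_derive v f z).
Proof. by move=> /(_ v)[h1 h2]; split; exact: rdiffP. Qed.

Lemma Cn_pdiff k D f z : Cn_on k.+1 D f -> D z -> pdiff f z.
Proof. by move=> [_ h] Dz v; have [h1 _] := h v; exact: h1. Qed.

Lemma pdiff_cst (c : C) z : pdiff (fun=> c) z.
Proof. by move=> v; have [/is_rderE[a _] /is_rderE[b _]] := is_cder_cst c v z; exact: (conj a b). Qed.

Lemma dbar_cst (c : C) w z : dbar_derive w (fun=> c) z = 0.
Proof.
by rewrite (is_cder_dbar (is_cder_cst c w z) (is_cder_cst c _ z)) mulr0 addr0 mulr0.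
Qed.

Lemma dbarD f g w z : pdiff f z -> pdiff g z ->
  dbar_derive w (fun y => f y + g y) z = dbar_derive w f z + dbar_derive w g z.
Proof.
move=> hf hg; rewrite (is_cder_dbar (is_cderD (pdiffP w hf) (pdiffP w hg))
  (is_cderD (pdiffP _ hf) (pdiffP _ hg))); exact: half_add.
Qed.

Lemma dbarM f g w z : pdiff f z -> pdiff g z ->
  dbar_derive w (fun y => f y * g y) z =
    dbar_derive w f z * g z + f z * dbar_derive w g z.
Proof.
move=> hf hg; rewrite (is_cder_dbar (is_cderM (pdiffP w hf) (pdiffP w hg))
  (is_cderM (pdiffP _ hf) (pdiffP _ hg))); exact: half_mul.
Qed.

Lemma dbarZ (c : C) f w z : pdiff f z ->
  dbar_derive w (fun y => c * f y) z = c * dbar_derive w f z.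
Proof.
by move=> hf; rewrite (dbarM _ (@pdiff_cst c z) hf) dbar_cst mul0r add0r.
Qed.

Lemma pdiffM f g z : pdiff f z -> pdiff g z -> pdiff (fun y => f y * g y) z.
Proof.
move=> hf hg v.
have [/is_rderE[a _] /is_rderE[b _]] := is_cderM (pdiffP v hf) (pdiffP v hg); exact: (conj a b).
Qed.

Lemma dbar_sum I (r : seq I) (F : I -> E -> C) w z :
  (forall i, pdiff (F i) z) ->
  dbar_derive w (fun y => \sum_(i <- r) F i y) z = \sum_(i <- r) dbar_derive w (F i) z.
Proof.
move=> h; rewrite (is_cder_dbar (is_cder_sum r (fun i => pdiffP w (h i)))
  (is_cder_sum r (fun i => pdiffP _ (h i)))).
by rewrite mulr_sumr -big_split mulr_sumr.
Qed.

Lemma dbar_near f g w z : (\forall y \near z, f y = g y) ->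
  dbar_derive w f z = dbar_derive w g z.
Proof. by move=> h; rewrite /dbar_derive !(real_derive_near _ h). Qed.

Lemma dbar_sym D f v w z : Cn_on 2 D f -> open D -> D z ->
  dbar_derive v (dbar_derive w f) z = dbar_derive w (dbar_derive v f) z.
Proof.
move=> hf oD Dz; have zD : nbhs z D by apply: open_nbhs_nbhs.
have key a b : dbar_derive a (dbar_derive b f) z =
    2^-1 * (2^-1 * (real_derive a (real_derive b f) z +
      'i * real_derive a (real_derive ('i *: b) f) z) +
     'i * (2^-1 * (real_derive ('i *: a) (real_derive b f) z +
      'i * real_derive ('i *: a) (real_derive ('i *: b) f) z))).
  apply: is_cder_dbar; apply: is_cderZ; apply: is_cderD.
  - exact: (Cn_is_cder a (Cn_der b hf) Dz).
  - apply: is_cderZ; exact: (Cn_is_cder a (Cn_der _ hf) Dz).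
  - exact: (Cn_is_cder _ (Cn_der b hf) Dz).
  - apply: is_cderZ; exact: (Cn_is_cder _ (Cn_der _ hf) Dz).
rewrite !key (real_derive_sym w v hf zD) (real_derive_sym ('i *: w) v hf zD).
rewrite (real_derive_sym w ('i *: v) hf zD) (real_derive_sym ('i *: w) ('i *: v) hf zD).
exact: half_sym.
Qed.

Lemma Cn_dbar k D f w : open D -> Cn_on k.+1 D f -> Cn_on k D (dbar_derive w f).
Proof.
move=> oD hf; apply: CnZ => //; apply: CnD => //; first exact: Cn_der.
by apply: CnZ => //; exact: Cn_der.
Qed.

End ComplexSmooth.

(** * Complex differentiability *)

Section Holomorphic.
Variables (R : realType) (n : nat).
Local Notation C := (Cplx R).
Local Notation E := 'rV[C]_n.
Implicit Types (f g : E -> C) (z w v h : E) (D : set E) (t s e : R) (k : nat).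

Lemma normC_rc t : `|(t%:C)%C : C| = ((`|t|)%:C)%C.
Proof. by rewrite normc_def /= expr0n /= addr0 sqrtr_sqr. Qed.

Lemma derivable_eps f v z : derivable f z v -> forall e, 0 < e ->
  exists2 r : R, 0 < r & forall h : C, `|h| < (r%:C)%C ->
    `|f (z + h *: v) - f z - h * 'D_v f z| <= (e%:C)%C * `|h|.
Proof.
move=> df e e0; have ec : 0 < (e%:C)%C :> C by rewrite ltcR.
have /cvgrPdist_le/(_ _ ec) := df.
rewrite near_withinE => /nbhs_ballP[r' /= /gt0_real[r r0 ->] hr].
exists r => // h tr; have [->|t0] := eqVneq h 0.
  by rewrite scale0r addr0 mul0r subr0 subrr !normr0 mulr0.
have := hr h; rewrite /ball /= sub0r normrN => /(_ tr t0).
rewrite -/(derive f z v) (addrC _ z) => hh.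
rewrite (_ : _ - _ = h * (h^-1 * (f (z + h *: v) - f z) - 'D_v f z)).
  by rewrite normrM [leRHS]mulrC; apply: ler_wpM2l => //; rewrite distrC.
by rewrite mulrBr mulVKf.
Qed.

Lemma derivable_is_cder f v z : derivable f z v -> is_cder f v z ('D_v f z).
Proof.
move=> /derivable_eps df.
split; apply/is_rder_eps => e /df[r r0 hr]; exists r => // t tr;
  have := hr ((t%:C)%C); rewrite normC_rc ltcR -rcM -/(rline z v t) => /(_ tr) hh;
  rewrite -lecR; apply: le_trans hh.
- by rewrite /ref -reB -re_rcM -reB ler_norm_re.
- by rewrite /imf -imB -im_rcM -imB ler_norm_im.
Qed.

Lemma hol_is_cder f v z : differentiable f z -> is_cder f v z ('d f z v).
Proof.
by move=> df; have := derivable_is_cder (@diff_derivable _ _ _ f z v df); rewrite (deriveE v df).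
Qed.

Lemma hol_real_derive f v z : differentiable f z -> real_derive v f z = 'd f z v.
Proof. by move=> /hol_is_cder h; exact: is_cder_val (h v). Qed.

Lemma hol_real_deriveZ f (c : C) v z : differentiable f z ->
  real_derive (c *: v) f z = c * real_derive v f z.
Proof. by move=> df; rewrite !hol_real_derive // linearZ. Qed.

Lemma CR_dbar f w z : real_derive ('i *: w) f z = 'i * real_derive w f z ->
  dbar_derive w f z = 0.
Proof. by move=> h; rewrite /dbar_derive h mulrA ii mulN1r subrr mulr0. Qed.

Lemma dbar_CR f w z : dbar_derive w f z = 0 ->
  real_derive ('i *: w) f z = 'i * real_derive w f z.
Proof.
move=> /eqP; rewrite /dbar_derive mulf_eq0 invr_eq0 pnatr_eq0 /= addr_eq0 => /eqP ->.
by rewrite mulrN mulrA ii mulN1r opprK.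
Qed.

Lemma hol_dbar f w z : differentiable f z -> dbar_derive w f z = 0.
Proof. by move=> df; apply: CR_dbar; exact: hol_real_deriveZ. Qed.

Lemma hol_pdiff f z : differentiable f z -> pdiff f z.
Proof.
move=> df v; have [/is_rderE[a _] /is_rderE[b _]] := hol_is_cder v df.
exact: (conj a b).
Qed.

Lemma entry_le_norm h j : `|h 0 j : C| <= `|h|.
Proof.
rewrite real_leNgt ?normr_real //; apply/negP => lt.
have : ball (0 : E) `|h 0 j| h by rewrite mx_norm_ball /ball_ /= sub0r normrN.
move=> [_ /(_ 0 j)]; rewrite mxE /ball /= sub0r normrN.
by rewrite ltxx.
Qed.

Lemma vnorm_le_norm h : exists2 r : R, `|h| = (r%:C)%C & vnorm h <= (n * 2)%:R * r.
Proof.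
have hr : `|h| = ((re `|h|)%:C)%C by rewrite RRe_real // normr_real.
exists (re `|h|) => //; set r := re _ in hr *.
have hj j : `|re (h 0 j)| <= r /\ `|im (h 0 j)| <= r.
  split; rewrite -lecR -hr; apply: le_trans (entry_le_norm h j).
  - exact: ler_norm_re.
  - exact: ler_norm_im.
apply: (@le_trans _ _ (\sum_(j < n) (r *+ 2))).
  by apply: ler_sum => j _; have [h1 h2] := hj j; rewrite mulr2n; exact: lerD.
by rewrite sumr_const card_ord -mulrnA mulnC mulr_natl.
Qed.

(** Being C^1 gives the real first-order expansion with differential [rdiffl]; the Cauchy-Riemann
    equations make this differential complex-linear, and uniqueness of the differential identifies
    it with ['d f z]. *)
Lemma CR_differentiable D f z : Cn_on 1 D f -> nbhs z D ->
  (forall w, dbar_derive w f z = 0) -> differentiable f z.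
Proof.
move=> hf zD hd; have [h1 h2] := (Cn_onE _ _ _).1 hf.
have Llin : linear_for *:%R (fun h => real_derive h f z : C^o).
  move=> c v w; rewrite (real_deriveD _ _ hf zD) (real_derive_c _ _ hf zD).
  by rewrite (dbar_CR (hd v)) mulrA -mulrDl -complex_split.
pose L : {linear E -> C^o} := HB.pack (fun h => real_derive h f z : C^o)
  (GRing.isLinear.Build C E C^o *:%R _ Llin).
have reL h : re (L h) = rdiffl (ref f) z h by rewrite -(rder_lin _ h1 zD).
have imL h : im (L h) = rdiffl (imf f) z h by rewrite -(rder_lin _ h2 zD).
have Lc : continuous (L : E -> C).
  move=> x.
  have aux (u : E -> R) : {for x, continuous (rdiffl u z)}.
    apply/continuous_vnorm => e e0.
    set K := \sum_i `|rder (rbasis R i) u z|.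
    have K0 : 0 <= K by apply: sumr_ge0.
    exists (e / (K + 1)); first by rewrite divr_gt0 //; lra.
    move=> w; rewrite ltr_pdivlMr; last lra.
    move=> hw; rewrite (_ : _ - _ = rdiffl u z (w - x)).
      apply: le_lt_trans (rdiffl_bound _ _ _) _; rewrite -/K mulrC.
      by apply: le_lt_trans hw; apply: ler_wpM2l; [exact: vnorm_ge0|lra].
    have := rdifflD u z (w - x) x; rewrite subrK => ->; ring.
  apply/continuousC_reim; split.
  - have -> : (fun y => re (L y)) = rdiffl (ref f) z by apply/funext => y; exact: reL.
    exact: aux.
  - have -> : (fun y => im (L y)) = rdiffl (imf f) z by apply/funext => y; exact: imL.
    exact: aux.
have dL : f \o shift z = cst (f z) + (L : E -> C) +o_ (0 : E) id.
  apply/eqaddoP => ec /gt0_real[e e0 ->].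
  (* The real and the imaginary part each contribute [e1 * vnorm h], and [vnorm h] is at most [2n]
     times the norm of [h]; the successor keeps the divisor positive. *)
  pose e1 := e / (2 * (n * 2).+1%:R).
  have N0 : 0 < (n * 2).+1%:R :> R by rewrite ltr0n.
  have e10 : 0 < e1 by rewrite divr_gt0 // mulr_gt0.
  have [a a0 ha] := C1_frechet h1 zD e10.
  have [b b0 hb] := C1_frechet h2 zD e10.
  apply/nbhs_vnorm; exists (Num.min a b); first by rewrite lt_min a0.
  move=> h; rewrite subr0 lt_min => /andP[/ha h3 /hb h4].
  rewrite -![(_ + _ : _ -> _) _]/(_ + _) -![(- _ : _ -> _) _]/(- _) /= /cst.
  apply: le_trans (norm_le_reim _) _.
  have [r hr hv] := vnorm_le_norm h.
  rewrite hr -rcM lecR !reD !imD !reN !imN reD imD reL imL addrC.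
  rewrite (addrC h z) !opprD !addrA.
  apply: (@le_trans _ _ (e1 * vnorm h + e1 * vnorm h)); first by rewrite addrC; exact: lerD.
  have r0 : 0 <= r by rewrite -lecR -hr normr_ge0.
  have n0 : (n * 2)%:R <= (n * 2).+1%:R :> R by rewrite ler_nat.
  have h5 : vnorm h <= (n * 2).+1%:R * r by apply: le_trans hv _; exact: ler_wpM2r.
  have h6 : e1 * vnorm h <= e1 * ((n * 2).+1%:R * r) by apply: ler_wpM2l => //; exact: ltW.
  have h7 : e1 * ((n * 2).+1%:R * r) *+ 2 = e * r.
    rewrite -mulr_natr /e1; move: ((n * 2).+1%:R : R) N0 => N N0.
    by field; rewrite gt_eqF.
  by rewrite -h7 mulr2n lerD.
apply/diff_locallyP; have dfL := diff_unique Lc dL.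
by rewrite dfL; split.
Qed.

End Holomorphic.

(** * Integrals of continuous functions on segments *)

Section RealIntegral.
Variable R : realType.
Implicit Types (f g F G : R -> R) (a b c t x M e : R).

Definition seg a b x : Prop := a <= x <= b.

Definition primitive f a b F := forall x, seg a b x -> is_derive x (1 : R) F (f x).

Lemma is_derive_cont F x d : is_derive x (1 : R) F d -> {for x, continuous F}.
Proof.
by move=> [h _]; apply: differentiable_continuous; apply/derivable1_diffP.
Qed.

Lemma mvt_segment F (dF : R -> R) a b :
  (forall x, seg a b x -> is_derive x (1 : R) F (dF x)) -> a <= b ->
  exists2 c, seg a b c & F b - F a = dF c * (b - a).
Proof.
move=> h ab; have [||c cab ->] := @MVT_segment _ F dF a b ab.
- by move=> x /subset_itv_oo_cc; rewrite in_itv => /h.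
- apply: continuous_in_subspaceT => x /set_mem /=; rewrite in_itv /= => hx.
  exact: is_derive_cont (h x hx).
by exists c => //; move: cab; rewrite in_itv.
Qed.

Lemma primitive_exists f a b : (forall x, seg a b x -> {for x, continuous f}) ->
  exists F, primitive f a b F.
Proof.
move=> fc.
(* Clamping to [[a, b]] makes [f] continuous on the whole line without changing it on the
   segment. *)
pose cl x := Num.max a (Num.min b x).
have [ab|ab] := leP a b; last first.
  by exists (fun=> 0) => x /andP[h1 h2]; have := le_trans h1 h2; rewrite leNgt ab.
have clab x : seg a b (cl x).
  by rewrite /seg /cl le_max lexx /= ge_max ab ge_min lexx.
have clc : continuous cl.
  move=> x; apply: (@continuous_max _ _ (fun=> a) (fun x => Num.min b x)).
    exact: cst_continuous.
  apply: (@continuous_min _ _ (fun=> b) id); first exact: cst_continuous.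
  by move=> y; exact: cvg_id.
have gc : continuous (f \o cl : R -> R).
  by move=> x; apply: continuous_comp; [exact: clc|exact/fc/clab].
(* The interval is enlarged by 1 on both sides, so that [a] and [b] become interior points and the
   fundamental theorem gives two-sided derivatives there. *)
have gi : lebesgue_measure.-integrable `[a - 1, b + 1] (EFin \o (f \o cl)).
  apply: continuous_compact_integrable; first exact: segment_compact.
  exact: continuous_subspaceT.
exists (fun x => (\int[lebesgue_measure]_(t in [set` `[a - 1, x]]) ((f \o cl) t))%R).
move=> x /andP[ax xb].
have h1 : x < b + 1 by lra.
have h2 : a - 1 < x by lra.
have [d1 d2] := continuous_FTC1_closed h1 gi h2 (gc x).
split; first exact: d1.
rewrite -derive1E d2 /= /cl; congr f.
by rewrite min_r // max_r.
Qed.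

(** The integral as the increment of a primitive, with value 0 if there is none. Its rules thereby
    become rules for derivatives; measure theory enters only through the existence of primitives. *)
Definition rint f a b : R :=
  match pselect (exists F, primitive f a b F) with
  | left h => let F := sval (cid h) in F b - F a
  | right _ => 0
  end.

Lemma seg_l a b : a <= b -> seg a b a. Proof. by move=> h; rewrite /seg lexx. Qed.
Lemma seg_r a b : a <= b -> seg a b b. Proof. by move=> h; rewrite /seg lexx andbT. Qed.

Lemma primitive_unique f a b F G : a <= b -> primitive f a b F -> primitive f a b G ->
  F b - F a = G b - G a.
Proof.
move=> ab hF hG.
have [|c _] := @mvt_segment (fun x => F x - G x) (fun=> 0) a b _ ab.
- move=> x hx; have := @is_deriveB _ _ _ F G x 1 _ _ (hF x hx) (hG x hx).
  by rewrite subrr.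
by rewrite mul0r => /eqP; rewrite subr_eq0 => /eqP; lra.
Qed.

Lemma rint_val f a b F : a <= b -> primitive f a b F -> rint f a b = F b - F a.
Proof.
move=> ab hF; rewrite /rint; case: pselect => [h|]; last by case; exists F.
exact: (primitive_unique ab (svalP (cid h)) hF).
Qed.

Lemma rint_ext f g a b : (forall x, seg a b x -> f x = g x) ->
  a <= b -> rint f a b = rint g a b.
Proof.
move=> fg ab; have e : forall F, primitive f a b F <-> primitive g a b F.
  by move=> F; split=> h x hx; have := h x hx; rewrite fg.
rewrite {1}/rint; case: pselect => [h|h].
  by apply/esym/rint_val => //; apply/e; exact: (svalP (cid h)).
rewrite /rint; case: pselect => // -[F hF]; case: h; exists F; exact/e.
Qed.

Definition contseg f a b := forall x, seg a b x -> {for x, continuous f}.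

Lemma rintD f g a b : a <= b -> contseg f a b -> contseg g a b ->
  rint (fun x => f x + g x) a b = rint f a b + rint g a b.
Proof.
move=> ab /primitive_exists[F hF] /primitive_exists[G hG].
rewrite (rint_val ab hF) (rint_val ab hG) (@rint_val _ a b (fun x => F x + G x)) //.
  ring.
by move=> x hx; exact: (@is_deriveD _ _ _ F G x 1 _ _ (hF x hx) (hG x hx)).
Qed.

Lemma rintZ (k : R) f a b : a <= b -> contseg f a b ->
  rint (fun x => k * f x) a b = k * rint f a b.
Proof.
move=> ab /primitive_exists[F hF].
rewrite (rint_val ab hF) (@rint_val _ a b (fun x => k * F x)) //; first ring.
by move=> x hx; exact: (@is_deriveZ _ _ _ F k x 1 _ (hF x hx)).
Qed.

Lemma rintB f g a b : a <= b -> contseg f a b -> contseg g a b ->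
  rint (fun x => f x - g x) a b = rint f a b - rint g a b.
Proof.
move=> ab /primitive_exists[F hF] /primitive_exists[G hG].
rewrite (rint_val ab hF) (rint_val ab hG) (@rint_val _ a b (fun x => F x - G x)) //.
  ring.
by move=> x hx; exact: (@is_deriveB _ _ _ F G x 1 _ _ (hF x hx) (hG x hx)).
Qed.

Lemma rint_bound f a b M : a <= b -> contseg f a b ->
  (forall x, seg a b x -> `|f x| <= M) -> `|rint f a b| <= M * (b - a).
Proof.
move=> ab /primitive_exists[F hF] hM; rewrite (rint_val ab hF).
have [c hc ->] := mvt_segment hF ab.
rewrite normrM [`|b - a|]ger0_norm ?subr_ge0 //.
by apply: ler_wpM2r; [rewrite subr_ge0|exact: hM].
Qed.

Lemma rint_cat f a c b : a <= c -> c <= b -> contseg f a b ->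
  rint f a b = rint f a c + rint f c b.
Proof.
move=> ac cb /primitive_exists[F hF].
rewrite (rint_val (le_trans ac cb) hF) (@rint_val f a c F ac) ?(@rint_val f c b F cb).
- ring.
- move=> x /andP[h1 h2]; apply: hF; rewrite /seg (le_trans ac h1) //.
- by move=> x /andP[h1 h2]; apply: hF; rewrite /seg h1 (le_trans h2 cb).
Qed.

Lemma rint_cst k a b : a <= b -> rint (fun=> k) a b = k * (b - a).
Proof.
move=> ab; rewrite (@rint_val _ a b (fun x => 0 + x * k) ab); first ring.
by move=> x _; exact: is_derive_affine.
Qed.

Section AffineReparam.
Variables (S : topologicalType) (s0 : S) (a b : R).
Hypothesis ab : a <= b.

(** A tube argument: joint continuity gives a product neighbourhood of each [(s0, t)], and
    compactness of [[a, b]] a common neighbourhood of [s0]. *)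
Lemma param_uniform (G : S -> R -> R) :
  (forall t, seg a b t -> {for (s0, t), continuous (fun p : S * R => G p.1 p.2)}) ->
  forall e, 0 < e -> \forall s \near s0, forall t, seg a b t -> `|G s t - G s0 t| < e.
Proof.
move=> hG e e0.
have cov := (compact_near_coveringP `[a, b]).1 (@segment_compact _ a b).
have h : \forall s \near nbhs s0, `[a, b] `<=` (fun t => `|G s t - G s0 t| < e).
  apply: cov => t; rewrite /= in_itv /= => tab.
  have e2 : 0 < e / 2 by lra.
  have /continuousR_eps/(_ _ e2) := hG t tab.
  move=> [[/= U V] [hU hV] hUV].
  exists (V, U) => /=; first by split.
  move=> [t' s] [/= Vt' Us].
  have h1 := hUV (s, t') (conj Us Vt').
  have h2 := hUV (s0, t') (conj (nbhs_singleton hU) Vt').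
  move: h1 h2; rewrite /=; move: (G s t') (G s0 t') (G s0 t) => x y z.
  move=> h1 h2; rewrite (_ : x - y = (x - z) - (y - z)); last by ring.
  by apply: le_lt_trans (ler_normB _ _) _; lra.
by apply: filterS h => s hs t tab; apply: hs; rewrite /= in_itv.
Qed.

Lemma joint_section (G : S -> R -> R) s t :
  {for (s, t), continuous (fun p : S * R => G p.1 p.2)} -> {for t, continuous (G s)}.
Proof.
move=> h; apply/continuousR_eps => e e0.
have /continuousR_eps/(_ e e0)[[U V] [/= hU hV] hUV] := h.
apply: filterS hV => t' Vt'; exact: (hUV (s, t') (conj (nbhs_singleton hU) Vt')).
Qed.

Lemma rint_param_continuous (G : S -> R -> R) :
  (forall t, seg a b t -> {for (s0, t), continuous (fun p : S * R => G p.1 p.2)}) ->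
  (\forall s \near s0, contseg (G s) a b) ->
  {for s0, continuous (fun s => rint (G s) a b)}.
Proof.
move=> hG hc; apply/continuousR_eps => e e0; have ab' := ab.
have e1 : 0 < e / (b - a + 1) by rewrite divr_gt0 //; lra.
have := param_uniform hG e1; apply: filterS2 hc => s hs hu.
have hs0 : contseg (G s0) a b by move=> t /hG/joint_section.
rewrite -rintB //.
apply: (@le_lt_trans _ _ (e / (b - a + 1) * (b - a))).
  apply: rint_bound => //; last by move=> t /hu/ltW.
  move=> t tab; apply: (@continuousB _ _ _ (G s) (G s0)); [exact: hs|exact: hs0].
rewrite mulrAC ltr_pdivrMr; last lra.
by rewrite ltr_pM2l //; lra.
Qed.

End AffineReparam.

(** The mean value theorem in the parameter turns [G h t - G 0 t] into [h * dG x t] with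
    [|x| <= |h|], and [dG x t] is close to [dG 0 t] uniformly in [t]. *)
Lemma rint_param_derive a b (G dG : R -> R -> R) : a <= b ->
  (forall t, seg a b t -> {for (0, t), continuous (fun p : R * R => dG p.1 p.2)}) ->
  (\forall h \near (0 : R), contseg (G h) a b) ->
  (\forall h \near (0 : R), forall t, seg a b t ->
     is_derive h (1 : R) (fun x => G x t) (dG h t)) ->
  is_derive (0 : R) (1 : R) (fun h => rint (G h) a b) (rint (dG 0) a b).
Proof.
move=> ab hdG hc hd; apply/is_derive_eps => e e0.
have e1 : 0 < e / (b - a + 1) by rewrite divr_gt0 //; lra.
have hu := param_uniform hdG e1.
have : \forall h \near (0 : R), contseg (G h) a b /\
    (forall t, seg a b t -> is_derive h (1 : R) (fun x => G x t) (dG h t)) /\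
    (forall t, seg a b t -> `|dG h t - dG 0 t| < e / (b - a + 1)).
  exact: filterI hc (filterI hd hu).
move=> /nbhs_ballP[r /= r0 hr].
exists r => // h hr0; rewrite add0r.
have rin x : `|x| <= `|h| -> ball (0 : R) r x.
  by move=> xh; rewrite /ball /= sub0r normrN; exact: le_lt_trans xh hr0.
have hdc : contseg (dG 0) a b by move=> t /hdG/joint_section.
have [hch _] := hr h (rin h (lexx _)).
have [hc0 _] : contseg (G 0) a b /\ True.
  have h0 : `|0 : R| <= `|h| by rewrite normr0.
  by have [hc0 _] := hr 0 (rin 0 h0).
have c1 : contseg (fun t => G h t - G 0 t) a b.
  by move=> t tab; apply: (@continuousB _ _ _ (G h) (G 0)); [exact: hch|exact: hc0].
have c2 : contseg (fun t => h * dG 0 t) a b.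
  move=> t tab; apply: (@continuousM _ _ (fun=> h) (dG 0)); last exact: hdc.
  exact: cst_continuous.
rewrite -(rintZ _ ab hdc) -(rintB ab hch hc0) -(rintB ab c1 c2).
have key t : seg a b t -> `|G h t - G 0 t - h * dG 0 t| <= e / (b - a + 1) * `|h|.
  move=> tab.
  have [x xh ->] : exists2 x, `|x| <= `|h| & G h t - G 0 t = h * dG x t.
    have [h0|h0] := leP 0 h.
    - have [|x /andP[x1 x2] ->] := @mvt_segment (fun x => G x t) (fun x => dG x t) 0 h _ h0.
        move=> x /andP[x1 x2]; have hx : `|x| <= `|h| by rewrite !ger0_norm.
        by have [_ [hxd _]] := hr x (rin x hx); exact: hxd.
      exists x; first by rewrite !ger0_norm.
      by rewrite subr0 mulrC.
    - have [|x /andP[x1 x2] e'] := @mvt_segment (fun x => G x t) (fun x => dG x t) h 0 _ (ltW h0).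
        move=> x /andP[x1 x2].
        have hx : `|x| <= `|h| by rewrite !ler0_norm ?lerN2 // ltW.
        by have [_ [hxd _]] := hr x (rin x hx); exact: hxd.
      exists x; first by rewrite !ler0_norm ?lerN2 // ltW.
      by move: e'; rewrite sub0r => e'; rewrite -opprB e' mulrN opprK mulrC.
  rewrite -mulrBr normrM mulrC ler_wpM2r //; apply/ltW.
  by have [_ [_ hxd]] := hr x (rin x xh); exact: hxd.
apply: (@le_trans _ _ (e / (b - a + 1) * `|h| * (b - a))).
  apply: rint_bound => // t tab.
  apply: (@continuousB _ _ _ (fun t => G h t - G 0 t) (fun t => h * dG 0 t)).
    exact: c1.
  exact: c2.
rewrite mulrAC; apply: ler_wpM2r => //.
rewrite mulrAC ler_pdivrMr; last lra.
by apply: ler_wpM2l; lra.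
Qed.

End RealIntegral.

(** * Integrals of complex-valued functions *)

Lemma continuous_pair (T U V : topologicalType) (f : T -> U) (g : T -> V) (x : T) :
  {for x, continuous f} -> {for x, continuous g} ->
  {for x, continuous (fun y => (f y, g y))}.
Proof.
move=> hf hg P [[/= A B] [hA hB] hAB]; change (\forall y \near x, P (f y, g y)).
have h1 : \forall y \near x, A (f y) by exact: hf.
have h2 : \forall y \near x, B (g y) by exact: hg.
by apply: (filterS _ (filterI h1 h2)) => y [Ay By]; apply: hAB.
Qed.

Section ComplexIntegral.
Variable R : realType.
Local Notation C := (Cplx R).
Implicit Types (f g F : R -> C) (a b c t x M e : R) (k : C).

Definition cint f a b : C :=
  Complex (rint (fun x => re (f x)) a b) (rint (fun x => im (f x)) a b).

(** A real-valued substitute for the modulus. It is submultiplicative and can reach twice a bound on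
    the modulus, whence several factors 2 in the estimates that follow. *)
Definition csize (x : C) : R := `|re x| + `|im x|.

Lemma csize_ge0 (x : C) : 0 <= csize x. Proof. exact: addr_ge0. Qed.
Lemma csizeD (x y : C) : csize (x + y) <= csize x + csize y.
Proof.
rewrite /csize reD imD; have := ler_normD (re x) (re y).
have := ler_normD (im x) (im y); lra.
Qed.
Lemma csizeN (x : C) : csize (- x) = csize x.
Proof. by rewrite /csize reN imN !normrN. Qed.
Lemma csizeB (x y : C) : csize (x - y) <= csize x + csize y.
Proof. by rewrite -(csizeN y); exact: csizeD. Qed.
Lemma csizeM (x y : C) : csize (x * y) <= csize x * csize y.
Proof.
rewrite /csize reM imM mulrDl !mulrDr -!normrM.
have := ler_normB (re x * re y) (im x * im y).
have := ler_normD (re x * im y) (im x * re y); lra.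
Qed.
Lemma csizeR t (x : C) : csize ((t%:C)%C * x) = `|t| * csize x.
Proof. by rewrite /csize re_rcM im_rcM !normrM mulrDr. Qed.
Lemma csizei (x : C) : csize ('i * x) = csize x.
Proof.
rewrite /csize reM imM re_i im_i !mul0r !mul1r sub0r add0r normrN.
by rewrite addrC.
Qed.
Lemma csize_eq0 (x : C) : csize x <= 0 -> x = 0.
Proof.
rewrite /csize => h; apply: eq_reim; apply/eqP; rewrite -normr_le0;
  have := normr_ge0 (re x); have := normr_ge0 (im x); lra.
Qed.

Definition ccontseg f a b := forall x, seg a b x -> {for x, continuous f}.

Lemma ccontseg_re f a b : ccontseg f a b -> contseg (fun x => re (f x)) a b.
Proof. by move=> h x /h/continuousC_reim[]. Qed.
Lemma ccontseg_im f a b : ccontseg f a b -> contseg (fun x => im (f x)) a b.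
Proof. by move=> h x /h/continuousC_reim[]. Qed.

Definition cprimitive f a b F := forall x, seg a b x ->
  is_derive x (1 : R) (fun t => re (F t)) (re (f x)) /\
  is_derive x (1 : R) (fun t => im (F t)) (im (f x)).

Lemma cint_val f F a b : a <= b -> cprimitive f a b F -> cint f a b = F b - F a.
Proof.
move=> ab hF; apply: eq_reim; rewrite ?reB ?imB /=.
- by apply: (@rint_val _ _ _ _ (fun t => re (F t))) => // x /hF[].
- by apply: (@rint_val _ _ _ _ (fun t => im (F t))) => // x /hF[].
Qed.

Lemma cint_ext f g a b : (forall x, seg a b x -> f x = g x) -> a <= b ->
  cint f a b = cint g a b.
Proof.
by move=> fg ab; apply: eq_reim; apply: rint_ext => // x /fg ->.
Qed.

Lemma cintD f g a b : a <= b -> ccontseg f a b -> ccontseg g a b ->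
  cint (fun x => f x + g x) a b = cint f a b + cint g a b.
Proof.
move=> ab hf hg; apply: eq_reim; rewrite ?reD ?imD /=.
- rewrite -rintD //; try exact: ccontseg_re.
  by apply: rint_ext => // x _; rewrite reD.
- rewrite -rintD //; try exact: ccontseg_im.
  by apply: rint_ext => // x _; rewrite imD.
Qed.

Lemma ccontsegM f g a b : ccontseg f a b -> ccontseg g a b ->
  ccontseg (fun x => f x * g x) a b.
Proof.
move=> hf hg x hx; apply: (@continuousM _ _ f g); [exact: hf|exact: hg].
Qed.

Lemma ccontsegD f g a b : ccontseg f a b -> ccontseg g a b ->
  ccontseg (fun x => f x + g x) a b.
Proof.
move=> hf hg x hx; apply: (@continuousD _ _ _ f g); [exact: hf|exact: hg].
Qed.

Lemma ccontseg_cst k a b : ccontseg (fun=> k) a b.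
Proof. by move=> x _; exact: cst_continuous. Qed.

Lemma cintZ k f a b : a <= b -> ccontseg f a b ->
  cint (fun x => k * f x) a b = k * cint f a b.
Proof.
move=> ab hf; have hr := ccontseg_re hf; have hi := ccontseg_im hf.
have cz (c : R) (u : R -> R) : contseg u a b -> contseg (fun x => c * u x) a b.
  move=> hu x hx; apply: (@continuousM _ _ (fun=> c) u); last exact: hu.
  exact: cst_continuous.
apply: eq_reim; rewrite ?reM ?imM /=.
- rewrite -!rintZ // -rintB //; try exact: cz.
  by apply: rint_ext => // x _; rewrite reM.
- rewrite -!rintZ // -rintD //; try exact: cz.
  by apply: rint_ext => // x _; rewrite imM.
Qed.

Lemma cintB f g a b : a <= b -> ccontseg f a b -> ccontseg g a b ->
  cint (fun x => f x - g x) a b = cint f a b - cint g a b.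
Proof.
move=> ab hf hg; have hN := ccontsegM (@ccontseg_cst (-1) a b) hg.
have e := cintD ab hf hN; rewrite (cintZ (-1) ab hg) mulN1r in e.
by rewrite -e; apply: cint_ext => // x _; rewrite mulN1r.
Qed.

Lemma cint_cat f a c b : a <= c -> c <= b -> ccontseg f a b ->
  cint f a b = cint f a c + cint f c b.
Proof.
move=> ac cb hf; apply: eq_reim; rewrite ?reD ?imD.
- exact: rint_cat ac cb (ccontseg_re hf).
- exact: rint_cat ac cb (ccontseg_im hf).
Qed.

Lemma cint_cst k a b : a <= b -> cint (fun=> k) a b = k * ((b - a)%:C)%C.
Proof.
move=> ab; apply: eq_reim; rewrite ?reM ?imM /= rint_cst //; ring.
Qed.

(** The factor 2 arises because the real and imaginary parts of the integral are bounded
    separately. *)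
Lemma cint_bound f a b M : a <= b -> ccontseg f a b ->
  (forall x, seg a b x -> csize (f x) <= M) -> csize (cint f a b) <= 2 * M * (b - a).
Proof.
move=> ab hf hM; rewrite /csize /=.
have h1 : `|rint (fun x => re (f x)) a b| <= M * (b - a).
  apply: rint_bound => //; first exact: ccontseg_re.
  by move=> x /hM; rewrite /csize; have := normr_ge0 (im (f x)); lra.
have h2 : `|rint (fun x => im (f x)) a b| <= M * (b - a).
  apply: rint_bound => //; first exact: ccontseg_im.
  by move=> x /hM; rewrite /csize; have := normr_ge0 (re (f x)); lra.
lra.
Qed.

Lemma cint_continuous (S : topologicalType) (s0 : S) (G : S -> R -> C) a b :
  a <= b ->
  (forall t, seg a b t -> {for (s0, t), continuous (fun p : S * R => G p.1 p.2)}) ->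
  (\forall s \near s0, ccontseg (G s) a b) ->
  {for s0, continuous (fun s => cint (G s) a b)}.
Proof.
move=> ab hG hc; apply/continuousC_reim; split.
- apply: (@rint_param_continuous _ _ _ _ _ ab (fun s t => re (G s t))).
    by move=> t /hG/continuousC_reim[].
  by apply: filterS hc => s; exact: ccontseg_re.
- apply: (@rint_param_continuous _ _ _ _ _ ab (fun s t => im (G s t))).
    by move=> t /hG/continuousC_reim[].
  by apply: filterS hc => s; exact: ccontseg_im.
Qed.

Lemma rline_continuous n (z v : 'rV[C]_n) x : {for x, continuous (rline z v)}.
Proof.
apply: continuous_rcoord => i.
rewrite (_ : (fun y => _) = (fun t => rcoord i z + t * rcoord i v)); last first.
  by apply/funext => t; rewrite rcoordD rcoordZ.
exact: is_derive_cont (is_derive_affine _ _ _).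
Qed.

Lemma cint_is_cder n (D : set 'rV[C]_n) (G dG : 'rV[C]_n -> R -> C) a b w z :
  a <= b -> open D -> D z ->
  (forall y t, D y -> seg a b t -> is_cder (fun y => G y t) w y (dG y t)) ->
  (forall t, seg a b t ->
    {for (z, t), continuous (fun p : 'rV[C]_n * R => dG p.1 p.2)}) ->
  (forall y, D y -> ccontseg (G y) a b) ->
  is_cder (fun y => cint (G y) a b) w z (cint (dG z) a b).
Proof.
move=> ab oD Dz hd hj hc.
have zD : nbhs z D by apply: open_nbhs_nbhs.
have [r r0 hr] := rline_nbhs w zD.
have near_r (P : R -> Prop) : (forall h, `|h| < r -> P h) -> \forall h \near (0 : R), P h.
  move=> hP; apply/nbhs_ballP; exists r => //= h.
  by rewrite /ball /= sub0r normrN; exact: hP.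
have jc t : seg a b t ->
    {for (0, t), continuous (fun p : R * R => dG (rline z w p.1) p.2)}.
  move=> tab; apply: (@continuous_comp _ _ _ (fun p : R * R => (rline z w p.1, p.2))
    (fun p : 'rV[C]_n * R => dG p.1 p.2)); last by rewrite /= rline0; exact: hj.
  apply: (@continuous_pair _ _ _ (fun p : R * R => rline z w p.1) (fun p : R * R => p.2)).
   apply: (@continuous_comp _ _ _ (@fst R R) (rline z w) (0, t)); first exact: cvg_fst.
    exact: rline_continuous.
  exact: cvg_snd.
have gen (p : C -> R) (q : C -> R) (pq : forall y t, D y -> seg a b t ->
      is_rder (fun y => p (G y t)) w y (q (dG y t)))
    (pc : forall y, D y -> contseg (fun t => p (G y t)) a b)
    (qj : forall t, seg a b t ->
      {for (0, t), continuous (fun x : R * R => q (dG (rline z w x.1) x.2))}) :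
    is_rder (fun y => rint (fun t => p (G y t)) a b) w z (rint (fun t => q (dG z t)) a b).
  have := @rint_param_derive R a b (fun h t => p (G (rline z w h) t))
    (fun h t => q (dG (rline z w h) t)) ab qj _ _.
  rewrite rline0; apply.
  - by apply: near_r => h hh; apply: pc; exact: hr.
  - by apply: near_r => h hh t tab; apply/(is_rder_line (fun y => p (G y t))); apply: pq => //; exact: hr.
split.
- apply: (gen (@complex.Re R) (@complex.Re R)).
  + by move=> y t Dy tab; have [] := hd y t Dy tab.
  + by move=> y Dy; apply: ccontseg_re; exact: hc.
  + by move=> t /jc/continuousC_reim[].
- apply: (gen (@complex.Im R) (@complex.Im R)).
  + by move=> y t Dy tab; have [] := hd y t Dy tab.
  + by move=> y Dy; apply: ccontseg_im; exact: hc.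
  + by move=> t /jc/continuousC_reim[].
Qed.

End ComplexIntegral.

(** * Goursat's theorem for rectangles *)

Section RingIdentities.
Variable K : comRingType.
Lemma split4 (i a1 a2 a3 a4 b1 b2 b3 : K) :
  a1 + a2 - (a3 + a4) + i * (b1 - b3) =
  a1 - a3 + i * (b2 - b3) + (a2 - a4 + i * (b1 - b2)).
Proof. ring. Qed.
Lemma split4' (i a1 a2 a3 b1 b2 b3 b4 : K) :
  a1 - a3 + i * (b1 + b2 - (b3 + b4)) =
  a1 - a2 + i * (b1 - b3) + (a2 - a3 + i * (b2 - b4)).
Proof. ring. Qed.
Lemma addB4 (i a1 a2 a3 a4 b1 b2 b3 b4 : K) :
  a1 + b1 - (a2 + b2) + i * (a3 + b3 - (a4 + b4)) =
  a1 - a2 + i * (a3 - a4) + (b1 - b2 + i * (b3 - b4)).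
Proof. ring. Qed.
End RingIdentities.

Section Goursat.
Variable R : realType.
Local Notation C := (Cplx R).
Implicit Types (G : R -> R -> C).

(* The integral of [G (x + iy) dz] along the boundary of a rectangle. *)
Definition bd G (x y h k : R) : C :=
  cint (fun s => G s y) x (x + h) - cint (fun s => G s (y + k)) x (x + h) +
  'i * (cint (G (x + h)) y (y + k) - cint (G x) y (y + k)).

(** Complex differentiability at [p + i q] of a function written in two real variables; [A] is the
    derivative and [s + i t] the increment. *)
Definition C_expansion G (p q : R) := exists A : C, forall e, 0 < e ->
  exists2 r, 0 < r & forall s t, `|s| < r -> `|t| < r ->
    csize (G (p + s) (q + t) - G p q - A * ((s%:C)%C + 'i * (t%:C)%C)) <=
      e * (`|s| + `|t|).

Definition sep_continuous G p q :=
  {for p, continuous (fun s => G s q)} /\ {for q, continuous (G p)}.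

Lemma csize_continuous (f : R -> C) (p : R) :
  (forall e, 0 < e -> exists2 r, 0 < r & forall s, `|s| < r -> csize (f (p + s) - f p) <= e) ->
  {for p, continuous f}.
Proof.
move=> h; apply/continuousC_reim; split; apply/continuousR_eps => e e0.
all: have e2 : 0 < e / 2 by lra.
all: have [r r0 hr] := h _ e2; apply/nbhs_ballP; exists r => //= y.
all: rewrite /ball /= distrC => yr; have := hr (y - p) yr; rewrite subrKC.
all: rewrite /csize reB imB.
- have := normr_ge0 (im (f y) - im (f p)); lra.
- have := normr_ge0 (re (f y) - re (f p)); lra.
Qed.

Lemma expansion_continuous G p q : C_expansion G p q -> sep_continuous G p q.
Proof.
move=> [A hA].
have A0 := csize_ge0 A.
split; apply: csize_continuous => e e0.
all: have [r r0 hr] := hA 1 ltr01.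
all: exists (Num.min r (e / (1 + csize A))); first by rewrite lt_min r0 divr_gt0 //; lra.
all: move=> s; rewrite lt_min => /andP[sr]; rewrite ltr_pdivlMr; last lra.
- move=> se; have := hr s 0 sr; rewrite normr0 => /(_ r0); rewrite rc0 mulr0 !addr0 mul1r.
  have h1 := csizeM A (s%:C)%C; rewrite {3}/csize /= normr0 addr0 in h1.
  set a := G (p + s) q - G p q; set b := A * _ => h2.
  have -> : a = (a - b) + b by rewrite subrK.
  apply: le_trans (csizeD _ _) _; rewrite -/b in h1; lra.
- move=> se; have := hr 0 s; rewrite normr0 => /(_ r0 sr); rewrite rc0 !addr0 !add0r mul1r.
  have h1 := csizeM A ('i * (s%:C)%C); rewrite csizei {3}/csize /= normr0 addr0 in h1.
  set a := G p (q + s) - G p q; set b := A * _ => h2.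
  have -> : a = (a - b) + b by rewrite subrK.
  apply: le_trans (csizeD _ _) _; rewrite -/b in h1; lra.
Qed.

Section Rectangle.
Variables (G : R -> R -> C) (a c H K : R).
Hypotheses (H0 : 0 < H) (K0 : 0 < K).
Hypothesis expG : forall p q, seg a (a + H) p -> seg c (c + K) q -> C_expansion G p q.

Definition inr x y h k :=
  [/\ a <= x, x + h <= a + H, c <= y & y + k <= c + K].

Lemma ccx x h y : a <= x -> x + h <= a + H -> seg c (c + K) y ->
  ccontseg (fun s => G s y) x (x + h).
Proof.
move=> ax xh hy s /andP[s1 s2]; apply: (proj1 (expansion_continuous (expG _ hy))).
by rewrite /seg (le_trans ax s1) (le_trans s2 xh).
Qed.

Lemma ccy y k x : c <= y -> y + k <= c + K -> seg a (a + H) x ->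
  ccontseg (G x) y (y + k).
Proof.
move=> cy yk hx s /andP[s1 s2]; apply: (proj2 (expansion_continuous (expG hx _))).
by rewrite /seg (le_trans cy s1) (le_trans s2 yk).
Qed.

Lemma bd_split_x x y h h' k : 0 <= h -> 0 <= h' -> 0 <= k -> inr x y (h + h') k ->
  bd G x y (h + h') k = bd G x y h k + bd G (x + h) y h' k.
Proof.
move=> h0 h'0 k0 [ax xh cy yk]; rewrite /bd (addrA x h h') in xh *.
have x1 : x <= x + h by lra.
have x2 : x + h <= x + h + h' by lra.
have hy : seg c (c + K) y by rewrite /seg; lra.
have hyk : seg c (c + K) (y + k) by rewrite /seg; lra.
have xh' : x + (h + h') <= a + H by rewrite addrA.
have c1 := ccx ax xh' hy; have c2 := ccx ax xh' hyk; rewrite (addrA x h) in c1 c2.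
rewrite (cint_cat x1 x2 c1) (cint_cat x1 x2 c2); exact: split4.
Qed.

Lemma bd_split_y x y h k k' : 0 <= h -> 0 <= k -> 0 <= k' -> inr x y h (k + k') ->
  bd G x y h (k + k') = bd G x y h k + bd G x (y + k) h k'.
Proof.
move=> h0 k0 k'0 [ax xh cy yk]; rewrite /bd (addrA y k k') in yk *.
have y1 : y <= y + k by lra.
have y2 : y + k <= y + k + k' by lra.
have hx : seg a (a + H) x by rewrite /seg; lra.
have hxh : seg a (a + H) (x + h) by rewrite /seg; lra.
have yk' : y + (k + k') <= c + K by rewrite addrA.
have c1 := ccy cy yk' hx; have c2 := ccy cy yk' hxh; rewrite (addrA y k) in c1 c2.
rewrite (cint_cat y1 y2 c1) (cint_cat y1 y2 c2); exact: split4'.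
Qed.

Lemma continuous_rc (x : R) : {for x, continuous (fun s : R => (s%:C)%C : C)}.
Proof.
apply: csize_continuous => e e0; exists e => // s se.
by rewrite -rcN -rcD /csize /= normr0 addr0 addrAC subrr add0r ltW.
Qed.

(** The affine part [F] of the expansion has boundary integral 0 by direct computation. The rest [E]
    is at most [e (h + k)] on the rectangle, and the four sides have total length [2 (h + k)];
    [cint_bound] supplies the remaining factor 2. *)
Lemma bd_local p q e r x y h k : 0 < e -> 0 <= h -> 0 <= k -> inr x y h k ->
  seg x (x + h) p -> seg y (y + k) q -> h < r -> k < r ->
  forall A, (forall s t, `|s| < r -> `|t| < r ->
    csize (G (p + s) (q + t) - G p q - A * ((s%:C)%C + 'i * (t%:C)%C)) <=
      e * (`|s| + `|t|)) ->
  csize (bd G x y h k) <= 4 * e * ((h + k) * (h + k)).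
Proof.
move=> e0 h0 k0 [ax xh cy yk] /andP[p1 p2] /andP[q1 q2] hr kr A hA.
pose B : C := G p q - A * ((p%:C)%C + 'i * (q%:C)%C).
pose F s t : C := B + A * (s%:C)%C + A * 'i * (t%:C)%C.
pose E s t : C := G s t - F s t.
have hE s t : seg x (x + h) s -> seg y (y + k) t -> csize (E s t) <= e * (h + k).
  move=> /andP[s1 s2] /andP[t1 t2].
  have ns : `|s - p| <= h by rewrite ler_norml; lra.
  have nt : `|t - q| <= k by rewrite ler_norml; lra.
  have := hA (s - p) (t - q) (le_lt_trans ns hr) (le_lt_trans nt kr).
  rewrite !subrKC => h1.
  have -> : E s t = G s t - G p q - A * (((s - p)%:C)%C + 'i * ((t - q)%:C)%C).
    by rewrite /E /F /B !rcD !rcN; ring.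
  apply: le_trans h1 _; apply: ler_wpM2l; [exact: ltW|exact: lerD].
have Fx t : forall u v, ccontseg (fun s => F s t) u v.
  move=> u v; apply: (@ccontsegD _ (fun s => B + A * (s%:C)%C) (fun=> A * 'i * (t%:C)%C)); last exact: ccontseg_cst.
  apply: (@ccontsegD _ (fun=> B) (fun s => A * (s%:C)%C)); first exact: ccontseg_cst.
  apply: (@ccontsegM _ (fun=> A) (fun s => (s%:C)%C)); first exact: ccontseg_cst.
  by move=> s _; exact: continuous_rc.
have Fy s : forall u v, ccontseg (F s) u v.
  move=> u v; apply: (@ccontsegD _ (fun=> B + A * (s%:C)%C) (fun t => A * 'i * (t%:C)%C)); first exact: ccontseg_cst.
  apply: (@ccontsegM _ (fun=> A * 'i) (fun s => (s%:C)%C)); first exact: ccontseg_cst.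
  by move=> t _; exact: continuous_rc.
have hy : seg c (c + K) y by rewrite /seg; lra.
have hyk : seg c (c + K) (y + k) by rewrite /seg; lra.
have hx : seg a (a + H) x by rewrite /seg; lra.
have hxh : seg a (a + H) (x + h) by rewrite /seg; lra.
have xh0 : x <= x + h by lra.
have yk0 : y <= y + k by lra.
have Ex t : seg c (c + K) t -> ccontseg (fun s => E s t) x (x + h).
  move=> ht s hs; rewrite /E; apply: (@continuousB _ _ _ (fun s => G s t) (fun s => F s t)).
    exact: (ccx ax xh ht).
  exact: (Fx t x (x + h)).
have Ey s : seg a (a + H) s -> ccontseg (E s) y (y + k).
  move=> hs t ht; rewrite /E; apply: (@continuousB _ _ _ (G s) (F s)).
    exact: (ccy cy yk hs).
  exact: (Fy s y (y + k)).
have GFE s t : G s t = F s t + E s t by rewrite /E subrKC.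
have bdE : bd G x y h k = bd F x y h k + bd E x y h k.
  rewrite /bd.
  rewrite (cint_ext (g := fun s => F s y + E s y)) => [|s _|//]; last exact: GFE.
  rewrite (cintD xh0 (Fx y _ _) (Ex y hy)).
  rewrite [in LHS](cint_ext (f := fun s => G s (y + k)) (g := fun s => F s (y + k) + E s (y + k))) => [|s _|//]; last exact: GFE.
  rewrite (cintD xh0 (Fx (y + k) _ _) (Ex _ hyk)).
  rewrite [in LHS](cint_ext (f := G (x + h)) (g := fun t => F (x + h) t + E (x + h) t)) => [|s _|//]; last exact: GFE.
  rewrite (cintD yk0 (Fy (x + h) _ _) (Ey _ hxh)).
  rewrite [in LHS](cint_ext (f := G x) (g := fun t => F x t + E x t)) => [|s _|//]; last exact: GFE.
  rewrite (cintD yk0 (Fy x _ _) (Ey _ hx)).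
  exact: addB4.
have bdF : bd F x y h k = 0.
  rewrite /bd -(cintB xh0 (Fx y _ _) (Fx (y + k) _ _)) -(cintB yk0 (Fy (x + h) _ _) (Fy x _ _)).
  rewrite (cint_ext (g := fun=> - (A * 'i * (k%:C)%C))) => [|s _|//]; last first.
    by rewrite /F rcD; ring.
  rewrite (cint_cst _ xh0).
  rewrite (cint_ext (g := fun=> A * (h%:C)%C)) => [|s _|//]; last first.
    by rewrite /F rcD; ring.
  rewrite (cint_cst _ yk0) (addrC x) addrK (addrC y) addrK; ring.
rewrite bdE bdF add0r /bd.
have b1 := cint_bound xh0 (Ex y hy) (fun s hs => hE s y hs (seg_l yk0)).
have b2 := cint_bound xh0 (Ex _ hyk) (fun s hs => hE s (y + k) hs (seg_r yk0)).
have b3 := cint_bound yk0 (Ey _ hxh) (fun t ht => hE (x + h) t (seg_r xh0) ht).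
have b4 := cint_bound yk0 (Ey _ hx) (fun t ht => hE x t (seg_l xh0) ht).
have xx : x + h - x = h by ring.
have yy : y + k - y = k by ring.
rewrite xx in b1 b2; rewrite yy in b3 b4.
apply: le_trans (csizeD _ _) _; rewrite csizei.
have := csizeB (cint (fun s => E s y) x (x + h)) (cint (fun s => E s (y + k)) x (x + h)).
have := csizeB (cint (E (x + h)) y (y + k)) (cint (E x) y (y + k)).
lra.
Qed.

Lemma half_pow_small (h r : R) : 0 < h -> 0 < r -> exists m : nat, h / 2 ^+ m < r.
Proof.
move=> h0 r0; exists (Num.truncn (h / r)).+1.
rewrite ltr_pdivrMr ?exprn_gt0 // mulrC -ltr_pdivrMr //.
have := truncnS_gt (h / r); set m := (Num.truncn _).+1 => hm.
apply: lt_trans hm _; rewrite -natrX ltr_nat; exact: ltn_expl.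
Qed.

(** Bisection: if the claim fails, one quarter of each bad rectangle is bad at the next scale, with
    the threshold divided by 4. The nested rectangles meet at a point, where [bd_local] contradicts
    the threshold. *)
Lemma goursat_eps e : 0 < e -> csize (bd G a c H K) <= e.
Proof.
move=> e0; rewrite leNgt; apply/negP => big.
pose hn (m : nat) := H / 2 ^+ m; pose kn (m : nat) := K / 2 ^+ m.
have p2 m : 0 < 2 ^+ m :> R by rewrite exprn_gt0.
have hn0 m : 0 < hn m by rewrite divr_gt0.
have kn0 m : 0 < kn m by rewrite divr_gt0.
have hnS m : hn m = hn m.+1 + hn m.+1.
  by rewrite /hn exprS; field; rewrite gt_eqF.
have knS m : kn m = kn m.+1 + kn m.+1.
  by rewrite /kn exprS; field; rewrite gt_eqF.
pose bad m (s : R * R) := inr s.1 s.2 (hn m) (kn m) /\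
  e / 4 ^+ m < csize (bd G s.1 s.2 (hn m) (kn m)).
pose next m (s s' : R * R) := bad m.+1 s' /\
  [/\ s.1 <= s'.1, s'.1 + hn m.+1 <= s.1 + hn m, s.2 <= s'.2 & s'.2 + kn m.+1 <= s.2 + kn m].
have step m s : bad m s -> exists s', next m s s'.
  move=> [[ax xh cy yk] hs]; apply: contrapT => no.
  have small s' : s.1 <= s'.1 -> s'.1 + hn m.+1 <= s.1 + hn m ->
      s.2 <= s'.2 -> s'.2 + kn m.+1 <= s.2 + kn m ->
      csize (bd G s'.1 s'.2 (hn m.+1) (kn m.+1)) <= e / 4 ^+ m.+1.
    move=> s1 s2 s3 s4; rewrite leNgt; apply/negP => hb; apply: no; exists s'.
    by split; [split => //; split; lra|split].
  have hm := hnS m; have km := knS m; have h0 := hn0 m.+1; have k0 := kn0 m.+1.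
  have e1 : bd G s.1 s.2 (hn m) (kn m) =
     (bd G s.1 s.2 (hn m.+1) (kn m.+1) + bd G s.1 (s.2 + kn m.+1) (hn m.+1) (kn m.+1)) +
     (bd G (s.1 + hn m.+1) s.2 (hn m.+1) (kn m.+1) +
      bd G (s.1 + hn m.+1) (s.2 + kn m.+1) (hn m.+1) (kn m.+1)).
    rewrite hm km bd_split_x ?bd_split_y //; try lra; split; lra.
  have a1 := small s; have a2 := small (s.1, s.2 + kn m.+1).
  have a3 := small (s.1 + hn m.+1, s.2); have a4 := small (s.1 + hn m.+1, s.2 + kn m.+1).
  move: hs; rewrite e1 ltNge => /negP; apply.
  have -> : e / 4 ^+ m = (e / 4 ^+ m.+1 + e / 4 ^+ m.+1) + (e / 4 ^+ m.+1 + e / 4 ^+ m.+1).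
    by rewrite exprS; field; rewrite gt_eqF // exprn_gt0.
  apply: le_trans (csizeD _ _) _; apply: lerD;
    apply: le_trans (csizeD _ _) _; apply: lerD.
  - by apply: a1; lra.
  - by apply: a2 => /=; lra.
  - by apply: a3 => /=; lra.
  - by apply: a4 => /=; lra.
pose st := fix st m : R * R := if m is m'.+1 then xget (st m') [set s' | next m' (st m') s'] else (a, c).
have bad_st m : bad m (st m).
  elim: m => [|m ih].
    rewrite /bad /inr /= /hn /kn !expr0 !divr1; split; last exact: big.
    by split.
  have [s' hs'] := step m _ ih.
  by have [] : next m (st m) (st m.+1) := xgetPex (st m) (ex_intro _ s' hs').
have next_st m : next m (st m) (st m.+1).
  have [s' hs'] := step m _ (bad_st m).
  exact: (xgetPex (st m) (ex_intro _ s' hs')).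
have mono i j : (i <= j)%N -> [/\ (st i).1 <= (st j).1, (st j).1 + hn j <= (st i).1 + hn i,
    (st i).2 <= (st j).2 & (st j).2 + kn j <= (st i).2 + kn i].
  move=> ij; rewrite -(subnK ij); elim: (j - i)%N => [|d [h1 h2 h3 h4]] //.
  have [_ [g1 g2 g3 g4]] := next_st (d + i)%N; rewrite addSn.
  by split; [exact: le_trans g1|exact: le_trans h2|exact: le_trans g3|exact: le_trans h4].
have cross i j : (st i).1 <= (st j).1 + hn j /\ (st i).2 <= (st j).2 + kn j.
  have [ij|/ltnW ij] := leqP i j.
    have [h1 _ h3 _] := mono i j ij; have := hn0 j; have := kn0 j; split; lra.
  have [_ h2 _ h4] := mono j i ij; have := hn0 i; have := kn0 i; split; lra.
(* The common point of the rectangles is the supremum of their lower left corners, taken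
   coordinatewise. *)
pose p := sup [set (st i).1 | i in setT]; pose q := sup [set (st i).2 | i in setT].
have sup1 i : seg (st i).1 ((st i).1 + hn i) p.
  apply/andP; split.
    apply: ub_le_sup; last by exists i.
    by exists ((st 0).1 + hn 0) => _ [j _ <-]; have [] := cross j 0%N.
  apply: ge_sup; first by exists (st 0).1; exists 0%N.
  by move=> _ [j _ <-]; have [] := cross j i.
have sup2 i : seg (st i).2 ((st i).2 + kn i) q.
  apply/andP; split.
    apply: ub_le_sup; last by exists i.
    by exists ((st 0).2 + kn 0) => _ [j _ <-]; have [] := cross j 0%N.
  apply: ge_sup; first by exists (st 0).2; exists 0%N.
  by move=> _ [j _ <-]; have [] := cross j i.
have hp : seg a (a + H) p by have := sup1 0%N; rewrite /= /hn expr0 divr1.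
have hq : seg c (c + K) q by have := sup2 0%N; rewrite /= /kn expr0 divr1.
have [A hA] := expG hp hq.
have HK : 0 < (H + K) * (H + K) by rewrite mulr_gt0 // addr_gt0.
(* At stage [m] the sides add up to [(H + K) / 2 ^+ m], so that the bound of [bd_local] is exactly
   [e / 4 ^+ m]. *)
pose e1 := e / (4 * ((H + K) * (H + K))).
have e10 : 0 < e1 by rewrite divr_gt0 // mulr_gt0.
have [r r0 hr] := hA e1 e10.
have [m hm] := half_pow_small (addr_gt0 H0 K0) r0.
have hm1 : hn m < r by apply: le_lt_trans hm; rewrite ler_pM2r ?invr_gt0 // lerDl ltW.
have km1 : kn m < r by apply: le_lt_trans hm; rewrite ler_pM2r ?invr_gt0 // lerDr ltW.
have [inr_m] := bad_st m; rewrite ltNge => /negP; apply.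
apply: le_trans (bd_local e10 (ltW (hn0 m)) (ltW (kn0 m)) inr_m (sup1 m) (sup2 m) hm1 km1 hr) _.
rewrite le_eqVlt; apply/orP; left; apply/eqP; rewrite /e1 /hn /kn (_ : 4 ^+ m = 2 ^+ m * 2 ^+ m); last first.
  by rewrite -exprMn; congr (_ ^+ _); ring.
move: (2 ^+ m : R) (p2 m) => P P0; field.
by rewrite gt_eqF //= gt_eqF // addr_gt0.
Qed.

Lemma goursat : bd G a c H K = 0.
Proof.
apply: csize_eq0; apply/ler_addgt0Pl => e e0; rewrite addr0; exact: goursat_eps.
Qed.

End Rectangle.
End Goursat.

(** * Cauchy's formula for the derivative; holomorphic functions are smooth *)

Section ComplexExponential.
Variable R : realType.
Local Notation C := (Cplx R).
Implicit Types (x y t : R).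

Definition cis t : C := Complex (cos t) (sin t).
Definition cex x y : C := ((expR x)%:C)%C * cis y.
(** The complex exponential, written on row vectors of length 1 so that the calculus on ['rV[C]_n]
    applies to it. *)
Definition cexp1 (w : 'rV[C]_1) : C := cex (re (w 0 0)) (im (w 0 0)).

Lemma cis_conj t : cis t * Num.conj (cis t) = 1.
Proof.
apply: eq_reim; rewrite ?reM ?imM re_conj im_conj /=; last by ring.
by rewrite mulrN opprK -!expr2 cos2Dsin2.
Qed.

Lemma csize_cis t : csize (cis t) <= 2.
Proof.
by rewrite /csize /=; have := cos_max t; have := sin_max t; lra.
Qed.

Lemma cex_neg x y : cex x y * cex (- x) (- y) = 1.
Proof.
rewrite /cex (_ : cis (- y) = Num.conj (cis y)); last first.
  by apply: eq_reim; rewrite ?re_conj ?im_conj /= ?cosN ?sinN.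
have E : expR x * expR (- x) = 1 by rewrite expRN mulfV // gt_eqF // expR_gt0.
by rewrite mulrACA cis_conj mulr1 -rcM E rc1.
Qed.


Lemma is_cder_cexp v z : is_cder cexp1 v z (v 0 0 * cexp1 z).
Proof.
have he := is_rder_comp1 (is_derive_expR _) (is_rder_rcoord (0, false) v z).
have hc := is_rder_comp1 (is_derive_cos _) (is_rder_rcoord (0, true) v z).
have hs := is_rder_comp1 (is_derive_sin _) (is_rder_rcoord (0, true) v z).
split.
- rewrite (_ : ref cexp1 = fun w => expR (rcoord (0, false) w) * cos (rcoord (0, true) w)).
    rewrite (_ : re _ = expR (rcoord (0, false) z) * rcoord (0, false) v *
      cos (rcoord (0, true) z) +
      expR (rcoord (0, false) z) * (- sin (rcoord (0, true) z) * rcoord (0, true) v)).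
      exact: is_rderM he hc.
    by rewrite reM /cexp1 /cex re_rcM im_rcM /rcoord /=; ring.
  by apply/funext => w; rewrite /ref /cexp1 /cex re_rcM.
- rewrite (_ : imf cexp1 = fun w => expR (rcoord (0, false) w) * sin (rcoord (0, true) w)).
    rewrite (_ : im _ = expR (rcoord (0, false) z) * rcoord (0, false) v *
      sin (rcoord (0, true) z) +
      expR (rcoord (0, false) z) * (cos (rcoord (0, true) z) * rcoord (0, true) v)).
      exact: is_rderM he hs.
    by rewrite imM /cexp1 /cex re_rcM im_rcM /rcoord /=; ring.
  by apply/funext => w; rewrite /imf /cexp1 /cex im_rcM.
Qed.

Lemma cexp1_continuous (z : 'rV[C]_1) : {for z, continuous cexp1}.
Proof.
have h1 := @rcoord_continuous R 1 (0, false) z.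
have h2 := @rcoord_continuous R 1 (0, true) z.
have he : {for z, continuous (fun w : 'rV[C]_1 => expR (rcoord (0, false) w))}.
  by apply: (continuous_comp h1); exact: (is_derive_cont (is_derive_expR _)).
apply/continuousC_reim; split.
- rewrite (_ : (fun y : 'rV[C]_1 => re (cexp1 y)) = fun w : 'rV[C]_1 => expR (rcoord (0, false) w) * cos (rcoord (0, true) w)).
    apply: (continuousM he).
    by apply: (continuous_comp h2); exact: (is_derive_cont (is_derive_cos _)).
  by apply/funext => w; rewrite /cexp1 /cex re_rcM.
- rewrite (_ : (fun y : 'rV[C]_1 => im (cexp1 y)) = fun w : 'rV[C]_1 => expR (rcoord (0, false) w) * sin (rcoord (0, true) w)).
    apply: (continuousM he).
    by apply: (continuous_comp h2); exact: (is_derive_cont (is_derive_sin _)).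
  by apply/funext => w; rewrite /cexp1 /cex im_rcM.
Qed.

Lemma Cn_cexp1 k : Cn_on k setT cexp1.
Proof.
elim: k => [|k ih]; first by split => // z _; exact: cexp1_continuous.
apply: (@CnI _ _ k setT _ (fun v z => v 0 0 * cexp1 z)); first exact: openT.
- by move=> z _; exact: cexp1_continuous.
- by move=> v z _; exact: is_cder_cexp.
- by move=> v; apply: CnZ ih; exact: openT.
Qed.

Lemma hol_cexp1 z : differentiable cexp1 z.
Proof.
apply: (@CR_differentiable _ _ setT) (Cn_cexp1 1) _ _; first exact: filterT.
move=> w; apply: CR_dbar; rewrite !(is_cder_val (is_cder_cexp _ _)) mxE.
by rewrite mulrA.
Qed.

End ComplexExponential.

Section CauchyDerivative.
Variables (R : realType) (n : nat).
Local Notation C := (Cplx R).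
Local Notation E := 'rV[C]_n.
Implicit Types (f g : E -> C) (z w v h : E) (D : set E) (t s e r : R) (k : nat).

Lemma vnorm_scale (c : C) v : vnorm (c *: v) <= csize c * vnorm v.
Proof.
rewrite /vnorm mulr_sumr; apply: ler_sum => j _; rewrite mxE; exact: csizeM.
Qed.

Lemma csize_norm (x : C) r : `|x| <= (r%:C)%C -> csize x <= 2 * r.
Proof.
move=> h; have h1 := le_trans (ler_norm_re x) h; have h2 := le_trans (ler_norm_im x) h.
by rewrite !lecR in h1 h2; rewrite /csize; lra.
Qed.

Lemma norm_csize (x : C) : `|x| <= ((csize x)%:C)%C.
Proof. exact: norm_le_reim. Qed.

Definition cvec (x y : R) : 'rV[C]_1 := const_mx (Complex x y : C).

Lemma hol_expansion (phi : 'rV[C]_1 -> C) (p q : R) :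
  differentiable phi (cvec p q) -> C_expansion (fun x y => phi (cvec x y)) p q.
Proof.
move=> dphi.
have := derivable_eps (@diff_derivable _ _ _ phi _ (const_mx 1) dphi).
set A := 'D__ _ _ => hA; exists A => e e0.
have e2 : 0 < e / 2 by lra.
have [r r0 hr] := hA _ e2; exists (r / 2); first lra.
move=> s t sr tr; have hst : `|Complex s t : C| <= ((`|s| + `|t|)%:C)%C by exact: norm_le_reim.
have := hr (Complex s t); rewrite (_ : _ < _); last first.
  by apply: le_lt_trans hst _; rewrite ltcR; lra.
move=> /(_ isT) h.
rewrite (_ : cvec (p + s) (q + t) = cvec p q + (Complex s t : C) *: const_mx 1); last first.
  by apply/rowP => j; rewrite !mxE mulr1; apply: eq_reim; rewrite ?reD ?imD.
rewrite (_ : ((s%:C)%C + 'i * (t%:C)%C) = Complex s t :> C); last first.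
  by apply: eq_reim; rewrite ?reD ?imD ?reM ?imM ?re_i ?im_i /=; ring.
rewrite [A * _]mulrC (_ : e * _ = 2 * (e / 2 * (`|s| + `|t|))); last by field.
apply: csize_norm; apply: le_trans h _; rewrite (rcM (e / 2)).
by apply: ler_wpM2l => //; rewrite lecR ltW.
Qed.

Lemma differentiable_line (c : 'rV[C]_1 -> C) f z v (w : 'rV[C]_1) :
  differentiable c w -> differentiable f (z + c w *: v) ->
  differentiable (fun w : 'rV[C]_1 => f (z + c w *: v)) w.
Proof.
move=> dc df.
have d1 : differentiable (fun w : 'rV[C]_1 => c w *: v) w by exact: differentiableZl.
have d2 := differentiableD (differentiable_cst z w) d1.
exact: (@differentiable_comp _ _ _ _ (fun w : 'rV[C]_1 => z + c w *: v) f w d2 df).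
Qed.

Lemma cis_continuous t : {for t, continuous (@cis R)}.
Proof.
apply/continuousC_reim; split; rewrite /cis /=.
- exact: is_derive_cont (is_derive_cos t).
- exact: is_derive_cont (is_derive_sin t).
Qed.

Lemma conj_cis_continuous t : {for t, continuous (fun t => Num.conj (cis t) : C)}.
Proof.
apply/continuousC_reim; split.
- exact: is_derive_cont (is_derive_cos t).
- exact: is_derive_cont (is_deriveN (is_derive_sin t)).
Qed.

Lemma pi2_gt0 : 0 < pi *+ 2 :> R.
Proof. by rewrite pmulrn_rgt0 // pi_gt0. Qed.

Lemma cint_conj_cis : cint (fun t => Num.conj (cis t) : C) 0 (pi *+ 2) = 0.
Proof.
rewrite (@cint_val _ _ (fun t => Complex (sin t) (cos t))) ?ltW ?pi2_gt0 //.
  by apply: eq_reim; rewrite ?reB ?imB /= ?sin2pi ?sin0 ?cos2pi ?cos0 subrr.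
move=> t _; split; first exact: is_derive_sin.
exact: is_derive_cos.
Qed.

(** Exponential coordinates remove the puncture: [phi w = (f (z + e^w v) - f z) e^(-w)] is
    holomorphic for [re w <= ln r] and has period [2 pi i]. By Goursat its integral over a vertical
    segment of length [2 pi] does not depend on the abscissa, and far to the left the integrand
    tends to the derivative. *)
Lemma cauchy_derivative f D z v r : 0 < r ->
  (forall s t, 0 <= s -> s <= r -> D (z + ((s%:C)%C * cis t) *: v)) ->
  (forall y, D y -> differentiable f y) ->
  cint (fun t => f (z + ((r%:C)%C * cis t) *: v) * Num.conj (cis t)) 0 (pi *+ 2) =
    ((r * (pi *+ 2))%:C)%C * real_derive v f z.
Proof.
move=> r0 hD hf.
have Dz : D z.
  by have := hD 0 0 (lexx 0) (ltW r0); rewrite rc0 mul0r scale0r addr0.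
set L := real_derive v f z.
have dL : L = 'D_v f z by rewrite /L hol_real_derive ?deriveE //; exact: hf.
pose phi (w : 'rV[C]_1) := (f (z + cexp1 w *: v) - f z) * cexp1 (- w).
have dphi (w : 'rV[C]_1) : re (w 0 0) <= ln r -> differentiable phi w.
  move=> wr; apply: (@differentiableM _ _ (fun w : 'rV[C]_1 => f (z + cexp1 w *: v) - f z) (fun w : 'rV[C]_1 => cexp1 (- w))).
    apply: (@differentiableB _ _ _ (fun w : 'rV[C]_1 => f (z + cexp1 w *: v)) (fun=> f z)); last exact: differentiable_cst.
    apply: differentiable_line; first exact: hol_cexp1.
    apply: hf; apply: hD; first by rewrite ltW // expR_gt0.
    by rewrite -[leRHS](lnK r0) ler_expR.
  have dN : differentiable (fun w : 'rV[C]_1 => - w) w.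
    apply: (@differentiableN _ _ _ (id : 'rV[C]_1 -> 'rV[C]_1)); exact: ex_diff.
  exact: (differentiable_comp dN (hol_cexp1 (- w))).
pose G x y := phi (cvec x y).
have GE x y : G x y = (f (z + cex x y *: v) - f z) * cex (- x) (- y).
  by rewrite /G /phi /cexp1 !mxE reN imN.
have per x : G x (pi *+ 2) = G x 0.
  rewrite !GE /cex (_ : cis (pi *+ 2) = cis 0); last first.
    by rewrite /cis cos2pi sin2pi cos0 sin0.
  rewrite (_ : cis (- (pi *+ 2)) = cis (- 0)) //.
  by rewrite /cis !cosN !sinN cos2pi sin2pi cos0 sin0.
have expG p q : p <= ln r -> C_expansion G p q.
  by move=> pr; apply: hol_expansion; apply: dphi; rewrite mxE.
have contG x : x <= ln r -> ccontseg (G x) 0 (pi *+ 2).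
  move=> xr y _; exact: (proj2 (expansion_continuous (expG x y xr))).
have const a : a < ln r -> cint (G (ln r)) 0 (pi *+ 2) = cint (G a) 0 (pi *+ 2).
  move=> ar; have H0 : 0 < ln r - a by rewrite subr_gt0.
  have := @goursat R G a 0 (ln r - a) (pi *+ 2) H0 pi2_gt0 _.
  rewrite /bd add0r (addrC a) subrK => gz.
  have {}gz := gz (fun p q hp _ => expG p q (proj2 (andP hp))).
  (* By periodicity the horizontal sides cancel. *)
  have e : cint (fun s => G s 0) a (ln r) = cint (fun s => G s (pi *+ 2)) a (ln r).
    by apply: cint_ext; [move=> s _; rewrite per|exact: ltW].
  move: gz; rewrite e subrr add0r => /eqP; rewrite mulf_eq0 => /orP[/eqP i0|].
    by have := oner_neq0 C; have := ii R; rewrite i0 mul0r => /eqP; rewrite eq_sym oppr_eq0 => ->.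
  by rewrite subr_eq0 => /eqP.
have lim : cint (G (ln r)) 0 (pi *+ 2) = L * ((pi *+ 2)%:C)%C.
  apply/eqP; rewrite -subr_eq0; apply/eqP/csize_eq0/ler_addgt0Pl => e e0; rewrite addr0.
  (* The 8 is [2 * 2 * 2]: one factor from [csize_norm] and one from each of the two exponentials.
     The other 2 comes from [cint_bound], and [pi *+ 2] is the length of the segment. *)
  pose e1 := e / (2 * 8 * (pi *+ 2)).
  have P0 := pi2_gt0.
  have e10 : 0 < e1 by rewrite divr_gt0 // mulr_gt0 //; lra.
  have [rho rho0 hrho] := derivable_eps (@diff_derivable _ _ _ f z v (hf z Dz)) e10.
  (* The first bound puts [a] strictly left of [ln r]; the second keeps the modulus of [cex a y], at
     most [2 * expR a], below [rho]. *)
  pose a := Num.min (ln r - 1) (ln (rho / 4)).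
  have ar : a < ln r by rewrite gt_min; apply/orP; left; lra.
  have arho : expR a <= rho / 4.
    have r4 : 0 < rho / 4 by lra.
    by rewrite -[leRHS](lnK r4) ler_expR ge_min lexx orbT.
  rewrite (const a ar).
  have cstE : L * ((pi *+ 2)%:C)%C = cint (fun=> L) 0 (pi *+ 2).
    by rewrite (cint_cst _ (ltW P0)) subr0.
  rewrite cstE -(cintB (ltW P0) (contG a (ltW ar)) (@ccontseg_cst _ L _ _)).
  have bnd y : seg 0 (pi *+ 2) y -> csize (G a y - L) <= 8 * e1.
    move=> _; rewrite GE.
    have hx : csize (cex a y) <= 2 * expR a.
      rewrite /cex csizeR ger0_norm ?expR_ge0 // [leRHS]mulrC.
      by apply: ler_wpM2l; [exact: expR_ge0|exact: csize_cis].
    have hn : `|cex a y| < (rho%:C)%C.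
      apply: le_lt_trans (norm_csize _) _; rewrite ltcR.
      apply: le_lt_trans hx _; lra.
    have := hrho _ hn; rewrite -dL => h1.
    have {}h1 : `|f (z + cex a y *: v) - f z - cex a y * L| <= ((e1 * (2 * expR a))%:C)%C.
      apply: le_trans h1 _; rewrite (rcM e1); apply: ler_wpM2l; first by rewrite lecR ltW.
      by apply: le_trans (norm_csize _) _; rewrite lecR.
    have {}h1 := csize_norm h1.
    rewrite (_ : _ - L = (f (z + cex a y *: v) - f z - cex a y * L) * cex (- a) (- y)).
      apply: le_trans (csizeM _ _) _.
      have h2 : csize (cex (- a) (- y)) <= 2 * expR (- a).
        rewrite /cex csizeR ger0_norm ?expR_ge0 // [leRHS]mulrC.
        by apply: ler_wpM2l; [exact: expR_ge0|exact: csize_cis].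
      have h3 : expR a * expR (- a) = 1 by rewrite expRN mulfV // gt_eqF // expR_gt0.
      apply: (@le_trans _ _ (2 * (e1 * (2 * expR a)) * (2 * expR (- a)))).
        by apply: ler_pM => //; exact: csize_ge0.
      rewrite (_ : _ * (2 * expR (- a)) = 8 * e1 * (expR a * expR (- a))); last by ring.
      by rewrite h3 mulr1.
    by rewrite [RHS]mulrBl [_ * L * _]mulrAC cex_neg mul1r.
  have := cint_bound (ltW P0) _ bnd; rewrite subr0.
  rewrite (_ : 2 * (8 * e1) * (pi *+ 2) = e); last first.
    by rewrite /e1; move: (pi *+ 2 : R) P0 => P P0; field; rewrite gt_eqF.
  apply; move=> y hy; apply: (@continuousB _ _ _ (G a) (fun=> L)); last exact: cst_continuous.
  exact: (contG a (ltW ar)).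
have P0 := ltW pi2_gt0.
have fc : ccontseg (fun t => f (z + ((r%:C)%C * cis t) *: v)) 0 (pi *+ 2).
  move=> t _; apply: (@continuous_comp _ _ _ (fun t => z + ((r%:C)%C * cis t) *: v) f); last first.
    by apply: differentiable_continuous; apply: hf; exact: (hD r t (ltW r0) (lexx r)).
  apply: continuous_rcoord => -[j b].
  have h : {for t, continuous (fun y => z 0 j + ((r%:C)%C * cis y) * v 0 j)}.
    apply: (@continuousD _ _ _ (fun=> z 0 j) (fun y => ((r%:C)%C * cis y) * v 0 j)).
      exact: cst_continuous.
    apply: (@continuousM _ _ (fun y => ((r%:C)%C * cis y)) (fun=> v 0 j)); last exact: cst_continuous.
    apply: (@continuousM _ _ (fun=> (r%:C)%C)); first exact: cst_continuous.
    exact: cis_continuous.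
  have [h1 h2] := (continuousC_reim _ _).1 h.
  have ec y : (z + ((r%:C)%C * cis y) *: v) 0 j = z 0 j + ((r%:C)%C * cis y) * v 0 j.
    by rewrite !mxE.
  case: b; rewrite /rcoord /=.
  - have -> : (fun y => im ((z + ((r%:C)%C * cis y) *: v) 0 j)) =
        (fun y => im (z 0 j + ((r%:C)%C * cis y) * v 0 j)) by apply/funext => y; rewrite ec.
    exact: h2.
  - have -> : (fun y => re ((z + ((r%:C)%C * cis y) *: v) 0 j)) =
        (fun y => re (z 0 j + ((r%:C)%C * cis y) * v 0 j)) by apply/funext => y; rewrite ec.
    exact: h1.
have cc : ccontseg (fun t => Num.conj (cis t) : C) 0 (pi *+ 2).
  by move=> t _; exact: conj_cis_continuous.
have main : ((r%:C)%C) * cint (G (ln r)) 0 (pi *+ 2) =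
    cint (fun t => f (z + ((r%:C)%C * cis t) *: v) * Num.conj (cis t)) 0 (pi *+ 2).
  have fz := ccontsegM (@ccontseg_cst _ (f z) 0 (pi *+ 2)) cc.
  have fcc := ccontsegM fc cc.
  rewrite -(cintZ _ P0 (contG _ (lexx _))).
  rewrite (cint_ext (g := fun t => f (z + ((r%:C)%C * cis t) *: v) * Num.conj (cis t) -
     f z * Num.conj (cis t))) => [|t _|//].
    by rewrite (cintB P0 fcc fz) (cintZ _ P0 cc) cint_conj_cis mulr0 subr0.
  rewrite GE /cex (lnK r0) expRN (lnK r0) (_ : cis (- t) = Num.conj (cis t)); last first.
    by apply: eq_reim; rewrite ?re_conj ?im_conj /= ?cosN ?sinN.
  rewrite mulrCA [((r%:C)%C) * (_ * _)]mulrA -rcM mulfV ?gt_eqF // rc1 mul1r.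
  by rewrite mulrBl.
by rewrite -main lim rcM mulrCA mulrC -mulrA [_ * L]mulrC mulrA.
Qed.

End CauchyDerivative.

(** * Holomorphic functions are smooth *)

Section HolomorphicSmooth.
Variables (R : realType) (n : nat).
Local Notation C := (Cplx R).
Local Notation E := 'rV[C]_n.
Implicit Types (f g u : E -> C) (z w v h : E) (D : set E) (t s e r : R) (k : nat).

Definition circ r v z t : E := z + ((r%:C)%C * cis t) *: v.

Lemma circ_continuous r v z t :
  {for (z, t), continuous (fun p : E * R => circ r v p.1 p.2)}.
Proof.
apply: continuous_rcoord => i.
have h1 : {for (z, t), continuous (fun p : E * R => rcoord i p.1)}.
  apply: (@continuous_comp _ _ _ fst (@rcoord R n i) (z, t)); first exact: cvg_fst.
  exact: rcoord_continuous.
have h2 : {for (z, t), continuous (fun p : E * R => rcoord i (((r%:C)%C * cis p.2) *: v))}.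
  apply: (@continuous_comp _ _ _ snd (fun t => rcoord i (((r%:C)%C * cis t) *: v)) (z, t)).
    exact: cvg_snd.
  have h : {for t, continuous (fun y : R => ((r%:C)%C * cis y) * v 0 i.1 : C)}.
    apply: (@continuousM _ _ (fun y => ((r%:C)%C * cis y)) (fun=> v 0 i.1)); last exact: cst_continuous.
    apply: (@continuousM _ _ (fun=> (r%:C)%C)); first exact: cst_continuous.
    exact: cis_continuous.
  have [h3 h4] := (continuousC_reim _ _).1 h.
  case: i h3 h4 {h h1} => j [] /= h3 h4; rewrite /rcoord /=.
  - have -> : (fun y => im ((((r%:C)%C * cis y) *: v) 0 j)) =
        (fun y => im (((r%:C)%C * cis y) * v 0 j)) by apply/funext => y; rewrite mxE.
    exact: h4.
  - have -> : (fun y => re ((((r%:C)%C * cis y) *: v) 0 j)) =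
        (fun y => re (((r%:C)%C * cis y) * v 0 j)) by apply/funext => y; rewrite mxE.
    exact: h3.
have -> : (fun p : E * R => rcoord i (circ r v p.1 p.2)) =
    (fun p => rcoord i p.1 + rcoord i (((r%:C)%C * cis p.2) *: v)).
  by apply/funext => p; rewrite /circ rcoordD.
exact: (@continuousD _ _ _ (fun p : E * R => rcoord i p.1)
  (fun p : E * R => rcoord i (((r%:C)%C * cis p.2) *: v)) _ h1 h2).
Qed.

Lemma circ_integrand_continuous u r v z t : {for circ r v z t, continuous u} ->
  {for (z, t), continuous (fun p : E * R => u (circ r v p.1 p.2) * Num.conj (cis p.2))}.
Proof.
move=> hu.
have h1 : {for (z, t), continuous (fun p : E * R => u (circ r v p.1 p.2))}.
  apply: (@continuous_comp _ _ _ (fun p : E * R => circ r v p.1 p.2) u); last exact: hu.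
  exact: circ_continuous.
have h2 : {for (z, t), continuous (fun p : E * R => Num.conj (cis p.2) : C)}.
  apply: (@continuous_comp _ _ _ snd (fun t => Num.conj (cis t) : C) (z, t)).
    exact: cvg_snd.
  exact: conj_cis_continuous.
exact: (continuousM h1 h2).
Qed.

Lemma circ_nbhd D z v : open D -> D z -> exists2 r, 0 < r &
  exists N : set E, [/\ open N, N z, N `<=` D &
    forall y, N y -> forall s t, 0 <= s -> s <= r -> D (circ s v y t)].
Proof.
move=> oD Dz; have /nbhs_vnorm[e e0 he] := open_nbhs_nbhs (conj oD Dz).
have V0 := vnorm_ge0 v.
(* Half of [e] is kept for the displacement of [y], and [csize ((s%:C)%C * cis t)] is at most
   [2 * r]. *)
pose r := e / (4 * (vnorm v + 1)).
have r0 : 0 < r by rewrite divr_gt0 // mulr_gt0 //; lra.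
pose B := [set w : E | vnorm (w - z) < e / 2].
exists r => //; exists B^°; split.
- exact: open_interior.
- by apply/nbhs_vnorm; exists (e / 2) => //; lra.
- by move=> y /interior_subset; rewrite /B /= => hy; apply: he; lra.
move=> y /interior_subset; rewrite /B /= => hy s t s0 sr; apply: he.
rewrite /circ addrAC; apply: le_lt_trans (vnormD _ _) _.
have h1 : csize ((s%:C)%C * cis t) <= 2 * r.
  rewrite csizeR ger0_norm // mulrC; apply: ler_pM => //; first exact: csize_ge0.
  exact: csize_cis.
have h2 : vnorm (((s%:C)%C * cis t) *: v) <= 2 * r * vnorm v.
  by apply: le_trans (vnorm_scale _ _) _; apply: ler_wpM2r.
have h3 : 2 * r * vnorm v <= e / 2.
  have -> : e / 2 = 2 * r * (vnorm v + 1).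
    have : vnorm v + 1 != 0 by rewrite gt_eqF //; lra.
    by rewrite /r; move: (vnorm v + 1) => K K0; field.
  by apply: ler_wpM2l; lra.
lra.
Qed.

(** One radius serves all [y] near [z]. The derivative is thereby expressed by values of [f] alone,
    and it can be differentiated again under the integral sign. *)
Lemma hol_circ f D z v : open D -> D z -> (forall y, D y -> differentiable f y) ->
  exists2 r, 0 < r & exists N : set E, [/\ open N, N z, N `<=` D,
    forall y, N y -> forall t, D (circ r v y t) &
    forall y, N y -> real_derive v f y = (((r * (pi *+ 2))^-1)%:C)%C *
      cint (fun t => f (circ r v y t) * Num.conj (cis t)) 0 (pi *+ 2)].
Proof.
move=> oD Dz hf; have [r r0 [N [oN Nz ND hN]]] := circ_nbhd v oD Dz.
exists r => //; exists N; split=> //.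
  by move=> y Ny t; apply: hN => //; exact: ltW.
move=> y Ny; rewrite (cauchy_derivative r0 (hN y Ny) hf) mulrA -rcM mulVf ?rc1 ?mul1r //.
by rewrite gt_eqF // mulr_gt0 // pi2_gt0.
Qed.

Lemma circ_cint_continuous u D N r v z : open N -> N z ->
  (forall y, N y -> forall t, D (circ r v y t)) ->
  (forall y, D y -> {for y, continuous u}) ->
  {for z, continuous (fun y => cint (fun t => u (circ r v y t) * Num.conj (cis t)) 0 (pi *+ 2))}.
Proof.
move=> oN Nz hN hu; apply: cint_continuous; first exact: ltW (pi2_gt0 R).
  by move=> t _; apply: (circ_integrand_continuous (u := u)); apply: hu; exact: hN.
have := open_nbhs_nbhs (conj oN Nz); apply: filterS => y Ny t _.
have := circ_integrand_continuous (hu _ (hN y Ny t)) => h.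
apply: (@continuous_comp _ _ _ (fun t => (y, t)) (fun p : E * R => u (circ r v p.1 p.2) * Num.conj (cis p.2)) t _ h).
apply: (@continuous_pair _ _ _ (fun=> y) id); first exact: cst_continuous.
exact: cvg_id.
Qed.

Lemma continuous_near (T U : topologicalType) (f g : T -> U) (x : T) :
  (\forall y \near x, f y = g y) -> {for x, continuous f} -> {for x, continuous g}.
Proof.
move=> fg fc P hP; rewrite -(nbhs_singleton fg) in hP.
have h : \forall y \near x, P (f y) by exact: fc.
by change (\forall y \near x, P (g y)); apply: (filterS _ (filterI fg h)) => y [<-].
Qed.

Lemma continuous_cmul (c : C) u z : {for z, continuous u} ->
  {for z, continuous (fun y => c * u y)}.
Proof. by move=> hu; apply: (@continuousM _ _ (fun=> c) u); [exact: cst_continuous|exact: hu]. Qed.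

Lemma hol_der_continuous f D v z : open D -> (forall y, D y -> differentiable f y) ->
  D z -> {for z, continuous (real_derive v f)}.
Proof.
move=> oD hf Dz; have [r r0 [N [oN Nz ND hN eN]]] := hol_circ v oD Dz hf.
pose g y : C := (((r * (pi *+ 2))^-1)%:C)%C *
  cint (fun t => f (circ r v y t) * Num.conj (cis t)) 0 (pi *+ 2).
have gf : \forall y \near z, g y = real_derive v f y.
  by have := open_nbhs_nbhs (conj oN Nz); apply: filterS => y /eN ->.
refine (@continuous_near _ _ g (real_derive v f) z gf _).
apply: (continuous_cmul (u := fun y => cint (fun t => f (circ r v y t) * Num.conj (cis t)) 0 (pi *+ 2))).
apply: (circ_cint_continuous oN Nz hN) => y Dy; apply: differentiable_continuous.
exact: hf.
Qed.

Lemma is_cder_circ f r v w y t : pdiff f (circ r v y t) ->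
  is_cder (fun x => f (circ r v x t) * Num.conj (cis t)) w y
    (real_derive w f (circ r v y t) * Num.conj (cis t)).
Proof.
move=> hf; have h : is_cder (fun x => f (circ r v x t)) w y (real_derive w f (circ r v y t)).
  have [h1 h2] := pdiffP w hf.
  have tr x : rline (circ r v y t) w x = circ r v (rline y w x) t.
    by rewrite /circ /rline addrAC.
  split.
  - by move: h1; rewrite /is_rder; under [X in is_derive _ _ X]eq_fun do rewrite tr.
  - by move: h2; rewrite /is_rder; under [X in is_derive _ _ X]eq_fun do rewrite tr.
apply: is_cder_eq (is_cderM h (is_cder_cst _ w y)) _; by rewrite mulr0 addr0.
Qed.

(** Differentiating the circle integral in a direction [w] replaces [f] by [real_derive w f], which
    is continuous and complex-linear in [w]. So the integral is C^1 and satisfies the Cauchy-Riemann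
    equations. *)
Lemma hol_der_hol f D v z : open D -> (forall y, D y -> differentiable f y) ->
  D z -> differentiable (real_derive v f) z.
Proof.
move=> oD hf Dz; have [r r0 [N [oN Nz ND hN eN]]] := hol_circ v oD Dz hf.
have P0 := ltW (pi2_gt0 R).
pose k := (((r * (pi *+ 2))^-1)%:C)%C : C.
pose I u y : C := cint (fun t => u (circ r v y t) * Num.conj (cis t)) 0 (pi *+ 2).
have dc w y : D y -> {for y, continuous (real_derive w f)}.
  exact: (hol_der_continuous oD hf).
have fc y : D y -> {for y, continuous f}.
  by move=> Dy; apply: differentiable_continuous; exact: hf.
have Iseg u y : (forall y, D y -> {for y, continuous u}) -> N y ->
    ccontseg (fun t => u (circ r v y t) * Num.conj (cis t)) 0 (pi *+ 2).
  move=> hu Ny t _; have := circ_integrand_continuous (hu _ (hN y Ny t)) => h.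
  apply: (@continuous_comp _ _ _ (fun t => (y, t)) (fun p : E * R => u (circ r v p.1 p.2) * Num.conj (cis p.2)) t _ h).
  apply: (@continuous_pair _ _ _ (fun=> y) id); first exact: cst_continuous.
  exact: cvg_id.
have dI w y : N y -> is_cder (I f) w y (I (real_derive w f) y).
  move=> Ny; apply: (cint_is_cder (D := N) (dG := fun y t => real_derive w f (circ r v y t) * Num.conj (cis t))) => //.
  - by move=> x t Nx _; apply: is_cder_circ; apply: hol_pdiff; apply: hf; exact: hN.
  - by move=> t _; apply: (circ_integrand_continuous (u := real_derive w f)); apply: dc; exact: hN.
  - by move=> x Nx; apply: Iseg.
have Ic w y : N y -> {for y, continuous (I (real_derive w f))}.
  by move=> Ny; apply: (circ_cint_continuous oN Ny hN); exact: dc.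
have C1 : Cn_on 1 N (fun y => k * I f y).
  apply: (@CnI _ _ 0 N _ (fun w y => k * I (real_derive w f) y)) => //.
  - move=> y Ny; apply: (continuous_cmul (u := I f)).
    exact: (circ_cint_continuous oN Ny hN).
  - by move=> w y Ny; apply: is_cderZ; exact: dI.
  - move=> w; split => // y Ny; apply: (continuous_cmul (u := I (real_derive w f))); exact: Ic.
have eqn y : N y -> \forall x \near y, k * I f x = real_derive v f x.
  by move=> Ny; have := open_nbhs_nbhs (conj oN Ny); apply: filterS => x /eN ->.
have C1' : Cn_on 1 N (real_derive v f) by apply: Cn_near C1.
apply: (CR_differentiable C1'); first exact: open_nbhs_nbhs.
move=> w; rewrite -(dbar_near w (eqn z Nz)); apply: CR_dbar.
rewrite !(is_cder_val (is_cderZ k (dI _ z Nz))) mulrCA; congr (_ * _).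
rewrite /I -(cintZ _ P0 (Iseg _ _ (dc w) Nz)); apply: cint_ext => // t _.
by rewrite (hol_real_deriveZ _ _ (hf _ (hN z Nz t))) mulrA.
Qed.

Lemma hol_smooth f D : open D -> (forall y, D y -> differentiable f y) -> smooth_on D f.
Proof.
move=> oD hf k; elim: k f hf => [|k ih] f hf.
  by split => // z Dz; apply: differentiable_continuous; exact: hf.
split; first by move=> z Dz; apply: differentiable_continuous; exact: hf.
move=> v; split; first by move=> z Dz; exact: (hol_pdiff (hf z Dz)).
by apply: ih => y Dy; exact: (hol_der_hol v oD hf Dy).
Qed.

End HolomorphicSmooth.

(** * Bump functions *)

Section SmoothStep.
Variable R : realType.
Implicit Types (x y e a c : R) (p : {poly R}).

Lemma expR_ge_pow (k : nat) y : 0 <= y -> (y / k.+1%:R) ^+ k.+1 <= expR y.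
Proof.
move=> y0; have k0 : 0 < k.+1%:R :> R by rewrite ltr0n.
have h : y / k.+1%:R <= expR (y / k.+1%:R).
  by apply: le_trans (expR_ge1Dx _); rewrite lerDr.
have -> : expR y = expR (y / k.+1%:R) ^+ k.+1.
  by rewrite -expRM_natl mulrC divfK // gt_eqF.
by apply: lerXn2r => //; rewrite nnegrE ?expR_ge0 // divr_ge0 // ltW.
Qed.

Lemma poly_exp_small p e : 0 < e -> exists2 M, 0 < M &
  forall y, M < y -> `|p.[y]| * expR (- y) <= e.
Proof.
have mono (j : nat) e' : 0 < e' -> exists2 M, 0 < M & forall y, M < y -> y ^+ j * expR (- y) <= e'.
  move=> e'0; pose K : R := j.+1%:R ^+ j.+1.
  have K0 : 0 < K by rewrite exprn_gt0 // ltr0n.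
  exists (K / e'); first by rewrite divr_gt0.
  move=> y yM; have y0 : 0 < y by apply: lt_trans yM; rewrite divr_gt0.
  have := expR_ge_pow j (ltW y0); rewrite expr_div_n -/K => h.
  rewrite expRN ler_pdivrMr ?expR_gt0 //.
  apply: (@le_trans _ _ (e' * (y ^+ j.+1 / K))); last by apply: ler_wpM2l => //; exact: ltW.
  rewrite mulrA ler_pdivlMr // exprS mulrA mulrC.
  apply: ler_wpM2r; first by rewrite exprn_ge0 // ltW.
  by move: yM; rewrite ltr_pdivrMr // mulrC => /ltW.
move=> e0.
have gen (m : nat) : exists2 M, 0 < M &
    forall y, M < y -> \sum_(i < m) `|p`_i| * y ^+ i * expR (- y) <= e.
  have : forall e', 0 < e' -> exists2 M, 0 < M &
    forall y, M < y -> \sum_(i < m) `|p`_i| * y ^+ i * expR (- y) <= e'.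
    elim: m => [|m ih] e' e'0; first by exists 1 => // y _; rewrite big_ord0 ltW.
    have e2 : 0 < e' / 2 by lra.
    have [M1 M10 h1] := ih _ e2.
    have p0 : 0 < `|p`_m| + 1 by have := normr_ge0 (p`_m); lra.
    have e3 : 0 < e' / 2 / (`|p`_m| + 1) by rewrite divr_gt0.
    have [M2 M20 h2] := mono m _ e3.
    exists (Num.max M1 M2); first by rewrite lt_max M10.
    move=> y; rewrite gt_max => /andP[y1 y2]; rewrite big_ord_recr /=.
    have := h1 y y1.
    have : `|p`_m| * y ^+ m * expR (- y) <= e' / 2.
      rewrite -mulrA; apply: (@le_trans _ _ (`|p`_m| * (e' / 2 / (`|p`_m| + 1)))).
        by apply: ler_wpM2l => //; exact: h2.
      rewrite mulrCA; apply: ler_piMr; first exact: ltW.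
      rewrite ler_pdivrMr // mul1r; lra.
    lra.
  exact.
have [M M0 hM] := gen (size p); exists M => // y yM.
have y0 : 0 < y by exact: lt_trans yM.
apply: le_trans (hM y yM); rewrite horner_coef.
apply: (@le_trans _ _ ((\sum_(i < size p) `|p`_i| * y ^+ i) * expR (- y))); last first.
  by rewrite mulr_suml.
apply: ler_wpM2r; first exact: expR_ge0.
apply: le_trans (ler_norm_sum _ _ _) _; apply: ler_sum => i _.
by rewrite normrM [`|y ^+ _|]ger0_norm // exprn_ge0 // ltW.
Qed.

(** The functions [p (1/x) e^(-1/x)], extended by 0, form a class closed under derivation; [flatd p]
    is the polynomial of the derivative. Smoothness at 0 then needs a single estimate for all
    orders. *)
Definition flat p x := if 0 < x then p.[x^-1] * expR (- x^-1) else 0.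
Definition flatd p : {poly R} := 'X ^+ 2 * (p - p^`()).

Lemma is_derive_flat p x : is_derive x (1 : R) (flat p) (flat (flatd p) x).
Proof.
have [x0|x0|->] := ltgtP x 0.
- rewrite {2}/flat ltNge (ltW x0) /=.
  apply: (@near_eq_is_derive _ _ _ (fun=> 0)).
  near=> y; rewrite /flat; case: ltP => // y0.
    have : y < 0 by near: y; exact: lt_nbhsl.
    by rewrite ltNge (ltW y0).
- rewrite {2}/flat x0.
  apply: (@near_eq_is_derive _ _ _ (fun y => p.[y^-1] * expR (- y^-1))).
    near=> y; rewrite /flat; case: ltP => // y0.
    have : 0 < y by near: y; exact: lt_nbhsr.
    by rewrite ltNge y0.
  have xn0 : x != 0 by rewrite gt_eqF.
  have hV := @is_deriveV R id x 1 1 xn0 (is_derive_id x 1).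
  have hp := @is_derive1_comp _ (horner p) (fun y => y^-1) x _ _ (is_derive_poly p _) hV.
  have hN := @is_deriveN _ _ _ (fun y : R => y^-1) x 1 _ hV.
  have he := @is_derive1_comp _ expR (fun y => - y^-1) x _ _ (is_derive_expR _) hN.
  have := @is_deriveM _ _ _ _ _ _ _ _ hp he.
  move=> h; apply: is_derive_eq h _.
  rewrite /flatd hornerM hornerXn hornerD hornerN /=.
  rewrite -![_ *: _]/(_ * _) !mulr1 -exprVn; ring.
- rewrite {2}/flat ltxx; apply/is_derive_eps => e e0.
  (* The extra factor ['X] accounts for the division by [t] in the difference quotient at 0. *)
  have [M M0 hM] := poly_exp_small ('X * p) e0.
  exists M^-1; first by rewrite invr_gt0.
  move=> t tM; rewrite add0r {2}/flat ltxx mulr0 !subr0 /flat; case: ltP => t0; last first.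
    by rewrite normr0 mulr_ge0 // ltW.
  have tM' : M < t^-1.
    by rewrite -[M]invrK ltf_pV2 ?posrE ?invr_gt0 //; move: tM; rewrite gtr0_norm.
  have := hM _ tM'; rewrite hornerM hornerX normrM [`|t^-1|]gtr0_norm ?invr_gt0 //.
  rewrite normrM [`|expR _|]gtr0_norm ?expR_gt0 // [`|t|]gtr0_norm //.
  by rewrite -mulrA mulrC ler_pdivrMr.
Unshelve. all: by end_near.
Qed.

Definition flat_seq (i : nat) : R -> R := flat (iter i flatd 1).

Lemma is_derive_flat_seq i x : is_derive x (1 : R) (flat_seq i) (flat_seq i.+1 x).
Proof. exact: is_derive_flat. Qed.

Definition flat0 := flat_seq 0.
Lemma flat0_gt0 x : 0 < x -> 0 < flat0 x.
Proof. by move=> x0; rewrite /flat0 /flat_seq /flat x0 /= hornerC mul1r expR_gt0. Qed.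
Lemma flat0_eq0 x : x <= 0 -> flat0 x = 0.
Proof. by move=> x0; rewrite /flat0 /flat_seq /flat ltNge x0. Qed.
Lemma flat0_ge0 x : 0 <= flat0 x.
Proof. by have [x0|x0] := leP x 0; [rewrite flat0_eq0|exact/ltW/flat0_gt0]. Qed.

Definition bstep a c x := flat0 (c - x) / (flat0 (c - x) + flat0 (x - a)).

Lemma bstep1 a c x : a < c -> x <= a -> bstep a c x = 1.
Proof.
move=> ac xa; rewrite /bstep (@flat0_eq0 (x - a)); last by lra.
by rewrite addr0 divff // gt_eqF //; apply: flat0_gt0; lra.
Qed.

Lemma bstep0 a c x : c <= x -> bstep a c x = 0.
Proof.
move=> cx; have h : c - x <= 0 by lra.
by rewrite /bstep (flat0_eq0 h) mul0r.
Qed.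

Lemma bstep_den a c x : a < c -> flat0 (c - x) + flat0 (x - a) != 0.
Proof.
move=> ac; have h1 := flat0_ge0 (c - x); have h2 := flat0_ge0 (x - a).
have [xa|ax] := leP x a.
  have h : 0 < c - x by lra.
  by have h3 := flat0_gt0 h; rewrite gt_eqF //; lra.
have h : 0 < x - a by lra.
by have h3 := flat0_gt0 h; rewrite gt_eqF //; lra.
Qed.

Lemma RCn_bstep n k (D : set 'rV[Cplx R]_n) (u : 'rV[Cplx R]_n -> R) a c :
  open D -> a < c -> RCn k D u -> RCn k D (fun z => bstep a c (u z)).
Proof.
move=> oD ac hu.
have h1 : RCn k D (fun z => flat0 (c - u z)).
  apply: (RCn_comp1 oD is_derive_flat_seq _ 0).
  by apply: RCnD => //; [exact: RCn_cst|exact: RCnN].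
have h2 : RCn k D (fun z => flat0 (u z - a)).
  apply: (RCn_comp1 oD is_derive_flat_seq _ 0).
  by apply: RCnD => //; exact: RCn_cst.
apply: RCnM => //; apply: RCnV => //; first by move=> z _; exact: bstep_den.
exact: RCnD.
Qed.

End SmoothStep.

(** * Solving one Cauchy-Riemann equation *)

Lemma cint_half (R : realType) (f1 f2 f3 : R -> Cplx R) (a b : R) : a <= b ->
  (forall t, seg a b t -> f3 t = 2^-1 * (f1 t + 'i * f2 t)) -> ccontseg f1 a b ->
  ccontseg f2 a b -> cint f2 a b = 0 -> cint f3 a b = 2^-1 * cint f1 a b.
Proof.
move=> ab e c1 c2 h0.
have ica := ccontsegM (@ccontseg_cst _ ('i : Cplx R) a b) c2.
rewrite (cint_ext e ab) (cintZ _ ab (ccontsegD c1 ica)) (cintD ab c1 ica) (cintZ _ ab c2).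
by rewrite h0 mulr0 addr0.
Qed.

Lemma is_derive_shift0 (R : realType) (phi : R -> R) (s t d : R) :
  is_derive t (1 : R) (fun h => phi (s + h)) d <-> is_derive (s + t) (1 : R) phi d.
Proof.
split=> /is_derive_eps h; apply/is_derive_eps => e /h[r r0 hr];
  by exists r => // x /hr; rewrite addrA.
Qed.

Lemma pi_cancel (R : realType) (x : Cplx R) :
  - ((pi^-1)%:C)%C * (2^-1 * - (x * ((pi *+ 2)%:C)%C)) = x.
Proof.
have p0 : pi != 0 :> R by rewrite gt_eqF // pi_gt0.
have e : ((pi *+ 2)%:C)%C = 2 * (pi%:C)%C :> Cplx R by rewrite mulr2n rcD mulr_natl mulr2n.
have ab : ((pi^-1)%:C)%C * (pi%:C)%C = 1 :> Cplx R by rewrite -rcM mulVf // rc1.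
rewrite e; move: ab; move: ((pi^-1)%:C)%C ((pi : R)%:C)%C => u v uv.
by transitivity (x * (u * v)); [field|rewrite uv mulr1].
Qed.

Section CauchyGreen.
Variables (R : realType) (n : nat).
Local Notation C := (Cplx R).
Local Notation E := 'rV[C]_n.
Implicit Types (f g u : E -> C) (z w v h : E) (D : set E) (t s e r : R) (k : nat).
Variables (D : set E) (e : E) (M : R).
Hypotheses (oD : open D) (M0 : 0 < M).
(** [D] is a union of complex lines in the direction [e], so an integral along such a line never
    leaves the domain. A cylinder will play this role. *)
Hypothesis De : forall z, D z -> forall c : C, D (z + c *: e).

Lemma circ2_continuous z s t :
  {for ((z, s), t), continuous (fun p : (E * R) * R => circ p.1.2 e p.1.1 p.2)}.
Proof.
apply: continuous_rcoord => i.
have h1 : {for ((z, s), t), continuous (fun p : (E * R) * R => rcoord i p.1.1)}.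
  apply: (@continuous_comp _ _ _ (fun p : (E * R) * R => p.1.1) (@rcoord R n i)).
    apply: (@continuous_comp _ _ _ fst fst ((z, s), t)); exact: cvg_fst.
  exact: rcoord_continuous.
have h2 : {for ((z, s), t), continuous (fun p : (E * R) * R => p.1.2)}.
  apply: (@continuous_comp _ _ _ fst snd ((z, s), t)); first exact: cvg_fst.
  exact: cvg_snd.
have h3 : {for ((z, s), t), continuous (fun p : (E * R) * R => rcoord i (cis p.2 *: e))}.
  apply: (@continuous_comp _ _ _ snd (fun t => rcoord i (cis t *: e)) ((z, s), t)).
    exact: cvg_snd.
  have h : {for t, continuous (fun y : R => cis y * e 0 i.1 : C)}.
    apply: (@continuousM _ _ (fun y => cis y) (fun=> e 0 i.1)); last exact: cst_continuous.
    exact: cis_continuous.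
  have [h3 h4] := (continuousC_reim _ _).1 h.
  case: i h3 h4 {h h1} => j [] /= h3 h4; rewrite /rcoord /=.
  - have -> : (fun y => im ((cis y *: e) 0 j)) = (fun y => im (cis y * e 0 j)).
      by apply/funext => y; rewrite mxE.
    exact: h4.
  - have -> : (fun y => re ((cis y *: e) 0 j)) = (fun y => re (cis y * e 0 j)).
      by apply/funext => y; rewrite mxE.
    exact: h3.
have -> : (fun p : (E * R) * R => rcoord i (circ p.1.2 e p.1.1 p.2)) =
    (fun p => rcoord i p.1.1 + p.1.2 * rcoord i (cis p.2 *: e)).
  by apply/funext => p; rewrite /circ rcoordD -scalerA rcoordZ.
apply: (@continuousD _ _ _ (fun p : (E * R) * R => rcoord i p.1.1)
  (fun p : (E * R) * R => p.1.2 * rcoord i (cis p.2 *: e)) _ h1).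
exact: (@continuousM _ _ (fun p : (E * R) * R => p.1.2) (fun p => rcoord i (cis p.2 *: e)) _ h2 h3).
Qed.

(** In polar coordinates the area element [s ds dt] cancels the modulus of the kernel [1 / c]; only
    its phase, the conjugate of [cis t], is left, and the integrand has no singularity. *)
Definition circ_int f s z : C := cint (fun t => f (circ s e z t) * Num.conj (cis t)) 0 (pi *+ 2).

Lemma De_circ z s t : D z -> D (circ s e z t). Proof. by move=> Dz; exact: De. Qed.

Lemma circ2_integrand f z s t : (forall y, D y -> {for y, continuous f}) -> D z ->
  {for ((z, s), t), continuous (fun p : (E * R) * R =>
    f (circ p.1.2 e p.1.1 p.2) * Num.conj (cis p.2))}.
Proof.
move=> fc Dz.
have h1 : {for ((z, s), t), continuous (fun p : (E * R) * R => f (circ p.1.2 e p.1.1 p.2))}.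
  apply: (@continuous_comp _ _ _ (fun p : (E * R) * R => circ p.1.2 e p.1.1 p.2) f).
    exact: circ2_continuous.
  exact/fc/De_circ.
have h2 : {for ((z, s), t), continuous (fun p : (E * R) * R => Num.conj (cis p.2) : C)}.
  apply: (@continuous_comp _ _ _ snd (fun t => Num.conj (cis t) : C) ((z, s), t)).
    exact: cvg_snd.
  exact: conj_cis_continuous.
exact: (continuousM h1 h2).
Qed.

Lemma circ_seg f z s a b : (forall y, D y -> {for y, continuous f}) -> D z ->
  ccontseg (fun t => f (circ s e z t) * Num.conj (cis t)) a b.
Proof.
move=> fc Dz t _; have h := @circ2_integrand f z s t fc Dz.
apply: (@continuous_comp _ _ _ (fun t => ((z, s), t)) (fun p : (E * R) * R =>
  f (circ p.1.2 e p.1.1 p.2) * Num.conj (cis p.2)) t _ h).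
apply: (@continuous_pair _ _ _ (fun=> (z, s)) id); first exact: cst_continuous.
exact: cvg_id.
Qed.

Lemma circ_int_continuous f z s : (forall y, D y -> {for y, continuous f}) -> D z ->
  {for (z, s), continuous (fun p : E * R => circ_int f p.2 p.1)}.
Proof.
move=> fc Dz.
apply: (@cint_continuous R _ (z, s) (fun (p : E * R) t => f (circ p.2 e p.1 t) * Num.conj (cis t))).
- exact: ltW (pi2_gt0 R).
- by move=> t _; exact: circ2_integrand.
- have zD := open_nbhs_nbhs (conj oD Dz).
  exists (D, setT) => /=; first by split => //; exact: filterT.
  by move=> [y s'] [/= Dy _]; exact: circ_seg.
Qed.

Lemma circ_int_seg f z a b : (forall y, D y -> {for y, continuous f}) -> D z ->
  ccontseg (fun s => circ_int f s z) a b.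
Proof.
move=> fc Dz s _; have h := @circ_int_continuous f z s fc Dz.
apply: (@continuous_comp _ _ _ (fun s => (z, s)) (fun p : E * R => circ_int f p.2 p.1) s _ h).
apply: (@continuous_pair _ _ _ (fun=> z) id); first exact: cst_continuous.
exact: cvg_id.
Qed.

(* The Cauchy transform [-1/pi \int f(z + c e) / c] of [f] along the complex
   line of [e], in polar coordinates [c = s cis t]. *)
Definition cauchyT f z : C :=
  - ((pi^-1)%:C)%C * cint (fun s => circ_int f s z) 0 M.

Lemma is_cder_cauchyT f w z : Cn_on 1 D f -> D z ->
  is_cder (cauchyT f) w z (cauchyT (real_derive w f) z).
Proof.
move=> hf Dz; have P0 := ltW (pi2_gt0 R).
have fc y : D y -> {for y, continuous f} by exact: Cn_cont hf.
have dc y : D y -> {for y, continuous (real_derive w f)} by exact: Cn_cont (Cn_der w hf).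
apply: is_cderZ.
apply: (cint_is_cder (D := D) (dG := fun y s => circ_int (real_derive w f) s y)) => //; first exact: ltW.
- move=> y s Dy _.
  apply: (cint_is_cder (D := D) (dG := fun y t => real_derive w f (circ s e y t) * Num.conj (cis t))) => //.
  + by move=> x t Dx _; apply: is_cder_circ; apply: (Cn_pdiff hf); exact: De_circ.
  + by move=> t _; apply: (circ_integrand_continuous (u := real_derive w f)); apply: dc; exact: De_circ.
  + by move=> x Dx; exact: circ_seg.
- by move=> s _; exact: (@circ_int_continuous (real_derive w f)).
- by move=> y Dy; exact: circ_int_seg.
Qed.

Lemma cauchyT_continuous f z : (forall y, D y -> {for y, continuous f}) -> D z ->
  {for z, continuous (cauchyT f)}.
Proof.
move=> fc Dz; apply: (continuous_cmul (u := fun z => cint (fun s => circ_int f s z) 0 M)).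
apply: cint_continuous; first exact: ltW.
- by move=> s _; exact: (@circ_int_continuous f).
- by have := open_nbhs_nbhs (conj oD Dz); apply: filterS => y Dy; exact: circ_int_seg.
Qed.

Lemma Cn_le k f : Cn_on k.+1 D f -> Cn_on 1 D f.
Proof. by elim: k => // k ih /CnS/ih. Qed.

Lemma Cn_cauchyT k f : Cn_on k D f -> Cn_on k D (cauchyT f).
Proof.
elim: k f => [|k ih] f hf.
  by split => // z Dz; apply: cauchyT_continuous => // y; exact: Cn_cont hf.
apply: (@CnI _ _ k D _ (fun w => cauchyT (real_derive w f))) => //.
- by move=> z Dz; apply: cauchyT_continuous => // y; exact: Cn_cont hf.
- by move=> w z Dz; apply: is_cder_cauchyT => //; exact: Cn_le hf.
- by move=> w; apply: ih; exact: Cn_der.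
Qed.

Lemma cauchyT_lin f g (b c : C) z : (forall y, D y -> {for y, continuous f}) ->
  (forall y, D y -> {for y, continuous g}) -> D z ->
  cauchyT (fun y => b * f y + c * g y) z = b * cauchyT f z + c * cauchyT g z.
Proof.
move=> fc gc Dz; have P0 := ltW (pi2_gt0 R); have M0' := ltW M0.
have e1 s : circ_int (fun y => b * f y + c * g y) s z = b * circ_int f s z + c * circ_int g s z.
  have sf := @circ_seg f z s 0 (pi *+ 2) fc Dz; have sg := @circ_seg g z s 0 (pi *+ 2) gc Dz.
  rewrite /circ_int -(cintZ b P0 sf) -(cintZ c P0 sg).
  rewrite -(cintD P0 (ccontsegM (@ccontseg_cst _ b _ _) sf) (ccontsegM (@ccontseg_cst _ c _ _) sg)).
  by apply: cint_ext => // t _; rewrite mulrDl !mulrA.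
have sf := @circ_int_seg f z 0 M fc Dz; have sg := @circ_int_seg g z 0 M gc Dz.
rewrite /cauchyT (cint_ext (fun s _ => e1 s) M0').
rewrite (cintD M0' (ccontsegM (@ccontseg_cst _ b _ _) sf) (ccontsegM (@ccontseg_cst _ c _ _) sg)).
rewrite (cintZ b M0' sf) (cintZ c M0' sg) mulrDr !mulrA.
by rewrite [_ * b]mulrC [_ * c]mulrC.
Qed.

Lemma cauchyT_ext f g z : (forall c : C, f (z + c *: e) = g (z + c *: e)) ->
  cauchyT f z = cauchyT g z.
Proof.
move=> fg; congr (_ * _); apply: cint_ext; last exact: ltW.
move=> s _; apply: cint_ext; last exact: ltW (pi2_gt0 R).
by move=> t _; rewrite /circ fg.
Qed.

Lemma cauchyT0 z : cauchyT (fun=> 0) z = 0.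
Proof.
rewrite /cauchyT /circ_int.
have e0 s : cint (fun t => 0 * Num.conj (cis t)) 0 (pi *+ 2) = 0 :> C.
  rewrite (cint_ext (g := fun=> 0)) ?(cint_cst _ (ltW (pi2_gt0 R))) ?mul0r //.
    by move=> t _; rewrite mul0r.
  exact: ltW (pi2_gt0 R).
rewrite (cint_ext (g := fun=> 0)) ?(cint_cst _ (ltW M0)) ?mul0r ?mulr0 //; last exact: ltW.
by move=> s _; exact: e0.
Qed.

Lemma dbar_cauchyT f w z : Cn_on 1 D f -> D z ->
  dbar_derive w (cauchyT f) z = cauchyT (dbar_derive w f) z.
Proof.
move=> hf Dz.
rewrite (is_cder_dbar (is_cder_cauchyT w hf Dz) (is_cder_cauchyT ('i *: w) hf Dz)).
have dc v y : D y -> {for y, continuous (real_derive v f)} by exact: Cn_cont (Cn_der v hf).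
have := @cauchyT_lin (real_derive w f) (real_derive ('i *: w) f) (2^-1) (2^-1 * 'i) z
  (dc w) (dc _) Dz.
rewrite mulrDr [2^-1 * ('i * _)]mulrA => <-; congr (cauchyT _ z); apply/funext => y.
by rewrite /dbar_derive mulrDr mulrA.
Qed.

Lemma real_derive_cis f t y : Cn_on 1 D f -> D y ->
  real_derive (cis t *: e) f y =
    ((cos t)%:C)%C * real_derive e f y + ((sin t)%:C)%C * real_derive ('i *: e) f y.
Proof. by move=> hf Dy; rewrite (real_derive_c _ _ hf (open_nbhs_nbhs (conj oD Dy))). Qed.

Lemma C1_curve (u : E -> R) (gam : R -> E) (t0 : R) w : RCn 1 D u -> D (gam t0) ->
  (forall i, is_derive t0 (1 : R) (fun t => rcoord i (gam t)) (rcoord i w)) ->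
  is_derive t0 (1 : R) (fun t => u (gam t)) (rder w u (gam t0)).
Proof.
move=> hu Dg hg; have gD := open_nbhs_nbhs (conj oD Dg).
rewrite (rder_lin w hu gD).
have := @C1_chain R n D u (fun x : R => gam (t0 + x)) w hu.
rewrite addr0 => /(_ gD) h.
have {}h : is_derive (0 : R) (1 : R) (fun t => u (gam (t0 + t))) (rdiffl u (gam t0) w).
  apply: h => i; apply/is_derive_eps => d d0.
  have /is_derive_eps/(_ d d0)[r r0 hr] := hg i.
  by exists r => // t /hr; rewrite add0r addr0.
apply/is_derive_eps => d d0; have /is_derive_eps/(_ d d0)[r r0 hr] := h.
by exists r => // t /hr; rewrite add0r addr0.
Qed.

Lemma C1_curveC f (gam : R -> E) (t0 : R) w : Cn_on 1 D f -> D (gam t0) ->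
  (forall i, is_derive t0 (1 : R) (fun t => rcoord i (gam t)) (rcoord i w)) ->
  is_derive t0 (1 : R) (fun t => re (f (gam t))) (re (real_derive w f (gam t0))) /\
  is_derive t0 (1 : R) (fun t => im (f (gam t))) (im (real_derive w f (gam t0))).
Proof.
move=> /Cn_onE[h1 h2] Dg hg; split.
- exact: (C1_curve h1 Dg hg).
- exact: (C1_curve h2 Dg hg).
Qed.

Lemma rcoord_cis i t s v : rcoord i (((s%:C)%C * cis t) *: v) =
  s * (cos t * rcoord i v + sin t * rcoord i ('i *: v)).
Proof.
rewrite -scalerA rcoordZ; congr (_ * _).
by rewrite (scale_complex (cis t) v) rcoordD !rcoordZ.
Qed.

Lemma circ_derive_s i z s t :
  is_derive s (1 : R) (fun s => rcoord i (circ s e z t)) (rcoord i (cis t *: e)).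
Proof.
rewrite (_ : (fun s => _) = fun s => rcoord i z + s * rcoord i (cis t *: e)).
  exact: is_derive_affine.
by apply/funext => x; rewrite /circ rcoordD -scalerA rcoordZ.
Qed.

Lemma circ_derive_t i z s t :
  is_derive t (1 : R) (fun t => rcoord i (circ s e z t))
    (rcoord i ((s%:C)%C *: (('i * cis t) *: e))).
Proof.
rewrite (_ : (fun t => _) =
  fun t => rcoord i z + s * (cos t * rcoord i e + sin t * rcoord i ('i *: e))); last first.
  by apply/funext => x; rewrite /circ rcoordD rcoord_cis.
have h1 := is_deriveM (is_derive_cos t) (is_derive_cst (rcoord i e) t (1 : R)).
have h2 := is_deriveM (is_derive_sin t) (is_derive_cst (rcoord i ('i *: e)) t (1 : R)).
have h3 := is_deriveD h1 h2.
have h4 := is_deriveD (is_derive_cst (rcoord i z) t (1 : R)) (is_deriveZ s h3).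
apply: is_derive_eq h4 _.
rewrite add0r rcoordZ; congr (_ * _).
have ic : 'i * cis t = Complex (- sin t) (cos t) :> C.
  by apply: eq_reim; rewrite ?reM ?imM re_i im_i /=; ring.
rewrite ic (scale_complex (Complex (- sin t) (cos t)) e) rcoordD !rcoordZ /=.
rewrite -![_ *: _]/(_ * _) !mulr0 !add0r; ring.
Qed.

(** For [s != 0] the integrand is [1 / s] times the [t]-derivative of the periodic function
    [f (circ s e z t)]. For [s = 0] the base point is fixed, and the integrand is a combination of
    sine and cosine with constant coefficients. *)
Lemma circ_cint_angular f z s : Cn_on 1 D f -> D z ->
  cint (fun t => real_derive (('i * cis t) *: e) f (circ s e z t)) 0 (pi *+ 2) = 0.
Proof.
move=> hf Dz; have P0 := ltW (pi2_gt0 R).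
have per x : circ x e z (pi *+ 2) = circ x e z 0.
  by rewrite /circ /cis cos2pi sin2pi cos0 sin0.
have zD y : D y -> nbhs y D by move=> Dy; exact: open_nbhs_nbhs.
have [s0|s0] := eqVneq s 0.
  have c0 t : circ s e z t = z by rewrite s0 /circ rc0 mul0r scale0r addr0.
  pose F t := ((cos t)%:C)%C * real_derive e f z + ((sin t)%:C)%C * real_derive ('i *: e) f z.
  rewrite (@cint_val _ _ F) // ?subrr.
    by rewrite /F cos2pi sin2pi cos0 sin0 subrr.
  move=> t _; rewrite c0 (real_derive_c _ _ hf (zD z Dz)).
  have -> : re ('i * cis t) = - sin t by rewrite reM re_i im_i mul0r mul1r sub0r.
  have -> : im ('i * cis t) = cos t by rewrite imM re_i im_i mul0r mul1r add0r.
  have lin (a b : R) : is_derive t (1 : R) (fun t => cos t * a + sin t * b) (- sin t * a + cos t * b).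
    have h1 := is_deriveM (is_derive_cos t) (is_derive_cst a t (1 : R)).
    have h2 := is_deriveM (is_derive_sin t) (is_derive_cst b t (1 : R)).
    apply: is_derive_eq (is_deriveD h1 h2) _.
    rewrite -![_ *: _]/(_ * _) !mulr0 !add0r /cst; ring.
  split.
  - rewrite reD !re_rcM; rewrite (_ : (fun t => re (F t)) =
      fun t => cos t * re (real_derive e f z) + sin t * re (real_derive ('i *: e) f z)).
      exact: lin.
    by apply/funext => x; rewrite /F reD !re_rcM.
  - rewrite imD !im_rcM; rewrite (_ : (fun t => im (F t)) =
      fun t => cos t * im (real_derive e f z) + sin t * im (real_derive ('i *: e) f z)).
      exact: lin.
    by apply/funext => x; rewrite /F imD !im_rcM.
have sc : (s%:C)%C != 0 :> C by apply: contra s0 => /eqP/(congr1 (@complex.Re R))/= ->.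
have e1 t : real_derive (('i * cis t) *: e) f (circ s e z t) =
    ((s^-1)%:C)%C * real_derive ((s%:C)%C *: (('i * cis t) *: e)) f (circ s e z t).
  by rewrite (real_deriveZ _ _ hf (zD _ (De_circ s t Dz))) mulrA -rcM mulVf // rc1 mul1r.
rewrite (@cint_val _ _ (fun t => ((s^-1)%:C)%C * f (circ s e z t))) //.
  by rewrite per subrr.
move=> t _; have [h1 h2] := C1_curveC hf (De_circ s t Dz) (fun i => circ_derive_t i z s t).
rewrite e1 re_rcM im_rcM; split.
- rewrite (_ : (fun t => _) = fun t => s^-1 * re (f (circ s e z t))); last first.
    by apply/funext => x; rewrite re_rcM.
  exact: is_deriveZ.
- rewrite (_ : (fun t => _) = fun t => s^-1 * im (f (circ s e z t))); last first.
    by apply/funext => x; rewrite im_rcM.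
  exact: is_deriveZ.
Qed.

Definition radial f z s : C := cint (fun t => f (circ s e z t)) 0 (pi *+ 2).
Definition radiald f z s : C := cint (fun t => real_derive (cis t *: e) f (circ s e z t)) 0 (pi *+ 2).

Lemma circ_joint f z s t : (forall y, D y -> {for y, continuous f}) -> D z ->
  {for (s, t), continuous (fun p : R * R => f (circ p.1 e z p.2))}.
Proof.
move=> fc Dz; apply: (@continuous_comp _ _ _ (fun p : R * R => circ p.1 e z p.2) f).
  apply: (@continuous_comp _ _ _ (fun p : R * R => ((z, p.1), p.2))
    (fun p : (E * R) * R => circ p.1.2 e p.1.1 p.2)); last exact: circ2_continuous.
  apply: (@continuous_pair _ _ _ (fun p : R * R => (z, p.1)) snd); last exact: cvg_snd.
  apply: (@continuous_pair _ _ _ (fun p : R * R => z) fst); last exact: cvg_fst.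
  exact: cst_continuous.
exact/fc/De_circ.
Qed.

Lemma circ_jointd f z s t : Cn_on 1 D f -> D z ->
  {for (s, t), continuous (fun p : R * R => real_derive (cis p.2 *: e) f (circ p.1 e z p.2))}.
Proof.
move=> hf Dz.
have dc v y : D y -> {for y, continuous (real_derive v f)} by exact: Cn_cont (Cn_der v hf).
have h1 := @circ_joint (real_derive e f) z s t (dc e) Dz.
have h2 := @circ_joint (real_derive ('i *: e) f) z s t (dc _) Dz.
have -> : (fun p : R * R => real_derive (cis p.2 *: e) f (circ p.1 e z p.2)) =
    fun p => ((cos p.2)%:C)%C * real_derive e f (circ p.1 e z p.2) +
      ((sin p.2)%:C)%C * real_derive ('i *: e) f (circ p.1 e z p.2).
  by apply/funext => p; rewrite (real_derive_cis _ hf) //; exact: De_circ.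
have h3 : {for (s, t), continuous (fun p : R * R => ((cos p.2)%:C)%C : C)}.
  apply: (@continuous_comp _ _ _ snd (fun t => ((cos t)%:C)%C : C) (s, t)); first exact: cvg_snd.
  apply: (@continuous_comp _ _ _ (@cos R) (fun t => (t%:C)%C : C)); last exact: continuous_rc.
  exact: is_derive_cont (is_derive_cos _).
have h4 : {for (s, t), continuous (fun p : R * R => ((sin p.2)%:C)%C : C)}.
  apply: (@continuous_comp _ _ _ snd (fun t => ((sin t)%:C)%C : C) (s, t)); first exact: cvg_snd.
  apply: (@continuous_comp _ _ _ (@sin R) (fun t => (t%:C)%C : C)); last exact: continuous_rc.
  exact: is_derive_cont (is_derive_sin _).
pose F1 (p : R * R) : C := ((cos p.2)%:C)%C * real_derive e f (circ p.1 e z p.2).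
pose F2 (p : R * R) : C := ((sin p.2)%:C)%C * real_derive ('i *: e) f (circ p.1 e z p.2).
have h5 : {for (s, t), continuous F1} by exact: continuousM h3 h1.
have h6 : {for (s, t), continuous F2} by exact: continuousM h4 h2.
exact: (@continuousD _ _ _ F1 F2 _ h5 h6).
Qed.

Lemma joint_seg (G : R -> R -> C) s a b :
  (forall t, {for (s, t), continuous (fun p : R * R => G p.1 p.2)}) -> ccontseg (G s) a b.
Proof.
move=> h t _; apply: (@continuous_comp _ _ _ (fun t => (s, t)) (fun p : R * R => G p.1 p.2) t _ (h t)).
apply: (@continuous_pair _ _ _ (fun=> s) id); first exact: cst_continuous.
exact: cvg_id.
Qed.

Lemma is_derive_radial f z s : Cn_on 1 D f -> D z ->
  is_derive s (1 : R) (fun s => re (radial f z s)) (re (radiald f z s)) /\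
  is_derive s (1 : R) (fun s => im (radial f z s)) (im (radiald f z s)).
Proof.
move=> hf Dz; have P0 := ltW (pi2_gt0 R).
have fc y : D y -> {for y, continuous f} by exact: Cn_cont hf.
have gen (p : C -> R) (pc : forall (T : topologicalType) (x : T) (g : T -> C),
      {for x, continuous g} -> {for x, continuous (fun y => p (g y))})
    (pd : forall x t, is_derive x (1 : R) (fun s => p (f (circ s e z t)))
       (p (real_derive (cis t *: e) f (circ x e z t)))) :
    is_derive s (1 : R) (fun s => rint (fun t => p (f (circ s e z t))) 0 (pi *+ 2))
      (rint (fun t => p (real_derive (cis t *: e) f (circ s e z t))) 0 (pi *+ 2)).
  have h := @rint_param_derive R 0 (pi *+ 2) (fun (h : R) t => p (f (circ (s + h) e z t)))
    (fun (h : R) t => p (real_derive (cis t *: e) f (circ (s + h) e z t))) P0 _ _ _.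
  rewrite !addr0 in h.
  have {}h : is_derive (0 : R) (1 : R) (fun h : R => rint (fun t => p (f (circ (s + h) e z t))) 0 (pi *+ 2))
     (rint (fun t => p (real_derive (cis t *: e) f (circ s e z t))) 0 (pi *+ 2)).
    apply: h.
    - move=> t _; apply: pc.
      apply: (@continuous_comp _ _ _ (fun q : R * R => (s + q.1, q.2))
        (fun q : R * R => real_derive (cis q.2 *: e) f (circ q.1 e z q.2))); last exact: circ_jointd.
      apply: (@continuous_pair _ _ _ (fun q : R * R => s + q.1) snd); last exact: cvg_snd.
      apply: (@continuousD _ _ _ (fun=> s) fst); [exact: cst_continuous|exact: cvg_fst].
    - apply: filterE => h' t ht; apply: (pc _ t (fun t => f (circ (s + h') e z t))).
      exact: (@joint_seg (fun s t => f (circ s e z t)) (s + h') 0 (pi *+ 2) (fun t => @circ_joint f z (s + h') t fc Dz) t ht).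
    - apply: filterE => h' t _.
      exact: (is_derive_shift0 (fun s => p (f (circ s e z t))) s h' _).2 (pd (s + h') t).
  have := (is_derive_shift0 (fun s => rint (fun t => p (f (circ s e z t))) 0 (pi *+ 2)) s 0 _).1 h.
  by rewrite addr0.
have pd x t := @C1_curveC f (fun s => circ s e z t) x (cis t *: e) hf (De_circ x t Dz)
  (fun i => circ_derive_s i z x t).
split.
- apply: (gen (@complex.Re R)); first by move=> T x g /continuousC_reim[].
  by move=> x t; have [] := pd x t.
- apply: (gen (@complex.Im R)); first by move=> T x g /continuousC_reim[].
  by move=> x t; have [] := pd x t.
Qed.

(** The conjugate of [cis t] is absorbed into the direction of [dbar_derive], which splits into a
    radial and an angular derivative. The angular part integrates to 0 over each circle; the radial
    part is the [s]-derivative of the circle integral, which runs from [2 pi f z] at radius 0 to 0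
    at radius [M]. *)
Lemma cauchy_green f z : Cn_on 1 D f -> D z -> (forall t, f (circ M e z t) = 0) ->
  cauchyT (dbar_derive e f) z = f z.
Proof.
move=> hf Dz fM; have P0 := ltW (pi2_gt0 R); have M0' := ltW M0.
have fc y : D y -> {for y, continuous f} by exact: Cn_cont hf.
have zD y : D y -> nbhs y D by move=> Dy; exact: open_nbhs_nbhs.
have half s : circ_int (dbar_derive e f) s z = 2^-1 * radiald f z s.
  have cs := @joint_seg (fun s t => real_derive (cis t *: e) f (circ s e z t)) s 0 (pi *+ 2)
    (fun t => @circ_jointd f z s t hf Dz).
  have pw t : dbar_derive e f (circ s e z t) * Num.conj (cis t) =
     2^-1 * (real_derive (cis t *: e) f (circ s e z t) +
       'i * real_derive (('i * cis t) *: e) f (circ s e z t)).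
    have Dc := De_circ s t Dz.
    rewrite -scalerA -/(dbar_derive (cis t *: e) f (circ s e z t)).
    by rewrite (dbar_deriveZ _ _ hf (zD _ Dc)) mulrC.
  (* Solving the previous identity for the angular term shows that this term is continuous in
     [t]. *)
  have ang t : 'i * real_derive (('i * cis t) *: e) f (circ s e z t) =
      2 * (dbar_derive e f (circ s e z t) * Num.conj (cis t)) -
      real_derive (cis t *: e) f (circ s e z t).
    by rewrite pw mulrA mulfV ?pnatr_eq0 // mul1r addrC addKr.
  have dbc : forall y, D y -> {for y, continuous (dbar_derive e f)}.
    by move=> y; exact: Cn_cont (Cn_dbar e oD hf).
  have cd := @circ_seg (dbar_derive e f) z s 0 (pi *+ 2) dbc Dz.
  have c2 := ccontsegM (@ccontseg_cst _ (2 : C) 0 (pi *+ 2)) cd.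
  have angc : ccontseg (fun t => real_derive (('i * cis t) *: e) f (circ s e z t)) 0 (pi *+ 2).
    have h : ccontseg (fun t => - 'i * ('i * real_derive (('i * cis t) *: e) f (circ s e z t))) 0 (pi *+ 2).
      apply: ccontsegM; first exact: ccontseg_cst.
      have := ccontsegD c2 (ccontsegM (@ccontseg_cst _ (-1 : C) 0 (pi *+ 2)) cs).
      rewrite (_ : (fun x => _) = (fun t => 'i * real_derive (('i * cis t) *: e) f (circ s e z t))) //.
      by apply/funext => t; rewrite ang mulN1r.
    move: h; rewrite (_ : (fun t => - 'i * _) = (fun t => real_derive (('i * cis t) *: e) f (circ s e z t))) //.
    by apply/funext => t; rewrite mulrA mulNr ii opprK mul1r.
  exact: (cint_half P0 (fun t _ => pw t) cs angc (circ_cint_angular s hf Dz)).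
have rc : ccontseg (radiald f z) 0 M.
  have dbc y : D y -> {for y, continuous (dbar_derive e f)}.
    by move=> Dy; exact: Cn_cont (Cn_dbar e oD hf) Dy.
  have h := ccontsegM (@ccontseg_cst _ (2 : C) 0 M) (@circ_int_seg (dbar_derive e f) z 0 M dbc Dz).
  have -> : radiald f z = fun s => 2 * circ_int (dbar_derive e f) s z.
    by apply/funext => s; rewrite half mulrA mulfV ?pnatr_eq0 // mul1r.
  exact: h.
rewrite /cauchyT (cint_ext (fun s _ => half s) M0') (cintZ _ M0' rc).
rewrite (@cint_val _ _ (radial f z)) //; last by move=> s _; exact: is_derive_radial.
rewrite {1}/radial (cint_ext (g := fun=> 0)) => [|t _|//]; last exact: fM.
rewrite (cint_cst _ P0) mul0r sub0r /radial (cint_ext (g := fun=> f z)) => [|t _|//]; last first.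
  by rewrite /circ rc0 mul0r scale0r addr0.
rewrite (cint_cst _ P0) subr0; exact: pi_cancel.
Qed.

End CauchyGreen.

(** * Alternating forms and the local dbar complex *)

Section InsertRow.
Variables (K : fieldType) (n : nat).

Definition insr m (i : 'I_m.+1) (r : 'rV[K]_n) (M : 'M[K]_(m, n)) : 'M[K]_(m.+1, n) :=
  \matrix_(k, j) if unlift i k is Some k' then M k' j else r 0 j.

Lemma row_insr m (i : 'I_m.+1) r (M : 'M[K]_(m, n)) : row i (insr i r M) = r.
Proof. by apply/rowP => j; rewrite !mxE unlift_none. Qed.

Lemma row_insr_lift m (i : 'I_m.+1) k r (M : 'M[K]_(m, n)) :
  row (lift i k) (insr i r M) = row k M.
Proof. by apply/rowP => j; rewrite !mxE liftK. Qed.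

Lemma row'_insr m (i : 'I_m.+1) r (M : 'M[K]_(m, n)) : row' i (insr i r M) = M.
Proof. by apply/matrixP => k j; rewrite !mxE liftK. Qed.

Lemma insr_row m (i : 'I_m.+1) (M : 'M[K]_(m.+1, n)) : insr i (row i M) (row' i M) = M.
Proof. by apply/matrixP => k j; rewrite !mxE; case: unliftP => [k' ->|->]; rewrite ?mxE. Qed.

Lemma row'_insr_lift m (k : 'I_m.+1) r (M : 'M[K]_(m.+1, n)) :
  row' (lift ord0 k) (insr ord0 r M) = insr ord0 r (row' k M).
Proof.
apply/matrixP => i j; rewrite !mxE.
case: (unliftP ord0 i) => [i' ->|->].
  rewrite (_ : lift (lift ord0 k) (lift ord0 i') = lift ord0 (lift k i')) ?liftK ?mxE //.
  by apply: val_inj; rewrite /= /bump /= !add1n ltnS addnS.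
rewrite (_ : lift (lift ord0 k) ord0 = ord0) ?unlift_none //.
by apply: val_inj.
Qed.

Lemma insr_lift m (k : 'I_m.+1) a b (M : 'M[K]_(m, n)) :
  insr (lift ord0 k) b (insr ord0 a M) = insr ord0 a (insr k b M).
Proof.
rewrite -[LHS](insr_row ord0) -[RHS](insr_row ord0) row_insr row'_insr.
congr insr.
  apply/rowP => j; rewrite !mxE.
  have -> : unlift (lift ord0 k) ord0 = Some ord0.
    by rewrite -[X in unlift _ X](_ : lift (lift ord0 k) ord0 = ord0) ?liftK //; apply: val_inj.
  by rewrite mxE unlift_none.
apply/matrixP => i j; rewrite !mxE.
case: (unliftP k i) => [i' ->|->]; last by rewrite unlift_none.
rewrite (_ : lift ord0 (lift k i') = lift (lift ord0 k) (lift ord0 i')) ?liftK ?mxE ?liftK //.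
by apply: val_inj; rewrite /= /bump /= !add1n ltnS addnS.
Qed.

Lemma row_row' m (k : 'I_m.+1) (l : 'I_m) (M : 'M[K]_(m.+1, n)) :
  row l (row' k M : 'M[K]_(m, n)) = row (lift k l) M.
Proof. by apply/rowP => j; rewrite !mxE. Qed.

(** The two hypotheses say that both sides delete the same rows [k] and [k2], in opposite orders;
    [l] and [l2] are the positions of the second row after the first has gone. *)
Lemma row'C m (k : 'I_m.+2) (l : 'I_m.+1) (k2 : 'I_m.+2) (l2 : 'I_m.+1) (M : 'M[K]_(m.+2, n)) :
  lift k l = k2 -> lift k2 l2 = k -> row' l (row' k M) = row' l2 (row' k2 M).
Proof.
move=> e1 e2; apply/matrixP => i j; rewrite !mxE; congr (M _ _); apply: val_inj => /=.
have e3 : bump k2 l2 = k by rewrite -[RHS](congr1 val e2).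
have e4 : k2 = bump k l :> nat by rewrite -e1.
have el2 : l2 = unbump l k :> nat.
  move: e3 e4; rewrite /bump /unbump.
  by case: (leqP k l); case: (leqP k2 l2); case: (ltnP l k) => /= *; lia.
by rewrite bumpC -e4 el2.
Qed.

End InsertRow.

Section SignedSums.
Variable K : numFieldType.

Lemma sum_lift m (k : 'I_m.+1) (F : 'I_m.+1 -> K) :
  \sum_(l < m) F (lift k l) = \sum_(k' | k' != k) F k'.
Proof.
case: m k F => [|m] k F.
  rewrite big_ord0 big1 // => i; by rewrite (ord1 i) (ord1 k) eqxx.
rewrite [RHS](reindex_onto (lift k) (fun k' => odflt ord0 (unlift k k'))) /=; last first.
  by move=> i; rewrite eq_sym => /unlift_some[j e /= ->] /=; rewrite e.
by apply: eq_bigl => l; rewrite liftK eqxx andbT eq_sym neq_lift.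
Qed.

Lemma signM k l (x : K) : (-1) ^+ k * ((-1) ^+ l * x) = (-1) ^+ (k + l) * x.
Proof. by rewrite mulrA exprD. Qed.

(** The sign of deleting row [k] and then row [k'], whose position has by then become
    [unbump k k']. *)
Definition sg2 (k k' : nat) : K := (-1) ^+ (k + unbump k k').

Lemma sg2_lift m (k : 'I_m.+1) (l : 'I_m) : sg2 k (lift k l) = (-1) ^+ (k + l).
Proof. by rewrite /sg2 /= bumpK. Qed.

Lemma sg2C k k' : k != k' -> sg2 k' k = - sg2 k k'.
Proof.
have aux a b : a = b.+1 -> (-1) ^+ a = - (-1) ^+ b :> K.
  by move=> ->; rewrite exprS mulN1r.
rewrite /sg2 /unbump; case: (ltngtP k k') => // h _.
  by apply: aux => /=; lia.
by apply: (canRL (@opprK _)); symmetry; apply: aux => /=; lia.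
Qed.

(** Exchanging [k] and [k'] changes the sign [sg2] but not [F], so the sum equals its own opposite.
    This is the cancellation behind both [dbar] squared being 0 and the compatibility of [dbar] with
    pullback. *)
Lemma sg2_cancel m (F : 'I_m.+1 -> 'I_m.+1 -> K) : (forall k k', k != k' -> F k k' = F k' k) ->
  \sum_(k < m.+1) \sum_(l < m) (-1) ^+ (k + l) * F k (lift k l) = 0.
Proof.
move=> hF; set S := LHS.
have eS : S = \sum_(k < m.+1) \sum_(k' < m.+1 | k' != k) sg2 k k' * F k k'.
  apply: eq_bigr => k _; rewrite -sum_lift; apply: eq_bigr => l _.
  by rewrite sg2_lift.
have : S = - S.
  rewrite {1}eS eS [LHS](exchange_big_dep predT) //= -sumrN; apply: eq_bigr => k _.
  rewrite -sumrN [LHS](eq_bigl (fun k' => k' != k)); last by move=> k' /=; rewrite eq_sym.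
  apply: eq_bigr => k' kk'; rewrite (sg2C (k := k) (k' := k')); last by rewrite eq_sym.
  by rewrite mulNr hF.
by move/eqP; rewrite -subr_eq0 opprK -mulr2n mulrn_eq0 /= => /eqP.
Qed.

End SignedSums.

Section Multilinear.
Variables (R : realType) (n : nat).
Local Notation C := (Cplx R).
Variable s : {rmorphism C -> C}.

Lemma altD m (g : 'M[C]_(m.+1, n) -> C) i a r b r' M : alternating_for s g ->
  g (insr i (a *: r + b *: r') M) = s a * g (insr i r M) + s b * g (insr i r' M).
Proof. by move=> [h _]; apply: (h _ _ _ i); rewrite ?row_insr ?row'_insr. Qed.

Lemma alt0 m (g : 'M[C]_(m.+1, n) -> C) i M : alternating_for s g -> g (insr i 0 M) = 0.
Proof.
move=> h; have := @altD _ _ i 0 0 0 0 M h.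
by rewrite !scale0r addr0 rmorph0 !mul0r addr0.
Qed.

Lemma alt_sum m (g : 'M[C]_(m.+1, n) -> C) i r M : alternating_for s g ->
  g (insr i r M) = \sum_j s (r 0 j) * g (insr i (delta_mx 0 j) M).
Proof.
move=> h; rewrite [r in LHS]row_sum_delta; elim: (index_enum _) => [|j js ih].
  by rewrite !big_nil alt0.
rewrite !big_cons -[\sum_(i <- js) r 0 i *: _]scale1r altD // rmorph1 mul1r -ih.
by [].
Qed.

(** Polarization: [g] vanishes on [(a + b, a + b)], [(a, a)] and [(b, b)]. *)
Lemma alt_swap m (g : 'M[C]_(m.+2, n) -> C) a b M : alternating_for s g ->
  g (insr ord0 a (insr ord0 b M)) = - g (insr ord0 b (insr ord0 a M)).
Proof.
move=> h; have e x : g (insr ord0 x (insr ord0 x M)) = 0.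
  case: h => _; move/(_ (insr ord0 x (insr ord0 x M)) ord0 (lift ord0 ord0)); apply => //.
  by rewrite row_insr_lift !row_insr.
have e2 := e (1 *: a + 1 *: b); rewrite (altD ord0 _ _ _ _ _ h) in e2.
rewrite -!(insr_lift ord0) !(altD (lift ord0 ord0) _ _ _ _ _ h) !rmorph1 !mul1r !insr_lift !e in e2.
rewrite add0r addr0 in e2.
by apply/eqP; rewrite -addr_eq0 e2.
Qed.

Lemma alt_ins m (g : 'M[C]_(m.+1, n) -> C) (x : 'rV[C]_n) : alternating_for s g ->
  alternating_for s (fun M : 'M_(m, n) => g (insr ord0 x M)).
Proof.
case: m g => [|m] g [h1 h2]; first by split=> [M N P []|M []].
split.
- move=> M N P i b c e1 e2 e3; apply: (h1 _ _ _ (lift ord0 i)).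
  + by rewrite !row_insr_lift.
  + by rewrite !row'_insr_lift e2.
  + by rewrite !row'_insr_lift e3.
- move=> M i j ij e; apply: (h2 _ (lift ord0 i) (lift ord0 j)).
  + by rewrite (inj_eq lift_inj).
  + by rewrite !row_insr_lift.
Qed.

Lemma alt_front m (g : 'M[C]_(m.+1, n) -> C) (i : 'I_m.+1) r M : alternating_for s g ->
  g (insr i r M) = (-1) ^+ i * g (insr ord0 r M).
Proof.
elim: m g i M => [|m ih] g i M h; first by rewrite (ord1 i) mul1r.
case: (unliftP ord0 i) => [k ->|->]; last by rewrite mul1r.
rewrite -[M](insr_row ord0) insr_lift.
rewrite (ih (fun N => g (insr ord0 (row ord0 M) N))); last exact: (alt_ins (row ord0 M) h).
by rewrite alt_swap //= /bump /= add1n exprS mulrN mulN1r mulNr.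
Qed.

Lemma alt_row0 m (g : 'M[C]_(m.+1, n) -> C) (i : 'I_m.+1) M : alternating_for s g ->
  g M = (-1) ^+ i * g (insr ord0 (row i M) (row' i M)).
Proof. by move=> h; rewrite -alt_front // insr_row. Qed.

Lemma alt_lin m (f g : 'M[C]_(m, n) -> C) (b c : C) : alternating_for s f -> alternating_for s g ->
  alternating_for s (fun M => b * f M + c * g M).
Proof.
move=> [f1 f2] [g1 g2]; split.
- move=> M N P i x y e1 e2 e3; rewrite (f1 _ _ _ i x y e1 e2 e3) (g1 _ _ _ i x y e1 e2 e3).
  ring.
- by move=> M i j ij e; rewrite (f2 _ _ _ ij e) (g2 _ _ _ ij e) !mulr0 addr0.
Qed.

End Multilinear.

Section LocalForms.
Variables (R : realType) (n p : nat).
Local Notation C := (Cplx R).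
Local Notation E := 'rV[C]_n.
Implicit Types (D : set E) (z : E).

Definition lform q := E -> 'M[C]_(p, n) -> 'M[C]_(q, n) -> C.

Definition lsmooth q D (om : lform q) :=
  [/\ forall z, D z -> forall w, alternating_for idfun (fun v => om z v w),
      forall z, D z -> forall v, alternating_for Num.conj (om z v) &
      forall v w, smooth_on D (fun z => om z v w)].

(** The expression of [dbar] in one chart without the sign [(-1) ^+ p], which [dbarE] puts back. *)
Definition ldbar q (om : lform q) : lform q.+1 := fun z v w =>
  \sum_(k < q.+1) (-1) ^+ k * dbar_derive (row k w) (fun y => om y v (row' k w)) z.

Lemma dbar_lin D (f g h : E -> C) (b c : C) u z : open D -> D z ->
  Cn_on 1 D f -> Cn_on 1 D g -> (forall y, D y -> h y = b * f y + c * g y) ->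
  dbar_derive u h z = b * dbar_derive u f z + c * dbar_derive u g z.
Proof.
move=> oD Dz hf hg e.
have pf := Cn_pdiff hf Dz; have pg := Cn_pdiff hg Dz.
rewrite -(dbarZ b u pf) -(dbarZ c u pg).
have qf := pdiffM (@pdiff_cst R n b z) pf; have qg := pdiffM (@pdiff_cst R n c z) pg.
rewrite -(dbarD u qf qg).
by apply: dbar_near; apply: filterS (open_nbhs_nbhs (conj oD Dz)) => y; exact: e.
Qed.

Lemma dbar_eq0 D (f : E -> C) u z : open D -> D z -> (forall y, D y -> f y = 0) ->
  dbar_derive u f z = 0.
Proof.
move=> oD Dz h; rewrite -[RHS](dbar_cst 0 u z); apply: dbar_near.
by apply: filterS (open_nbhs_nbhs (conj oD Dz)) => y; exact: h.
Qed.

Lemma pdiff_dbar D (f : E -> C) u z : open D -> D z -> Cn_on 2 D f ->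
  pdiff (dbar_derive u f) z.
Proof. by move=> oD Dz hf; exact: (Cn_pdiff (Cn_dbar u oD hf) Dz). Qed.

Lemma ldbar_near q D (om om' : lform q) z v w : open D -> D z ->
  (forall y v w, D y -> om y v w = om' y v w) -> ldbar om z v w = ldbar om' z v w.
Proof.
move=> oD Dz h; apply: eq_bigr => k _; congr (_ * _); apply: dbar_near.
by apply: filterS (open_nbhs_nbhs (conj oD Dz)) => y; exact: h.
Qed.

Lemma ldbar_lin q D (om om' : lform q) (b c : C) z v w : open D -> D z ->
  lsmooth D om -> lsmooth D om' ->
  ldbar (fun y v w => b * om y v w + c * om' y v w) z v w =
  b * ldbar om z v w + c * ldbar om' z v w.
Proof.
move=> oD Dz [_ _ h] [_ _ h']; rewrite /ldbar !mulr_sumr -big_split /=.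
apply: eq_bigr => k _.
rewrite (dbar_lin _ oD Dz (h v (row' k w) 1%N) (h' v (row' k w) 1%N) (fun _ _ => erefl)).
by rewrite mulrDr !(mulrCA ((-1) ^+ k)).
Qed.

Lemma lsmooth_lin q D (om om' : lform q) (b c : C) : open D ->
  lsmooth D om -> lsmooth D om' ->
  lsmooth D (fun y v w => b * om y v w + c * om' y v w).
Proof.
move=> oD [h1 h2 h3] [h1' h2' h3']; split.
- by move=> z Dz w; exact: (alt_lin (s := idfun) b c (h1 z Dz w) (h1' z Dz w)).
- by move=> z Dz v; exact: (alt_lin (s := Num.conj) b c (h2 z Dz v) (h2' z Dz v)).
- by move=> v w k; exact: (CnD oD (CnZ b oD (h3 v w k)) (CnZ c oD (h3' v w k))).
Qed.

Lemma lsmooth0 q D : open D -> lsmooth D ((fun _ _ _ => 0) : lform q).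
Proof.
move=> oD; split=> [z Dz w|z Dz v|v w k].
- by split=> // *; rewrite !mulr0 addr0.
- by split=> // *; rewrite !mulr0 addr0.
- exact: Cn_cst.
Qed.

Lemma lsmooth_eq q D (om om' : lform q) : open D ->
  (forall y v w, D y -> om y v w = om' y v w) -> lsmooth D om -> lsmooth D om'.
Proof.
move=> oD e [h1 h2 h3]; split.
- move=> z Dz w; rewrite (_ : (fun v => _) = (fun v => om z v w)); first exact: h1.
  by apply/funext => v; rewrite e.
- move=> z Dz v; rewrite (_ : om' z v = om z v); first exact: h2.
  by apply/funext => w; rewrite e.
- by move=> v w k; apply: Cn_eq oD _ (h3 v w k) => y Dy; exact: e.
Qed.

Lemma lsmooth_sub q D D' (om : lform q) : D' `<=` D -> lsmooth D om -> lsmooth D' om.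
Proof.
move=> sD [h1 h2 h3]; split=> [z /sD Dz|z /sD Dz|v w k]; [exact: h1|exact: h2|].
exact: Cn_subset sD (h3 v w k).
Qed.

(** In the term where row [i] is the direction of differentiation, the claim is conjugate linearity
    of [dbar_derive] in its direction; in all others row [i] is an argument of [om]. *)
Lemma ldbar_alt_lin q D (om : lform q) z v : open D -> D z -> lsmooth D om ->
  forall M N P i b c, row i M = b *: row i N + c *: row i P ->
     row' i N = row' i M -> row' i P = row' i M ->
     ldbar om z v M = Num.conj b * ldbar om z v N + Num.conj c * ldbar om z v P.
Proof.
move=> oD Dz [_ h2 h3] M N P i b c e1 e2 e3.
rewrite /ldbar !mulr_sumr -big_split /=; apply: eq_bigr => k _.
rewrite !(mulrCA _ ((-1) ^+ k)) -mulrDr; congr (_ * _).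
case: (unliftP i k) => [k' ek|->]; last first.
  rewrite e1 e2 e3 (dbar_deriveD _ _ (h3 v (row' i M) 1%N) (open_nbhs_nbhs (conj oD Dz))).
  by rewrite !(dbar_deriveZ _ _ (h3 v (row' i M) 1%N) (open_nbhs_nbhs (conj oD Dz))).
have rowk (Q Q' : 'M[C]_(q.+1, n)) : row' i Q = row' i Q' -> row k Q = row k Q'.
  by move=> e; apply/rowP => j; have /matrixP/(_ k' j) := e; rewrite !mxE -ek.
rewrite -(rowk _ _ e2) (rowk _ _ (etrans e3 (esym e2))).
apply: dbar_lin oD Dz (h3 _ _ 1%N) (h3 _ _ 1%N) _ => y Dy.
case: q om h2 h3 M N P i k e1 e2 e3 k' ek rowk => [|q] om h2 h3 M N P i k e1 e2 e3 k' ek rowk.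
  by have [] := k'.
have ik : i != k by rewrite ek neq_lift.
case: (unliftP k i) => [i' ei|ei]; last by rewrite ei eqxx in ik.
have rc (Q : 'M[C]_(q.+2, n)) : row' i' (row' k Q) = row' k' (row' i Q) by apply: row'C.
apply: (proj1 (h2 y Dy v) _ _ _ i').
- by rewrite !row_row' -ei.
- by rewrite !rc e2.
- by rewrite !rc e3.
Qed.

(** Terms that keep both equal rows vanish since [om] alternates. The two that delete one of them
    differentiate the same function in the same direction, with opposite signs [sg2]. *)
Lemma ldbar_alt_eq0 q D (om : lform q) z v : open D -> D z -> lsmooth D om ->
  forall M i j, i != j -> row i M = row j M -> ldbar om z v M = 0.
Proof.
move=> oD Dz [_ h2 h3] M i j ij e.
case: q om h2 h3 M i j ij e => [|q] om h2 h3 M i j ij e.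
  by rewrite (ord1 i) (ord1 j) eqxx in ij.
rewrite /ldbar (bigD1 i) //= (bigD1 j) /=; last by rewrite eq_sym.
rewrite big1 ?addr0 => [|k /andP[ki kj]]; last first.
  rewrite (dbar_eq0 _ oD Dz) ?mulr0 // => y Dy.
  case: (unliftP k i) => [i' ei|ei]; last by rewrite ei eqxx in ki.
  case: (unliftP k j) => [j' ej|ej]; last by rewrite ej eqxx in kj.
  apply: (proj2 (h2 y Dy v) _ i' j').
    by apply: contra ij => /eqP e'; rewrite ei ej e'.
  by rewrite !row_row' -ei -ej.
case: (unliftP i j) => [j' ej|ej]; last by rewrite ej eqxx in ij.
case: (unliftP j i) => [i' ei|ei]; last by rewrite ei eqxx in ij.
have zD := open_nbhs_nbhs (conj oD Dz).
have rw (k : 'I_q.+2) (l : 'I_q.+1) (N : 'M[C]_(q.+1, n)) : N = insr ord0 (row l (row' k M)) (row' l (row' k M)) ->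
    (-1) ^+ k * dbar_derive (row k M) (fun y => om y v (row' k M)) z =
    sg2 C k (lift k l) * dbar_derive (row k M) (fun y => om y v N) z.
  move=> eN; rewrite sg2_lift exprD -mulrA; congr (_ * _).
  rewrite -(dbarZ _ _ (Cn_pdiff (h3 v N 1%N) Dz)); apply: dbar_near.
  by apply: filterS zD => y Dy; rewrite eN -(alt_row0 (s := Num.conj) l _ (h2 y Dy v)).
rewrite (rw i j' _ erefl) (rw j i' (insr ord0 (row j' (row' i M)) (row' j' (row' i M)))); last first.
  congr insr; last exact: row'C.
  by rewrite !row_row' -ei -ej.
have ji : (j != i :> nat) by rewrite eq_sym; exact: ij.
by rewrite -ej -ei e (sg2C C ji) mulNr addNr.
Qed.

Lemma lsmooth_ldbar q D (om : lform q) : open D -> lsmooth D om -> lsmooth D (ldbar om).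
Proof.
move=> oD hom; have [h1 h2 h3] := hom; split.
- move=> z Dz w; split=> [M N P i b c e1 e2 e3|M i j ij e].
    rewrite /ldbar !mulr_sumr -big_split /=; apply: eq_bigr => k _.
    rewrite !(mulrCA _ ((-1) ^+ k)) -mulrDr; congr (_ * _).
    apply: dbar_lin oD Dz (h3 _ _ 1%N) (h3 _ _ 1%N) _ => y Dy.
    exact: (proj1 (h1 y Dy _) _ _ _ i).
  rewrite /ldbar big1 // => k _; rewrite (dbar_eq0 _ oD Dz) ?mulr0 // => y Dy.
  exact: (proj2 (h1 y Dy _) _ i j).
- move=> z Dz v; split=> [M N P i b c|M i j]; first exact: ldbar_alt_lin oD Dz hom _ _ _ _ _ _.
  exact: ldbar_alt_eq0 oD Dz hom _ _ _.
- move=> v w k; apply: Cn_sum => // i _; apply: CnZ => //; apply: Cn_dbar => //.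
  exact: h3.
Qed.

(** The second derivatives commute and the order of deleting two rows does not matter, so [F] is
    symmetric and [sg2_cancel] applies. *)
Lemma ldbarK q D (om : lform q) z v w : open D -> D z -> lsmooth D om ->
  ldbar (ldbar om) z v w = 0.
Proof.
move=> oD Dz [h1 h2 h3].
pose rem k k' : 'M[C]_(q, n) := if unlift k k' is Some l then row' l (row' k w) else 0.
pose F (k k' : 'I_q.+2) :=
  dbar_derive (row k w) (dbar_derive (row k' w) (fun y => om y v (rem k k'))) z.
rewrite -[RHS](@sg2_cancel _ _ F) => [|k k' kk'].
  apply: eq_bigr => k _; rewrite /ldbar.
  have pd l : pdiff (dbar_derive (row l (row' k w)) (fun y => om y v (row' l (row' k w)))) z.
    exact: (pdiff_dbar _ oD Dz (h3 v (row' l (row' k w)) 2%N)).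
  rewrite dbar_sum => [|l]; last exact: (pdiffM (pdiff_cst _ _) (pd l)).
  rewrite mulr_sumr; apply: eq_bigr => l _.
  rewrite (dbarZ _ _ (pd l)).
  have eF : F k (lift k l) = dbar_derive (row k w)
      (dbar_derive (row l (row' k w)) (fun y => om y v (row' l (row' k w)))) z.
    by rewrite /F /rem liftK row_row'.
  by rewrite eF; exact: signM.
rewrite /F (_ : rem k k' = rem k' k); first exact: (dbar_sym _ _ (h3 v (rem k' k) 2%N) oD Dz).
rewrite /rem; case: (unliftP k k') => [l e1|e]; last by rewrite e eqxx in kk'.
case: (unliftP k' k) => [l2 e2|e]; last by rewrite e eqxx in kk'.
exact: row'C.
Qed.

End LocalForms.

(** * The Dolbeault-Grothendieck lemma *)

Section DolbeaultGrothendieck.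
Variables (R : realType) (n p : nat).
Local Notation C := (Cplx R).
Local Notation E := 'rV[C]_n.
Implicit Types (D : set E) (z y : E) (j : 'I_n).
Local Notation lform := (@lform R n p).

Definition contr q (e : E) (om : lform q.+1) : lform q :=
  fun y v w => om y v (insr ord0 e w).

(** For [e] the [j]-th unit vector and [om] alternating, this says that [om] has no term containing
    [dzbar_j]. *)
Definition kills q D (e : E) (om : lform q) :=
  forall y v w k, D y -> row k w = e -> om y v w = 0.

Lemma lsmooth_contr q D e (om : lform q.+1) : lsmooth D om -> lsmooth D (contr e om).
Proof.
move=> [h1 h2 h3]; split=> [z Dz w|z Dz v|v w]; [exact: h1| |exact: h3].
exact: (alt_ins (s := Num.conj) e (h2 z Dz v)).
Qed.

Lemma kills_contr q D e (om : lform q.+1) : lsmooth D om ->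
  (forall y v w, D y -> contr e om y v w = 0) -> kills D e om.
Proof.
move=> [_ h2 _] h y v w k Dy ek.
by rewrite (alt_row0 (s := Num.conj) k w (h2 y Dy v)) ek [om _ _ _]h ?mulr0.
Qed.

(** In every other term of [ldbar] the row [e] remains an argument of [om], which it kills. *)
Lemma ldbar_kill q D (om : lform q) e z v w : open D -> D z -> kills D e om ->
  ldbar om z v (insr ord0 e w) = dbar_derive e (fun y => om y v w) z.
Proof.
move=> oD Dz ke; rewrite /ldbar big_ord_recl mul1r row_insr row'_insr big1 ?addr0 // => k _.
rewrite (dbar_eq0 _ oD Dz) ?mulr0 // => y Dy.
case: q om k w ke => [|q] om k w ke; first by case: k.
apply: (ke _ _ _ ord0 Dy).
by rewrite row'_insr_lift row_insr.
Qed.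

Lemma ldbar0 q D (om : lform q) z v w : open D -> D z ->
  (forall y v w, D y -> om y v w = 0) -> ldbar om z v w = 0.
Proof.
move=> oD Dz h; rewrite /ldbar big1 // => k _.
by rewrite (dbar_eq0 _ oD Dz) ?mulr0 // => y Dy; exact: h.
Qed.

Lemma dbar_line_cst (f : E -> C) e z : (forall c : C, f (z + c *: e) = f z) ->
  dbar_derive e f z = 0.
Proof.
move=> h.
have rd v : (exists b : C, v = b *: e) -> real_derive v f z = 0.
  move=> [b ->]; rewrite -(is_cder_val (is_cder_cst (f z) (b *: e) z)).
  have hl t : f (z + (t%:C)%C *: (b *: e)) = f z by rewrite scalerA h.
  rewrite /real_derive.
  have -> : re_line f (b *: e) z = re_line (fun=> f z) (b *: e) z.
    by apply/funext => t; rewrite /re_line hl.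
  have -> // : im_line f (b *: e) z = im_line (fun=> f z) (b *: e) z.
  by apply/funext => t; rewrite /im_line hl.
rewrite /dbar_derive (rd e) ?(rd ('i *: e)) ?mulr0 ?addr0 ?mulr0 //; first by exists 'i.
by exists 1; rewrite scale1r.
Qed.

Lemma Cn_extend0 k D D' (f g : E -> C) : open D -> Cn_on k D f ->
  (forall z, D z -> g z = f z) ->
  (forall z, D' z -> ~ D z -> \forall y \near z, g y = 0) -> Cn_on k D' g.
Proof.
move=> oD hf gf g0; apply/Cn_pointwise => z D'z.
have [Dz|nDz] := pselect (D z).
  apply: (Cn_near (f := f)).
    by move=> _ ->; apply: filterS (open_nbhs_nbhs (conj oD Dz)) => y Dy; rewrite gf.
  by move/Cn_pointwise : hf; apply.
apply: (Cn_near (f := fun=> 0)).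
  by move=> _ ->; apply: filterS (g0 z D'z nDz) => y ->.
exact: (Cn_subset (@subsetT _ [set z]) (Cn_cst k 0 openT)).
Qed.

(** The squared distance in the [j]-th variable, a polynomial in the real coordinates and so smooth
    without exception. The numbers [rho] below are therefore squares of radii. *)
Definition sqd (z0 : E) j z : R := rcoord (j, false) (z - z0) ^+ 2 + rcoord (j, true) (z - z0) ^+ 2.

Lemma RCn_sqd k D z0 j : open D -> RCn k D (sqd z0 j).
Proof.
move=> oD; have h i : RCn k D (fun z => rcoord i (z - z0)).
  rewrite (_ : (fun z => _) = fun z => rcoord i z + - rcoord i z0); last first.
    by apply/funext => z; exact: rcoordB.
  by apply: RCnD => //; [exact: RCn_rcoord|exact: RCn_cst].
by apply: RCnD => //; apply: RCnM => //; exact: h.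
Qed.

Lemma sqd_continuous z0 j z : {for z, continuous (sqd z0 j)}.
Proof. exact: (RCn_cont (RCn_sqd 0 z0 j openT) I). Qed.

Lemma sqd_lt z0 j z (r : R) : sqd z0 j z < r -> \forall y \near z, sqd z0 j y < r.
Proof. by move=> h; exact: (@sqd_continuous z0 j z [set x | x < r] (open_nbhs_nbhs (conj (@open_lt _ r) h))). Qed.

Lemma sqd_gt z0 j z (r : R) : r < sqd z0 j z -> \forall y \near z, r < sqd z0 j y.
Proof. by move=> h; exact: (@sqd_continuous z0 j z [set x | r < x] (open_nbhs_nbhs (conj (@open_gt _ r) h))). Qed.

(** Only the variables selected by [P] are restricted: [predT] gives a polydisc, and omitting one
    index gives a cylinder invariant under translation in that variable. *)
Definition pdisc (P : pred 'I_n) z0 (rho : 'I_n -> R) : set E :=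
  [set z | forall j, P j -> sqd z0 j z < rho j].

Lemma open_pdisc P z0 rho : open (pdisc P z0 rho).
Proof.
rewrite openE => z hz; rewrite /interior.
apply: (@filter_forall _ _ (fun j y => P j -> sqd z0 j y < rho j) (nbhs z)) => j.
case: (boolP (P j)) => Pj; last exact: filterS filterT.
by apply: filterS (sqd_lt (hz j Pj)) => y.
Qed.

Lemma sqd_shift z0 i j z (c : C) : i != j -> sqd z0 i (z + c *: delta_mx 0 j) = sqd z0 i z.
Proof.
move=> ij; have e b : rcoord (i, b) (z + c *: delta_mx 0 j - z0) = rcoord (i, b) (z - z0).
  by rewrite /rcoord /= !mxE eqxx (negbTE ij) /= mulr0 addr0.
by rewrite /sqd !e.
Qed.

(** Where the radius [3 (r + 1)] comes from: the mixed term of the expansion is at least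
    [-6 (r + 1)^2] by Cauchy-Schwarz, against [9 (r + 1)^2] from the circle, which leaves more than
    [r]. *)
Lemma circ_far_aux (a b c s r M : R) : c ^+ 2 + s ^+ 2 = 1 -> a ^+ 2 + b ^+ 2 < r ->
  M = 3 * (r + 1) -> r <= (a + M * c) ^+ 2 + (b + M * s) ^+ 2.
Proof.
move=> cs ab ->; have r0 : 0 < r by nra.
have d1 : (a * c + b * s) ^+ 2 < (r + 1) ^+ 2.
  have h : (a * c + b * s) ^+ 2 + (a * s - b * c) ^+ 2 = (a ^+ 2 + b ^+ 2) * (c ^+ 2 + s ^+ 2) by ring.
  rewrite cs mulr1 in h; have := sqr_ge0 (a * s - b * c); nra.
have d2 : - (r + 1) < a * c + b * s by nra.
have h : (a + 3 * (r + 1) * c) ^+ 2 + (b + 3 * (r + 1) * s) ^+ 2 =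
  a ^+ 2 + b ^+ 2 + 6 * (r + 1) * (a * c + b * s) + 9 * (r + 1) ^+ 2 * (c ^+ 2 + s ^+ 2) by ring.
rewrite h cs; have := sqr_ge0 a; have := sqr_ge0 b; nra.
Qed.

Lemma circ_far z0 j z (r : R) t : 0 < r -> sqd z0 j z < r ->
  r <= sqd z0 j (circ (3 * (r + 1)) (delta_mx 0 j) z t).
Proof.
move=> r0 h.
have e b : rcoord (j, b) (circ (3 * (r + 1)) (delta_mx 0 j) z t - z0) =
    rcoord (j, b) (z - z0) + 3 * (r + 1) * (if b then sin t else cos t).
  rewrite /rcoord /circ /= !mxE !eqxx /= mulr1.
  by case: b; rewrite ?reD ?imD ?re_rcM ?im_rcM /= addrAC.
by rewrite /sqd !e; exact: circ_far_aux (cos2Dsin2 t) h (erefl _).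
Qed.

Lemma lsmooth_mul q D (om : lform q) (chi : E -> C) : open D -> smooth_on D chi ->
  lsmooth D om -> lsmooth D (fun y v w => chi y * om y v w).
Proof.
move=> oD hchi [h1 h2 h3]; split.
- move=> z Dz w; have := alt_lin (s := idfun) (chi z) 0 (h1 z Dz w) (h1 z Dz w).
  by under eq_fun do rewrite mul0r addr0.
- move=> z Dz v; have := alt_lin (s := Num.conj) (chi z) 0 (h2 z Dz v) (h2 z Dz v).
  by under eq_fun do rewrite mul0r addr0.
- by move=> v w k; exact: CnM oD (hchi k) (h3 v w k).
Qed.

Lemma kills_all q D (om : lform q.+1) : lsmooth D om ->
  (forall j, kills D (delta_mx 0 j) om) -> forall y v w, D y -> om y v w = 0.
Proof.
move=> [_ h2 _] h y v w Dy; rewrite -[w](insr_row ord0).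
rewrite (alt_sum (s := Num.conj) _ _ _ (h2 y Dy v)) big1 // => j _.
by rewrite (h j _ _ _ ord0 Dy) ?mulr0 // row_insr.
Qed.

(** Closedness evaluated on the rows [e'], [e], [w]: as [e'] is killed, a single term of [ldbar]
    survives. *)
Lemma dbar_contr q D (om : lform q.+1) e e' z v w : open D -> D z -> lsmooth D om ->
  (forall z v w, D z -> ldbar om z v w = 0) -> kills D e' om ->
  dbar_derive e' (fun y => contr e om y v w) z = 0.
Proof.
move=> oD Dz hom cl ke; have := cl z v (insr ord0 e' (insr ord0 e w)) Dz.
by rewrite (ldbar_kill _ _ oD Dz ke).
Qed.

Section Step.
Variables (q : nat) (z0 : E) (rho : 'I_n -> R) (om : lform q.+1) (j0 : 'I_n) (a c : R).
Let D := pdisc predT z0 rho.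
Let D' := pdisc (fun j => j != j0) z0 rho.
Let e : E := delta_mx 0 j0.
Hypotheses (ac : a < c) (crho : c < rho j0) (rho0 : 0 < rho j0).
Hypothesis (hom : lsmooth D om).

Definition cutoff z : C := ((bstep a c (sqd z0 j0 z))%:C)%C.

Lemma smooth_cutoff G : open G -> smooth_on G cutoff.
Proof.
move=> oG k; apply/Cn_onE; split; last exact: (RCn_cst k 0 oG).
exact: (RCn_bstep oG ac (RCn_sqd k z0 j0 oG)).
Qed.

Lemma pdiscE z : D z <-> D' z /\ sqd z0 j0 z < rho j0.
Proof.
split=> [h|[h h0] j _]; first by split=> [j _|]; exact: h.
by have [->|jj0] := eqVneq j j0; [exact: h0|exact: h].
Qed.

(** The coefficient of [dzbar_j0], cut off in the variable [z_j0] and extended by 0 from the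
    polydisc [D] to the cylinder [D'], on which the Cauchy transform along [e] is available. *)
Definition slice : lform q := fun y v w =>
  if `[< D y >] then cutoff y * contr e om y v w else 0.

Lemma slice_in y v w : D y -> slice y v w = cutoff y * contr e om y v w.
Proof. by move=> Dy; rewrite /slice asboolT. Qed.

Lemma slice_out z : D' z -> ~ D z -> \forall y \near z, forall v w, slice y v w = 0.
Proof.
move=> D'z nD; have h : c < sqd z0 j0 z.
  by rewrite ltNge; apply/negP => h; apply: nD; apply/pdiscE; split => //; exact: le_lt_trans h crho.
apply: filterS (sqd_gt h) => y hy v w; rewrite /slice /cutoff bstep0 ?mul0r; first by case: ifP.
exact: ltW.
Qed.

Lemma lsmooth_slice : lsmooth D' slice.
Proof.
have oD : open D by exact: open_pdisc.
have [h1 h2 h3] := lsmooth_mul oD (smooth_cutoff oD) (lsmooth_contr e hom).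
split.
- move=> z D'z w; have [Dz|nDz] := pselect (D z).
    by under eq_fun do rewrite (slice_in _ _ Dz); exact: h1.
  have h := nbhs_singleton (slice_out D'z nDz).
  by under eq_fun do rewrite h; split=> // *; rewrite !mulr0 addr0.
- move=> z D'z v; have [Dz|nDz] := pselect (D z).
    by rewrite (_ : slice z v = fun w => cutoff z * contr e om z v w);
      [exact: h2|apply/funext => w; rewrite slice_in].
  have h := nbhs_singleton (slice_out D'z nDz).
  by rewrite (_ : slice z v = fun=> 0); [split=> // *; rewrite !mulr0 addr0|apply/funext => w].
- move=> v w k; apply: (Cn_extend0 oD (h3 v w k)) => [z Dz|z D'z nDz]; first exact: slice_in.
  by apply: filterS (slice_out D'z nDz) => y; apply.
Qed.

(** The radius of [circ_far]: a circle of radius [M] along [e] about a point of [D] lies outside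
    [D], where [slice] vanishes, as [cauchy_green] demands. *)
Let M : R := 3 * (rho j0 + 1).
Let M0 : 0 < M. Proof. by rewrite /M; have := rho0; lra. Qed.
Let oD' : open D'. Proof. exact: open_pdisc. Qed.
Let De z : D' z -> forall b : C, D' (z + b *: e).
Proof. by move=> h b j jj; rewrite sqd_shift //; exact: h. Qed.

Definition prim : lform q := fun z v w => cauchyT e M (fun y => slice y v w) z.

Lemma prim_eq0 z v w : D' z -> (forall y, D' y -> slice y v w = 0) -> prim z v w = 0.
Proof.
move=> Dz h; rewrite /prim (cauchyT_ext (g := fun=> 0) M0) ?(cauchyT0 e M0) // => b.
exact: h (De Dz b).
Qed.

Lemma prim_lin z v w v1 w1 v2 w2 (b1 b2 : C) : D' z ->
  (forall y, D' y -> slice y v w = b1 * slice y v1 w1 + b2 * slice y v2 w2) ->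
  prim z v w = b1 * prim z v1 w1 + b2 * prim z v2 w2.
Proof.
move=> Dz h; have [_ _ h3] := lsmooth_slice.
rewrite /prim -(cauchyT_lin oD' M0 De b1 b2 (fun y Dy => Cn_cont (h3 v1 w1 0%N) Dy)
  (fun y Dy => Cn_cont (h3 v2 w2 0%N) Dy) Dz).
by apply: (cauchyT_ext M0) => b; exact: h (De Dz b).
Qed.

Lemma lsmooth_prim : lsmooth D' prim.
Proof.
have [h1 h2 h3] := lsmooth_slice; split.
- move=> z Dz w; split=> [A N P i b b' e1 e2 e3|A i j ij eA].
    by apply: prim_lin => // y Dy; exact: (proj1 (h1 y Dy w) _ _ _ i).
  by apply: prim_eq0 => // y Dy; exact: (proj2 (h1 y Dy w) _ i j).
- move=> z Dz v; split=> [A N P i b b' e1 e2 e3|A i j ij eA].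
    by apply: prim_lin => // y Dy; exact: (proj1 (h2 y Dy v) _ _ _ i).
  by apply: prim_eq0 => // y Dy; exact: (proj2 (h2 y Dy v) _ i j).
- by move=> v w k; exact: (Cn_cauchyT oD' M0 De (h3 v w k)).
Qed.

Lemma dbar_prim_self z v w : D z -> sqd z0 j0 z <= a ->
  dbar_derive e (fun y => prim y v w) z = contr e om z v w.
Proof.
move=> Dz za; have [D'z zr] := iffLR (pdiscE z) Dz; have [_ _ h3] := lsmooth_slice.
rewrite (dbar_cauchyT oD' M0 De e (h3 v w 1%N) D'z).
rewrite (cauchy_green oD' M0 De (h3 v w 1%N) D'z).
  by rewrite slice_in // /cutoff bstep1 // mul1r.
move=> t; rewrite /slice; case: asboolP => // /pdiscE[_].
by rewrite ltNge (circ_far t rho0 zr).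
Qed.

(** [dbar_derive] passes under the Cauchy transform. There it annihilates the cutoff, which depends
    on [z_j0] only, and the contraction, by closedness through [dbar_contr]. *)
Lemma dbar_prim_other j z v w : j != j0 -> (forall z v w, D z -> ldbar om z v w = 0) ->
  kills D (delta_mx 0 j) om -> D' z ->
  dbar_derive (delta_mx 0 j) (fun y => prim y v w) z = 0.
Proof.
move=> jj0 cl ke D'z; have [_ _ h3] := lsmooth_slice.
have oD : open D by exact: open_pdisc.
rewrite (dbar_cauchyT oD' M0 De _ (h3 v w 1%N) D'z).
rewrite (cauchyT_ext (g := fun=> 0) M0) ?(cauchyT0 e M0) // => b.
move: (z + b *: e) (De D'z b) => y D'y.
have [Dy|nDy] := pselect (D y); last first.
  rewrite -[RHS](dbar_cst 0 (delta_mx 0 j) y); apply: dbar_near.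
  by apply: filterS (slice_out D'y nDy) => x hx; exact: hx.
rewrite (dbar_near (g := fun x => cutoff x * contr e om x v w)); last first.
  by apply: filterS (open_nbhs_nbhs (conj oD Dy)) => x Dx; exact: slice_in.
have [_ _ h3'] := lsmooth_contr e hom.
rewrite (dbarM _ (Cn_pdiff (smooth_cutoff oD 1%N) Dy) (Cn_pdiff (h3' v w 1%N) Dy)).
rewrite (dbar_contr _ _ _ oD Dy hom cl ke) mulr0 addr0 dbar_line_cst ?mul0r // => b'.
by rewrite /cutoff sqd_shift // eq_sym.
Qed.

Lemma kills_prim j : kills D (delta_mx 0 j) om -> kills D' (delta_mx 0 j) prim.
Proof.
move=> ke y v w k D'y ek; apply: prim_eq0 => // x D'x.
rewrite /slice; case: asboolP => // Dx.
rewrite /contr (ke _ _ _ (lift ord0 k) Dx) ?mulr0 //.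
by rewrite row_insr_lift.
Qed.

Lemma kills_prim_self : kills D' e prim.
Proof.
move=> y v w k D'y ek; apply: prim_eq0 => // x D'x.
rewrite /slice; case: asboolP => // Dx; have [_ h2 _] := hom.
rewrite /contr (proj2 (h2 x Dx v) _ ord0 (lift ord0 k)) ?mulr0 //.
by rewrite row_insr row_insr_lift.
Qed.

End Step.

(** Induction on [m], where [om] involves only [dzbar_j] with [j < m]. Subtracting [ldbar] of the
    Cauchy transform of the [dzbar_j0] coefficient, [j0] being the last such index, removes
    [dzbar_j0] and brings none of the removed ones back. Each step costs a smaller polydisc. *)
Lemma dbar_poincare_ind q z0 (m : nat) : (m <= n)%N -> forall (rho rho' : 'I_n -> R) (om : lform q.+1),
  (forall j, rho' j < rho j) -> (forall j, 0 < rho' j) ->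
  lsmooth (pdisc predT z0 rho) om ->
  (forall z v w, pdisc predT z0 rho z -> ldbar om z v w = 0) ->
  (forall j, (m <= j)%N -> kills (pdisc predT z0 rho) (delta_mx 0 j) om) ->
  exists2 eta : lform q, lsmooth (pdisc predT z0 rho') eta &
    forall z v w, pdisc predT z0 rho' z -> ldbar eta z v w = om z v w.
Proof.
elim: m => [|m ih] mn rho rho' om lr r0 hom cl ke.
  (* For [m = 0] every [dzbar_j] is absent, and a form of degree at least 1 in them is 0. *)
  have om0 := kills_all hom (fun j => ke j (leq0n j)).
  exists (fun _ _ _ => 0); first exact/lsmooth0/open_pdisc.
  move=> z v w Dz; rewrite (ldbar0 (om := fun _ _ _ => 0) v w (@open_pdisc predT z0 rho') Dz) // om0 //.
  by move=> j Pj; exact: lt_trans (Dz j Pj) (lr j).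
pose j0 := Ordinal mn; pose rho2 j := (rho j + rho' j) / 2.
have lr1 j : rho' j < rho2 j by rewrite /rho2; have := lr j; lra.
have lr2 j : rho2 j < rho j by rewrite /rho2; have := lr j; lra.
(* The cutoff is 1 on the smaller polydisc [D2], whose size is halfway between [rho'] and [rho], and
   0 before the boundary of [D] is reached. *)
pose a := rho2 j0; pose c := (rho2 j0 + rho j0) / 2.
have ac : a < c by rewrite /a /c; have := lr2 j0; lra.
have crho : c < rho j0 by rewrite /c; have := lr2 j0; lra.
have rho0 : 0 < rho j0 by have := lr1 j0; have := lr2 j0; have := r0 j0; lra.
pose D := pdisc predT z0 rho; pose D2 := pdisc predT z0 rho2.
have D2D : D2 `<=` D by move=> z h j Pj; exact: lt_trans (h j Pj) (lr2 j).
have oD : open D by exact: open_pdisc.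
have oD2 : open D2 by exact: open_pdisc.
pose eta1 := prim z0 rho om j0 a c.
have DD' : D `<=` pdisc (fun j => j != j0) z0 rho by move=> z h j _; exact: h.
have D2D' : D2 `<=` pdisc (fun j => j != j0) z0 rho by move=> z /D2D/DD'.
have h1 : lsmooth D2 eta1 := lsmooth_sub D2D' (lsmooth_prim ac crho rho0 hom).
have h1b : lsmooth D2 (ldbar eta1) := lsmooth_ldbar oD2 h1.
have hom2 : lsmooth D2 om := lsmooth_sub D2D hom.
pose om2 : lform q.+1 := fun y v w => 1 * om y v w + (-1) * ldbar eta1 y v w.
have hom2' : lsmooth D2 om2 := lsmooth_lin 1 (-1) oD2 hom2 h1b.
have cl2 z v w : D2 z -> ldbar om2 z v w = 0.
  move=> Dz; rewrite (ldbar_lin _ _ _ _ oD2 Dz hom2 h1b) (ldbarK _ _ oD2 Dz h1) mulr0 addr0.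
  by rewrite cl ?mulr0 //; exact: D2D.
have kp j : (m <= j)%N -> kills D2 (delta_mx 0 j) eta1.
  move=> mj y v w k /D2D' Dy ek; have [ej|ne] := eqVneq j j0.
    by rewrite ej in ek; exact: (kills_prim_self a c rho0 hom v Dy ek).
  apply: (kills_prim a c rho0 (ke j _) v Dy ek).
  by rewrite ltn_neqAle mj andbT; apply: contra ne => /eqP e; apply/eqP/val_inj.
have ke2 j : (m <= j)%N -> kills D2 (delta_mx 0 j) om2.
  move=> mj; apply: kills_contr => // y v w Dy.
  rewrite /contr /om2 (ldbar_kill _ _ oD2 Dy (kp j mj)) mul1r mulN1r.
  have [->|ne] := eqVneq j j0.
    rewrite (dbar_prim_self ac crho rho0 hom) ?subrr //; first exact: D2D.
    by apply/ltW/Dy.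
  have kj : kills D (delta_mx 0 j) om.
    by apply: ke; rewrite ltn_neqAle mj andbT; apply: contra ne => /eqP e; apply/eqP/val_inj.
  rewrite (dbar_prim_other ac crho rho0 hom) ?subr0 //; last exact: D2D'.
  by rewrite (kj _ _ _ ord0) ?row_insr //; exact: D2D.
have [eta2 h2 e2] := ih (ltnW mn) rho2 rho' om2 lr1 r0 hom2' cl2 ke2.
have D'D2 : pdisc predT z0 rho' `<=` D2 by move=> z h j Pj; exact: lt_trans (h j Pj) (lr1 j).
have h1' := lsmooth_sub D'D2 h1.
exists (fun y v w => 1 * eta1 y v w + 1 * eta2 y v w).
  exact: lsmooth_lin 1 1 (@open_pdisc predT z0 rho') h1' h2.
move=> z v w Dz; rewrite (ldbar_lin _ _ _ _ (@open_pdisc predT z0 rho') Dz h1' h2) e2 //.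
by rewrite /om2 !mul1r mulN1r addrC subrK.
Qed.

Lemma dbar_poincare q D z0 (om : lform q.+1) : open D -> D z0 -> lsmooth D om ->
  (forall z v w, D z -> ldbar om z v w = 0) ->
  exists2 D0, [/\ open D0, D0 z0 & D0 `<=` D] & exists2 eta : lform q, lsmooth D0 eta &
    forall z v w, D0 z -> ldbar eta z v w = om z v w.
Proof.
move=> oD Dz hom cl.
have /nbhs_box[r r0 hr] := open_nbhs_nbhs (conj oD Dz).
pose rho (j : 'I_n) : R := r ^+ 2; pose rho' (j : 'I_n) : R := r ^+ 2 / 2.
have rr : 0 < r ^+ 2 by rewrite exprn_gt0.
have sD : pdisc predT z0 rho `<=` D.
  move=> z h; apply: hr => j; have := h j isT; rewrite /rho /sqd /rcoord /= !mxE.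
  rewrite reD imD reN imN /cnear => hj.
  have := sqr_ge0 (re (z 0 j) + - re (z0 0 j)); have := sqr_ge0 (im (z 0 j) + - im (z0 0 j)) => *.
  by split; rewrite ltr_norml; apply/andP; split; nra.
(* With [m = n] the condition on killed indices is empty. *)
have [eta h1 h2] := @dbar_poincare_ind q z0 n (leqnn n) rho rho' om
  (fun j => ltac:(rewrite /rho /rho'; lra)) (fun j => ltac:(rewrite /rho'; lra))
  (lsmooth_sub sD hom) (fun z v w Dz => cl z v w (sD z Dz))
  (fun j h => False_ind _ ltac:(by move: (ltn_ord j); rewrite ltnNge h)).
exists (pdisc predT z0 rho'); last by exists eta.
split; first exact: open_pdisc.
  by move=> j _; rewrite /sqd /rcoord /= !mxE !subrr /= expr0n /= addr0 /rho'; lra.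
by apply: subset_trans sD => z h j Pj; apply: lt_trans (h j Pj) _; rewrite /rho /rho'; lra.
Qed.

End DolbeaultGrothendieck.

(** * Pullback of forms *)

Section MultilinearFamilies.
Variables (R : realType) (n d : nat).
Local Notation C := (Cplx R).
Local Notation E := 'rV[C]_n.
Variable s : {rmorphism C -> C}.
Variable D : set E.
Hypothesis oD : open D.

Definition rep m (l : 'I_m) (M N : 'M[C]_(m, d)) : 'M[C]_(m, d) :=
  \matrix_(i, j) if i == l then N i j else M i j.

Lemma rep_insr m (l : 'I_m.+1) (M N : 'M[C]_(m.+1, d)) :
  rep l M N = insr l (row l N) (row' l M).
Proof.
apply/matrixP => i j; rewrite !mxE; case: unliftP => [i' ->|->].
  by rewrite eq_sym (negbTE (neq_lift _ _)) ?mxE.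
by rewrite eqxx ?mxE.
Qed.

Lemma rep_lift m (l : 'I_m) (M N : 'M[C]_(m.+1, d)) :
  rep (lift ord0 l) M N = insr ord0 (row ord0 M) (rep l (row' ord0 M) (row' ord0 N)).
Proof.
apply/matrixP => i j; rewrite !mxE; case: unliftP => [i' ->|->]; last first.
  by rewrite (negbTE (neq_lift _ _)) ?mxE.
by rewrite (inj_eq lift_inj) ?mxE.
Qed.

Lemma multi_rep0 m (g : 'M[C]_(m, d) -> C) l M : alternating_for s g -> g (rep l M 0) = 0.
Proof.
case: m g l M => [|m] g l M h; first by case: l.
by rewrite rep_insr row0; exact: alt0 h.
Qed.

Lemma multi_expand m (om : E -> 'M[C]_(m.+1, d) -> C) (W : E -> 'M[C]_(m.+1, d)) y :
  alternating_for s (om y) ->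
  \sum_j s (W y ord0 j) * om y (insr ord0 (delta_mx 0 j) (row' ord0 (W y))) = om y (W y).
Proof.
move=> h; rewrite -[X in _ = om y X](insr_row ord0) (alt_sum _ _ _ h).
by apply: eq_bigr => j _; rewrite mxE.
Qed.

(** Expanding the first row in the standard basis makes it a combination of scalar functions, and
    induction on the number of rows treats the others. *)
Lemma multi_smooth k m (om : E -> 'M[C]_(m, d) -> C) (W : E -> 'M[C]_(m, d)) :
  (forall z, D z -> alternating_for s (om z)) ->
  (forall M, Cn_on k D (fun z => om z M)) ->
  (forall l j, Cn_on k D (fun z => s (W z l j))) -> Cn_on k D (fun z => om z (W z)).
Proof.
elim: m om W => [|m ih] om W h1 h2 h3.
  by rewrite (_ : (fun z => _) = fun z => om z 0) //; apply/funext => z; rewrite (flatmx0 (W z)).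
apply: (Cn_eq oD (fun z Dz => multi_expand W (h1 z Dz))).
apply: Cn_sum => // j _; apply: (CnM oD (h3 ord0 j)).
apply: (ih (fun z M => om z (insr ord0 (delta_mx 0 j) M)) (fun z => row' ord0 (W z))).
- by move=> z Dz; exact: alt_ins (h1 z Dz).
- by move=> M; exact: h2.
- move=> l i; rewrite (_ : (fun z => _) = fun z => s (W z (lift ord0 l) i)); first exact: h3.
  by apply/funext => z; rewrite mxE.
Qed.

(** The Leibniz rule for a multilinear map with varying arguments: one term with frozen rows, and
    for each row one term where it is replaced by its derivative. The morphism [s] is the identity
    for holomorphic rows and conjugation for antiholomorphic ones. *)
Lemma multi_dbar m (om : E -> 'M[C]_(m, d) -> C) (W : E -> 'M[C]_(m, d)) (DW : 'M[C]_(m, d)) u z : D z ->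
  (forall y, D y -> alternating_for s (om y)) ->
  (forall M, Cn_on 1 D (fun y => om y M)) ->
  (forall l j, Cn_on 1 D (fun y => s (W y l j))) ->
  (forall l j, dbar_derive u (fun y => s (W y l j)) z = s (DW l j)) ->
  dbar_derive u (fun y => om y (W y)) z =
    dbar_derive u (fun y => om y (W z)) z + \sum_(l < m) om z (rep l (W z) DW).
Proof.
move=> Dz; have zD := open_nbhs_nbhs (conj oD Dz).
elim: m om W DW => [|m ih] om W DW h1 h2 h3 h4.
  rewrite big_ord0 addr0; congr (dbar_derive u _ z); apply/funext => y.
  by rewrite (flatmx0 (W y)) (flatmx0 (W z)).
pose G j y := om y (insr ord0 (delta_mx 0 j) (row' ord0 (W y))).
have hG j : Cn_on 1 D (G j).
  apply: (@multi_smooth 1 m (fun y M => om y (insr ord0 (delta_mx 0 j) M)) (fun y => row' ord0 (W y))).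
  - by move=> y Dy; exact: alt_ins (h1 y Dy).
  - by move=> M; exact: h2.
  - move=> l i; rewrite (_ : (fun y => _) = fun y => s (W y (lift ord0 l) i)); first exact: h3.
    by apply/funext => y; rewrite mxE.
have pG j := Cn_pdiff (hG j) Dz.
have pW j := Cn_pdiff (h3 ord0 j) Dz.
have e1 : dbar_derive u (fun y => om y (W y)) z =
    \sum_j (s (DW ord0 j) * G j z + s (W z ord0 j) * dbar_derive u (G j) z).
  rewrite (@dbar_near _ _ _ (fun y => \sum_j s (W y ord0 j) * G j y)); last first.
    by apply: filterS zD => y Dy; rewrite (multi_expand W (h1 y Dy)).
  rewrite dbar_sum => [|j]; last exact: (pdiffM (pW j) (pG j)).
  by apply: eq_bigr => j _; rewrite (dbarM u (pW j) (pG j)) h4.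
have e2 j : dbar_derive u (G j) z =
    dbar_derive u (fun y => om y (insr ord0 (delta_mx 0 j) (row' ord0 (W z)))) z +
    \sum_(l < m) om z (insr ord0 (delta_mx 0 j) (rep l (row' ord0 (W z)) (row' ord0 DW))).
  apply: (ih (fun y M => om y (insr ord0 (delta_mx 0 j) M)) (fun y => row' ord0 (W y)) (row' ord0 DW)).
  - by move=> y Dy; exact: alt_ins (h1 y Dy).
  - by move=> M; exact: h2.
  - move=> l i; rewrite (_ : (fun y => _) = fun y => s (W y (lift ord0 l) i)); first exact: h3.
    by apply/funext => y; rewrite mxE.
  - move=> l i; rewrite mxE -h4; congr (dbar_derive u _ z).
    by apply/funext => y; rewrite mxE.
have e3 : \sum_j s (DW ord0 j) * G j z = om z (rep ord0 (W z) DW).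
  by rewrite rep_insr (alt_sum _ _ _ (h1 z Dz)); apply: eq_bigr => j _; rewrite mxE.
have e4 : \sum_j s (W z ord0 j) *
    dbar_derive u (fun y => om y (insr ord0 (delta_mx 0 j) (row' ord0 (W z)))) z =
    dbar_derive u (fun y => om y (W z)) z.
  have pz j := Cn_pdiff (h2 (insr ord0 (delta_mx 0 j) (row' ord0 (W z)))) Dz.
  rewrite [RHS](@dbar_near _ _ _ (fun y => \sum_j s (W z ord0 j) *
      om y (insr ord0 (delta_mx 0 j) (row' ord0 (W z))))); last first.
    by apply: filterS zD => y Dy; rewrite (multi_expand (fun=> W z) (h1 y Dy)).
  rewrite dbar_sum => [|j]; last exact: (pdiffM (pdiff_cst _ _) (pz j)).
  by apply: eq_bigr => j _; rewrite (dbarZ _ _ (pz j)).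
have e5 : \sum_j s (W z ord0 j) * (\sum_(l < m) om z (insr ord0 (delta_mx 0 j)
    (rep l (row' ord0 (W z)) (row' ord0 DW)))) = \sum_(l < m) om z (rep (lift ord0 l) (W z) DW).
  under eq_bigr do rewrite mulr_sumr.
  rewrite exchange_big /=; apply: eq_bigr => l _.
  rewrite rep_lift (alt_sum _ _ _ (h1 z Dz)); apply: eq_bigr => j _.
  by rewrite mxE.
rewrite e1 big_split /= e3 big_ord_recl addrCA; congr (_ + _).
by under eq_bigr do rewrite e2 mulrDr; rewrite big_split /= e4 e5.
Qed.

End MultilinearFamilies.

Lemma addr_eq0r (V : zmodType) (a s : V) : s = 0 -> a + s = a.
Proof. by move=> ->; exact: addr0. Qed.

Section Pullback.
Variables (R : realType) (n p : nat).
Local Notation C := (Cplx R).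
Local Notation E := 'rV[C]_n.
Local Notation lform := (@lform R n p).
Variables (tau : E -> E) (D D' : set E).
Hypothesis oD : open D.
Hypothesis oD' : open D'.
Hypothesis tauD : forall z, D z -> D' (tau z).
Hypothesis dtau : forall z, D z -> differentiable tau z.

Definition pull q (om : lform q) : lform q := fun z v w =>
  om (tau z) (v *m 'J tau z) (w *m 'J tau z).

Let tc j : E -> C := fun y => tau y 0 j.

Lemma hol_tc j z : D z -> differentiable (tc j) z.
Proof.
move=> Dz; apply: (@differentiable_comp _ _ _ _ tau (fun y : E => y 0 j : C)); first exact: dtau.
exact: differentiable_coord.
Qed.

Lemma mulJE m z (v : 'M[C]_(m, n)) k j : D z ->
  (v *m 'J tau z) k j = real_derive (row k v) (tc j) z.
Proof.
move=> Dz; have -> : (v *m 'J tau z) k j = (row k v *m 'J tau z) 0 j by rewrite -row_mul [RHS]mxE.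
rewrite hol_real_derive; last exact: hol_tc.
rewrite /jacobian mul_rV_lin1.
have @f : {linear E -> C}.
  by exists (fun N : E => N 0 j); do 2![eexists]; do ?[constructor];
     rewrite ?mxE// => ? *; rewrite ?mxE//; move=> ?; rewrite !mxE.
have fc : continuous f by exact: coord_continuous.
have -> : tc j = f \o tau by [].
rewrite (diff_comp (dtau Dz) (linear_differentiable (f := f) (tau z) fc)).
by rewrite diff_lin.
Qed.

Lemma Cn_tc k j : Cn_on k D (tc j).
Proof. exact: hol_smooth oD (fun y Dy => hol_tc j Dy) k. Qed.

Lemma Cn_mulJ r m (v : 'M[C]_(m, n)) k j : Cn_on r D (fun z => (v *m 'J tau z) k j : C).
Proof.
apply: (Cn_eq oD (fun z Dz => esym (mulJE v k j Dz))).
exact: Cn_der (Cn_tc r.+1 j).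
Qed.

Lemma dbar_mulJ m (v : 'M[C]_(m, n)) k j u z : D z ->
  dbar_derive u (fun z => (v *m 'J tau z) k j : C) z = 0.
Proof.
move=> Dz; rewrite (@dbar_near _ _ _ (real_derive (row k v) (tc j))); last first.
  by apply: filterS (open_nbhs_nbhs (conj oD Dz)) => y Dy; exact: mulJE.
apply: hol_dbar; exact: hol_der_hol oD (fun y Dy => hol_tc j Dy) Dz.
Qed.

Lemma half_cancel (a i : C) : i * i = -1 -> 2^-1 * (a + i * (- i * a)) = a.
Proof. by move=> ii; rewrite mulrA mulrN ii opprK mul1r -mulr2n -[a *+ 2]mulr_natl mulrA mulVf ?mul1r // pnatr_eq0. Qed.

Lemma dbar_conj_hol (f : E -> C) u z : differentiable f z ->
  dbar_derive u (fun y => Num.conj (f y)) z = Num.conj (real_derive u f z).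
Proof.
move=> df.
have h v := is_cder_conj (pdiffP v (hol_pdiff df)).
rewrite (is_cder_dbar (h u) (h ('i *: u))) (hol_real_deriveZ _ _ df) rmorphM /= conjCi.
exact: half_cancel (ii R).
Qed.

(** The derivative in direction [u] of the rows of [v *m 'J tau z], that is, second derivatives of
    the coordinate change. *)
Definition hess m (v : 'M[C]_(m, n)) u z : 'M[C]_(m, n) :=
  \matrix_(k, j) real_derive u (real_derive (row k v) (tc j)) z.

Lemma dbar_conj_mulJ m (v : 'M[C]_(m, n)) k j u z : D z ->
  dbar_derive u (fun z => Num.conj ((v *m 'J tau z) k j) : C) z = Num.conj (hess v u z k j).
Proof.
move=> Dz; rewrite (@dbar_near _ _ _ (fun y => Num.conj (real_derive (row k v) (tc j) y))); last first.
  by apply: filterS (open_nbhs_nbhs (conj oD Dz)) => y Dy; rewrite mulJE.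
rewrite mxE dbar_conj_hol //; exact: hol_der_hol oD (fun y Dy => hol_tc j Dy) Dz.
Qed.

Lemma is_rder_tau (u : E -> R) v z : RCn 1 D' u -> D z ->
  is_rder (fun y => u (tau y)) v z (rder (v *m 'J tau z) u (tau z)).
Proof.
move=> hu Dz; have zD' := open_nbhs_nbhs (conj oD' (tauD Dz)).
rewrite (rder_lin _ hu zD').
have := @C1_chain _ _ D' u (fun t => tau (rline z v t)) (v *m 'J tau z) hu.
rewrite rline0; apply=> // -[j b].
have [h1 h2] := pdiffP v (hol_pdiff (hol_tc j Dz)).
have e : (v *m 'J tau z) 0 j = real_derive v (tc j) z by rewrite mulJE // row_id.
by rewrite /rcoord e; case: b => /=; [exact: h2|exact: h1].
Qed.

Lemma is_cder_tau f v z : Cn_on 1 D' f -> D z ->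
  is_cder (fun y => f (tau y)) v z (real_derive (v *m 'J tau z) f (tau z)).
Proof.
by move=> /Cn_onE[h1 h2] Dz; split; [exact: is_rder_tau h1 Dz|exact: is_rder_tau h2 Dz].
Qed.

Lemma dbar_tau f v z : Cn_on 1 D' f -> D z ->
  dbar_derive v (fun y => f (tau y)) z = dbar_derive (v *m 'J tau z) f (tau z).
Proof.
move=> hf Dz; rewrite (is_cder_dbar (is_cder_tau v hf Dz) (is_cder_tau ('i *: v) hf Dz)).
by rewrite -scalemxAl.
Qed.

Lemma Cn_tau k f : Cn_on k D' f -> Cn_on k D (fun y => f (tau y)).
Proof.
have h i : RCn k D (fun y => rcoord i (tau y)).
  by have /Cn_onE[h1 h2] := Cn_tc k i.1; rewrite /rcoord; case: i.2.
by move=> /Cn_onE[h1 h2]; apply/Cn_onE; split; [exact: (@RCn_comp _ _ _ tau D D' oD tauD oD' k (ref f) h1 h)|exact: (@RCn_comp _ _ _ tau D D' oD tauD oD' k (imf f) h2 h)].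
Qed.

Section Form.
Variables (q : nat) (om : lform q).
Hypothesis hom : lsmooth D' om.

Lemma Cn_pull_w k V (w : 'M[C]_(q, n)) : Cn_on k D (fun z => om (tau z) V (w *m 'J tau z)).
Proof.
have [h1 h2 h3] := hom.
apply: (multi_smooth (s := Num.conj) oD (om := fun z => om (tau z) V)).
- by move=> z Dz; exact: h2 (tauD Dz) V.
- by move=> M; exact: Cn_tau (h3 V M k).
- by move=> l j; exact: Cn_conj oD (Cn_mulJ k w l j).
Qed.

Lemma Cn_pull k v w : Cn_on k D (fun z => pull om z v w).
Proof.
have [h1 h2 h3] := hom.
apply: (multi_smooth (s := idfun) oD (om := fun z V => om (tau z) V (w *m 'J tau z))).
- by move=> z Dz; exact: h1 (tauD Dz) _.
- by move=> M; exact: Cn_pull_w.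
- by move=> l j; exact: (Cn_mulJ k v l j).
Qed.

Lemma alt_mulJ s m (g : 'M[C]_(m, n) -> C) (J : 'M[C]_n) : alternating_for s g ->
  alternating_for s (fun v => g (v *m J)).
Proof.
case: m g => [|m] g [h1 h2]; first by split=> [M N P []|M []].
have row'M (i : 'I_m.+1) (M : 'M[C]_(m.+1, n)) : row' i (M *m J) = row' i M *m J.
  by apply/matrixP => k l; rewrite !mxE; apply: eq_bigr => x _; rewrite !mxE.
have rowM (i : 'I_m.+1) (M : 'M[C]_(m.+1, n)) : row i (M *m J) = row i M *m J := row_mul i M J.
split=> [M N P i b c e1 e2 e3|M i j ij e].
  apply: (h1 (M *m J) (N *m J) (P *m J) i).
  + by rewrite (rowM i M) (rowM i N) (rowM i P) e1 mulmxDl -!scalemxAl.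
  + by rewrite (row'M i M) (row'M i N) e2.
  + by rewrite (row'M i M) (row'M i P) e3.
by apply: (h2 _ i j) => //; rewrite (rowM i M) (rowM j M) e.
Qed.

Lemma lsmooth_pull : lsmooth D (pull om).
Proof.
have [h1 h2 h3] := hom; split.
- by move=> z Dz w; exact: (alt_mulJ _ (h1 (tau z) (tauD Dz) _)).
- by move=> z Dz v; exact: (alt_mulJ _ (h2 (tau z) (tauD Dz) _)).
- by move=> v w k; exact: Cn_pull.
Qed.

(** The rows [v *m 'J tau] are holomorphic and contribute 0; the conjugated rows [w *m 'J tau]
    contribute the second derivatives of [tau]. *)
Lemma dbar_pull v w u z : D z ->
  dbar_derive u (fun y => pull om y v w) z =
  dbar_derive (u *m 'J tau z) (fun y => om y (v *m 'J tau z) (w *m 'J tau z)) (tau z) +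
  \sum_(l < q) om (tau z) (v *m 'J tau z) (rep l (w *m 'J tau z) (hess w u z)).
Proof.
move=> Dz; have [h1 h2 h3] := hom.
have s0 : \sum_(l < p) om (tau z) (rep l (v *m 'J tau z) 0) (w *m 'J tau z) = 0.
  apply: big1 => l _.
  exact: (multi_rep0 (s := idfun) l _ (h1 (tau z) (tauD Dz) (w *m 'J tau z))).
have e1 := @multi_dbar R n n idfun D oD p (fun z V => om (tau z) V (w *m 'J tau z))
  (fun z => v *m 'J tau z) 0 u z Dz (fun y Dy => h1 (tau y) (tauD Dy) _)
  (fun M => Cn_pull_w 1 M w) (fun l j => Cn_mulJ 1 v l j)
  (fun l j => etrans (dbar_mulJ v l j u Dz) (esym (mxE _ _ _ _))).
have e2 := @multi_dbar R n n Num.conj D oD q (fun y W => om (tau y) (v *m 'J tau z) W)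
  (fun z => w *m 'J tau z) (hess w u z) u z Dz (fun y Dy => h2 (tau y) (tauD Dy) _)
  (fun M => Cn_tau (h3 _ M 1%N)) (fun l j => Cn_conj oD (Cn_mulJ 1 w l j))
  (fun l j => dbar_conj_mulJ w l j u Dz).
have e3 := dbar_tau u (h3 (v *m 'J tau z) (w *m 'J tau z) 1%N) Dz.
exact: (etrans e1 (etrans (addr_eq0r _ s0) (etrans e2 (congr1 (+%R^~ _) e3)))).
Qed.

End Form.

(** Second derivatives of [tau] are symmetric in their two directions, while deleting the two rows
    in either order gives opposite signs. So these terms drop out of the alternating sum and [ldbar]
    commutes with pullback. *)
Lemma hess_sum0 q (om : lform q) V (w : 'M[C]_(q.+1, n)) z : lsmooth D' om -> D z ->
  \sum_(k < q.+1) (-1) ^+ k *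
    (\sum_(l < q) om (tau z) V (rep l (row' k w *m 'J tau z) (hess (row' k w) (row k w) z))) = 0.
Proof.
move=> [_ h2 _] Dz.
case: q om w h2 => [|q] om w h2; first by rewrite big1 // => k _; rewrite big_ord0 mulr0.
pose rem k k' : 'M[C]_(q, n) := if unlift k k' is Some l then row' l (row' k (w *m 'J tau z)) else 0.
pose F (k k' : 'I_q.+2) := om (tau z) V (insr ord0
  (\row_j real_derive (row k w) (real_derive (row k' w) (tc j)) z) (rem k k')).
have row'M m (i : 'I_m.+1) (M : 'M[C]_(m.+1, n)) (J : 'M[C]_n) : row' i (M *m J) = row' i M *m J.
  by apply/matrixP => k l; rewrite !mxE; apply: eq_bigr => x _; rewrite !mxE.
rewrite -[RHS](@sg2_cancel _ _ F) => [|k k' kk'].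
  apply: eq_bigr => k _; rewrite mulr_sumr; apply: eq_bigr => l _.
  rewrite rep_insr (alt_front (s := Num.conj) l _ _ (h2 (tau z) (tauD Dz) V)) signM.
  congr (_ * om _ _ (insr _ _ _)).
    by apply/rowP => j; rewrite !mxE row_row'.
  by rewrite /rem liftK !row'M.
have er : rem k k' = rem k' k.
  rewrite /rem; case: (unliftP k k') => [l e1|e]; last by rewrite e eqxx in kk'.
  case: (unliftP k' k) => [l2 e2|e]; last by rewrite e eqxx in kk'.
  exact: row'C.
have eh : \row_j real_derive (row k w) (real_derive (row k' w) (tc j)) z =
    \row_j real_derive (row k' w) (real_derive (row k w) (tc j)) z.
  apply/rowP => j; rewrite [LHS]mxE [RHS]mxE.
  exact: (real_derive_sym _ _ (Cn_tc 2 j) (open_nbhs_nbhs (conj oD Dz))).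
exact: (f_equal2 (fun r m => om (tau z) V (insr ord0 r m)) eh er).
Qed.

Lemma ldbar_pull q (om : lform q) v w z : lsmooth D' om -> D z ->
  ldbar (pull om) z v w = ldbar om (tau z) (v *m 'J tau z) (w *m 'J tau z).
Proof.
move=> hom.
move=> Dz.
pose a k := dbar_derive (row k (w *m 'J tau z))
  (fun y => om y (v *m 'J tau z) (row' k (w *m 'J tau z))) (tau z).
pose b k := \sum_(l < q) om (tau z) (v *m 'J tau z)
  (rep l (row' k w *m 'J tau z) (hess (row' k w) (row k w) z)).
have e k : dbar_derive (row k w) (fun y => pull om y v (row' k w)) z = a k + b k.
  have er : row' k (w *m 'J tau z) = row' k w *m 'J tau z.
    by apply/matrixP => i j; rewrite !mxE; apply: eq_bigr => x _; rewrite !mxE.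
  by rewrite /a /b row_mul er; exact: (dbar_pull hom v (row' k w) (row k w) Dz).
have e0 : \sum_(k < q.+1) (-1) ^+ k * b k = 0 := hess_sum0 _ _ hom Dz.
transitivity (\sum_(k < q.+1) ((-1) ^+ k * a k + (-1) ^+ k * b k)).
  by apply: eq_bigr => k _; rewrite e mulrDr.
by rewrite big_split /= e0 addr0.
Qed.

End Pullback.

(** * Smooth forms on the manifold *)

Section Charts.
Variables (R : realType) (n : nat) (X : topologicalType) (A : complex_atlas R n X).
Local Notation C := (Cplx R).
Local Notation E := 'rV[C]_n.
Implicit Types (U V W : set X) (i j k : chart_idx A) (z : E) (x : X).

Lemma chart_imageP i U z : chart_image i U z <->
  [/\ chart_dom i (chart_inv i z), U (chart_inv i z) & chart i (chart_inv i z) = z].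
Proof.
split=> [[x [dx Ux] <-]|[h1 h2 h3]]; first by rewrite chartK.
by exists (chart_inv i z).
Qed.

Lemma chart_image_sub i U V : U `<=` V -> chart_image i U `<=` chart_image i V.
Proof. by move=> UV z /chart_imageP[h1 h2 h3]; apply/chart_imageP; split=> //; exact: UV. Qed.

Lemma chart_imageI i U V z :
  chart_image i (U `&` V) z <-> chart_image i U z /\ chart_image i V z.
Proof.
split=> [/chart_imageP[h1 [h2 h2'] h3]|[/chart_imageP[h1 h2 h3] /chart_imageP[_ h2' _]]].
  by split; apply/chart_imageP.
by apply/chart_imageP.
Qed.

Lemma chart_image_chart i U x : chart_dom i x -> U x -> chart_image i U (chart i x).
Proof. by move=> dx Ux; exists x. Qed.

Lemma open_chart_image i U : open U -> open (chart_image i U).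
Proof.
move=> oU; rewrite openE => z /chart_imageP[h1 h2 h3].
have cz : (chart i @` chart_dom i) z by exists (chart_inv i z).
have n1 : \forall y \near z, (chart i @` chart_dom i) y.
  exact: open_nbhs_nbhs (conj (@open_chart_cod _ _ _ A i) cz).
have n2 : \forall y \near z, U (chart_inv i y).
  exact: (chart_inv_continuous cz (open_nbhs_nbhs (conj oU h2))).
rewrite /interior; apply: filterS (filterI n1 n2) => y [[x dx <-] Uy].
by rewrite chartK // in Uy; exists x.
Qed.

Lemma transition_inv i j z : chart_image i (chart_dom j) z ->
  chart_inv j (transition i j z) = chart_inv i z.
Proof. by move=> /chart_imageP[h1 h2 h3]; rewrite /transition /= chartK. Qed.

Lemma transition_image i j U z : chart_image i (U `&` chart_dom j) z ->
  chart_image j (U `&` chart_dom i) (transition i j z).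
Proof.
by move=> /chart_imageP[h1 [h2 h2'] h3]; apply: chart_image_chart.
Qed.

Lemma transition_comp i j k z : chart_image i (chart_dom j) z ->
  transition j k (transition i j z) = transition i k z.
Proof. by move=> h; rewrite {1}/transition /= transition_inv. Qed.

Lemma transition_diff i j z : chart_image i (chart_dom j) z ->
  differentiable (transition i j) z.
Proof. exact: transition_holomorphic. Qed.

Lemma jacobian_comp (f g : E -> E) z : differentiable f z -> differentiable g (f z) ->
  'J (g \o f) z = 'J f z *m 'J g (f z).
Proof.
move=> df dg; apply/row_matrixP => r.
have e (h : E -> E) y u : u *m 'J h y = 'd h y u := mul_rV_lin1 ('d h y) u.
have gen (M N : 'M[C]_n) : row r (M *m N) = delta_mx 0 r *m M *m N by rewrite rowE mulmxA.
have dgf : 'd (g \o f) z (delta_mx 0 r) = 'd g (f z) ('d f z (delta_mx 0 r)).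
  exact: (congr1 (fun h => h _) (diff_comp df dg)).
apply: etrans (rowE _ _) _; apply: etrans (e _ _ _) _; apply: etrans dgf _.
symmetry; apply: etrans (gen _ _) _; apply: etrans (e g _ _) _.
exact: (congr1 (fun u => 'd g (f z) u) (e f z _)).
Qed.

Lemma jacobian_near (f g : E -> E) (D : set E) z : open D -> D z ->
  (forall y, D y -> differentiable f y) -> (forall y, D y -> differentiable g y) ->
  (forall y, D y -> f y = g y) -> 'J f z = 'J g z.
Proof.
move=> oD Dz df dg fg; apply/matrixP => a b.
have e (M : 'M[C]_n) : M a b = ((1%:M : 'M[C]_n) *m M) a b by rewrite mul1mx.
apply: etrans (e _) _; apply: etrans (mulJE df 1%:M a b Dz) _.
symmetry; apply: etrans (e _) _; apply: etrans (mulJE dg 1%:M a b Dz) _.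
apply: real_derive_near; apply: filterS (open_nbhs_nbhs (conj oD Dz)) => y Dy.
by rewrite fg.
Qed.

Lemma transition_jacobian i j k z : chart_image i (chart_dom j `&` chart_dom k) z ->
  'J (transition i k) z = 'J (transition i j) z *m 'J (transition j k) (transition i j z).
Proof.
have oD := @open_chart_image i _ (openI (@open_chart_dom _ _ _ A j) (@open_chart_dom _ _ _ A k)).
have d1 y : chart_image i (chart_dom j `&` chart_dom k) y -> differentiable (transition i j) y.
  by move=> /chart_imageI[h _]; exact: transition_diff.
have d2 y : chart_image i (chart_dom j `&` chart_dom k) y ->
    differentiable (transition j k) (transition i j y).
  rewrite setIC => /transition_image/chart_imageI[h _]; exact: transition_diff.
move=> Dz; rewrite -(jacobian_comp (d1 z Dz) (d2 z Dz)).
apply: (jacobian_near oD Dz) => y Dy; first by apply: transition_diff; case/chart_imageI: Dy.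
  by apply: differentiable_comp; [exact: d1|exact: d2].
by rewrite /= transition_comp //; case/chart_imageI: Dy.
Qed.

End Charts.
Arguments open_chart_image {R n X A} i {U} _.

Section SmoothForms.
Variables (R : realType) (n : nat) (X : topologicalType) (A : complex_atlas R n X).
Variable p : nat.
Local Notation C := (Cplx R).
Local Notation E := 'rV[C]_n.
Implicit Types (U V W : set X) (i j k : chart_idx A) (z : E) (x : X).
Local Notation form := (@Defs.form R n X A p).
Local Notation smooth := (@smooth_forms R n X A p _).
Local Notation CI := (@chart_image R n X A).
Local Notation T := (@transition R n X A).

Lemma formE q (a : C) (om eta : form q) i z v w :
  (a *: om + eta) i z v w = a * om i z v w + eta i z v w.
Proof. by []. Qed.

Lemma form_eq q (om eta : form q) :
  (forall i z v w, om i z v w = eta i z v w) -> om = eta.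
Proof.
by move=> h; apply/funext => i; apply/funext => z; apply/funext => v; apply/funext => w.
Qed.

Lemma form_res_in q V (om : form q) i z : CI i V z -> form_res V om i z = om i z.
Proof. by move=> h; rewrite /form_res /patch mem_set. Qed.

Lemma form_res_out q V (om : form q) i z : ~ CI i V z -> form_res V om i z = 0.
Proof. by move=> h; rewrite /form_res /patch memNset. Qed.

Lemma form_res_lin q V (a : C) (om eta : form q) :
  form_res V (a *: om + eta) = a *: form_res V om + form_res V eta.
Proof.
apply: form_eq => i z v w; rewrite formE.
have [h|h] := pselect (CI i V z); first by rewrite !form_res_in.
by rewrite !form_res_out // mulr0 addr0.
Qed.

Lemma form_res_comp q V W (om : form q) : W `<=` V ->
  form_res W (form_res V om) = form_res W om.
Proof.
move=> WV; apply: form_eq => i z v w.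
have [h|h] := pselect (CI i W z); last by rewrite !form_res_out.
by rewrite !form_res_in //; exact: (chart_image_sub WV h).
Qed.

Lemma form_res_eqP q V (om eta : form q) : form_res V om = form_res V eta <->
  forall i z, CI i V z -> om i z = eta i z.
Proof.
split=> [h i z Vz|h].
  by have := congr1 (fun f => f i z) h; rewrite !form_res_in.
apply: form_eq => i z v w; have [Vz|nVz] := pselect (CI i V z).
  by rewrite !form_res_in // h.
by rewrite !form_res_out.
Qed.

(** The definition regrouped chart by chart. Alternation is asked for on the chart image only;
    elsewhere the form is 0 and alternates trivially. *)
Record smooth_form_spec q U (om : form q) : Prop := SmoothFormSpec {
  sf_out : forall i z, ~ CI i U z -> om i z = 0 ;
  sf_smooth : forall i, lsmooth (CI i U) (om i) ;
  sf_compat : forall i j z v w, CI i (U `&` chart_dom j) z ->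
    om i z v w = pull (T i j) (om j) z v w }.

Lemma smooth_formsE q U (om : form q) : smooth U om <-> smooth_form_spec U om.
Proof.
split=> [[[h1 h2 h3 h4] h5]|[h1 h2 h4]].
  have hs i : lsmooth (CI i U) (om i).
    split; [by move=> z _ w; exact: h2|by move=> z _ v; exact: h3|exact: h5].
  exact: (SmoothFormSpec h1 hs h4).
have hs i v w : smooth_on (CI i U) (fun z => om i z v w) by have [_ _ h] := h2 i; apply: h.
split; last exact: hs.
split; [exact: h1| | |exact: h4].
- move=> i z w; have [h' _ _] := h2 i; have [h|h] := pselect (CI i U z); first exact: h'.
  by split=> [M N P k b c _ _ _|M k l _ _]; rewrite !(h1 i z h) ?mulr0 ?addr0.
- move=> i z v; have [_ h' _] := h2 i; have [h|h] := pselect (CI i U z); first exact: h'.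
  by split=> [M N P k b c _ _ _|M k l _ _]; rewrite !(h1 i z h) ?mulr0 ?addr0.
Qed.

Lemma smooth_lin q U (a : C) (om eta : form q) : open U ->
  smooth U om -> smooth U eta -> smooth U (a *: om + eta).
Proof.
move=> oU /smooth_formsE[h1 h2 h3] /smooth_formsE[g1 g2 g3]; apply/smooth_formsE; split.
- by move=> i z nz; apply/funext => v; apply/funext => w; rewrite formE h1 // g1 // mulr0 addr0.
- move=> i; have oD := open_chart_image i oU.
  apply: (lsmooth_eq oD _ (lsmooth_lin a 1 oD (h2 i) (g2 i))) => y v w _.
  by rewrite formE mul1r.
- move=> i j z v w h; rewrite formE /pull formE.
  by congr (_ * _ + _); [exact: h3|exact: g3].
Qed.

Lemma smooth0 q U : open U -> smooth U (0 : form q).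
Proof.
move=> oU; apply/smooth_formsE; split=> // i.
exact: (lsmooth0 p q (open_chart_image i oU)).
Qed.

Lemma smooth_res q U V (om : form q) : open U -> open V -> V `<=` U ->
  smooth U om -> smooth V (form_res V om).
Proof.
move=> oU oV VU /smooth_formsE[h1 h2 h3]; apply/smooth_formsE; split.
- by move=> i z nz; exact: form_res_out.
- move=> i; apply: (lsmooth_eq (open_chart_image i oV) (om := om i)) => [y v w Vy|].
    by rewrite form_res_in.
  exact: lsmooth_sub (chart_image_sub VU) (h2 i).
- move=> i j z v w h; have [hV hj] := (chart_imageI _ _ _ _).1 h.
  have [hV' _] := (chart_imageI _ _ _ _).1 (transition_image h).
  rewrite /pull !form_res_in //; apply: h3.
  by apply/chart_imageI; split=> //; exact: (chart_image_sub VU hV).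
Qed.

Lemma smooth_res_id q U (om : form q) : smooth U om -> form_res U om = om.
Proof.
move=> /smooth_formsE[h1 _ _]; apply: form_eq => i z v w.
have [h|h] := pselect (CI i U z); first by rewrite form_res_in.
by rewrite form_res_out // h1.
Qed.

Lemma lsmooth_local q (D : set E) (om : @lform R n p q) :
  (forall z, D z -> exists (D0 : set E) (om0 : @lform R n p q),
     [/\ open D0, D0 z, lsmooth D0 om0 & forall y v w, D0 y -> om y v w = om0 y v w]) ->
  lsmooth D om.
Proof.
move=> h; split.
- move=> z /h[D0 [om0 [oD Dz [h1 _ _] e]]] w.
  by rewrite (_ : (fun v => _) = fun v => om0 z v w); [exact: h1|apply/funext => v; exact: e].
- move=> z /h[D0 [om0 [oD Dz [_ h2 _] e]]] v.
  by rewrite (_ : om z v = om0 z v); [exact: h2|apply/funext => w; exact: e].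
- move=> v w k; apply/Cn_pointwise => z /h[D0 [om0 [oD Dz [_ _ h3] e]]].
  apply: (Cn_near (f := fun y => om0 y v w)).
    by move=> _ ->; apply: filterS (open_nbhs_nbhs (conj oD Dz)) => y Dy; rewrite e.
  by apply: (Cn_subset _ (h3 v w k)) => _ ->.
Qed.

Lemma smooth_glue q (I : Type) (V : I -> set X) (s : I -> form q) :
  (forall r, open (V r)) -> (forall r, smooth (V r) (s r)) ->
  (forall r r', form_res (V r `&` V r') (s r) = form_res (V r `&` V r') (s r')) ->
  exists2 t : form q, smooth (\bigcup_r V r) t & forall r, form_res (V r) t = s r.
Proof.
move=> oV hs cs.
have U_ex i z : CI i (\bigcup_r V r) z -> exists r, CI i (V r) z.
  by move=> /chart_imageP[h1 [r _ h2] h3]; exists r; apply/chart_imageP.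
pose t : form q := fun i z v w => if pselect (exists r, CI i (V r) z) is left h
  then s (projT1 (cid h)) i z v w else 0.
have tE r i z v w : CI i (V r) z -> t i z v w = s r i z v w.
  move=> hr; rewrite /t; case: pselect => [h|[]]; last by exists r.
  case: (cid h) => r' /= hr'.
  by have /form_res_eqP -> // := cs r' r; apply/chart_imageI.
exists t; last first.
  move=> r; apply: form_eq => i z v w; have [h|h] := pselect (CI i (V r) z).
    by rewrite form_res_in // (tE r).
  by rewrite form_res_out //; have /smooth_formsE[-> //] := hs r.
apply/smooth_formsE; split.
- move=> i z nz; apply/funext => v; apply/funext => w; rewrite /t; case: pselect => // -[r hr].
  by case: nz; apply: (chart_image_sub _ hr) => y Vy; exists r.
- move=> i; apply: lsmooth_local => z /U_ex[r hr].
  exists (CI i (V r)), (s r i); split=> //; first exact: open_chart_image.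
    by have /smooth_formsE[_ h _] := hs r; exact: h.
  by move=> y v w; exact: tE.
- move=> i j z v w /chart_imageI[/U_ex[r hr] hj].
  have hrj : CI i (V r `&` chart_dom j) z by apply/chart_imageI.
  have [hr' _] := (chart_imageI _ _ _ _).1 (transition_image hrj).
  rewrite /pull (tE r) // (tE r j) //.
  by have /smooth_formsE[_ _ h] := hs r; exact: h.
Qed.

Lemma smooth_sep q (I : Type) (V : I -> set X) (t : form q) : smooth (\bigcup_r V r) t ->
  (forall r, form_res (V r) t = 0) -> t = 0.
Proof.
move=> /smooth_formsE[h1 _ _] h; apply: form_eq => i z v w.
have [hz|hz] := pselect (CI i (\bigcup_r V r) z); last by rewrite h1.
have [r hr] : exists r, CI i (V r) z.
  by move/chart_imageP: hz => [k1 [r _ k2] k3]; exists r; apply/chart_imageP.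
by rewrite -(form_res_in t hr) h.
Qed.

End SmoothForms.

(** * The Dolbeault complex on the manifold *)

Section DbarForms.
Variables (R : realType) (n : nat) (X : topologicalType) (A : complex_atlas R n X).
Variable p : nat.
Local Notation C := (Cplx R).
Local Notation E := 'rV[C]_n.
Implicit Types (U V W : set X) (i j k : chart_idx A) (z : E) (x : X).
Local Notation form := (@Defs.form R n X A p).
Local Notation smooth := (@smooth_forms R n X A p _).
Local Notation CI := (@chart_image R n X A).
Local Notation T := (@transition R n X A).

Lemma dbarE q U (om : form q) i z v w : CI i U z ->
  dbar U om i z v w = (-1) ^+ p * ldbar (om i) z v w.
Proof. by move=> h; rewrite /dbar form_res_in. Qed.

Lemma dbar_out q U (om : form q) i z : ~ CI i U z -> dbar U om i z = 0.
Proof. exact: form_res_out. Qed.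

Lemma transition_diffI i j U z : CI i (U `&` chart_dom j) z -> differentiable (T i j) z.
Proof. by move=> /chart_imageI[_ h]; exact: transition_diff. Qed.

Lemma transition_imageI i j U z : CI i (U `&` chart_dom j) z -> CI j U (T i j z).
Proof. by move=> /transition_image/chart_imageI[]. Qed.

Lemma smooth_dbar q U (om : form q) : open U -> smooth U om -> smooth U (dbar U om).
Proof.
move=> oU /smooth_formsE[h1 h2 h3]; apply/smooth_formsE; split.
- by move=> i z nz; exact: dbar_out.
- move=> i; have oD := open_chart_image i oU; have h := lsmooth_ldbar oD (h2 i).
  apply: (lsmooth_eq oD _ (lsmooth_lin ((-1) ^+ p) 0 oD h h)) => y v w Dy.
  by rewrite dbarE // mul0r addr0.
- move=> i j z v w hz; have [zU _] := (chart_imageI _ _ _ _).1 hz.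
  have oD := open_chart_image i (openI oU (@open_chart_dom _ _ _ A j)).
  have e1 := dbarE om v w zU.
  have e2 := dbarE om (v *m 'J (T i j) z) (w *m 'J (T i j) z) (transition_imageI hz).
  have e3 : ldbar (om i) z v w = ldbar (pull (T i j) (om j)) z v w.
    by apply: (ldbar_near v w oD hz) => y v' w' hy; exact: h3.
  have e4 := ldbar_pull oD (open_chart_image j oU) (fun z hz => transition_imageI hz)
    (fun z hz => transition_diffI hz) v w (h2 j) hz.
  exact: (etrans e1 (etrans (congr1 ( *%R ((-1) ^+ p)) (etrans e3 e4)) (esym e2))).
Qed.

Lemma dbar_form_lin q U (a : C) (om eta : form q) : open U -> smooth U om -> smooth U eta ->
  dbar U (a *: om + eta) = a *: dbar U om + dbar U eta.
Proof.
move=> oU /smooth_formsE[_ h2 _] /smooth_formsE[_ g2 _].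
apply: form_eq => i z v w; rewrite formE.
have [h|h] := pselect (CI i U z); last by rewrite !dbar_out // mulr0 addr0.
rewrite !dbarE //; have oD := open_chart_image i oU.
rewrite (ldbar_near v w oD h (om' := fun y v w => a * om i y v w + 1 * eta i y v w)); last first.
  by move=> y v' w' _; rewrite formE mul1r.
by rewrite (ldbar_lin a 1 v w oD h (h2 i) (g2 i)) mul1r mulrDr mulrCA.
Qed.

Lemma dbar_res q U V (om : form q) : open U -> open V -> V `<=` U ->
  form_res V (dbar U om) = dbar V (form_res V om).
Proof.
move=> oU oV VU; apply: form_eq => i z v w.
have [h|h] := pselect (CI i V z); last by rewrite form_res_out // dbar_out.
have e0 : form_res V (dbar U om) i z v w = dbar U om i z v w by rewrite form_res_in.
have e1 := dbarE om v w (chart_image_sub VU h).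
have e2 := dbarE (form_res V om) v w h.
have e3 : ldbar (om i) z v w = ldbar (form_res V om i) z v w.
  apply: (ldbar_near v w (open_chart_image i oV) h) => y v' w' hy.
  by rewrite form_res_in.
exact: (etrans e0 (etrans e1 (etrans (congr1 ( *%R ((-1) ^+ p)) e3) (esym e2)))).
Qed.

Lemma dbar_dbar q U (om : form q) : open U -> smooth U om -> dbar U (dbar U om) = 0.
Proof.
move=> oU /smooth_formsE[_ h2 _]; apply: form_eq => i z v w.
have [h|h] := pselect (CI i U z); last by rewrite dbar_out.
rewrite dbarE //; have oD := open_chart_image i oU.
have hl := lsmooth_ldbar oD (h2 i).
rewrite (ldbar_near v w oD h (om' := fun y v w => (-1) ^+ p * ldbar (om i) y v w + 0 * ldbar (om i) y v w)); last first.
  by move=> y v' w' hy; rewrite dbarE // mul0r addr0.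
by rewrite (ldbar_lin _ _ v w oD h hl hl) (ldbarK v w oD h (h2 i)) !mulr0 addr0 mulr0.
Qed.

(** One direction is the smoothness of holomorphic functions; the other is [CR_differentiable],
    since in degree [(p, 0)] the form [dbar U om] collects the Cauchy-Riemann expressions of the
    coefficients. *)
Lemma holo_formsE U (om : form 0) : open U ->
  holo_forms U om <-> smooth U om /\ dbar U om = 0.
Proof.
move=> oU; split=> [[hr hd]|[hs hd]].
  have hs i v w : smooth_on (CI i U) (fun z => om i z v w : C).
    exact: hol_smooth (open_chart_image i oU) (hd i v w).
  split; first by split.
  apply: form_eq => i z v w; have [h|h] := pselect (CI i U z); last by rewrite dbar_out.
  rewrite dbarE // /ldbar big1 ?mulr0 // => k _.
  by rewrite hol_dbar ?mulr0 //; exact: hd.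
split; first by case: hs.
move=> i v w z hz; have [_ /(_ i v w) h3] := hs.
apply: (CR_differentiable (h3 1%N) (open_nbhs_nbhs (conj (open_chart_image i oU) hz))) => u.
have := congr1 (fun f => f i z v u) hd; rewrite dbarE // /ldbar big_ord1 mul1r row_id.
rewrite (flatmx0 (row' ord0 u)) (flatmx0 w) => /eqP.
by rewrite mulf_eq0 signr_eq0 /= => /eqP.
Qed.

(** The equation is solved in a single chart around [x]; the solution is carried to the other charts
    by pullback along the transition maps, with which [ldbar] commutes. *)
Lemma dbar_exact q U (om : form q.+1) x : open U -> smooth U om -> dbar U om = 0 -> U x ->
  exists V (eta : form q), [/\ open V, V x, V `<=` U, smooth V eta & form_res V om = dbar V eta].
Proof.
move=> oU /smooth_formsE[h1 h2 h3] cl Ux.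
have : [set: X] x by [].
rewrite -(chart_cover A) => -[i _ xi].
have oD := open_chart_image i oU.
have Dx : CI i U (chart i x) by exact: chart_image_chart.
have cl' z v w : CI i U z -> ldbar (om i) z v w = 0.
  move=> hz; have := congr1 (fun f => f i z v w) cl; rewrite dbarE // => /eqP.
  by rewrite mulf_eq0 signr_eq0 /= => /eqP.
have [D0 [oD0 D0x D0D] [eta heta etaE]] := dbar_poincare oD Dx (h2 i) cl'.
pose V := [set y | [/\ chart_dom i y, U y & D0 (chart i y)]].
have oV : open V.
  rewrite openE => y [y1 y2 y3]; rewrite /interior.
  have n1 := open_nbhs_nbhs (conj (@open_chart_dom _ _ _ A i) y1).
  have n2 := open_nbhs_nbhs (conj oU y2).
  have n3 : \forall y' \near y, D0 (chart i y').
    exact: (chart_continuous y1 (open_nbhs_nbhs (conj oD0 y3))).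
  by apply: filterS (filterI n1 (filterI n2 n3)) => y' [a1 [a2 a3]].
have VU : V `<=` U by move=> y [].
have VT j z : CI j V z -> CI j (V `&` chart_dom i) z.
  move=> /chart_imageP[a1 [a2 a3 a4] a5]; apply/chart_imageP; split=> //; split=> //.
have VD j z : CI j V z -> D0 (T j i z).
  by move=> /chart_imageP[a1 [a2 a3 a4] a5].
pose s : C := (-1) ^+ p.
(* The factor [s = (-1) ^+ p] undoes the sign by which [dbar] differs from [ldbar]. *)
pose et : form q := fun j z v w => if pselect (CI j V z) then s * pull (T j i) eta z v w else 0.
have etE j z v w : CI j V z -> et j z v w = s * pull (T j i) eta z v w.
  by move=> h; rewrite /et; case: pselect.
have lp j : lsmooth (CI j V) (pull (T j i) eta).
  exact: (lsmooth_pull (open_chart_image j oV) oD0 (VD j) (fun z hz => transition_diffI (VT j z hz)) heta).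
have het : smooth V et.
  apply/smooth_formsE; split.
  - by move=> j z nz; apply/funext => v; apply/funext => w; rewrite /et; case: pselect.
  - move=> j; apply: (lsmooth_eq (open_chart_image j oV) _ (lsmooth_lin s 0 (open_chart_image j oV) (lp j) (lp j))).
    by move=> y v w hy; rewrite etE // mul0r addr0.
  - move=> j k z v w hz; have [hz1 hz2] := (chart_imageI _ _ _ _).1 hz.
    have hik : CI j (chart_dom k `&` chart_dom i) z.
      by apply/chart_imageI; split=> //; have /chart_imageI[] := VT j z hz1.
    have e1 := etE j z v w hz1.
    have e2 := etE k (T j k z) (v *m 'J (T j k) z) (w *m 'J (T j k) z) (transition_imageI hz).
    have eJ m (u : 'M[C]_(m, n)) :
        u *m 'J (T j i) z = u *m 'J (T j k) z *m 'J (T k i) (T j k z).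
      exact: (etrans (congr1 (mulmx u) (transition_jacobian hik)) (mulmxA _ _ _)).
    have eT : T k i (T j k z) = T j i z := transition_comp i hz2.
    have f3 a a' b b' c c' : a = a' -> b = b' -> c = c' -> eta a b c = eta a' b' c'.
      by move=> -> -> ->.
    have e3 := f3 _ _ _ _ _ _ (esym eT) (eJ _ v) (eJ _ w).
    exact: (etrans e1 (etrans (congr1 ( *%R s) e3) (esym e2))).
have Vx : V x by [].
exists V, et; split=> //.
apply: form_eq => j z v w; have [hz|hz] := pselect (CI j V z); last first.
  by rewrite form_res_out // dbar_out.
have e0 : form_res V om j z v w = om j z v w by rewrite form_res_in.
have e1 := dbarE et v w hz.
have e2 : ldbar (et j) z v w =
    ldbar (fun y v w => s * pull (T j i) eta y v w + 0 * pull (T j i) eta y v w) z v w.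
  by apply: (ldbar_near v w (open_chart_image j oV) hz) => y v' w' hy; rewrite etE // mul0r addr0.
have e3 := ldbar_lin s 0 v w (open_chart_image j oV) hz (lp j) (lp j).
have e4 := ldbar_pull (open_chart_image j oV) oD0 (VD j) (fun z hz => transition_diffI (VT j z hz)) v w heta hz.
have e5 := etaE _ (v *m 'J (T j i) z) (w *m 'J (T j i) z) (VD j z hz).
have e6 : om j z v w = om i (T j i z) (v *m 'J (T j i) z) (w *m 'J (T j i) z).
  by apply: h3; apply: (chart_image_sub _ (VT j z hz)) => y [/VU Uy dy]; split.
have fin (a b c : C) : a = s * b + 0 * b -> b = c -> s * a = c.
  by move=> -> ->; rewrite mul0r addr0 mulrA -expr2 sqrr_sign mul1r.
have := fin _ _ _ (etrans e2 e3) (etrans e4 e5) => e7.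
exact: (etrans e0 (etrans e6 (etrans (esym e7) (esym e1)))).
Qed.

End DbarForms.

(** * Compactness and cutoffs on the manifold *)

Section CompactSets.
Variable T : topologicalType.
Implicit Types (K Q U V W : set T) (x y : T).

(** Near-covering compactness applied to the filter of finite lists directed by inclusion: locally
    it is enough to have one suitable index in the list. *)
Lemma compact_finite_cover K (I : Type) (U : I -> set T) : compact K ->
  (forall x, K x -> exists i, nbhs x (U i)) ->
  exists l : seq I, forall x, K x -> exists2 i, List.In i l & U i x.
Proof.
move=> /compact_near_coveringP cK h.
pose F : set_system (seq I) := fun S =>
  exists l0, forall l, (forall i, List.In i l0 -> List.In i l) -> S l.
have FF : Filter F.
  split; first by exists nil.
  - move=> P Q [l1 h1] [l2 h2]; exists (l1 ++ l2) => l hl; split.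
      by apply: h1 => i hi; apply: hl; apply/List.in_or_app; left.
    by apply: h2 => i hi; apply: hl; apply/List.in_or_app; right.
  - by move=> P Q PQ [l0 h0]; exists l0 => l hl; apply/PQ/h0.
have [|l hl] := cK _ F (fun l x => exists2 i, List.In i l & U i x) FF.
  move=> x /h[i hi]; exists (U i, [set l | List.In i l]).
    by split=> //=; exists [:: i] => l; apply; left.
  by move=> [y l] /= [Uy il]; exists i.
by exists l; exact: hl.
Qed.

Lemma open_list_cap (I : Type) (l : seq I) (f : I -> set T) : (forall i, open (f i)) ->
  open [set y | forall i, List.In i l -> f i y].
Proof.
move=> of_; elim: l => [|i l ih].
  rewrite (_ : [set y | _] = setT); first exact: openT.
  by apply/seteqP; split=> [//|y _ j []].
rewrite (_ : [set y | _] = f i `&` [set y | forall j, List.In j l -> f j y]).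
  exact: openI (of_ i) ih.
apply/seteqP; split=> [y h|y [h1 h2] j [<- //|hj]]; last exact: h2.
by split; [apply: h; left|move=> j hj; apply: h; right].
Qed.

(** Used twice for two compact sets: to separate the second from a point, and then the first from
    the second. *)
Lemma compact_separation K Q : compact K ->
  (forall y, K y -> exists V W, [/\ open V, open W, V y, Q `<=` W & V `&` W `<=` set0]) ->
  exists V W, [/\ open V, open W, K `<=` V, Q `<=` W & V `&` W `<=` set0].
Proof.
move=> cK h.
pose I := {VW : set T * set T | [/\ open VW.1, open VW.2, Q `<=` VW.2 & VW.1 `&` VW.2 `<=` set0]}.
have [|l hl] := @compact_finite_cover K I (fun i => (sval i).1) cK.
  move=> x /h[V [W [oV oW Vx QW VW]]].
  unshelve eexists; first by exists (V, W).
  exact: open_nbhs_nbhs.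
exists (\bigcup_(i in [set i : I | List.In i l]) (sval i).1),
  [set y | forall i, List.In i l -> (sval i).2 y]; split.
- by apply: bigcup_open => i _; case: (svalP i).
- by apply: open_list_cap => i; case: (svalP i).
- by move=> x /hl[i il Vx]; exists i.
- by move=> y Qy i _; case: (svalP i) => _ _ h' _; exact: h'.
- by move=> y [[i il Vy] /(_ i il) Wy]; case: (svalP i) => _ _ _; apply; split; [exact: Vy|exact: Wy].
Qed.

Lemma hausdorff_compact_separation K Q : hausdorff_space T -> compact K -> compact Q ->
  K `&` Q `<=` set0 ->
  exists V W, [/\ open V, open W, K `<=` V, Q `<=` W & V `&` W `<=` set0].
Proof.
rewrite open_hausdorff => hT cK cQ KQ; apply: compact_separation => // y Ky.
have [|V [W [oV oW QV yW VW]]] := @compact_separation Q [set y] cQ.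
  move=> x Qx; have xy : x != y by apply/eqP => e; apply: (KQ y); split=> //; rewrite -e.
  have [[V W] /= [xV yW] [oV oW /eqP VW]] := hT x y xy.
  exists V, W; split=> //; first exact: set_mem.
    by move=> _ ->; exact: set_mem.
  by rewrite VW.
exists W, V; split=> //; first exact: yW.
by rewrite setIC.
Qed.

End CompactSets.

Section Cutoffs.
Variables (R : realType) (n : nat) (X : topologicalType) (A : complex_atlas R n X).
Hypothesis hX : hausdorff_space X.
Local Notation C := (Cplx R).
Local Notation E := 'rV[C]_n.
Implicit Types (U V W N K : set X) (i k : chart_idx A) (z : E) (chi : X -> C).
Local Notation CI := (@chart_image R n X A).
Local Notation T := (@transition R n X A).

Definition cbox (z0 : E) (r : R) : set E :=
  [set z | forall j, ((fun xy : R * R => z0 0 j + Complex xy.1 xy.2 : C) @`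
    (`[- r, r] `*` `[- r, r])) (z 0 j)].

Lemma compact_cbox z0 r : compact (cbox z0 r).
Proof.
apply: (@rV_compact C n (fun j => (fun xy : R * R => z0 0 j + Complex xy.1 xy.2 : C) @`
    (`[- r, r] `*` `[- r, r]))) => j.
apply: continuous_compact; last by apply: compact_setX; exact: segment_compact.
apply: continuous_subspaceT => xy.
have h : {for xy, continuous (fun xy : R * R => Complex xy.1 xy.2 : C)}.
  by apply/continuousC_reim; split; [exact: cvg_fst|exact: cvg_snd].
exact: (cvgD (cvg_cst (z0 0 j)) h).
Qed.

Lemma cboxP z0 r z : (forall j, `|re (z 0 j - z0 0 j)| <= r /\ `|im (z 0 j - z0 0 j)| <= r) ->
  cbox z0 r z.
Proof.
move=> h j; have [h1 h2] := h j; exists (re (z 0 j - z0 0 j), im (z 0 j - z0 0 j)) => /=.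
  by split; rewrite /= in_itv /= -ler_norml.
have e (c : C) : Complex (re c) (im c) = c by case: c.
by rewrite e addrC subrK.
Qed.

Lemma cbox_near z0 r e z : r < e -> cbox z0 r z -> box e z0 z.
Proof.
move=> re_ h j; have [[a b] [/= ha hb] <-] := h j.
move: ha hb; rewrite /= !in_itv /= -!ler_norml => ha hb.
rewrite /cnear reD imD /= ![_ + _ - _]addrAC !subrr !add0r.
by split; apply: le_lt_trans re_.
Qed.

Lemma compact_chart_box i U x : open U -> chart_dom i x -> U x ->
  exists2 r : R, 0 < r & [/\ compact (chart_inv i @` cbox (chart i x) r),
    chart_inv i @` cbox (chart i x) r `<=` U &
    cbox (chart i x) r `<=` CI i U].
Proof.
move=> oU dx Ux.
have /nbhs_box[e e0 he] := open_nbhs_nbhs (conj (open_chart_image i oU) (chart_image_chart dx Ux)).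
have sub : cbox (chart i x) (e / 2) `<=` CI i U.
  by move=> z hz; apply: he; apply: cbox_near hz; lra.
exists (e / 2); first by lra.
split=> //; last by move=> _ [z /sub/chart_imageP[_ Uz _] <-].
apply: continuous_compact; last exact: compact_cbox.
apply: continuous_in_subspaceT => z /set_mem/sub[y [dy _] <-].
by apply: chart_inv_continuous; exists y.
Qed.

Lemma local_compact U x : open U -> U x ->
  exists V K, [/\ open V, V x, V `<=` K, compact K & K `<=` U].
Proof.
move=> oU Ux; have : [set: X] x by [].
rewrite -(chart_cover A) => -[i _ dx].
have [r r0 [cK KU sub]] := compact_chart_box oU dx Ux.
pose V := [set y | chart_dom i y /\ pdisc predT (chart i x) (fun=> r ^+ 2) (chart i y)].
exists V, (chart_inv i @` cbox (chart i x) r); split=> //.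
- rewrite openE => y [y1 y2]; rewrite /interior.
  have n1 := open_nbhs_nbhs (conj (@open_chart_dom _ _ _ A i) y1).
  have n2 : \forall y' \near y, pdisc predT (chart i x) (fun=> r ^+ 2) (chart i y').
    exact: (chart_continuous y1 (open_nbhs_nbhs (conj (@open_pdisc _ _ _ _ _) y2))).
  by apply: filterS (filterI n1 n2) => y' [a1 a2].
- split=> // j _; rewrite /sqd /rcoord /= !mxE !subrr /= expr0n /= addr0.
  by rewrite exprn_gt0.
- move=> y [dy py]; exists (chart i y); last by rewrite chartK.
  apply: cboxP => j; have := py j isT; rewrite /sqd /rcoord /= !mxE.
  move: (re _) (im _) => a b hab.
  have := sqr_ge0 a; have := sqr_ge0 b => *.
  by split; rewrite ler_norml; apply/andP; split; nra.
Qed.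

(** The basic open sets that lie in a compact subset of [U] already cover it, by local compactness.
    The basis is indexed through an injection into [nat], and indices without such a set receive
    [set0]. *)
Lemma countable_compact_cover U : @second_countable X -> open U ->
  exists B K : nat -> set X, [/\ forall m, open (B m), forall m, B m `<=` K m,
    forall m, compact (K m), forall m, K m `<=` U & U `<=` \bigcup_m B m].
Proof.
move=> [b /countable_injP[f finj] [bo bB]] oU.
pose good S K := [/\ b S, S `<=` K, compact K & K `<=` U].
pose P m S := f S = m /\ exists K, good S K.
have ch m : exists SK : set X * set X, [/\ open SK.1, SK.1 `<=` SK.2, compact SK.2, SK.2 `<=` U &
    forall S, P m S -> SK.1 = S].
  have [[S [fS [K [bS SK cK KU]]]]|nS] := pselect (exists S, P m S).
    exists (S, K); split=> //=; first exact: bo.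
    move=> S' [fS' [K' [bS' _ _ _]]]; apply: finj; rewrite ?inE //.
    by rewrite fS fS'.
  exists (set0, set0); split=> //=; [exact: open0|exact: compact0|].
  by move=> S PS; case: nS; exists S.
exists (fun m => (sval (cid (ch m))).1), (fun m => (sval (cid (ch m))).2); split;
  try by move=> m; case: (svalP (cid (ch m))).
move=> x Ux; have [V [K [oV Vx VK cK KU]]] := local_compact oU Ux.
have [S [bS Sx] SV] := bB x V (open_nbhs_nbhs (conj oV Vx)).
have PS : P (f S) S.
  by split=> //; exists K; split=> //; apply: subset_trans VK.
exists (f S) => //.
by case: (svalP (cid (ch (f S)))) => _ _ _ _ /(_ S PS) ->.
Qed.

Definition Xsmooth chi := forall k, smooth_on (CI k setT) (fun z => chi (chart_inv k z)).

(** Vanishing near each point outside [N], and not only at these points, is what makes the product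
    with a form on [N] smooth after extension by 0. *)
Definition good_cutoff N chi :=
  Xsmooth chi /\ forall x, ~ N x -> \forall y \near x, chi y = 0.

(** The function is [1 - (1 - chi) (1 - chi')], equal to 1 wherever one of the two is. *)
Lemma good_cutoff_join N chi chi' : good_cutoff N chi -> good_cutoff N chi' ->
  good_cutoff N (fun y => chi y + chi' y + (-1) * (chi y * chi' y)).
Proof.
move=> [h1 h2] [g1 g2]; split=> [k r|x nx].
  have oD := @open_chart_image _ _ _ A k _ (@openT X).
  exact: (CnD oD (CnD oD (h1 k r) (g1 k r)) (CnZ (-1) oD (CnM oD (h1 k r) (g1 k r)))).
apply: filterS (filterI (h2 x nx) (g2 x nx)) => y [-> ->].
by rewrite mul0r mulr0 !addr0.
Qed.

Lemma local_cutoff N x : open N -> N x ->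
  exists2 chi, good_cutoff N chi & \forall y \near x, chi y = 1.
Proof.
move=> oN Nx; have : [set: X] x by [].
rewrite -(chart_cover A) => -[i _ dx].
have [r r0 [cK KN sub]] := compact_chart_box oN dx Nx.
set z0 := chart i x in cK KN sub *; set K := chart_inv i @` _ in cK KN.
have rr : 0 < r ^+ 2 by rewrite exprn_gt0.
pose a := r ^+ 2 / 2; have ac : a < r ^+ 2 by rewrite /a; lra.
pose f z : C := \prod_(j < n) cutoff z0 j a (r ^+ 2) z.
pose chi y : C := if pselect (chart_dom i y) then f (chart i y) else 0.
have chi_in y : chart_dom i y -> chi y = f (chart i y).
  by rewrite /chi; case: pselect.
have chi_out y : ~ K y -> chi y = 0.
  rewrite /chi; case: pselect => // dy nK.
  have [j hj] : exists j, r ^+ 2 <= sqd z0 j (chart i y).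
    apply: contrapT => hn; apply: nK; exists (chart i y); last by rewrite chartK.
    apply: cboxP => j; have : sqd z0 j (chart i y) < r ^+ 2.
      by rewrite ltNge; apply/negP => h; apply: hn; exists j.
    rewrite /sqd /rcoord /= !mxE; move: (re _) (im _) => b d hbd.
    have := sqr_ge0 b; have := sqr_ge0 d => *.
    by split; rewrite ler_norml; apply/andP; split; nra.
  by rewrite /f (bigD1 j) //= /cutoff bstep0 // mul0r.
(* The Hausdorff property enters here: the compact set [K] is closed in [X], so the cutoff vanishes
   near every point outside it, also at points outside the chart. *)
have oK : open (~` K) by rewrite openC; exact: compact_closed.
have chi_near y : ~ K y -> \forall y' \near y, chi y' = 0.
  by move=> nK; apply: filterS (open_nbhs_nbhs (conj oK nK)) => y'; exact: chi_out.
exists chi.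
  split; last by move=> y nN; apply: chi_near => /KN.
  move=> k m.
  have oD := open_chart_image k (@open_chart_dom _ _ _ A i).
  apply: (Cn_extend0 (f := fun z => f (T k i z)) oD) => [|z /chart_imageP[h1 h2 h3]|z h nz].
  - apply: (Cn_tau oD (@openT E) (fun _ _ => I) (fun z hz => transition_diff hz)).
    by apply: Cn_prod => [|j]; [exact: openT|exact: smooth_cutoff ac _ openT m].
  - exact: chi_in.
  - have cz : (chart k @` chart_dom k) z.
      by move: h => [y' [dy _] <-]; exists y'.
    have nK : ~ K (chart_inv k z).
      move=> [z' /sub/chart_imageP[h1 h2 h3] e]; apply: nz.
      move: h => /chart_imageP[h1' _ h3']; apply/chart_imageP; split=> //.
      by rewrite -e.
    exact: (chart_inv_continuous cz (chi_near _ nK)).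
have n1 := open_nbhs_nbhs (conj (@open_chart_dom _ _ _ A i) dx).
have p0 : pdisc predT z0 (fun=> a) z0.
  by move=> j _; rewrite /sqd /rcoord /= !mxE !subrr /= expr0n /= addr0 /a; lra.
have n2 : \forall y \near x, pdisc predT z0 (fun=> a) (chart i y).
  exact: (chart_continuous dx (open_nbhs_nbhs (conj (@open_pdisc _ _ _ _ _) p0))).
apply: filterS (filterI n1 n2) => y [dy py].
rewrite chi_in // /f big1 // => j _; rewrite /cutoff bstep1 //.
by apply/ltW/py.
Qed.

Lemma cutoff_compact N K : open N -> compact K -> K `<=` N ->
  exists2 chi, good_cutoff N chi & exists W, [/\ open W, K `<=` W & forall y, W y -> chi y = 1].
Proof.
move=> oN cK KN.
pose I := {chi | good_cutoff N chi}.
have [|l hl] := @compact_finite_cover X K I (fun c => interior [set y | sval c y = 1]) cK.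
  move=> x /KN Nx; have [chi gchi h] := local_cutoff oN Nx.
  unshelve eexists; first by exists chi.
  exact: nbhs_interior.
suff [chi gchi hchi] : exists2 chi, good_cutoff N chi &
    forall y, (exists2 c : I, List.In c l & sval c y = 1) -> chi y = 1.
  exists chi => //; exists (\bigcup_(c in [set c : I | List.In c l]) interior [set y | sval c y = 1]).
  split; [by apply: bigcup_open => c _; exact: open_interior| |].
    by move=> x /hl[c cl h]; exists c.
  by move=> y [c cl h]; apply: hchi; exists c => //; exact: (interior_subset h).
elim: (l) => [|c l' [chi gchi hchi]].
  exists (fun=> 0); last by move=> y [c []].
  split=> [k m|x _]; last exact: filterS filterT.
  exact: Cn_cst (open_chart_image k openT).
exists (fun y => sval c y + chi y + (-1) * (sval c y * chi y)).
  exact: good_cutoff_join (svalP c) gchi.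
move=> y [c' [<-|cl] h]; first by rewrite h mul1r mulN1r addrK.
by rewrite (hchi y) ?mulr1 ?mulN1r ?[_ + 1]addrC ?addrK //; exists c'.
Qed.

Lemma smooth_cutoff_form p q N (om : @Defs.form R n X A p q) chi : open N -> smooth_forms N om ->
  good_cutoff N chi ->
  smooth_forms setT ((fun i z v w => chi (chart_inv i z) * om i z v w) : @Defs.form R n X A p q).
Proof.
move=> oN /smooth_formsE[h1 h2 h3] [c1 c2]; apply/smooth_formsE; split.
- move=> i z nz; apply/funext => v; apply/funext => w; rewrite h1 ?mulr0 //.
  by apply: contra_not nz; exact: chart_image_sub.
- move=> i; apply: lsmooth_local => z hz.
  have [hN|nN] := pselect (CI i N z).
    have oD := open_chart_image i oN.
    exists (CI i N), (fun z v w => chi (chart_inv i z) * om i z v w); split=> //.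
    apply: lsmooth_mul => // m; exact: (Cn_subset (chart_image_sub (@subsetT _ N)) (c1 i m)).
  have nNz : ~ N (chart_inv i z).
    by move=> Nz; apply: nN; move/chart_imageP: hz => [a1 _ a3]; apply/chart_imageP.
  have cz : (chart i @` chart_dom i) z by move: hz => [y' [dy _] <-]; exists y'.
  have n0 : \forall y \near z, chi (chart_inv i y) = 0.
    exact: (chart_inv_continuous cz (c2 _ nNz)).
  exists (interior [set y | chi (chart_inv i y) = 0]), (fun _ _ _ => 0); split.
  + exact: open_interior.
  + exact: n0.
  + exact: lsmooth0 (@open_interior _ _).
  + by move=> y v w /interior_subset /= ->; rewrite mul0r.
- move=> i j z v w hz; have [_ hj] := (chart_imageI _ _ _ _).1 hz.
  have e1 : chi (chart_inv j (T i j z)) = chi (chart_inv i z) by rewrite transition_inv.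
  have [hN|nN] := pselect (CI i N z).
    have e2 : om i z v w = pull (T i j) (om j) z v w by apply: h3; apply/chart_imageI.
    exact: (etrans (congr1 (fun x => chi (chart_inv i z) * x) e2)
      (congr1 (fun x => x * pull (T i j) (om j) z v w) (esym e1))).
  have nN' : ~ CI j N (T i j z).
    move=> /chart_imageP[_ Nz _]; apply: nN; rewrite transition_inv // in Nz.
    by move/chart_imageP: hj => [a1 _ a3]; apply/chart_imageP.
  have e2 : om i z v w = 0 by rewrite h1.
  have e3 : om j (T i j z) (v *m 'J (T i j) z) (w *m 'J (T i j) z) = 0.
    exact: (congr1 (fun f => f _ _) (h1 j _ nN')).
  have fin (a b c d : C) : b = 0 -> d = 0 -> a * b = c * d by move=> -> ->; rewrite !mulr0.
  exact: fin e2 e3.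
Qed.

Lemma smooth_soft p q N K (om : @Defs.form R n X A p q) : open N -> compact K -> K `<=` N ->
  smooth_forms N om -> exists2 om' : @Defs.form R n X A p q, smooth_forms setT om' &
    exists W, [/\ open W, K `<=` W, W `<=` N & form_res W om' = form_res W om].
Proof.
move=> oN cK KN hom; have [chi gchi [W [oW KW hW]]] := cutoff_compact oN cK KN.
exists (fun i z v w => chi (chart_inv i z) * om i z v w); first exact: smooth_cutoff_form gchi.
exists (W `&` N); split; [exact: openI|by move=> x Kx; split; [exact: KW|exact: KN]|by move=> x []|].
apply/form_res_eqP => i z /chart_imageP[_ [Wz _] _].
by apply/funext => v; apply/funext => w; rewrite hW // mul1r.
Qed.

End Cutoffs.

(** * Soft sheaves and exactness of sections *)

Section Presheaves.
Variables (K : fieldType) (X : topologicalType).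
Implicit Types (U V W N Q : set X).

(* Sheaves of subspaces [pin U] of ambient modules; as in [sheaf], only open
   sets are meaningful. *)
Record psh := Psh {
  amb : set X -> lmodType K ;
  pin : forall U, set (amb U) ;
  prs : forall U V, amb U -> amb V ;
  pin0 : forall U, open U -> pin (0 : amb U) ;
  pin_lin : forall U a (s t : amb U), open U -> pin s -> pin t -> pin (a *: s + t) ;
  prs_in : forall U V (s : amb U), open U -> open V -> V `<=` U -> pin s -> pin (prs V s) ;
  prs_lin : forall U V a (s t : amb U), open U -> open V -> V `<=` U -> pin s -> pin t ->
    prs V (a *: s + t) = a *: prs V s + prs V t ;
  prs_id : forall U (s : amb U), open U -> pin s -> prs U s = s ;
  prs_comp : forall U V W (s : amb U), open U -> open V -> open W -> V `<=` U -> W `<=` V ->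
    pin s -> prs W (prs V s) = prs W s ;
  psep : forall I (V : I -> set X) (t : amb (\bigcup_i V i)), (forall i, open (V i)) ->
    pin t -> (forall i, prs (V i) t = 0) -> t = 0 ;
  pglue : forall I (V : I -> set X) (s : forall i, amb (V i)), (forall i, open (V i)) ->
    (forall i, pin (s i)) ->
    (forall i j, prs (V i `&` V j) (s i) = prs (V i `&` V j) (s j)) ->
    exists2 t : amb (\bigcup_i V i), pin t & forall i, prs (V i) t = s i
}.

Section Sections.
Variable S : psh.

Lemma pinB U (s t : amb S U) : open U -> pin s -> pin t -> pin (s - t).
Proof. by move=> oU hs ht; rewrite addrC -scaleN1r; exact: pin_lin. Qed.

Lemma pinD U (s t : amb S U) : open U -> pin s -> pin t -> pin (s + t).
Proof. by move=> oU hs ht; rewrite -[s]scale1r; exact: pin_lin. Qed.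

Lemma prsB U V (s t : amb S U) : open U -> open V -> V `<=` U -> pin s -> pin t ->
  prs V (s - t) = prs V s - prs V t.
Proof. by move=> oU oV VU hs ht; rewrite addrC -scaleN1r prs_lin // scaleN1r addrC. Qed.

Lemma prsD U V (s t : amb S U) : open U -> open V -> V `<=` U -> pin s -> pin t ->
  prs V (s + t) = prs V s + prs V t.
Proof. by move=> oU oV VU hs ht; rewrite -[s in LHS]scale1r prs_lin // scale1r. Qed.

Lemma prs0 U V : open U -> open V -> V `<=` U -> prs V (0 : amb S U) = 0.
Proof.
move=> oU oV VU; have p0 := pin0 S oU.
by rewrite -[0 in LHS](subrr 0) prsB // subrr.
Qed.

Lemma psepU U I (V : I -> set X) (s t : amb S U) : U = \bigcup_i V i ->
  (forall i, open (V i)) -> pin s -> pin t -> (forall i, prs (V i) s = prs (V i) t) -> s = t.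
Proof.
move=> eU; subst U => oV hs ht h.
have oU : open (\bigcup_i V i) by apply: bigcup_open.
have sub i : V i `<=` \bigcup_i V i by move=> x Vx; exists i.
apply/eqP; rewrite -subr_eq0; apply/eqP; apply: psep => // [|i]; first exact: pinB.
by rewrite prsB // h subrr.
Qed.

Lemma psep_local U (s t : amb S U) : open U -> pin s -> pin t ->
  (forall x, U x -> exists V, [/\ open V, V x, V `<=` U & prs V s = prs V t]) -> s = t.
Proof.
move=> oU hs ht h.
pose I := {V | [/\ open V, V `<=` U & prs V s = prs V t]}.
apply: (@psepU U I (fun i => sval i)) => // [|i|i]; last 2 first.
- by case: (svalP i).
- by case: (svalP i).
apply/seteqP; split=> [x /h[V [oV Vx VU e]]|x [[V [oV VU e]] _ Vx]]; last exact: (VU x Vx).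
have iV : [/\ open V, V `<=` U & prs V s = prs V t] by split.
by exists (exist _ V iV).
Qed.

Lemma pglueU U I (V : I -> set X) (s : forall i, amb S (V i)) : U = \bigcup_i V i ->
  (forall i, open (V i)) -> (forall i, pin (s i)) ->
  (forall i j, prs (V i `&` V j) (s i) = prs (V i `&` V j) (s j)) ->
  exists2 t : amb S U, pin t & forall i, prs (V i) t = s i.
Proof. by move=> eU; subst U; exact: pglue. Qed.

Lemma pglue2 U V (s : amb S U) (t : amb S V) : open U -> open V -> pin s -> pin t ->
  prs (U `&` V) s = prs (U `&` V) t ->
  exists2 g : amb S (U `|` V), pin g & prs U g = s /\ prs V g = t.
Proof.
move=> oU oV hs ht e.
pose F b := if b then U else V.
pose f b : amb S (F b) := if b return amb S (F b) then s else t.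
have [g hg ge] : exists2 g : amb S (U `|` V), pin g & forall b, prs (F b) g = f b.
  apply: pglueU => [|[]|[]|[] []] //=.
  - apply/seteqP; split=> [x [?|?]|x [[] _]]; by [exists true|exists false|left|right].
  - by rewrite setIC.
by exists g => //; split; [exact: (ge true)|exact: (ge false)].
Qed.

End Sections.

Record shmap (S T : psh) := Shmap {
  pf :> forall U, amb S U -> amb T U ;
  pf_in : forall U (s : amb S U), open U -> pin s -> pin (pf s) ;
  pf_lin : forall U a (s t : amb S U), open U -> pin s -> pin t ->
    pf (a *: s + t) = a *: pf s + pf t ;
  pf_rs : forall U V (s : amb S U), open U -> open V -> V `<=` U -> pin s ->
    prs V (pf s) = pf (prs V s)
}.

Section Maps.
Variables (S T : psh) (d : shmap S T).

Lemma pfB U (s t : amb S U) : open U -> pin s -> pin t -> d U (s - t) = d U s - d U t.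
Proof. by move=> oU hs ht; rewrite addrC -scaleN1r pf_lin // scaleN1r addrC. Qed.

Lemma pfD U (s t : amb S U) : open U -> pin s -> pin t -> d U (s + t) = d U s + d U t.
Proof. by move=> oU hs ht; rewrite -[s in LHS]scale1r pf_lin // scale1r. Qed.

Lemma pf0 U : open U -> d U 0 = 0.
Proof. by move=> oU; have p0 := pin0 S oU; rewrite -[0 in LHS](subrr 0) pfB // subrr. Qed.

Definition locimg U (t : amb T U) := forall x, U x ->
  exists V (s : amb S V), [/\ open V, V x, V `<=` U, pin s & prs V t = d V s].

(** Softness of the kernel of [d], spelled out without forming the kernel as a sheaf. *)
Definition ksoft := forall N Q (s : amb S N), open N -> compact Q -> Q `<=` N ->
  pin s -> d N s = 0 -> exists s' : amb S setT, [/\ pin s', d setT s' = 0 &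
    exists W, [/\ open W, Q `<=` W, W `<=` N & prs W s' = prs W s]].

End Maps.

Definition soft (S : psh) := forall N Q (s : amb S N), open N -> compact Q -> Q `<=` N ->
  pin s -> exists2 s' : amb S setT, pin s' &
    exists W, [/\ open W, Q `<=` W, W `<=` N & prs W s' = prs W s].

Section Lifting.
Hypothesis hX : hausdorff_space X.
Hypothesis lc : forall U x, open U -> U x ->
  exists V Q, [/\ open V, V x, V `<=` Q, compact Q & Q `<=` U].
Hypothesis cc : forall U, open U -> exists B Q : nat -> set X,
  [/\ forall m, open (B m), forall m, B m `<=` Q m, forall m, compact (Q m),
      forall m, Q m `<=` U & U `<=` \bigcup_m B m].

Variables (S T : psh) (d : shmap S T).
Hypothesis ks : ksoft d.

Section FixedTarget.
Variables (U : set X) (t : amb T U).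
Hypotheses (oU : open U) (ht : pin t) (lt : locimg d t).

Definition lift_on N (s : amb S N) := [/\ open N, N `<=` U, pin s & d N s = prs N t].

Lemma lift_sub N N' (s : amb S N) : lift_on s -> open N' -> N' `<=` N ->
  lift_on (prs N' s).
Proof.
move=> [oN NU hs e] oN' N'N; split=> //; [exact: subset_trans NU|exact: prs_in|].
by rewrite -pf_rs // e prs_comp.
Qed.

Lemma lift_diff N N' (s : amb S N) (s' : amb S N') : lift_on s -> lift_on s' ->
  let D := prs (N `&` N') s - prs (N `&` N') s' in pin D /\ d _ D = 0.
Proof.
move=> h h'; have [oN _ _ _] := h; have [oN' _ _ _] := h'.
have [a1 s1 p1 e1] := lift_sub h (openI oN oN') (@subIsetl _ N N').
have [a2 s2 p2 e2] := lift_sub h' (openI oN oN') (@subIsetr _ N N').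
by move=> D; split; [exact: pinB|rewrite /D pfB // e1 e2 subrr].
Qed.

(* Correct a lift on N' by a global section of the kernel so that it agrees
   near Q with a given lift on N. *)
Lemma lift_correct Q N N' (s : amb S N) (s' : amb S N') : compact Q -> Q `<=` N -> Q `<=` N' ->
  lift_on s -> lift_on s' -> exists2 s1 : amb S N', lift_on s1 &
    exists W, [/\ open W, Q `<=` W, W `<=` N `&` N' & prs W s1 = prs W s].
Proof.
move=> cQ QN QN' h h'; have [oN NU hs es] := h; have [oN' N'U hs' es'] := h'.
have [pD dD] := lift_diff h' h; have oI := openI oN' oN.
have [k [hk dk [W [oW QW WI eW]]]] := ks oI cQ (fun x Qx => conj (QN' x Qx) (QN x Qx)) pD dD.
have r_k : pin (prs N' k) by exact: (prs_in openT).
have WN' : W `<=` N' by move=> x /WI[].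
have WN : W `<=` N by move=> x /WI[].
exists (s' - prs N' k).
  split=> //; first exact: pinB.
  by rewrite pfB // -pf_rs ?dk ?prs0 ?subr0 //; exact: openT.
exists W; split=> //; first by rewrite setIC.
rewrite prsB // [prs W (prs N' k)]prs_comp //; last exact: openT.
have sl := @subIsetl _ N' N; have sr := @subIsetr _ N' N.
rewrite eW (prsB oI oW WI (prs_in oN' oI sl hs') (prs_in oN oI sr hs)).
rewrite (prs_comp oN' oI oW sl WI hs') (prs_comp oN oI oW sr WI hs).
by rewrite opprB addrCA subrr addr0.
Qed.

(** The second lift is corrected to agree with the first on a neighbourhood [W] of the intersection
    of [Q] and [Q']. What remains of [Q] and [Q'] outside [W] is separated by disjoint open [V] and
    [V'], so the shrunken domains [M] and [M'] meet only inside [W], and the lifts glue. *)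
Lemma lift_union Q Q' : compact Q -> compact Q' ->
  (exists N (s : amb S N), Q `<=` N /\ lift_on s) ->
  (exists N (s : amb S N), Q' `<=` N /\ lift_on s) ->
  exists N (s : amb S N), Q `|` Q' `<=` N /\ lift_on s.
Proof.
move=> cQ cQ' [N [s [QN h]]] [N' [s0 [QN' h0]]].
have cl := compact_closed hX cQ; have cl' := compact_closed hX cQ'.
have cI : compact (Q `&` Q') by apply: (subclosed_compact _ cQ); [exact: closedI|exact: subIsetl].
have [s' h' [W [oW QW WN e]]] := lift_correct cI (fun x h => QN x h.1) (fun x h => QN' x h.2) h h0.
have cD P : compact P -> compact (P `&` ~` W).
  move=> cP; apply: (subclosed_compact _ cP); last exact: subIsetl.
  by apply: closedI; [exact: compact_closed|exact: open_closedC].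
have [|V [V' [oV oV' QV QV' VV']]] := hausdorff_compact_separation hX (cD Q cQ) (cD Q' cQ').
  by move=> x [[Qx nW] [Q'x _]]; apply: nW; exact: QW.
have [oN NU hs es] := h; have [oN' NU' hs' es'] := h'.
pose M := N `&` (W `|` V); pose M' := N' `&` (W `|` V').
have oM : open M by apply: openI => //; exact: openU.
have oM' : open M' by apply: openI => //; exact: openU.
have MI : M `&` M' `<=` W.
  move=> x [[_ [//|Vx]] [_ [//|V'x]]]; exfalso; exact: (VV' x).
have hM := lift_sub h oM (@subIsetl _ _ _); have hM' := lift_sub h' oM' (@subIsetl _ _ _).
have [_ MU pM dM] := hM; have [_ MU' pM' dM'] := hM'.
have [|g hg [g1 g2]] := pglue2 oM oM' pM pM'.
  have oI := openI oM oM'.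
  rewrite !prs_comp //; try exact: subIsetl; try exact: subIsetr.
  have WN1 : W `<=` N by move=> x /WN[].
  have WN2 : W `<=` N' by move=> x /WN[].
  by rewrite -(prs_comp oN oW oI WN1 MI hs) -e prs_comp.
exists (M `|` M'), g; split.
  move=> x [Qx|Qx]; [left|right].
    by split; [exact: QN|have [|nW] := pselect (W x); [left|right; apply: QV]].
  by split; [exact: QN'|have [|nW] := pselect (W x); [left|right; apply: QV']].
have oMM : open (M `|` M') by exact: openU.
have MMU : M `|` M' `<=` U by move=> x []; [exact: MU|exact: MU'].
split=> //.
apply: (@psepU T _ bool (fun b => if b then M else M')) => [|[]|||[]] //.
- by apply/seteqP; split=> [x [?|?]|x [[] _]]; by [exists true|exists false|left|right].
- exact: pf_in.
- exact: prs_in.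
- rewrite (pf_rs d oMM oM (@subsetUl _ M M') hg) g1 dM.
  by rewrite (prs_comp oU oMM oM MMU (@subsetUl _ M M') ht).
- rewrite (pf_rs d oMM oM' (@subsetUr _ M M') hg) g2 dM'.
  by rewrite (prs_comp oU oMM oM' MMU (@subsetUr _ M M') ht).
Qed.

Lemma lift_set0 : exists N (s : amb S N), set0 `<=` N /\ lift_on s.
Proof.
exists set0, 0; split=> //; split; [exact: open0|exact: sub0set|exact/pin0/open0|].
apply: psep_local => //; [exact: open0| |].
  by apply: pf_in; [exact: open0|exact/pin0/open0].
by apply: prs_in => //; exact: open0.
Qed.

Lemma lift_compact Q : compact Q -> Q `<=` U -> exists N (s : amb S N), Q `<=` N /\ lift_on s.
Proof.
move=> cQ QU.
pose I := {P | compact P /\ exists N (s : amb S N), P `<=` N /\ lift_on s}.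
have [|l hl] := @compact_finite_cover X Q I (fun i => sval i) cQ.
  move=> x /QU Ux; have [V [s [oV Vx VU hs e]]] := lt Ux.
  have [B [P [oB Bx BP cP PV]]] := lc oV Vx.
  unshelve eexists.
    exists P; split=> //; exists V, s; split=> //.
  exact: filterS BP (open_nbhs_nbhs (conj oB Bx)).
suff [P [cP lP hP]] : exists P, [/\ compact P, exists N (s : amb S N), P `<=` N /\ lift_on s &
    forall x, (exists2 i : I, List.In i l & sval i x) -> P x].
  have [N [s [PN h]]] := lP; exists N, s; split=> // x Qx.
  by apply/PN/hP/hl.
elim: (l) => [|i l' [P [cP lP hP]]].
  exists set0; split; [exact: compact0|exact: lift_set0|by move=> x [i []]].
have [ci li] := svalP i.
exists (sval i `|` P); split; [exact: compactU|exact: lift_union|].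
by move=> x [j [<-|jl] jx]; [left|right; apply: hP; exists j].
Qed.

(** Lifts near an increasing sequence of compact sets are corrected one after the other, each to
    agree with its predecessor near the previous compact set. On each member of the exhaustion the
    sequence is then constant from some stage on, and it glues. *)
Lemma lift_sections : exists2 s : amb S U, pin s & d U s = t.
Proof.
have [B [Q [oB BQ cQ QU UB]]] := cc oU.
(* Unions of the first [m] compact sets; the unions [Vm] of the corresponding open sets lie inside
   them and exhaust [U]. *)
pose Cm := fix f m := if m is m'.+1 then f m' `|` Q m' else set0.
pose Vm := fix f m := if m is m'.+1 then f m' `|` B m' else set0.
have cC m : compact (Cm m).
  by elim: m => [|m ih]; [exact: compact0|exact: compactU].
have CU m : Cm m `<=` U by elim: m => [|m ih] // x [/ih|/QU].
have oV m : open (Vm m) by elim: m => [|m ih]; [exact: open0|exact: openU].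
have VC m : Vm m `<=` Cm m by elim: m => [|m ih] // x [/ih|/BQ]; [left|right].
pose St := {N : set X & amb S N}.
pose P m (st : St) := Cm m `<=` projT1 st /\ lift_on (projT2 st).
have st0 : exists st, P 0%N st by have [N [s h]] := lift_set0; exists (existT _ N s).
have step m st : P m st -> exists st', P m.+1 st' /\ exists W, [/\ open W, Cm m `<=` W,
    W `<=` projT1 st `&` projT1 st' & prs W (projT2 st') = prs W (projT2 st)].
  case: st => N s [/= CN h]; have [N' [s' [CN' h']]] := lift_compact (cC m.+1) (CU m.+1).
  have [s1 h1 [W hW]] := lift_correct (cC m) CN (fun x hx => CN' x (or_introl hx)) h h'.
  by exists (existT _ N' s1); split=> //; exists W.
pose sq := fix f m : {st | P m st} := if m is m'.+1
  then exist (P m'.+1) (sval (cid (step m' _ (svalP (f m'))))) (proj1 (svalP (cid (step m' _ (svalP (f m'))))))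
  else exist (P 0%N) _ (svalP (cid st0)).
pose N m := projT1 (sval (sq m)); pose s m : amb S (N m) := projT2 (sval (sq m)).
have CN m : Cm m `<=` N m by case: (svalP (sq m)).
have hs m : lift_on (s m) by case: (svalP (sq m)).
have agree m : exists W, [/\ open W, Cm m `<=` W, W `<=` N m `&` N m.+1 &
    prs W (s m.+1) = prs W (s m)].
  exact: (proj2 (svalP (cid (step m _ (svalP (sq m)))))).
have VN m : Vm m `<=` N m by move=> x /VC/CN.
have hg m := lift_sub (hs m) (oV m) (VN m).
pose g m := prs (Vm m) (s m).
have VS m : Vm m `<=` Vm m.+1 by move=> x; left.
have g1 m : prs (Vm m) (g m.+1) = g m.
  have [oN NU ps ds] := hs m; have [oN' NU' ps' ds'] := hs m.+1.
  have [W [oW CW WN e]] := agree m.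
  have WN1 : W `<=` N m by move=> x /WN[].
  have WN2 : W `<=` N m.+1 by move=> x /WN[].
  have VW : Vm m `<=` W by move=> x /VC/CW.
  rewrite /g (prs_comp oN' (oV m.+1) (oV m) (VN m.+1) (VS m) ps').
  by rewrite -(prs_comp oN' oW (oV m) WN2 VW ps') e prs_comp.
have Vmono m k : Vm m `<=` Vm (k + m)%N.
  by elim: k => [|k ih] //; apply: subset_trans ih _; exact: VS.
have pg m : pin (g m) by case: (hg m).
have gk m k : prs (Vm m) (g (k + m)%N) = g m.
  elim: k => [|k ih]; first by rewrite prs_id.
  rewrite -[RHS]ih -[in RHS]g1.
  by rewrite [RHS]prs_comp //; exact: Vmono.
have [G pG eG] : exists2 G : amb S U, pin G & forall m, prs (Vm m) G = g m.
  apply: pglueU => // [|m m'].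
    apply/seteqP; split=> [x /UB[m _ Bx]|x [m _ /VC/CU]] //; by exists m.+1 => //; right.
  have sym a k : prs (Vm a `&` Vm (k + a)%N) (g a) = prs (Vm a `&` Vm (k + a)%N) (g (k + a)%N).
    rewrite -{1}(gk a k).
    exact: (prs_comp (oV _) (oV a) (openI (oV a) (oV _)) (Vmono a k) (@subIsetl _ _ _) (pg _)).
  case: (leqP m m') => h; first by have := sym m (m' - m)%N; rewrite subnK.
  by have := sym m' (m - m')%N; rewrite (subnK (ltnW h)) setIC => ->.
exists G => //.
apply: (@psepU T _ nat Vm) => //.
- apply/seteqP; split=> [x /UB[m _ Bx]|x [m _ /VC/CU]] //; by exists m.+1 => //; right.
- exact: pf_in.
- move=> m; have VU : Vm m `<=` U by move=> x /VC/CU.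
  by rewrite pf_rs // eG; case: (hg m).
Qed.

End FixedTarget.
End Lifting.
End Presheaves.

(** * Injectivity of sheaves of functions *)

Section LinearExtension.
Variables (K : fieldType) (V M : lmodType K).
Implicit Types (G : V -> M -> Prop).

(** The graph of a linear map defined on a subspace, with the third clause making it single-valued.
    Graphs are ordered by inclusion, as Zorn's lemma wants. *)
Definition linrel G := [/\ G 0 0,
  forall a v m v' m', G v m -> G v' m' -> G (a *: v + v') (a *: m + m') &
  forall m, G 0 m -> m = 0].

Lemma linrelZ G a v m : linrel G -> G v m -> G (a *: v) (a *: m).
Proof. by move=> [h0 h _] hv; have := h a _ _ _ _ hv h0; rewrite !addr0. Qed.

Lemma linrel_fun G v m m' : linrel G -> G v m -> G v m' -> m = m'.
Proof.
move=> [h0 h hf] hm hm'; have := h (-1) _ _ _ _ hm' hm.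
rewrite scaleN1r addNr scaleN1r => /hf/eqP.
by rewrite addrC subr_eq0 => /eqP.
Qed.

Definition adjoin (D : V -> M -> Prop) (v0 : V) : V -> M -> Prop := fun v m => exists c w, D w m /\ v = w + c *: v0.

Lemma linrel_adjoin D v0 : linrel D -> ~ (exists m, D v0 m) -> linrel (adjoin D v0).
Proof.
move=> hD nv; have [h0 h hf] := hD; split.
- by exists 0, 0; rewrite scale0r addr0.
- move=> a v m v' m' [c [w [hw ->]]] [c' [w' [hw' ->]]].
  exists (a * c + c'), (a *: w + w'); split; first exact: h.
  by rewrite scalerDr scalerDl scalerA addrACA.
- move=> m [c [w [hw e]]]; have [c0|c0] := eqVneq c 0.
    by move: e; rewrite c0 scale0r addr0 => e; apply: hf; rewrite e.
  case: nv; exists ((- c^-1) *: m).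
  have -> : v0 = (- c^-1) *: w; last exact: linrelZ.
  have -> : w = - (c *: v0) by apply/eqP; rewrite -addr_eq0 -e.
  by rewrite scalerN scaleNr opprK scalerA mulVf // scale1r.
Qed.

(** In the maximality argument a new vector is sent to 0, so extending never enlarges the range; the
    third conclusion records this for [quotient_map]. *)
Lemma linear_extension G : linrel G -> exists H : V -> M,
  [/\ forall a v v', H (a *: v + v') = a *: H v + H v',
      forall v m, G v m -> H v = m & forall v, exists v', G v' (H v)].
Proof.
move=> hG.
pose P D := [/\ linrel D, forall v m, G v m -> D v m &
  forall v m, D v m -> exists v', G v' m].
have PG : P G by split=> // v m h; exists v.
pose R (D D' : {D | P D}) := `[< forall v m, sval D v m -> sval D' v m >].
have [| | | |[D [hD GD rD]] Dmax] := @Zorn {D | P D} R.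
- by move=> D; apply/asboolP.
- by move=> D1 D2 D3 /asboolP h1 /asboolP h2; apply/asboolP => v m /h1/h2.
- move=> [D1 p1] [D2 p2] /asboolP /= h1 /asboolP /= h2; apply: eq_exist.
  by apply/funext => v; apply/funext => m; apply/propext; split=> [/h1|/h2].
- move=> F tF; have [[D0 FD0]|nF] := pselect (exists D0, F D0); last first.
    by exists (exist _ _ PG) => D FD; case: nF; exists D.
  pose D v m := exists2 D1, F D1 & sval D1 v m.
  suff pD : P D by exists (exist _ _ pD) => D1 FD1; apply/asboolP => v m h; exists D1.
  split; first split.
  + by exists D0 => //; case: (svalP D0) => -[].
  + move=> a v m v' m' [D1 F1 h1] [D2 F2 h2].
    have [/asboolP h|/asboolP h] := tF D1 D2 F1 F2.
      exists D2 => //; case: (svalP D2) => -[_ hh _] _ _; exact: hh (h _ _ h1) h2.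
    exists D1 => //; case: (svalP D1) => -[_ hh _] _ _; exact: hh h1 (h _ _ h2).
  + by move=> m [D1 F1 h1]; case: (svalP D1) => -[_ _ hh] _ _; exact: hh.
  + by move=> v m h; exists D0 => //; case: (svalP D0) => _ hh _; exact: hh.
  + by move=> v m [D1 F1 h1]; case: (svalP D1) => _ _ hh; exact: hh h1.
have tot v : exists m, D v m.
  apply: contrapT => nv.
  have pA : P (adjoin D v).
    split; first exact: linrel_adjoin.
      by move=> w m /GD h; exists 0, w; rewrite scale0r addr0.
    by move=> w m [c [w' [h _]]]; exact: rD h.
  have RA : R (exist _ D (And3 hD GD rD)) (exist _ _ pA).
    by apply/asboolP => w m /= h; exists 0, w; rewrite scale0r addr0.
  have eD : adjoin D v = D by exact: (congr1 sval (Dmax _ RA)).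
  apply: nv; exists 0; have : adjoin D v v 0; last by rewrite [adjoin D v]eD.
  by exists 1, 0; split; [have [] := hD|rewrite scale1r add0r].
pose H v := sval (cid (tot v)).
have HD v : D v (H v) := svalP (cid (tot v)).
exists H; split=> [a v v'|v m h|v].
- have [_ h _] := hD; exact: (linrel_fun hD (HD _) (h _ _ _ _ _ (HD v) (HD v'))).
- exact: (linrel_fun hD (HD _) (GD _ _ h)).
- exact: rD (HD v).
Qed.

End LinearExtension.

(** * Quotients of a module, realized inside the module *)

Section QuotientMap.
Variables (K : fieldType) (V : lmodType K).

Definition lin_subspace (S : set V) := S 0 /\ forall a s t, S s -> S t -> S (a *: s + t).

(** Extending the identity of [S] without enlarging its range gives a projection [H] onto [S]; then
    [v - H v] has kernel [S] and stands for the class of [v]. *)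
Lemma quotient_map (S : set V) : lin_subspace S -> exists P : V -> V,
  (forall a v v', P (a *: v + v') = a *: P v + P v') /\ forall v, P v = 0 <-> S v.
Proof.
move=> [S0 SD].
have [|H [h1 h2 h3]] := @linear_extension K V V (fun v m => S v /\ m = v).
  split=> [|a v m v' m' [s ->] [s' ->]|m []] //.
  by split=> //; exact: SD.
exists (fun v => v - H v); split=> [a v v'|v].
  by rewrite h1 scalerBr opprD addrACA.
split=> [/eqP|Sv]; last by rewrite (h2 v v) ?subrr.
rewrite subr_eq0 => /eqP ->; have [v' [Sv' e]] := h3 v.
by rewrite e.
Qed.

Definition qmap (S : set V) : V -> V :=
  if pselect (lin_subspace S) is left h then sval (cid (quotient_map h)) else fun=> 0.

Lemma qmap_lin S a v v' : qmap S (a *: v + v') = a *: qmap S v + qmap S v'.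
Proof.
rewrite /qmap; case: pselect => [h|_]; last by rewrite scaler0 addr0.
exact: (proj1 (svalP (cid (quotient_map h)))).
Qed.

Lemma qmap_ker S v : lin_subspace S -> qmap S v = 0 <-> S v.
Proof.
move=> hS; rewrite /qmap; case: pselect => // h.
exact: (proj2 (svalP (cid (quotient_map h)))).
Qed.

Lemma qmap_eq S v v' : lin_subspace S -> S (v - v') -> qmap S v = qmap S v'.
Proof.
move=> hS /(qmap_ker _ hS).2; rewrite addrC -scaleN1r qmap_lin scaleN1r addrC => /eqP.
by rewrite subr_eq0 => /eqP.
Qed.

End QuotientMap.

Section FunctionSheaf.
Variables (K : fieldType) (X : topologicalType).
Implicit Types (U V W N : set X) (x : X).

Section PshOfSheaf.
Variable F : sheaf K X.

Lemma sheaf_sep I (V : I -> set X) (t : F (\bigcup_i V i)) : (forall i, open (V i)) ->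
  (forall i, rst F _ (V i) t = 0) -> t = 0.
Proof.
move=> oV h.
have [t0 [h0 u0]] := @sheaf_glue _ _ F I V (fun i => 0) oV
  (fun i j => etrans (raddf0 _) (esym (raddf0 _))).
by rewrite -(u0 t h) (u0 0) // => i; exact: raddf0.
Qed.

Definition psh_of_sheaf : psh K X.
Proof.
unshelve refine (@Psh K X (fun U => F U) (fun U => setT) (fun U V => rst F U V)
  _ _ _ _ _ _ _ _) => //.
- by move=> U V a s t _ _ _ _ _; exact: linearP.
- by move=> U s oU _; exact: rst_id.
- by move=> U V W s oU oV oW VU WV _; exact: rst_comp.
- by move=> I V t oV _ h; exact: sheaf_sep h.
- move=> I V s oV _ h; have [t [ht _]] := sheaf_glue oV h.
  by exists t.
Defined.

End PshOfSheaf.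

Variable M : lmodType K.

Definition fsec U : lmodType K := {x | U x} -> M.

Definition ext0 U (s : {x | U x} -> M) : X -> M :=
  fun x => if pselect (U x) is left h then s (exist _ x h) else 0.

Lemma ext0_in U (s : {x | U x} -> M) (y : {x | U x}) : ext0 s (sval y) = s y.
Proof.
case: y => x h /=; rewrite /ext0; case: pselect => // h'.
by congr s; exact: eq_exist.
Qed.

Lemma ext0_lin U a (s t : fsec U) x : ext0 (a *: s + t) x = a *: ext0 s x + ext0 t x.
Proof. by rewrite /ext0; case: pselect => // _; rewrite scaler0 addr0. Qed.

Lemma ext0_0 U x : ext0 (0 : fsec U) x = 0.
Proof. by rewrite /ext0; case: pselect. Qed.

Definition frs U V (s : fsec U) : fsec V := fun y => ext0 s (sval y).
Arguments frs {U} V s.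

Lemma ext0_frs U V (s : fsec U) x : V x -> ext0 (frs V s) x = ext0 s x.
Proof. by move=> Vx; rewrite -[x in LHS]/(sval (exist V x Vx)) ext0_in. Qed.

Lemma frs_is_linear U V : linear (@frs U V).
Proof. by move=> a s t; apply/funext => y; exact: ext0_lin. Qed.

HB.instance Definition _ U V :=
  GRing.isLinear.Build K (fsec U) (fsec V) *:%R (@frs U V) (@frs_is_linear U V).

Definition fsheaf : sheaf K X.
Proof.
unshelve refine (@Build_sheaf K X fsec (fun U V => @frs U V : {linear fsec U -> fsec V}) _ _ _).
- by move=> U s oU; apply/funext => y; exact: ext0_in.
- by move=> U V W s oU oV oW VU WV; apply/funext => -[y Wy]; exact: ext0_frs (WV _ Wy).
- move=> I V s oV h.
  pose t : fsec (\bigcup_i V i) := fun y => ext0 (s (sval (cid2 (svalP y)))) (sval y).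
  have tE i (y : {x | V i x}) : frs (V i) t y = s i y.
    have Uy : (\bigcup_i V i) (sval y) by exists i => //; exact: svalP.
    have -> : frs (V i) t y = t (exist _ (sval y) Uy).
      by rewrite /frs -[sval y in LHS]/(sval (exist _ (sval y) Uy)) ext0_in.
    rewrite /t /=; case: (cid2 _) => j /= _ Vj.
    have := congr1 (fun f => ext0 f (sval y)) (h j i).
    rewrite !ext0_frs; try by split=> //; exact: svalP.
    by move=> ->; rewrite ext0_in.
  exists t; split=> [i|t' ht']; first by apply/funext => y; exact: tE.
  apply/funext => -[y Uy]; have [i _ Vi] := Uy.
  have e (f : fsec (\bigcup_i V i)) : frs (V i) f (exist _ y Vi) = f (exist _ y Uy).
    exact: (ext0_in f (exist _ y Uy)).
  have h' : frs (V i) t' (exist _ y Vi) = s i (exist _ y Vi).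
    exact: (congr1 (fun f : fsec (V i) => f (exist _ y Vi)) (ht' i)).
  exact: (etrans (esym (e t)) (etrans (tE i (exist _ y Vi)) (etrans (esym h') (e t')))).
Defined.

Lemma fsheaf_flabby : flabby fsheaf.
Proof.
move=> U s oU; exists (fun y => ext0 s (sval y)); apply/funext => y.
apply: etrans (ext0_in s y).
exact: (@ext0_in setT (fun y => ext0 s (sval y)) (exist _ (sval y) I)).
Qed.

Definition fpsh := psh_of_sheaf fsheaf.

Section Extension.
Variables (S T : psh K X) (d : shmap S T) (g : shmap S fpsh).
Hypothesis gd : forall U (s : amb S U), open U -> pin s -> d U s = 0 -> g U s = 0.
Hypothesis softT : soft T.

(** Germs at [x] are represented by global sections. Softness, applied to the compact set consisting
    of [x], provides representatives. *)
Definition germ_at x U (t : amb T U) (t' : amb T setT) :=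
  pin t' /\ exists W, [/\ open W, W x, W `<=` U & prs W t' = prs W t].

Lemma germ_ex x U (t : amb T U) : open U -> pin t -> U x -> exists t', germ_at x t t'.
Proof.
move=> oU ht Ux.
have [|t' ht' [W [oW xW WU e]]] := softT oU (@compact_set1 _ x) _ ht.
  by move=> _ ->.
by exists t'; split=> //; exists W; split=> //; exact: xW.
Qed.

(** The partial map on germs sending the image of [s] under [d] to the value of [g s] at [x]; it is
    single-valued because [g] kills what [d] kills. *)
Definition germ_rel x (t : amb T setT) (m : M) := exists N (s : amb S N),
  [/\ open N, N x, pin s, pin t & prs N t = d N s] /\ m = ext0 (g N s) x.

Lemma ext0_g N N' (s : amb S N) x : open N -> open N' -> N' `<=` N -> pin s -> N' x ->
  ext0 (g N' (prs N' s)) x = ext0 (g N s) x.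
Proof. by move=> oN oN' NN hs N'x; rewrite -(pf_rs g oN oN' NN hs); exact: ext0_frs. Qed.

Lemma linrel_germ x : linrel (germ_rel x).
Proof.
split.
- exists setT, 0; split; last by rewrite (pf0 g openT) ext0_0.
  split=> //; [exact: openT|exact/pin0/openT|exact/pin0/openT|].
  by rewrite (pf0 d openT) prs0 //; exact: openT.
- move=> a t m t' m' [N [s [[oN Nx hs ht e] ->]]] [N' [s' [[oN' N'x hs' ht' e'] ->]]].
  have oI := openI oN oN'; have sl := @subIsetl _ N N'; have sr := @subIsetr _ N N'.
  have p1 := prs_in oN oI sl hs; have p2 := prs_in oN' oI sr hs'.
  have Ix : (N `&` N') x by [].
  exists (N `&` N'), (a *: prs (N `&` N') s + prs (N `&` N') s'); split; last first.
    rewrite (pf_lin g a oI p1 p2) ext0_lin.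
    by rewrite (ext0_g oN oI sl hs Ix) (ext0_g oN' oI sr hs' Ix).
  split=> //; [exact: pin_lin|exact: (pin_lin _ openT)|].
  rewrite (pf_lin d a oI p1 p2) (prs_lin a openT oI (@subsetT _ _) ht ht').
  rewrite -(prs_comp openT oN oI (@subsetT _ _) sl ht) -(prs_comp openT oN' oI (@subsetT _ _) sr ht').
  by rewrite e e' !pf_rs.
- move=> m [N [s [[oN Nx hs _ e] ->]]].
  rewrite (gd oN hs) ?ext0_0 // -e prs0 //; exact: openT.
Qed.

Definition germ_ext x : amb T setT -> M := sval (cid (linear_extension (linrel_germ x))).

Lemma germ_ext_lin x a t t' : germ_ext x (a *: t + t') = a *: germ_ext x t + germ_ext x t'.
Proof. have [h _ _] := svalP (cid (linear_extension (linrel_germ x))); exact: h. Qed.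

Lemma germ_ext_val x t m : germ_rel x t m -> germ_ext x t = m.
Proof. have [_ h _] := svalP (cid (linear_extension (linrel_germ x))); exact: h. Qed.

Lemma germ_ext_eq x U (t : amb T U) t1 t2 : open U -> pin t ->
  germ_at x t t1 -> germ_at x t t2 -> germ_ext x t1 = germ_ext x t2.
Proof.
move=> oU ht [h1 [W1 [oW1 xW1 WU1 e1]]] [h2 [W2 [oW2 xW2 WU2 e2]]].
have oI := openI oW1 oW2; have sl := @subIsetl _ W1 W2; have sr := @subIsetr _ W1 W2.
have p12 : pin (t1 - t2) := pinB openT h1 h2.
have : germ_ext x (t1 - t2) = 0.
  apply: germ_ext_val; exists (W1 `&` W2), 0; split; last by rewrite (pf0 g oI) ext0_0.
  split=> //; first exact: pin0.
  rewrite (pf0 d oI) (prsB openT oI (@subsetT _ _) h1 h2).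
  rewrite -(prs_comp openT oW1 oI (@subsetT _ _) sl h1) e1 (prs_comp oU oW1 oI WU1 sl ht).
  rewrite -(prs_comp openT oW2 oI (@subsetT _ _) sr h2) e2 (prs_comp oU oW2 oI WU2 sr ht).
  by rewrite subrr.
by rewrite addrC -scaleN1r germ_ext_lin scaleN1r addrC => /eqP; rewrite subr_eq0 => /eqP.
Qed.

Definition ext_map U (t : amb T U) : fsec U := fun y =>
  if pselect (open U /\ pin t) is left a
  then germ_ext (sval y) (sval (cid (germ_ex (proj1 a) (proj2 a) (svalP y)))) else 0.

Lemma ext_mapE U (t : amb T U) (y : {x | U x}) t' : open U -> pin t ->
  germ_at (sval y) t t' -> ext_map t y = germ_ext (sval y) t'.
Proof.
move=> oU ht h; rewrite /ext_map; case: pselect => [a|[]] //.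
case: cid => t1 /= h1; exact: germ_ext_eq oU ht h1 h.
Qed.

(** A section of the target is an arbitrary function, so the values prescribed by the linear maps
    [germ_ext x] at the various points need no compatibility. *)
Lemma shmap_extension : exists h : shmap T fpsh,
  forall U (s : amb S U), open U -> pin s -> h U (d U s) = g U s.
Proof.
unshelve eexists.
  unshelve refine (@Shmap K X T fpsh (fun U t => ext_map t) _ _ _) => //.
  - move=> U a s t oU hs ht; apply/funext => y.
    have [s1 gs] := germ_ex oU hs (svalP y); have [t1 gt] := germ_ex oU ht (svalP y).
    have -> : ext_map (a *: s + t) y = germ_ext (sval y) (a *: s1 + t1).
      apply: ext_mapE => //; first exact: pin_lin.
      move: gs gt => [h1 [W1 [oW1 xW1 WU1 e1]]] [h2 [W2 [oW2 xW2 WU2 e2]]].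
      have oI := openI oW1 oW2; have sl := @subIsetl _ W1 W2; have sr := @subIsetr _ W1 W2.
      have IU : W1 `&` W2 `<=` U by move=> x [/WU1].
      split; first exact: (pin_lin _ openT).
      exists (W1 `&` W2); split=> //.
      rewrite (prs_lin a openT oI (@subsetT _ _) h1 h2) (prs_lin a oU oI IU hs ht).
      rewrite -(prs_comp openT oW1 oI (@subsetT _ _) sl h1) e1 (prs_comp oU oW1 oI WU1 sl hs).
      by rewrite -(prs_comp openT oW2 oI (@subsetT _ _) sr h2) e2 (prs_comp oU oW2 oI WU2 sr ht).
    by rewrite germ_ext_lin -(ext_mapE oU hs gs) -(ext_mapE oU ht gt).
  - move=> U V s oU oV VU hs; apply/funext => y.
    have Uy : U (sval y) := VU _ (svalP y).
    have [s1 gs] := germ_ex oU hs Uy.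
    have -> : prs (p := fpsh) V (ext_map s) y = ext_map s (exist _ (sval y) Uy).
      exact: (ext0_in (ext_map s) (exist _ (sval y) Uy)).
    rewrite (@ext_mapE U s (exist _ (sval y) Uy) s1 oU hs gs); symmetry.
    apply: ext_mapE; [exact: oV|exact: prs_in|].
    move: gs => [h1 [W1 [oW1 xW1 WU1 e1]]]; have oI := openI oW1 oV.
    split=> //; exists (W1 `&` V); split=> //; first exact: (conj xW1 (svalP y)).
    rewrite (prs_comp oU oV oI VU (@subIsetr _ _ _) hs).
    by rewrite -(prs_comp openT oW1 oI (@subsetT _ _) (@subIsetl _ _ _) h1) e1 (prs_comp oU oW1 oI WU1 (@subIsetl _ _ _) hs).
move=> U s oU hs /=; apply/funext => y.
have hd := pf_in d oU hs.
have [t1 gt] := germ_ex oU hd (svalP y).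
rewrite (ext_mapE oU hd gt); case: gt => h1 [W [oW xW WU e]].
rewrite (@germ_ext_val _ _ (g U s y)) //.
exists W, (prs W s); split.
  split=> //; first exact: (prs_in oU oW WU hs).
  by rewrite e pf_rs.
by rewrite (ext0_g oU oW WU hs xW) ext0_in.
Qed.

End Extension.
End FunctionSheaf.

(** * Resolutions, chain maps and homotopies *)

Section Resolutions.
Variables (K : fieldType) (X : topologicalType).
Implicit Types (U V W N : set X) (x : X).

Definition shcomp (S T Q : psh K X) (f : shmap S T) (g : shmap T Q) : shmap S Q.
Proof.
unshelve refine (@Shmap K X S Q (fun U s => g U (f U s)) _ _ _).
- by move=> U s oU hs; apply: pf_in => //; exact: pf_in.
- by move=> U a s t oU hs ht; rewrite pf_lin // pf_lin //; exact: pf_in.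
- by move=> U V s oU oV VU hs; rewrite pf_rs ?pf_rs //; exact: pf_in.
Defined.

Definition shsub (S T : psh K X) (f g : shmap S T) : shmap S T.
Proof.
unshelve refine (@Shmap K X S T (fun U s => f U s - g U s) _ _ _).
- by move=> U s oU hs; apply: pinB => //; exact: pf_in.
- by move=> U a s t oU hs ht; rewrite !pf_lin // scalerBr opprD addrACA.
- by move=> U V s oU oV VU hs; rewrite prsB ?pf_rs //; exact: pf_in.
Defined.

Lemma locimg_kill (S T Q : psh K X) (d : shmap S T) (f : shmap T Q) U (s : amb T U) :
  (forall V (a : amb S V), open V -> pin a -> f V (d V a) = 0) ->
  open U -> pin s -> locimg d s -> f U s = 0.
Proof.
move=> h oU hs ls; apply: psep_local => //; [exact: pf_in|exact: pin0|].
move=> x /ls[V [a [oV Vx VU ha e]]]; exists V; split=> //.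
by rewrite pf_rs // e h // prs0.
Qed.

Variable O : psh K X.

Record ecs := Ecs {
  et : nat -> psh K X ;
  eaug : shmap O (et 0) ;
  ed : forall q, shmap (et q) (et q.+1) ;
  e_inj : forall U (s : amb O U), open U -> pin s -> eaug U s = 0 -> s = 0 ;
  e_ad : forall U (s : amb O U), open U -> pin s -> ed 0 U (eaug U s) = 0 ;
  e_dd : forall q U (s : amb (et q) U), open U -> pin s -> ed q.+1 U (ed q U s) = 0 ;
  e_ex0 : forall U (s : amb (et 0) U), open U -> pin s -> ed 0 U s = 0 -> locimg eaug s ;
  e_exS : forall q U (s : amb (et q.+1) U), open U -> pin s -> ed q.+1 U s = 0 ->
    locimg (ed q) s
}.

Record cmap (A B : ecs) := Cmap {
  cm : forall q, shmap (et A q) (et B q) ;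
  cm_aug : forall U (s : amb O U), open U -> pin s -> cm 0 U (eaug A U s) = eaug B U s ;
  cm_d : forall q U (s : amb (et A q) U), open U -> pin s ->
    cm q.+1 U (ed A q U s) = ed B q U (cm q U s)
}.

(** Injectivity relative to maps into soft sheaves. Exactness and injectivity of [d] are replaced by
    the condition that [g] vanishes on the kernel of [d], the form in which both chain maps and
    homotopies are extended. *)
Definition sh_injective (Q : psh K X) := forall (S T : psh K X) (d : shmap S T) (g : shmap S Q),
  (forall U (s : amb S U), open U -> pin s -> d U s = 0 -> g U s = 0) -> soft T ->
  exists h : shmap T Q, forall U (s : amb S U), open U -> pin s -> h U (d U s) = g U s.

Section Comparison.
Variables A L : ecs.
Hypothesis injL : forall q, sh_injective (et L q).
Hypothesis softA : forall q, soft (et A q).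

Lemma chain_map_exists : exists _ : cmap A L, True.
Proof.
(* The invariant carried by the recursion: composed with the next differential of [L], the map kills
   the kernel of the next differential of [A], which is the condition for the next extension. *)
pose Q q (f : shmap (et A q) (et L q)) := forall U (s : amb (et A q) U), open U -> pin s ->
  ed A q U s = 0 -> ed L q U (f U s) = 0.
have [a0 ha0] : exists a0 : shmap (et A 0) (et L 0),
    forall U (s : amb O U), open U -> pin s -> a0 U (eaug A U s) = eaug L U s.
  have gd U (s : amb O U) : open U -> pin s -> eaug A U s = 0 -> eaug L U s = 0.
    by move=> oU hs /(e_inj oU hs) ->; exact: pf0.
  exact: (@injL 0%N O (et A 0) (eaug A) (eaug L) gd (@softA 0%N)).
have Q0 : Q 0%N a0.
  move=> U s oU hs /(e_ex0 oU hs) ls.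
  apply: (locimg_kill (f := shcomp a0 (ed L 0)) _ oU hs ls) => V o oV ho /=.
  rewrite ha0 //; exact: (@e_ad L V o oV ho).
have step q f : Q q f -> exists2 f' : shmap (et A q.+1) (et L q.+1), Q q.+1 f' &
    forall U (s : amb (et A q) U), open U -> pin s ->
      f' U (ed A q U s) = ed L q U (f U s).
  move=> Qf.
  have [f' hf'] := @injL q.+1 _ _ (ed A q) (shcomp f (ed L q)) Qf (@softA q.+1).
  exists f' => // U s oU hs /(e_exS oU hs) ls.
  apply: (locimg_kill (f := shcomp f' (ed L q.+1)) _ oU hs ls) => V b oV hb /=.
  rewrite hf' //; exact: (@e_dd L q V (f V b) oV (pf_in f oV hb)).
pose sq := fix g q : {f | Q q f} := if q is q'.+1
  then exist (Q q'.+1) (s2val (cid2 (step q' _ (svalP (g q')))))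
    (s2valP (cid2 (step q' _ (svalP (g q')))))
  else exist (Q 0%N) a0 Q0.
unshelve eexists => //.
unshelve refine (@Cmap A L (fun q => sval (sq q)) ha0 _).
by move=> q U s oU hs; exact: (s2valP' (cid2 (step q _ (svalP (sq q)))) U s oU hs).
Qed.

Variables phi psi : cmap A L.

(** As for chain maps: the next homotopy extends [phi - psi] minus the contribution of the previous
    one, a map that kills cocycles because these are locally coboundaries. *)
Lemma homotopy_exists : exists h : forall q, shmap (et A q.+1) (et L q),
  (forall U (s : amb (et A 0) U), open U -> pin s ->
     cm phi 0 U s - cm psi 0 U s = h 0%N U (ed A 0 U s)) /\
  (forall q U (s : amb (et A q.+1) U), open U -> pin s ->
     cm phi q.+1 U s - cm psi q.+1 U s - ed L q U (h q U s) = h q.+1 U (ed A q.+1 U s)).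
Proof.
pose g q (h : shmap (et A q.+1) (et L q)) :=
  shsub (shsub (cm phi q.+1) (cm psi q.+1)) (shcomp h (ed L q)).
pose P q h := forall U (s : amb (et A q.+1) U), open U -> pin s ->
  ed A q.+1 U s = 0 -> g q h U s = 0.
have [h0 hh0] : exists h0 : shmap (et A 1) (et L 0),
    forall U (s : amb (et A 0) U), open U -> pin s ->
      h0 U (ed A 0 U s) = cm phi 0 U s - cm psi 0 U s.
  have gd U (s : amb (et A 0) U) : open U -> pin s -> ed A 0 U s = 0 ->
      shsub (cm phi 0) (cm psi 0) U s = 0.
    move=> oU hs /(e_ex0 oU hs) ls.
    apply: (locimg_kill _ oU hs ls) => V o oV ho /=.
    by rewrite !cm_aug // subrr.
  have [h hh] := @injL 0%N _ _ (ed A 0) (shsub (cm phi 0) (cm psi 0)) gd (@softA 1%N).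
  by exists h.
have P0 : P 0%N h0.
  move=> U s oU hs /(e_exS oU hs) ls; apply: (locimg_kill _ oU hs ls) => V b oV hb /=.
  have e : g 0%N h0 V (ed A 0 V b) = cm phi 1 V (ed A 0 V b) - cm psi 1 V (ed A 0 V b) -
    ed L 0 V (h0 V (ed A 0 V b)) := erefl.
  have e1 := pfB (ed L 0) oV (pf_in (cm phi 0) oV hb) (pf_in (cm psi 0) oV hb).
  apply: etrans e _; rewrite (hh0 V b oV hb) (cm_d phi oV hb) (cm_d psi oV hb).
  by apply/eqP; rewrite subr_eq0 e1.
have step q h : P q h -> exists2 h' : shmap (et A q.+2) (et L q.+1), P q.+1 h' &
    forall U (s : amb (et A q.+1) U), open U -> pin s ->
    h' U (ed A q.+1 U s) = cm phi q.+1 U s - cm psi q.+1 U s - ed L q U (h U s).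
  move=> Ph; have [h' hh'] := @injL q.+1 _ _ (ed A q.+1) (g q h) Ph (@softA q.+2).
  exists h' => // U s oU hs /(e_exS oU hs) ls; apply: (locimg_kill _ oU hs ls) => V b oV hb /=.
  have e : g q.+1 h' V (ed A q.+1 V b) = cm phi q.+2 V (ed A q.+1 V b) -
    cm psi q.+2 V (ed A q.+1 V b) - ed L q.+1 V (h' V (ed A q.+1 V b)) := erefl.
  have p1 := pf_in (cm phi q.+1) oV hb; have p2 := pf_in (cm psi q.+1) oV hb.
  have p3 := pf_in (ed L q) oV (pf_in h oV hb).
  have e1 := pfB (ed L q.+1) oV (pinB oV p1 p2) p3.
  have e2 := pfB (ed L q.+1) oV p1 p2.
  have e3 : ed L q.+1 V (ed L q V (h V b)) = 0 := @e_dd L q V (h V b) oV (pf_in h oV hb).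
  apply: etrans e _; rewrite (hh' V b oV hb) (cm_d phi oV hb) (cm_d psi oV hb).
  by apply/eqP; rewrite subr_eq0 e1 e2 e3 subr0.
pose sq := fix f q : {h | P q h} := if q is q'.+1
  then exist (P q'.+1) (s2val (cid2 (step q' _ (svalP (f q')))))
    (s2valP (cid2 (step q' _ (svalP (f q')))))
  else exist (P 0%N) h0 P0.
exists (fun q => sval (sq q)); split=> [U s oU hs|q U s oU hs].
  by rewrite /= hh0.
by rewrite [RHS](s2valP' (cid2 (step q _ (svalP (sq q)))) U s oU hs).
Qed.

End Comparison.

(** * The resolution by sheaves of arbitrary functions *)

Section InjectiveResolution.
Variables (V0 : lmodType K) (iota : shmap O (@fpsh K X V0)).
Hypothesis iota_inj : forall U (s : amb O U), open U -> pin s -> iota U s = 0 -> s = 0.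

(** A germ of functions with values in [LM q] is represented by a function on all of [X]. So
    [X -> LM q], read modulo a subspace at each point, is large enough to house every stalk of the
    cokernel in degree [q]. *)
Fixpoint LM (q : nat) : lmodType K := if q is q'.+1 then (X -> LM q' : lmodType K) else V0.

(** The functions whose germ at [x] comes from the preceding term: from [O] in degree 0, from the
    differential afterwards. *)
Fixpoint LS (q : nat) : X -> set (X -> LM q) :=
  match q return X -> set (X -> LM q) with
  | 0 => fun x => [set s | exists N (o : amb O N),
      [/\ open N, N x, pin o & forall y, N y -> s y = ext0 (iota N o) y]]
  | q'.+1 => fun x => [set s | exists N (a : X -> LM q'),
      [/\ open N, N x & forall y, N y -> s y = @qmap K (X -> LM q') (@LS q' y) a]]
  end.

Lemma qmap0 (V : lmodType K) (S : set V) : qmap S 0 = 0.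
Proof. by have := qmap_lin S (-1) 0 0; rewrite scaler0 addr0 scaleN1r addNr. Qed.

Lemma LS_zero q x (s : X -> LM q) N : open N -> N x -> (forall y, N y -> s y = 0) -> LS x s.
Proof.
case: q s => [|q] s oN Nx h.
  exists N, 0; split=> //; first exact: pin0.
  by move=> y /h ->; rewrite (pf0 iota oN) ext0_0.
by exists N, 0; split=> // y /h ->; rewrite qmap0.
Qed.

Lemma LS_subspace q x : @lin_subspace K (X -> LM q) (@LS q x).
Proof.
split; first by apply: (LS_zero (N := setT)) => //; exact: openT.
case: q => [|q] a s t.
  move=> [N [m [oN Nx ho e]]] [N' [m' [oN' N'x ho' e']]].
  have oI := openI oN oN'; have sl := @subIsetl _ N N'; have sr := @subIsetr _ N N'.
  have p1 := prs_in oN oI sl ho; have p2 := prs_in oN' oI sr ho'.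
  exists (N `&` N'), (a *: prs (N `&` N') m + prs (N `&` N') m'); split=> //; first exact: pin_lin.
  move=> y Iy; have [Ny N'y] := Iy; rewrite (pf_lin iota a oI p1 p2) ext0_lin.
  rewrite (ext0_g iota oN oI sl ho Iy) (ext0_g iota oN' oI sr ho' Iy).
  by rewrite -e // -e'.
move=> [N [b [oN Nx e]]] [N' [b' [oN' N'x e']]].
exists (N `&` N'), (a *: b + b'); split=> //; first exact: openI.
by move=> y [Ny N'y]; rewrite qmap_lin -e // -e'.
Qed.

Lemma qmap_LS_eq q x (s t : X -> LM q) N : open N -> N x -> (forall y, N y -> s y = t y) ->
  @qmap K (X -> LM q) (LS x) s = qmap (LS x) t.
Proof.
move=> oN Nx h; apply: qmap_eq; first exact: LS_subspace.
by apply: (LS_zero oN Nx) => y Ny; rewrite -[LHS]/(s y - t y) h // subrr.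
Qed.

(** The value at [y] is the class of the germ at [y] modulo [LS], realized by [qmap] within
    [X -> LM q]. The kernel is thus the local image of the previous map, and exactness is built
    in. *)
Definition dL q : shmap (@fpsh K X (LM q)) (@fpsh K X (LM q.+1)).
Proof.
unshelve refine (@Shmap K X (@fpsh K X (LM q)) (@fpsh K X (LM q.+1)) (fun U s =>
  (fun y : {x | U x} => @qmap K (X -> LM q) (LS (sval y)) (ext0 s)) : {x | U x} -> LM q.+1) _ _ _) => //.
- move=> U a s t oU _ _; apply/funext => y.
  have -> : ext0 (a *: s + t) = a *: (ext0 s : X -> LM q) + ext0 t.
    by apply/funext => x; exact: ext0_lin.
  exact: (@qmap_lin K (X -> LM q)).
- move=> U V s oU oV VU _; apply/funext => y.
  have Uy : U (sval y) := VU _ (svalP y).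
  apply: etrans (ext0_in _ (exist U (sval y) Uy)) _.
  apply: (@qmap_LS_eq q (sval y) _ _ V oV (svalP y)) => x Vx.
  by symmetry; exact: ext0_frs.
Defined.

Lemma dL_LS q U (s : amb (@fpsh K X (LM q)) U) :
  dL q U s = 0 <-> forall y : {x | U x}, LS (sval y) (ext0 s).
Proof.
split=> [h y|h].
  apply/(@qmap_ker K (X -> LM q) _ (ext0 s) (LS_subspace q (sval y))).
  exact: (congr1 (fun f : fsec (LM q.+1) U => f y) h).
apply/funext => y.
exact/(@qmap_ker K (X -> LM q) _ (ext0 s) (LS_subspace q (sval y))).
Qed.

Definition Lres : ecs.
Proof.
unshelve refine (@Ecs (fun q => @fpsh K X (LM q)) iota dL _ _ _ _ _).
- exact: iota_inj.
- move=> U s oU hs; apply/dL_LS => y; exists U, s; split=> //; exact: svalP.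
- move=> q U s oU _; apply/dL_LS => y; exists U, (ext0 s); split=> //; first exact: svalP.
  by move=> x Ux; exact: (ext0_in _ (exist U x Ux)).
- move=> U s oU _ /dL_LS h x Ux; have [N [m [oN Nx ho e]]] := h (exist _ x Ux).
  have oI := openI oN oU; have sl := @subIsetl _ N U.
  exists (N `&` U), (prs (N `&` U) m); split=> //; first exact: prs_in.
  rewrite -(pf_rs iota oN oI sl ho); apply/funext => y.
  by apply: e; case: (svalP y).
- move=> q U s oU _ /dL_LS h x Ux; have [N [a [oN Nx e]]] := h (exist _ x Ux).
  have oI := openI oN oU.
  exists (N `&` U), ((fun y => a (sval y)) : fsec (LM q) (N `&` U)); split=> //.
  apply/funext => y; have [Ny Uy] := svalP y.
  apply: etrans (e _ Ny) _.
  apply: (@qmap_LS_eq q (sval y) _ _ _ oI (svalP y)) => x' Ix'; symmetry.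
  exact: (ext0_in ((fun y => a (sval y)) : fsec (LM q) (N `&` U)) (exist _ x' Ix')).
Defined.

Lemma Lres_injective q : sh_injective (et Lres q).
Proof. by move=> S T d g gd sT; exact: (@shmap_extension K X (LM q) S T d g gd sT). Qed.

End InjectiveResolution.

Definition psum (S T : psh K X) : psh K X.
Proof.
unshelve refine (@Psh K X (fun U => (amb S U * amb T U)%type : lmodType K)
  (fun U s => pin s.1 /\ pin s.2) (fun U V s => (prs V s.1, prs V s.2)) _ _ _ _ _ _ _ _).
- by move=> U oU; split; exact: pin0.
- by move=> U a s t oU [h1 h2] [g1 g2]; split; exact: pin_lin.
- by move=> U V s oU oV VU [h1 h2]; split; exact: prs_in.
- by move=> U V a s t oU oV VU [h1 h2] [g1 g2]; rewrite /= !prs_lin.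
- by move=> U [s1 s2] oU [h1 h2] /=; rewrite !prs_id.
- by move=> U V W [s1 s2] oU oV oW VU WV [h1 h2] /=; rewrite !prs_comp.
- move=> I V [t1 t2] oV [/= h1 h2] h.
  have -> : t1 = 0 by apply: psep => // i; have := congr1 fst (h i).
  by have -> : t2 = 0 by apply: psep => // i; have := congr1 snd (h i).
- move=> I V s oV hs h.
  have [t1 p1 e1] := pglue oV (fun i => proj1 (hs i)) (fun i j => congr1 fst (h i j)).
  have [t2 p2 e2] := pglue oV (fun i => proj2 (hs i)) (fun i j => congr1 snd (h i j)).
  exists (t1, t2) => // i; rewrite /= e1 e2.
  by case: (s i).
Defined.

Lemma soft_psum (S T : psh K X) : soft S -> soft T -> soft (psum S T).
Proof.
move=> hS hT N Q [s t] oN cQ QN [/= hs ht].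
have [s' ps [W [oW QW WN e]]] := hS N Q s oN cQ QN hs.
have [t' pt [W' [oW' QW' WN' e']]] := hT N Q t oN cQ QN ht.
exists ((s', t') : amb (psum S T) setT) => //; exists (W `&` W').
have oI := openI oW oW'; have sl := @subIsetl _ W W'; have sr := @subIsetr _ W W'.
split=> //; [by move=> x Qx; split; [exact: QW|exact: QW']|by move=> x [/WN]|].
rewrite /= -(prs_comp openT oW oI (@subsetT _ _) sl ps) e (prs_comp oN oW oI WN sl hs).
by rewrite -(prs_comp openT oW' oI (@subsetT _ _) sr pt) e' (prs_comp oN oW' oI WN' sr ht).
Qed.

End Resolutions.

Ltac pn := solve [repeat first [assumption | exact: openT | exact: subsetT | apply: pin0
  | apply: pinB | apply: pinD | apply: pf_in | apply: prs_in]].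

(** * Exact complexes of soft sheaves and mapping cones *)

Section ExactSections.
Variables (K : fieldType) (X : topologicalType).
Implicit Types (U V W N : set X) (x : X).
Hypothesis hX : hausdorff_space X.
Hypothesis lc : forall U x, open U -> U x ->
  exists V Q, [/\ open V, V x, V `<=` Q, compact Q & Q `<=` U].
Hypothesis cc : forall U, open U -> exists B Q : nat -> set X,
  [/\ forall m, open (B m), forall m, B m `<=` Q m, forall m, compact (Q m),
      forall m, Q m `<=` U & U `<=` \bigcup_m B m].

Lemma ksoft_inj (S T : psh K X) (d : shmap S T) :
  (forall U (s : amb S U), open U -> pin s -> d U s = 0 -> s = 0) -> ksoft d.
Proof.
move=> inj N Q s oN cQ QN hs ds; exists 0; split; [exact/pin0/openT|exact/pf0/openT|].
by exists N; split=> //; rewrite (inj N s) // !prs0 //; exact: openT.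
Qed.

Section Complex.
Variables (k : nat -> psh K X) (D : forall q, shmap (k q) (k q.+1)).
Hypothesis soft_k : forall q, soft (k q).
Hypothesis inj : forall U (s : amb (k 0) U), open U -> pin s -> D 0 U s = 0 -> s = 0.
Hypothesis dd : forall q U (s : amb (k q) U), open U -> pin s -> D q.+1 U (D q U s) = 0.
Hypothesis exS : forall q U (s : amb (k q.+1) U), open U -> pin s -> D q.+1 U s = 0 ->
  locimg (D q) s.

(** By induction the kernel of [D q] is soft, so a section [s] killed by [D q.+1] lifts over the
    whole of [N] to [k q]. The lift is extended by softness of [k q], and its image under [D q]
    extends [s]. *)
Lemma exact_ksoft q : ksoft (D q).
Proof.
elim: q => [|q ih]; first exact: ksoft_inj inj.
move=> N Q s oN cQ QN hs ds.
have [a ha ea] := lift_sections hX lc cc ih oN hs (exS oN hs ds).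
have [a' ha' [W [oW QW WN e]]] := soft_k oN cQ QN ha.
exists (D q setT a'); split; [pn|exact: dd openT ha'|].
exists W; split=> //.
by rewrite pf_rs ?e -?pf_rs ?ea //; exact: openT.
Qed.

Lemma exact_sections q U (s : amb (k q.+1) U) : open U -> pin s -> D q.+1 U s = 0 ->
  exists2 a : amb (k q) U, pin a & D q U a = s.
Proof. by move=> oU hs ds; exact: (lift_sections hX lc cc (@exact_ksoft q) oU hs (exS oU hs ds)). Qed.

End Complex.

Variable O : psh K X.

Section Cone.
Variables (A B : ecs O) (al : cmap A B).
Hypothesis softA : forall q, soft (et A q).
Hypothesis softB : forall q, soft (et B q).

(** The mapping cone of [al], with the term from [B] shifted by one degree. It has no cohomology
    because [A] and [B] resolve the same [O] and [al] is the identity there. *)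
Definition cone q := if q is q'.+1 then psum (et A q'.+1) (et B q') else et A 0.

Definition cone_d0 : shmap (cone 0) (cone 1).
Proof.
unshelve refine (@Shmap K X (cone 0) (cone 1) (fun U a => (ed A 0 U a, cm al 0 U a)) _ _ _).
- by move=> U s oU hs; split; exact: pf_in.
- by move=> U a s t oU hs ht; rewrite !pf_lin.
- by move=> U V s oU oV VU hs; rewrite /= !pf_rs.
Defined.

Definition cone_dS q : shmap (cone q.+1) (cone q.+2).
Proof.
unshelve refine (@Shmap K X (cone q.+1) (cone q.+2)
  (fun U a => (ed A q.+1 U a.1, cm al q.+1 U a.1 - ed B q U a.2)) _ _ _).
- by move=> U s oU [h1 h2]; split => /=; pn.
- move=> U a [s1 s2] [t1 t2] oU [h1 h2] [g1 g2].
  have aux (V V' : lmodType K) (x1 x2 : V) (y1 y2 z1 z2 : V') :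
      (a *: x1 + x2, (a *: y1 + y2) - (a *: z1 + z2)) = a *: (x1, y1 - z1) + (x2, y2 - z2).
    by rewrite [RHS](_ : _ = (a *: x1 + x2, a *: (y1 - z1) + (y2 - z2))) // scalerBr opprD addrACA.
  by rewrite /= !pf_lin // aux.
- move=> U V [s1 s2] oU oV VU [h1 h2] /=.
  by rewrite prsB ?pf_rs //; pn.
Defined.

Definition cone_d q : shmap (cone q) (cone q.+1) :=
  match q return shmap (cone q) (cone q.+1) with 0 => cone_d0 | q'.+1 => cone_dS q' end.

Lemma soft_cone q : soft (cone q).
Proof. by case: q => [|q]; [exact: softA|exact: soft_psum]. Qed.

Lemma cone_inj U (a : amb (et A 0) U) : open U -> pin a -> ed A 0 U a = 0 ->
  cm al 0 U a = 0 -> a = 0.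
Proof.
move=> oU ha da aa; apply: psep_local => //; first exact: pin0.
move=> x Ux; have [V [m [oV Vx VU ho e]]] := e_ex0 oU ha da Ux.
exists V; split=> //; rewrite e prs0 //.
rewrite (@e_inj _ _ _ B V m oV ho) ?pf0 //.
by rewrite -(cm_aug al oV ho) -e -pf_rs // aa prs0.
Qed.

(** If locally [a] is the coboundary of [a1], then [al a1 - l] is closed in [B]. In degree 0 it
    comes from a section of [O], which is subtracted from [a1]; in higher degree it is a coboundary,
    whose primitive becomes the second component. *)
Lemma cone_exact_local q U (s : amb (cone q.+1) U) : open U -> pin s ->
  cone_d q.+1 U s = 0 -> locimg (cone_d q) s.
Proof.
case: q s => [|q] [a l] oU [/= ha hl] [da] /eqP; rewrite subr_eq0 => /eqP e x Ux.
  have [V [a1 [oV Vx VU h1 e1]]] := e_exS oU ha da Ux.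
  have hlV : pin (prs V l) by pn.
  have c0 : ed B 0 V (cm al 0 V a1 - prs V l) = 0.
    by rewrite pfB //; [rewrite -cm_d // -e1 -!pf_rs // e subrr|pn].
  have hc : pin (cm al 0 V a1 - prs V l) by pn.
  have [W [m [oW Wx WV hm em]]] := e_ex0 oV hc c0 Vx.
  have h1W : pin (prs W a1) by pn.
  exists W, (prs W a1 - eaug A W m); split=> //; [exact: subset_trans VU|pn|].
  congr pair.
    rewrite pfB //; last by pn.
    by rewrite e_ad // subr0 -pf_rs // -e1 prs_comp.
  rewrite pfB //; last by pn.
  rewrite cm_aug // -em prsB //; last by pn.
  by rewrite -pf_rs // prs_comp // opprB addrCA subrr addr0.
have [V [a1 [oV Vx VU h1 e1]]] := e_exS oU ha da Ux.
have hlV : pin (prs V l) by pn.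
have hc : pin (cm al q.+1 V a1 - prs V l) by pn.
have c0 : ed B q.+1 V (cm al q.+1 V a1 - prs V l) = 0.
  by rewrite pfB //; [rewrite -cm_d // -e1 -!pf_rs // e subrr|pn].
have [W [m [oW Wx WV hm em]]] := e_exS oV hc c0 Vx.
have h1W : pin (prs W a1) by pn.
exists W, ((prs W a1, m) : amb (cone q.+1) W); split=> //; first exact: subset_trans VU.
congr pair => /=; first by rewrite -pf_rs // -e1 prs_comp.
rewrite -em prsB //; last by pn.
by rewrite -pf_rs // prs_comp // opprB addrCA subrr addr0.
Qed.

(** Coboundaries of sections over [U], where degree 0 has only the zero one. It lets the arguments
    below treat degree 0 and the others alike. *)
Definition BL q U : amb (et B q) U -> Prop :=
  match q return amb (et B q) U -> Prop with
  | 0 => fun e => e = 0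
  | q'.+1 => fun e => exists2 m : amb (et B q') U, pin m & ed B q' U m = e
  end.

Lemma cone_exact q U (a : amb (et A q.+1) U) (l : amb (et B q) U) : open U -> pin a -> pin l ->
  ed A q.+1 U a = 0 -> cm al q.+1 U a = ed B q U l ->
  exists (a' : amb (et A q) U) e, [/\ pin a', BL e, ed A q U a' = a & cm al q U a' - e = l].
Proof.
move=> oU ha hl da e.
have c_dd r V (s : amb (cone r) V) : open V -> pin s -> cone_d r.+1 V (cone_d r V s) = 0.
  case: r s => [|r] s oV hs.
    by congr pair; rewrite /= ?e_dd // cm_d // subrr.
  have [h1 h2] := hs.
  congr pair; rewrite /= ?e_dd // cm_d // pfB //; try by pn.
  by rewrite e_dd // subr0 subrr.
have c_inj V (s : amb (cone 0) V) : open V -> pin s -> cone_d 0 V s = 0 -> s = 0.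
  by move=> oV hs [e1 e2]; exact: cone_inj oV hs e1 e2.
have hs : pin ((a, l) : amb (cone q.+1) U) by split.
have ds : cone_d q.+1 U ((a, l) : amb (cone q.+1) U) = 0.
  by congr pair => //=; rewrite e subrr.
have := exact_sections soft_cone c_inj c_dd cone_exact_local oU hs ds.
case: (q) a l {ha hl da e hs ds} => [|r] a l [s hs] /=.
  by case=> e1 e2; exists s, 0; split=> //; rewrite subr0.
case: s hs => s m [/= h1 h2] [e1 e2]; exists s, (ed B r U m); split=> //.
by exists m.
Qed.

End Cone.

Lemma aug_sections (A : ecs O) U (s : amb (et A 0) U) : open U -> pin s -> ed A 0 U s = 0 ->
  exists2 o : amb O U, pin o & eaug A U o = s.
Proof.
move=> oU hs ds.
exact: (lift_sections hX lc cc (ksoft_inj (@e_inj _ _ _ A)) oU hs (e_ex0 oU hs ds)).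
Qed.

Definition pflabby (S : psh K X) := forall U (s : amb S U), open U -> pin s ->
  exists2 t : amb S setT, pin t & prs U t = s.

Lemma BL_pin (B : ecs O) q U (e : amb (et B q) U) : open U -> BL e -> pin e.
Proof. by case: q e => [|q] e oU /=; [move=> ->; exact: pin0|move=> [m hm <-]; pn]. Qed.

Lemma BL_closed (B : ecs O) q U (e : amb (et B q) U) : open U -> BL e -> ed B q U e = 0.
Proof. by case: q e => [|q] e oU /=; [move=> ->; exact: pf0|move=> [m hm <-]; exact: e_dd]. Qed.

(** Extending the primitive, rather than the section, keeps the extension a coboundary. *)
Lemma BL_ext (B : ecs O) q U (e : amb (et B q) U) : (forall q, pflabby (et B q)) -> open U ->
  BL e -> exists2 e' : amb (et B q) setT, BL e' & prs U e' = e.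
Proof.
move=> fB oU; case: q e => [|q] e /=.
  by move=> ->; exists 0 => //; rewrite prs0 //; exact: openT.
move=> [m hm <-]; have [m' hm' em] := fB q U m oU hm.
exists (ed B q setT m'); first by exists m'.
by rewrite pf_rs ?em //; exact: openT.
Qed.

Lemma BL_d (B : ecs O) q U (m : amb (et B q) U) : pin m -> BL (ed B q U m).
Proof. by move=> hm; exists m. Qed.

End ExactSections.

(** * Comparison of relative cohomologies *)

Section RelativeComparison.
Variables (K : fieldType) (X : topologicalType).
Implicit Types (U V W N : set X) (x : X).
Hypothesis hX : hausdorff_space X.
Hypothesis lc : forall U x, open U -> U x ->
  exists V Q, [/\ open V, V x, V `<=` Q, compact Q & Q `<=` U].
Hypothesis cc : forall U, open U -> exists B Q : nat -> set X,
  [/\ forall m, open (B m), forall m, B m `<=` Q m, forall m, compact (Q m),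
      forall m, Q m `<=` U & U `<=` \bigcup_m B m].

Lemma pflabby_soft (S : psh K X) : pflabby S -> soft S.
Proof.
move=> fS N Q s oN cQ QN hs; have [t ht et] := fS N s oN hs.
by exists t => //; exists N; split=> //; rewrite et prs_id.
Qed.

Variable O : psh K X.
Variables (E F L : ecs O) (al : cmap E L) (be : cmap F L).
Hypothesis softE : forall q, soft (et E q).
Hypothesis fF : forall q, pflabby (et F q).
Hypothesis fL : forall q, pflabby (et L q).
Variable X' : set X.
Hypothesis oX' : open X'.

Let softF q : soft (et F q). Proof. exact: pflabby_soft. Qed.
Let softL q : soft (et L q). Proof. exact: pflabby_soft. Qed.
Let oT : open [set: X]. Proof. exact: openT. Qed.
Let XT : X' `<=` [set: X]. Proof. exact: subsetT. Qed.

Definition relE r (xi : amb (et E r.+1) setT) (eta : amb (et E r) X') :=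
  [/\ pin xi, pin eta, ed E r.+1 setT xi = 0 & prs X' xi = ed E r X' eta].

Definition relF q (s : amb (et F q) setT) := [/\ pin s, ed F q setT s = 0 & prs X' s = 0].

(** The relation [cohomologous_in] with [L] as the common resolution. *)
Definition corr r (xi : amb (et E r.+1) setT) (eta : amb (et E r) X')
    (s : amb (et F r.+1) setT) :=
  exists t : amb (et L r) setT, [/\ pin t, prs X' t = cm al r X' eta &
    cm al r.+1 setT xi - cm be r.+1 setT s = ed L r setT t].

(** Extending [al eta] to [t0] on [X] and subtracting its coboundary from [al xi] gives a closed
    [lam] that vanishes on [X']. Exactness of the cone over [X] yields a cocycle [s0] of [F] with
    [be s0] cohomologous to [lam]; exactness over [X'] shows that [s0] is there the coboundary of
    some [b], and [b] extends because [F] is flabby. *)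
Lemma corr_to_F r xi eta : @relE r xi eta -> exists2 s, @relF r.+1 s & corr xi eta s.
Proof.
move=> [hxi heta dxi rxi].
have [t0 ht0 et0] := fL oX' (pf_in (cm al r) oX' heta).
pose lam := cm al r.+1 setT xi - ed L r setT t0.
have hlam : pin lam by rewrite /lam; pn.
have dlam : ed L r.+1 setT lam = 0.
  rewrite /lam pfB //; try by pn.
  by rewrite -cm_d // dxi pf0 // e_dd // subr0.
have rlam : prs X' lam = 0.
  rewrite /lam prsB //; try by pn.
  by rewrite !pf_rs // et0 rxi cm_d // subrr.
have h0 : pin (0 : amb (et F r.+2) setT) by exact: pin0.
have d0 : ed F r.+2 setT 0 = 0 by exact: pf0.
have e0 : cm be r.+2 setT 0 = ed L r.+1 setT lam by rewrite dlam pf0.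
have [s0 [e [hs0 [l hl el] ds0 es0]]] := cone_exact hX lc cc softF softL oT h0 hlam d0 e0.
have he : pin e by rewrite -el; pn.
have dX : ed F r.+1 X' (prs X' s0) = 0 by rewrite -pf_rs // ds0 prs0.
have eX : cm be r.+1 X' (prs X' s0) = ed L r X' (prs X' l).
  apply/eqP; rewrite -subr_eq0 -!pf_rs // el -prsB ?es0 ?rlam //; try by pn.
have hsX : pin (prs X' s0) by pn.
have hlX : pin (prs X' l) by pn.
have [b [e' [hb be' db eb]]] := cone_exact hX lc cc softF softL oX' hsX hlX dX eX.
have [b1 hb1 eb1] := fF oX' hb; have [e1 be1 ee1] := BL_ext fL oX' be'.
have he1 := BL_pin oT be1; have de1 := BL_closed oT be1.
(* Subtracting the coboundary of the extension [b1] of [b] makes the cocycle vanish on [X']. *)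
exists (s0 - ed F r setT b1).
  split; [by pn|rewrite pfB //; try by pn|rewrite prsB //; try by pn].
    by rewrite ds0 e_dd // subr0.
  by rewrite pf_rs // eb1 db subrr.
exists (t0 + (cm be r setT b1 - l - e1)); split; first by pn.
  rewrite prsD //; try by pn.
  rewrite !prsB //; try by pn.
  have z (V : zmodType) (x y : V) : x - (x - y) - y = 0 by rewrite opprB addrCA subrr addr0 subrr.
  by rewrite et0 pf_rs // eb1 ee1 -eb z addr0.
rewrite (pfD (ed L r)) //; try by pn.
rewrite !pfB //; try by pn.
rewrite de1 subr0 cm_d //.
have -> : cm al r.+1 setT xi = lam + ed L r setT t0 by rewrite /lam subrK.
have aux (V : zmodType) (a b' c d : V) : a - b' + c - (a - d) = c + (d - b').
  by rewrite opprB [LHS]addrC !addrA subrK [LHS]addrC addrA.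
by rewrite -es0 el aux.
Qed.

(** The same chase from the other side. The primitive [eta] of [xi] over [X'] is kept as the second
    component instead of being extended; only sections of [L] are extended. *)
Lemma corr_to_E r s : @relF r.+1 s -> exists xi eta, @relE r xi eta /\ corr xi eta s.
Proof.
move=> [hs ds rs].
have hl : pin (cm be r.+1 setT s) by pn.
have h0 : pin (0 : amb (et E r.+2) setT) by exact: pin0.
have d0 : ed E r.+2 setT 0 = 0 by exact: pf0.
have e0 : cm al r.+2 setT 0 = ed L r.+1 setT (cm be r.+1 setT s).
  by rewrite -cm_d // ds !pf0.
have [xi [e [hxi [l hl' el] dxi exi]]] := cone_exact hX lc cc softE softL oT h0 hl d0 e0.
have dX : ed E r.+1 X' (prs X' xi) = 0 by rewrite -pf_rs // dxi prs0.
have eX : cm al r.+1 X' (prs X' xi) = ed L r X' (prs X' l).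
  apply/eqP; rewrite -subr_eq0 -!pf_rs // el -prsB ?exi //; try by pn.
    by rewrite pf_rs // rs pf0.
  by rewrite -el; pn.
have hxX : pin (prs X' xi) by pn.
have hlX : pin (prs X' l) by pn.
have [eta [e' [heta be' deta eeta]]] := cone_exact hX lc cc softE softL oX' hxX hlX dX eX.
have [e1 be1 ee1] := BL_ext fL oX' be'.
have he1 := BL_pin oT be1; have de1 := BL_closed oT be1.
exists xi, eta; split; first by split.
exists (l + e1); split; first by pn.
  by rewrite prsD // ee1 -eeta subrK.
by rewrite pfD // de1 addr0 el -exi opprB addrCA subrr addr0.
Qed.

(** In degree 1 there is no [w], since the second component of a cochain of degree 0 is 0. *)
Definition cobE r (xi : amb (et E r.+1) setT) (eta : amb (et E r) X') : Prop :=
  exists2 z : amb (et E r) setT, pin z & xi = ed E r setT z /\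
  match r return amb (et E r) X' -> amb (et E r) X' -> Prop with
  | 0 => fun eta zX => eta = zX
  | r'.+1 => fun eta zX => exists2 w : amb (et E r') X', pin w & eta = zX - ed E r' X' w
  end eta (prs X' z).

Definition cobF r (s : amb (et F r.+1) setT) : Prop :=
  exists2 s' : amb (et F r) setT, pin s' /\ prs X' s' = 0 & s = ed F r setT s'.

(** A primitive of the cocycle in [E] produces a primitive [u] of [be s] in [L] that vanishes on
    [X']. Exactness of the cone gives a primitive [s'] of [s]; over [X'] it is 0 in degree 0 and
    otherwise a coboundary, which is removed by flabbiness of [F]. *)
Lemma corr_cobE r xi eta s : @relE r xi eta -> @relF r.+1 s -> corr xi eta s ->
  cobE xi eta -> cobF s.
Proof.
move=> [hxi heta dxi rxi] [hs ds rs] [t [ht rt et]] [z hz [exi Hz]].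
have hBL : BL (cm al r X' (prs X' z) - cm al r X' eta).
  case: (r) eta z {hxi dxi rxi t ht rt et} heta hz {exi} Hz => [|r'] eta z heta hz /=.
    by move=> ->; rewrite subrr.
  move=> [w hw ->]; exists (cm al r' X' w); first by pn.
  have hz' : pin (prs X' z) by pn.
  have hw' : pin (ed E r' X' w) by pn.
  by rewrite (pfB _ oX' hz' hw') cm_d // opprB addrCA subrr addr0.
have [e be1 ee] := BL_ext fL oX' hBL.
have he := BL_pin oT be1; have de := BL_closed oT be1.
(* The closed term [e] extends from [X'] the difference of [al z] and [al eta], so that [u] is 0
   there. *)
pose u := cm al r setT z - t - e.
have hu : pin u by rewrite /u; pn.
have du : cm be r.+1 setT s = ed L r setT u.
  rewrite /u pfB //; try by pn.
  rewrite pfB //; try by pn.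
  by rewrite de subr0 -cm_d // -exi -et opprB addrCA subrr addr0.
have ru : prs X' u = 0.
  rewrite /u prsB //; try by pn.
  rewrite prsB //; try by pn.
  by rewrite ee rt pf_rs // subrr.
have [s' [e' [hs' be' ds' es']]] := cone_exact hX lc cc softF softL oT hs hu ds du.
have he' := BL_pin oT be'.
have rs' : cm be r X' (prs X' s') = prs X' e'.
  apply/eqP; rewrite -subr_eq0 -pf_rs // -prsB ?es' ?ru //; by pn.
have dX : ed F r X' (prs X' s') = 0 by rewrite -pf_rs // ds' rs.
case: (r) s s' e' hs' be' ds' rs' dX {hs ds rs es' he' hxi dxi rxi heta Hz hBL et du hz exi rt ht he de be1 ee hu ru u e z t xi eta}
    => [|r'] s s' e' hs' /= be' ds' rs' dX.
  exists s' => //; split=> //.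
  have hX' : pin (prs X' s') by pn.
  by apply: (cone_inj (al := be) oX' hX' dX); rewrite rs' be' prs0.
move: be' rs' => [m hm <-] rs'; rewrite pf_rs // in rs'.
have hX' : pin (prs X' s') by pn.
have hm' : pin (prs X' m) by pn.
have [b [_ [hb _ db _]]] := cone_exact hX lc cc softF softL oX' hX' hm' dX rs'.
have [b1 hb1 eb1] := fF oX' hb.
exists (s' - ed F r' setT b1).
  split; first by pn.
  by rewrite prsB //; [rewrite pf_rs // eb1 db subrr|pn].
by rewrite pfB //; [rewrite e_dd // subr0|pn].
Qed.

(** Here [be s' + t] is a primitive of [al xi], hence [xi] has a primitive [z]. Over [X'] the
    difference of [z] and [eta] is closed with exact image in [L], so it is itself exact, or 0 in
    degree 0. *)
Lemma corr_cobF r xi eta s : @relE r xi eta -> @relF r.+1 s -> corr xi eta s ->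
  cobF s -> cobE xi eta.
Proof.
move=> [hxi heta dxi rxi] [hs ds rs] [t [ht rt et]] [s' [hs' rs'] es].
have hu : pin (cm be r setT s' + t) by pn.
have e0 : cm al r.+1 setT xi = ed L r setT (cm be r setT s' + t).
  rewrite pfD //; try by pn.
  by rewrite -cm_d // -es -et addrC subrK.
have [z [e [hz bz dz ez]]] := cone_exact hX lc cc softE softL oT hxi hu dxi e0.
have he := BL_pin oT bz.
have hzX : pin (prs X' z) by pn.
have hD : pin (prs X' z - eta) by pn.
have aD : cm al r X' (prs X' z - eta) = prs X' e.
  rewrite pfB // -pf_rs // -rt.
  have -> : cm al r setT z = cm be r setT s' + t + e by rewrite -ez subrK.
  rewrite prsD //; try by pn.
  rewrite prsD //; try by pn.
  by rewrite pf_rs // rs' pf0 // add0r addrC addrA addNr add0r.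
have dD : ed E r X' (prs X' z - eta) = 0 by rewrite pfB // -pf_rs // dz rxi subrr.
exists z => //; split; first by rewrite dz.
case: (r) xi eta s s' t z e {hu e0 hxi dxi rxi hs ds rs et es ez ht rt hs' rs' dz} heta hz bz he hzX hD aD dD
    => [|r'] xi eta s s' t z e heta hz /= bz he hzX hD aD dD.
  apply/esym/eqP; rewrite -subr_eq0; apply/eqP.
  by apply: (cone_inj (al := al) oX' hD dD); rewrite aD bz prs0.
move: bz aD => [m hm <-] aD; rewrite pf_rs // in aD.
have hm' : pin (prs X' m) by pn.
have [w [_ [hw _ dw _]]] := cone_exact hX lc cc softE softL oX' hD hm' dD aD.
by exists w => //; rewrite dw opprB addrCA subrr addr0.
Qed.

Lemma corr_lin r a xi eta s xi' eta' s' : @relE r xi eta -> @relF r.+1 s -> corr xi eta s ->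
  @relE r xi' eta' -> @relF r.+1 s' -> corr xi' eta' s' ->
  corr (a *: xi + xi') (a *: eta + eta') (a *: s + s').
Proof.
move=> [hxi heta _ _] [hs _ _] [t [ht rt et]] [hxi' heta' _ _] [hs' _ _] [t' [ht' rt' et']].
exists (a *: t + t'); split; first exact: pin_lin.
  by rewrite prs_lin // pf_lin // rt rt'.
by rewrite !pf_lin // -et -et' scalerBr opprD addrACA.
Qed.

(** In degree 0 cocycles are global sections of [O] vanishing on [X'], and both augmentations start
    from the same [O]. *)
Lemma corr0_to_F (xi : amb (et E 0) setT) : pin xi -> ed E 0 setT xi = 0 -> prs X' xi = 0 ->
  exists2 s, @relF 0 s & cm al 0 setT xi = cm be 0 setT s.
Proof.
move=> hxi dxi rxi; have [m hm em] := aug_sections hX lc cc oT hxi dxi.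
exists (eaug F setT m); last by rewrite cm_aug // -em cm_aug.
split; [by pn|exact: e_ad|].
have -> : prs X' (eaug F setT m) = eaug F X' (prs X' m) by rewrite pf_rs.
rewrite (@e_inj _ _ _ E X' (prs X' m)) ?pf0 //; first by pn.
by rewrite -pf_rs // em.
Qed.

Lemma corr0_to_E (s : amb (et F 0) setT) : relF s ->
  exists2 xi : amb (et E 0) setT, [/\ pin xi, ed E 0 setT xi = 0 & prs X' xi = 0] &
    cm al 0 setT xi = cm be 0 setT s.
Proof.
move=> [hs ds rs]; have [m hm em] := aug_sections hX lc cc oT hs ds.
exists (eaug E setT m); last by rewrite cm_aug // -em cm_aug.
split; [by pn|exact: e_ad|].
have -> : prs X' (eaug E setT m) = eaug E X' (prs X' m) by rewrite pf_rs.
rewrite (@e_inj _ _ _ F X' (prs X' m)) ?pf0 //; first by pn.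
by rewrite -pf_rs // em.
Qed.

Lemma corr0_inj (xi : amb (et E 0) setT) (s : amb (et F 0) setT) : pin xi -> ed E 0 setT xi = 0 ->
  relF s -> cm al 0 setT xi = cm be 0 setT s -> (xi = 0 <-> s = 0).
Proof.
move=> hxi dxi [hs ds _] e; split=> e0.
  by apply: (cone_inj (al := be) oT hs ds); rewrite -e e0 pf0.
by apply: (cone_inj (al := al) oT hxi dxi); rewrite e e0 pf0.
Qed.

(** * Independence of the common resolution *)

Section Change.
Hypothesis injL : forall q, sh_injective (et L q).
Variables (J : ecs O) (aJ : cmap E J) (bJ : cmap F J).
Hypothesis fJ : forall q, pflabby (et J q).

Definition corrJ r (xi : amb (et E r.+1) setT) (eta : amb (et E r) X')
    (s : amb (et F r.+1) setT) :=
  exists t : amb (et J r) setT, [/\ pin t, prs X' t = cm aJ r X' eta &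
    cm aJ r.+1 setT xi - cm bJ r.+1 setT s = ed J r setT t].

Definition cmcomp (A B D : ecs O) (f : cmap A B) (g : cmap B D) : cmap A D.
Proof.
unshelve refine (@Cmap _ _ _ A D (fun q => shcomp (cm f q) (cm g q)) _ _).
- by move=> U s oU hs /=; rewrite !cm_aug.
- by move=> q U s oU hs /=; rewrite !cm_d //; pn.
Defined.

(** A chain map [j] from [J] to [L] exists, and [al] and [be] are homotopic to the composites of
    [aJ] and [bJ] with [j], because all these maps induce the identity on [O]. The homotopies [h]
    and [k] transport the primitive [t] from [J] to [L]. *)
Lemma corr_change : (forall r xi eta s, @relE r xi eta -> @relF r.+1 s ->
    corrJ xi eta s -> corr xi eta s) /\
  (forall (xi : amb (et E 0) setT) (s : amb (et F 0) setT), pin xi -> ed E 0 setT xi = 0 ->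
    relF s -> cm aJ 0 setT xi = cm bJ 0 setT s -> cm al 0 setT xi = cm be 0 setT s).
Proof.
have softJ q : soft (et J q) by exact: pflabby_soft.
have [j _] := chain_map_exists injL softJ.
have [h [h0 hS]] := homotopy_exists injL softE al (cmcomp aJ j).
have [k [k0 kS]] := homotopy_exists injL softF be (cmcomp bJ j).
split=> [r xi eta s [hxi heta dxi rxi] [hs ds rs] [t [ht rt et]]|xi s hxi dxi [hs ds rs] e]; last first.
  have := h0 setT xi oT hxi; rewrite dxi pf0 // => /eqP; rewrite subr_eq0 => /eqP -> /=.
  have := k0 setT s oT hs; rewrite ds pf0 // => /eqP; rewrite subr_eq0 => /eqP -> /=.
  by rewrite e.
have ha : cm al r.+1 setT xi - cm j r.+1 setT (cm aJ r.+1 setT xi) = ed L r setT (h r setT xi).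
  have := hS r setT xi oT hxi; rewrite dxi pf0 // => /eqP; rewrite subr_eq0 => /eqP.
  by move=> ->.
have hb : cm be r.+1 setT s - cm j r.+1 setT (cm bJ r.+1 setT s) = ed L r setT (k r setT s).
  have := kS r setT s oT hs; rewrite ds pf0 // => /eqP; rewrite subr_eq0 => /eqP.
  by move=> ->.
(* On [X'] the homotopy formula leaves a coboundary [e], the one of [h eta] (0 in degree 0); it is
   extended to [X] so that it can be added to the primitive. *)
have hBL : exists2 e, BL e & cm al r X' eta - cm j r X' (cm aJ r X' eta) =
    e + h r X' (ed E r X' eta).
  case: (r) eta heta {xi s t hxi dxi rxi hs ds rs ht rt et ha hb} => [|r'] eta heta.
    by exists 0 => //; rewrite add0r -h0.
  have e1 := hS r' X' eta oX' heta; exists (ed L r' X' (h r' X' eta)).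
    by apply: BL_d; pn.
  by rewrite -e1 [RHS]addrC subrK.
have [e be1 ee] := hBL; have [e1 be2 ee1] := BL_ext fL oX' be1.
have he1 := BL_pin oT be2; have de1 := BL_closed oT be2.
have hjt : pin (cm j r setT t) by pn.
have hh : pin (h r setT xi) by pn.
have hk : pin (k r setT s) by pn.
exists (cm j r setT t + h r setT xi - k r setT s + e1); split; first by pn.
  rewrite prsD //; try by pn.
  rewrite prsB //; try by pn.
  rewrite prsD // !pf_rs // rt rs pf0 // subr0 rxi ee1.
  rewrite -[RHS](subrK (cm j r X' (cm aJ r X' eta))) ee [RHS]addrC -addrA.
  by congr (_ + _); exact: addrC.
rewrite pfD //; try by pn.
rewrite pfB //; try by pn.
rewrite pfD // de1 addr0 -ha -hb -cm_d // -et pfB //; try by pn.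
have aux (V : zmodType) (a b c d : V) : a - b = c - d + (a - c) - (b - d).
  by rewrite opprB [c - d + _]addrC [a - c + _]addrA subrK addrA subrK.
exact: aux.
Qed.

End Change.
End RelativeComparison.

(** * From cochain relations to cohomology *)

Section CohomologyRelation.
Variables (K : fieldType) (G H : complex_in K).

Definition linear_complex (G : complex_in K) :=
  (forall q, @lin_subspace K (ambient G q) (@cochains _ G q)) /\
  forall q a (c c' : ambient G q), cochains c -> cochains c' ->
    coboundary (a *: c + c') = a *: coboundary c + coboundary c'.

Lemma linear_complex0 (D : complex_in K) q : linear_complex D ->
  coboundary (0 : ambient D q) = 0.
Proof.
move=> [h1 h2]; have [c0 _] := h1 q.
by have := h2 q (-1) _ _ c0 c0; rewrite scaler0 addr0 scaleN1r addNr.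
Qed.

Lemma cocycles_subspace (D : complex_in K) q : linear_complex D ->
  @lin_subspace K (ambient D q) (@cocycles _ D q).
Proof.
move=> hD; have [h1 h2] := hD; have [c0 cD] := h1 q.
split; first by split=> //; exact: linear_complex0.
move=> a s t [cs es] [ct et]; split; first exact: cD.
by rewrite h2 // es et scaler0 addr0.
Qed.

Lemma coboundaries_subspace (D : complex_in K) q : linear_complex D ->
  @lin_subspace K (ambient D q) (@coboundaries _ D q).
Proof.
move=> hD; case: q => [|q].
  by split=> // a s t -> ->; rewrite /= scaler0 addr0.
have [h1 h2] := hD; have [c0 cD] := h1 q; split.
  by exists 0 => //; exact: linear_complex0.
move=> a _ _ [s cs <-] [t ct <-]; exists (a *: s + t); first exact: cD.
exact: h2.
Qed.

Lemma coh_classP (D : complex_in K) q (c c' : ambient D q) : linear_complex D ->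
  coh_class c = coh_class c' <-> coboundaries (c - c').
Proof.
move=> hD; have [b0 bD] := coboundaries_subspace q hD.
have bA s t : coboundaries s -> coboundaries t -> coboundaries (s + t : ambient D q).
  by move=> hs ht; rewrite -[s]scale1r; exact: bD.
have bN s : coboundaries s -> coboundaries (- s : ambient D q).
  by move=> hs; rewrite -scaleN1r -[_ *: _]addr0; exact: bD.
split=> [e|hb].
  have : coh_class c' c by rewrite -e; exists 0 => //; rewrite addr0.
  by move=> [b hb <-]; rewrite addrC addKr.
apply/seteqP; split=> _ [b hb' <-].
  by exists (c - c' + b); [exact: bA|rewrite addrA addrCA subrr addr0].
exists (- (c - c') + b); first by apply: bA => //; exact: bN.
by rewrite opprB addrA addrCA subrr addr0.
Qed.

Variables (q : nat) (rel : ambient G q -> ambient H q -> Prop).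
Hypotheses (lG : linear_complex G) (lH : linear_complex H).
Hypothesis rel_lin : forall a c c' s s', cocycles c -> cocycles s -> cocycles c' -> cocycles s' ->
  rel c s -> rel c' s' -> rel (a *: c + c') (a *: s + s').
Hypothesis rel_to : forall c, cocycles c -> exists2 s, cocycles s & rel c s.
Hypothesis rel_from : forall s, cocycles s -> exists2 c, cocycles c & rel c s.
Hypothesis rel_cob : forall c s, cocycles c -> cocycles s -> rel c s ->
  (coboundaries c <-> coboundaries s).
Hypothesis rel0 : forall s, cocycles s -> coboundaries s -> rel 0 s.

Lemma rel_class c s c' s' : cocycles c -> cocycles s -> cocycles c' -> cocycles s' ->
  rel c s -> rel c' s' -> (coh_class c = coh_class c' <-> coh_class s = coh_class s').
Proof.
move=> hc hs hc' hs' r r'; rewrite !coh_classP //.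
have [_ cG] := cocycles_subspace q lG; have [_ cH] := cocycles_subspace q lH.
have := rel_cob (cG (-1) _ _ hc' hc) (cH (-1) _ _ hs' hs) (rel_lin (-1) hc' hs' hc hs r' r).
by rewrite !scaleN1r ![- _ + _]addrC.
Qed.

Lemma coh_iso_of_relation : exists Phi : set (ambient G q) -> set (ambient H q),
  coh_iso Phi /\ forall c s, cocycles c -> cocycles s ->
    (Phi (coh_class c) = coh_class s <-> rel c s).
Proof.
have [g0 cG] := cocycles_subspace q lG; have [_ cH] := cocycles_subspace q lH.
pose Phi S : set (ambient H q) := [set t | exists c s,
  [/\ cocycles c, cocycles s, rel c s, S = coh_class c & coh_class s t]].
have PhiE c s : cocycles c -> cocycles s -> rel c s -> Phi (coh_class c) = coh_class s.
  move=> hc hs r; apply/seteqP; split=> [t [c' [s' [hc' hs' r' e ht]]]|t ht]; last by exists c, s.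
  by rewrite ((rel_class hc hs hc' hs' r r').1 e).
have PhiP c s : cocycles c -> cocycles s -> (Phi (coh_class c) = coh_class s <-> rel c s).
  move=> hc hs; split=> [e|]; last exact: PhiE.
  have [s0 hs0 r0] := rel_to hc.
  have e' : coh_class s = coh_class s0 by rewrite -e (PhiE c s0).
  have hd : cocycles (s - s0) by rewrite addrC -scaleN1r; exact: cH.
  (* [s] differs by a coboundary from a cocycle [s0] related to [c], and 0 is related to that
     coboundary. *)
  have := rel_lin 1 hc hs0 g0 hd r0 (rel0 hd ((coh_classP _ _ lH).1 e')).
  by rewrite !scale1r addr0 addrC subrK.
exists Phi; split=> //; split.
  split.
  - move=> _ [c hc <-]; have [s hs r] := rel_to hc.
    by exists s => //; rewrite (PhiE c s).
  - move=> _ _ /set_mem[c hc <-] /set_mem[c' hc' <-].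
    have [s hs r] := rel_to hc; have [s' hs' r'] := rel_to hc'.
    by rewrite (PhiE c s) // (PhiE c' s') // => /(rel_class hc hs hc' hs' r r').2.
  - move=> _ [s hs <-]; have [c hc r] := rel_from hs.
    by exists (coh_class c); [exists c|exact: PhiE].
move=> a c c' s s' hc hc' hs hs' /PhiP r /PhiP r'.
by apply: PhiE; [exact: cG|exact: cH|apply: rel_lin => //; [exact: r|exact: r']].
Qed.

End CohomologyRelation.

(** * The Dolbeault complex and flabby resolutions as resolutions of holomorphic forms *)

Section DolbeaultSheaves.
Variables (R : realType) (n : nat) (X : topologicalType) (A : complex_atlas R n X).
Variable p : nat.
Local Notation C := (Cplx R).
Implicit Types (U V W : set X).

Definition Epsh (q : nat) : psh C X.
Proof.
unshelve refine (@Psh C X (fun U => @Defs.form R n X A p q) (fun U => @smooth_forms R n X A p q U)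
  (fun U V s => form_res V s) _ _ _ _ _ _ _ _).
- by move=> U; exact: smooth0.
- by move=> U a s t; exact: smooth_lin.
- by move=> U V s oU oV VU; exact: smooth_res.
- by move=> U V a s t _ _ _ _ _; exact: form_res_lin.
- by move=> U s _; exact: smooth_res_id.
- by move=> U V W s _ _ _ _ WV _; exact: form_res_comp.
- by move=> I V t _; exact: smooth_sep.
- by move=> I V s oV hs; exact: smooth_glue.
Defined.

Lemma holo_lin U a (s t : @Defs.form R n X A p 0) : open U -> holo_forms U s -> holo_forms U t ->
  holo_forms U (a *: s + t).
Proof.
move=> oU /(holo_formsE _ oU)[h1 h2] /(holo_formsE _ oU)[g1 g2]; apply/(holo_formsE _ oU).
by split; [exact: smooth_lin|rewrite dbar_form_lin // h2 g2 scaler0 addr0].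
Qed.

Lemma holo_res U V (s : @Defs.form R n X A p 0) : open U -> open V -> V `<=` U ->
  holo_forms U s -> holo_forms V (form_res V s).
Proof.
move=> oU oV VU /(holo_formsE _ oU)[h1 h2]; apply/(holo_formsE _ oV).
split; first exact: smooth_res h1.
by rewrite -(dbar_res s oU oV VU) h2; exact: (@prs0 _ _ (Epsh 1) U V oU oV VU).
Qed.

Definition Opsh : psh C X.
Proof.
unshelve refine (@Psh C X (fun U => @Defs.form R n X A p 0) (fun U => @holo_forms R n X A p U)
  (fun U V s => form_res V s) _ _ _ _ _ _ _ _).
- move=> U oU; apply/(holo_formsE _ oU); split; first exact: smooth0.
  have s0 := @smooth0 _ _ _ A p 0%N U oU; have := dbar_form_lin (-1) oU s0 s0.
  by rewrite scaler0 addr0 scaleN1r addNr.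
- by move=> U a s t; exact: holo_lin.
- by move=> U V s; exact: holo_res.
- by move=> U V a s t _ _ _ _ _; exact: form_res_lin.
- by move=> U s oU /(holo_formsE _ oU)[h _]; exact: smooth_res_id.
- by move=> U V W s _ _ _ _ WV _; exact: form_res_comp.
- move=> I V t oV /(holo_formsE _ (bigcup_open (fun i _ => oV i)))[h _]; exact: smooth_sep.
- move=> I V s oV hs e; have oU := bigcup_open (fun i (_ : setT i) => oV i).
  have [t ht et] := smooth_glue oV (fun i => ((holo_formsE _ (oV i)).1 (hs i)).1) e.
  exists t => //; apply/(holo_formsE _ oU); split=> //.
  apply: (smooth_sep (smooth_dbar oU ht)) => i.
  rewrite (dbar_res t oU (oV i)) ?et; last by move=> x Vx; exists i.
  exact: ((holo_formsE _ (oV i)).1 (hs i)).2.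
Defined.

Definition Eaug : shmap Opsh (Epsh 0).
Proof.
unshelve refine (@Shmap C X Opsh (Epsh 0) (fun U s => s) _ _ _) => //.
by move=> U s oU /(holo_formsE _ oU)[].
Defined.

Definition Edbar q : shmap (Epsh q) (Epsh q.+1).
Proof.
unshelve refine (@Shmap C X (Epsh q) (Epsh q.+1) (fun U s => dbar U s) _ _ _).
- by move=> U s; exact: smooth_dbar.
- by move=> U a s t; exact: dbar_form_lin.
- by move=> U V s oU oV VU _; exact: dbar_res.
Defined.

Definition Eecs : ecs Opsh.
Proof.
unshelve refine (@Ecs C X Opsh Epsh Eaug Edbar _ _ _ _ _) => //.
- by move=> U s oU /(holo_formsE _ oU)[].
- by move=> q U s; exact: dbar_dbar.
- move=> U s oU hs ds x Ux; exists U, s; split=> //; first exact/holo_formsE.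
  exact: smooth_res_id.
- move=> q U s oU hs ds x Ux; exact: dbar_exact.
Defined.

Section OfResolution.
Variable G : flabby_resolution A p.

Definition Gaug : shmap Opsh (psh_of_sheaf (res_sheaf G 0)).
Proof.
unshelve refine (@Shmap C X Opsh (psh_of_sheaf (res_sheaf G 0)) (fun U s => res_aug G U s) _ _ _) => //.
- by move=> U a s t; exact: res_aug_linear.
- by move=> U V s; exact: res_aug_rst.
Defined.

Definition Gd q : shmap (psh_of_sheaf (res_sheaf G q)) (psh_of_sheaf (res_sheaf G q.+1)).
Proof.
unshelve refine (@Shmap C X (psh_of_sheaf (res_sheaf G q)) (psh_of_sheaf (res_sheaf G q.+1))
  (fun U s => res_d G q U s) _ _ _) => //.
- by move=> U a s t _ _ _; exact: linearP.
- by move=> U V s oU oV VU _; exact: res_d_rst.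
Defined.

Definition Gecs : ecs Opsh.
Proof.
unshelve refine (@Ecs C X Opsh (fun q => psh_of_sheaf (res_sheaf G q)) Gaug Gd _ _ _ _ _).
- by move=> U s; exact: res_aug_inj.
- by move=> U s; exact: res_d_aug.
- by move=> q U s oU _; exact: res_d_d.
- move=> U s oU _ ds x Ux; have [V [om [h1 h2 h3 h4 h5]]] := res_exact0 oU ds Ux.
  by exists V, om.
- move=> q U s oU _ ds x Ux; have [V [t [h1 h2 h3 h4]]] := res_exactS oU ds Ux.
  by exists V, t.
Defined.

Lemma Gecs_flabby q : pflabby (et Gecs q).
Proof. by move=> U s oU _; have [t ht] := res_flabby s oU; exists t. Qed.

End OfResolution.

Definition cmap_dolb (F J : flabby_resolution A p) (c : comparison F J) : cmap Eecs (Gecs J).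
Proof.
unshelve refine (@Cmap C X Opsh Eecs (Gecs J) (fun q => @Shmap C X (Epsh q)
  (psh_of_sheaf (res_sheaf J q)) (fun U xi => cmp_dolb c U xi) _ _ _) _ _) => //=.
- by move=> U a s t; exact: cmp_dolb_linear.
- by move=> U V s; exact: cmp_dolb_rst.
- by move=> U s; exact: cmp_dolb_aug.
- by move=> q U s; exact: cmp_dolb_d.
Defined.

Definition cmap_res (F J : flabby_resolution A p) (c : comparison F J) : cmap (Gecs F) (Gecs J).
Proof.
unshelve refine (@Cmap C X Opsh (Gecs F) (Gecs J) (fun q => @Shmap C X
  (psh_of_sheaf (res_sheaf F q)) (psh_of_sheaf (res_sheaf J q))
  (fun U s => cmp_res c q U s) _ _ _) _ _) => //=.
- by move=> U a s t _ _ _; exact: linearP.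
- by move=> U V s oU oV VU _; exact: cmp_res_rst.
- by move=> U s; exact: cmp_res_aug.
- by move=> q U s oU _; exact: cmp_res_d.
Defined.

(** The value at [y] is the form restricted to the one-point set of [y], so that all values lie in
    one fixed module and a form is recovered from them. *)
Definition iota : shmap Opsh (@fpsh C X (@Defs.form R n X A p 0)).
Proof.
unshelve refine (@Shmap C X Opsh (@fpsh C X (@Defs.form R n X A p 0)) (fun U s =>
  (fun y : {x | U x} => form_res [set sval y] s) : {x | U x} -> @Defs.form R n X A p 0) _ _ _) => //.
- by move=> U a s t _ _ _; apply/funext => y; exact: form_res_lin.
- move=> U V s oU oV VU hs; apply/funext => y; have Uy : U (sval y) := VU _ (svalP y).
  apply: etrans (ext0_in _ (exist U (sval y) Uy)) _; symmetry.
  by apply: form_res_comp => _ ->; exact: svalP.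
Defined.

Lemma iota_inj U (s : amb Opsh U) : open U -> pin s -> iota U s = 0 -> s = 0.
Proof.
move=> oU /(holo_formsE _ oU)[/smooth_formsE[h1 _ _] _] e; apply: form_eq => i z v w.
have [hz|nz] := pselect (chart_image i U z); last by rewrite h1.
have /chart_imageP[k1 k2 k3] := hz.
have e1 : form_res [set chart_inv i z] s = 0.
  exact: (congr1 (fun f : {x | U x} -> _ => f (exist _ (chart_inv i z) k2)) e).
by rewrite -(form_res_in (V := [set chart_inv i z]) s) ?e1 //; apply/chart_imageP.
Qed.

Let Lr := Lres iota_inj.

Lemma dL_is_linear q U : linear (dL iota q U).
Proof.
move=> a s t; apply/funext => y.
have e : ext0 (a *: s + t) = a *: (ext0 s : X -> LM X (@Defs.form R n X A p 0) q) + ext0 t.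
  by apply/funext => x; exact: ext0_lin.
exact: (etrans (congr1 _ e) (@qmap_lin C (X -> LM X (@Defs.form R n X A p 0) q) _ a _ _)).
Qed.

Definition dL_linear q U :
    {linear fsec (LM X (@Defs.form R n X A p 0) q) U -> fsec (LM X (@Defs.form R n X A p 0) q.+1) U} :=
  HB.pack (dL iota q U : fsec _ U -> fsec _ U)
    (GRing.isLinear.Build C _ _ *:%R (dL iota q U) (@dL_is_linear q U)).

(** The auxiliary resolution in the format of the statement, so that it can itself be the common
    resolution in [canonically_related]. *)
Definition Lfr : flabby_resolution A p.
Proof.
unshelve refine (@Build_flabby_resolution R n X A p
  (fun q => fsheaf X (LM X (@Defs.form R n X A p 0) q)) _ dL_linear (fun U s => iota U s)
  _ _ _ _ _ _ _ _).
- by move=> q; exact: fsheaf_flabby.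
- by move=> q U V s oU oV VU; exact: (pf_rs (dL iota q) oU oV VU I).
- by move=> U a om eta oU ho he; exact: (pf_lin iota a oU ho he).
- by move=> U V om oU oV VU ho; exact: (pf_rs iota oU oV VU ho).
- by move=> U om oU ho; exact: iota_inj.
- by move=> U om oU ho; exact: (@e_ad _ _ _ Lr U om oU ho).
- by move=> q U s oU; exact: (@e_dd _ _ _ Lr q U s oU I).
- move=> U s oU ds x Ux; have [V [om [h1 h2 h3 h4 h5]]] := @e_ex0 _ _ _ Lr U s oU I ds x Ux.
  by exists V, om.
- move=> q U s oU ds x Ux; have [V [t [h1 h2 h3 _ h4]]] := @e_exS _ _ _ Lr q U s oU I ds x Ux.
  by exists V, t.
Defined.

Lemma Lfr_injective q : sh_injective (et (Gecs Lfr) q).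
Proof. exact: (@Lres_injective _ _ _ _ _ iota_inj q). Qed.

End DolbeaultSheaves.

Lemma corr0_lin (K : fieldType) (X : topologicalType) (O : psh K X) (E F L : ecs O)
    (al : cmap E L) (be : cmap F L) a xi s xi' s' : pin xi -> pin s -> pin xi' -> pin s' ->
  cm al 0 setT xi = cm be 0 setT s -> cm al 0 setT xi' = cm be 0 setT s' ->
  cm al 0 setT (a *: xi + xi') = cm be 0 setT (a *: s + s').
Proof. by move=> h1 g1 h2 g2 e e'; rewrite !pf_lin ?e ?e' //; exact: openT. Qed.

Section Pairs.
Variables (K : pzRingType) (V W : lmodType K).

Lemma fst_lin a (c c' : (V * W)%type) : fst (a *: c + c') = a *: c.1 + c'.1.
Proof. by []. Qed.

Lemma snd_lin a (c c' : (V * W)%type) : snd (a *: c + c') = a *: c.2 + c'.2.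
Proof. by []. Qed.

Lemma pair_lin a (x x' : V) (y y' : W) :
  (a *: x + x', a *: y + y') = a *: (x, y) + (x', y').
Proof. by []. Qed.

End Pairs.

(** * The canonical isomorphism *)

Section Conclusion.
Variables (R : realType) (n : nat) (X : topologicalType) (A : complex_atlas R n X).
Hypothesis hX : hausdorff_space X.
Hypothesis sc : @second_countable X.
Variables (p : nat) (X' : set X) (F : flabby_resolution A p).
Hypothesis oX' : open X'.
Local Notation C := (Cplx R).
Local Notation E := (Eecs A p).
Local Notation L := (Gecs (Lfr A p)).
Local Notation G := (Gecs F).

Let lc U x (oU : open U) (Ux : U x) := @local_compact R n X A U x oU Ux.
Let cc U (oU : open U) := @countable_compact_cover R n X A U sc oU.

Lemma Eecs_soft q : soft (et E q).
Proof. by move=> N Q s oN cQ QN hs; exact: smooth_soft. Qed.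

Section Maps.
Variables (al : cmap E L) (be : cmap G L).

(** A [comparison] asks for linear maps on every set, whereas [be] is linear on open sets only; 0 is
    the default elsewhere. *)
Definition extend_map q U (s : res_sheaf F q U) : res_sheaf (Lfr A p) q U :=
  if pselect (open U) then cm be q U s else 0.

Lemma extend_mapE q U s : open U -> extend_map (q := q) s = cm be q U s.
Proof. by move=> oU; rewrite /extend_map; case: pselect. Qed.

Lemma extend_map_is_linear q U : linear (@extend_map q U).
Proof.
move=> a s t; have [oU|nU] := pselect (open U).
  rewrite !extend_mapE //; exact: (@pf_lin _ _ _ _ (cm be q) U a s t oU I I).
have e x : @extend_map q U x = 0 by rewrite /extend_map; case: pselect.
by rewrite !e scaler0 addr0.
Qed.

Definition extend_linear q U : {linear res_sheaf F q U -> res_sheaf (Lfr A p) q U} :=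
  HB.pack (@extend_map q U)
    (GRing.isLinear.Build C _ _ *:%R (@extend_map q U) (@extend_map_is_linear q U)).

Definition comparison_Lfr : comparison F (Lfr A p).
Proof.
unshelve refine (@Build_comparison R n X A p F (Lfr A p) (fun q U s => cm al q U s)
  extend_linear _ _ _ _ _ _ _).
- by move=> q U a s t oU hs ht; exact: (@pf_lin _ _ _ _ (cm al q) U a s t oU hs ht).
- by move=> q U V s oU oV VU hs; exact: (@pf_rs _ _ _ _ (cm al q) U V s oU oV VU hs).
- by move=> q U s oU hs; exact: (@cm_d _ _ _ _ _ al q U s oU hs).
- by move=> U s oU hs; exact: (@cm_aug _ _ _ _ _ al U s oU hs).
- move=> q U V s oU oV VU; rewrite /= !extend_mapE //.
  exact: (@pf_rs _ _ _ _ (cm be q) U V s oU oV VU I).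
- move=> q U s oU; rewrite /= !extend_mapE //.
  exact: (@cm_d _ _ _ _ _ be q U s oU I).
- move=> U s oU hs; rewrite /= !extend_mapE //.
  exact: (@cm_aug _ _ _ _ _ be U s oU hs).
Defined.

Definition rel q : ambient (relative_dolbeault A p X') q -> res_sheaf F q setT -> Prop :=
  match q return ambient (relative_dolbeault A p X') q -> res_sheaf F q setT -> Prop with
  | 0 => fun xi s => cm al 0 setT xi.1 = cm be 0 setT s
  | r.+1 => fun xi s => @corr _ _ _ E G L al be X' r xi.1 xi.2 s
  end.

Lemma cocyclesE r (xi : ambient (relative_dolbeault A p X') r.+1) :
  cocycles xi <-> @relE _ _ _ E X' r xi.1 xi.2.
Proof.
split=> [[[h1 h2] e]|[h1 h2 e1 e2]].
  split=> //; first exact: (congr1 fst e).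
  by apply/eqP; rewrite -subr_eq0; apply/eqP; exact: (congr1 snd e).
split; first by split.
by congr pair; [exact: e1|apply/eqP; rewrite subr_eq0; apply/eqP; exact: e2].
Qed.

Lemma cocycles0E (xi : ambient (relative_dolbeault A p X') 0) :
  cocycles xi <-> [/\ pin (xi.1 : amb (et E 0) setT), xi.2 = 0, ed E 0 setT (xi.1 : amb (et E 0) setT) = 0 &
    prs X' (xi.1 : amb (et E 0) setT) = 0].
Proof.
split=> [[[h1 h2] e]|[h1 h2 e1 e2]].
  by split=> //; [exact: (congr1 fst e)|exact: (congr1 snd e)].
by split; [split|congr pair; [exact: e1|exact: e2]].
Qed.

Lemma cocyclesF q (s : ambient (relative_sections F X') q) : cocycles s <-> @relF _ _ _ G X' q s.
Proof. by split=> [[h1 h2]|[_ h1 h2]]; split. Qed.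

Lemma coboundariesE r (xi : ambient (relative_dolbeault A p X') r.+1) :
  coboundaries xi <-> @cobE _ _ _ E X' r xi.1 xi.2.
Proof.
case: r xi => [|r] [x1 x2]; split=> /=.
- move=> [[z1 z2] [h1 _] e]; exists z1 => //; split; first exact: (esym (congr1 fst e)).
  exact: (esym (congr1 snd e)).
- by move=> [z hz [e1 e2]]; exists (z, 0); [exact: (conj hz erefl)|exact: (f_equal2 pair (esym e1) (esym e2))].
- move=> [[z1 z2] [h1 h2] e]; exists z1 => //; split; first exact: (esym (congr1 fst e)).
  by exists z2 => //; exact: (esym (congr1 snd e)).
- by move=> [z hz [e1 [w hw e2]]]; exists (z, w); [exact: (conj hz hw)|exact: (f_equal2 pair (esym e1) (esym e2))].
Qed.

Lemma coboundariesF r (s : ambient (relative_sections F X') r.+1) :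
  coboundaries s <-> @cobF _ _ _ G X' r s.
Proof.
split=> [[t ht <-]|[t [_ ht] ->]]; first by exists t.
by exists t.
Qed.

Lemma vartheta0_lin a (c c' : rdolb_ambient A p 0) : smooth_forms setT c.1 ->
  smooth_forms setT c'.1 ->
  vartheta X' (a *: c + c') = a *: vartheta X' c + vartheta X' c'.
Proof.
move=> h g; have e1 := dbar_form_lin a (@openT X) h g; have e2 := form_res_lin X' a c.1 c'.1.
have f1 : fst (a *: c + c') = a *: c.1 + c'.1 := fst_lin a c c'.
rewrite /vartheta f1 e1 e2; exact: (pair_lin a _ _ _ _).
Qed.

Lemma varthetaS_lin q a (c c' : rdolb_ambient A p q.+1) : smooth_forms setT c.1 ->
  smooth_forms setT c'.1 -> smooth_forms X' c.2 -> smooth_forms X' c'.2 ->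
  vartheta X' (a *: c + c') = a *: vartheta X' c + vartheta X' c'.
Proof.
move=> h1 g1 h2 g2; have e1 := dbar_form_lin a (@openT X) h1 g1.
have e2 := form_res_lin X' a c.1 c'.1; have e3 := dbar_form_lin a oX' h2 g2.
have e4 : form_res X' (a *: c.1 + c'.1) - dbar X' (a *: c.2 + c'.2) =
    a *: (form_res X' c.1 - dbar X' c.2) + (form_res X' c'.1 - dbar X' c'.2).
  by rewrite e2 e3 scalerBr opprD addrACA.
have f1 : fst (a *: c + c') = a *: c.1 + c'.1 := fst_lin a c c'.
have f2 : snd (a *: c + c') = a *: c.2 + c'.2 := snd_lin a c c'.
rewrite /vartheta f1 f2 e1 e4; exact: (pair_lin a _ _ _ _).
Qed.

Lemma rdolb_cochains0_subspace :
  @lin_subspace C (rdolb_ambient A p 0) (rdolb_cochains (A := A) (p := p) X' (q := 0)).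
Proof.
have oT := @openT X; split; first by split; [exact: smooth0|].
move=> a s t [h1 h2] [g1 g2]; split.
  exact: (eq_ind_r _ (smooth_lin a oT h1 g1) (fst_lin a s t)).
by apply: etrans (snd_lin a s t) _; rewrite h2 g2 scaler0 addr0.
Qed.

Lemma rdolb_cochainsS_subspace q :
  @lin_subspace C (rdolb_ambient A p q.+1) (rdolb_cochains (A := A) (p := p) X' (q := q.+1)).
Proof.
have oT := @openT X; split; first by split; exact: smooth0.
move=> a s t [h1 h2] [g1 g2]; split.
  exact: (eq_ind_r _ (smooth_lin a oT h1 g1) (fst_lin a s t)).
exact: (eq_ind_r _ (smooth_lin a oX' h2 g2) (snd_lin a s t)).
Qed.

Lemma vartheta_lin q a (c c' : rdolb_ambient A p q) : rdolb_cochains X' c ->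
  rdolb_cochains X' c' -> vartheta X' (a *: c + c') = a *: vartheta X' c + vartheta X' c'.
Proof.
case: q c c' => [|q] c c' [h1 h2] [g1 g2]; first exact: vartheta0_lin.
exact: varthetaS_lin.
Qed.

Lemma linear_dolbeault : linear_complex (relative_dolbeault A p X').
Proof.
split; last exact: vartheta_lin.
by case=> [|q]; [exact: rdolb_cochains0_subspace|exact: rdolb_cochainsS_subspace].
Qed.

Lemma linear_sections : linear_complex (relative_sections F X').
Proof.
split=> [q|q a s t _ _]; last exact: linearP.
by split=> [|a s t /= hs ht]; [exact: raddf0|rewrite linearP /= hs ht scaler0 addr0].
Qed.

Let fG q : pflabby (et G q) := @Gecs_flabby R n X A p F q.
Let fL q : pflabby (et L q) := @Gecs_flabby R n X A p (Lfr A p) q.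

(** From left to right, [L] itself with the chosen maps is a comparison; from right to left, any
    comparison is moved to [L] by [corr_change]. *)
Lemma rel_canonical q (xi : ambient (relative_dolbeault A p X') q)
    (s : ambient (relative_sections F X') q) : cocycles xi -> cocycles s ->
  (rel xi s <-> canonically_related X' xi s).
Proof.
move=> hxi hs; split.
  case: q xi s hxi hs => [|r] xi s hxi hs.
    move=> e; exists (Lfr A p), comparison_Lfr.
    exact: (etrans e (esym (extend_mapE s (@openT X)))).
  move=> [t [_ rt et]]; exists (Lfr A p), comparison_Lfr; exists t; split; first exact: rt.
  exact: (etrans (congr1 (fun u => cm al r.+1 setT xi.1 - u) (extend_mapE s (@openT X))) et).
move=> [J [c hc]].
have [hS h0] := corr_change al be Eecs_soft fG fL oX' (@Lfr_injective R n X A p)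
  (cmap_dolb c) (cmap_res c) (@Gecs_flabby R n X A p J).
case: q xi s hxi hs hc => [|r] xi s hxi hs hc.
  by have [h1 _ h2 _] := (cocycles0E xi).1 hxi; apply: h0 h1 h2 ((cocyclesF s).1 hs) hc.
apply: hS ((cocyclesE xi).1 hxi) ((cocyclesF s).1 hs) _.
by move: hc => [t [t1 t2]]; exists t.
Qed.

Lemma coh_iso_rel q : exists Phi : set (ambient (relative_dolbeault A p X') q) ->
    set (ambient (relative_sections F X') q),
  coh_iso Phi /\ forall xi s, cocycles xi -> cocycles s ->
    (Phi (coh_class xi) = coh_class s <-> rel xi s).
Proof.
have oT := @openT X; have XT := @subsetT _ X'.
apply: (coh_iso_of_relation linear_dolbeault linear_sections); case: q => [|r].
- move=> a c c' s s' /cocycles0E[h1 _ _ _] /cocyclesF[g1 _ _] /cocycles0E[h2 _ _ _] /cocyclesF[g2 _ _] e e'.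
  exact: (etrans (congr1 (cm al 0 setT) (fst_lin a c c')) (corr0_lin a h1 g1 h2 g2 e e')).
- move=> a c c' s s' /cocyclesE h1 /cocyclesF g1 /cocyclesE h2 /cocyclesF g2 e e'.
  have hc := corr_lin oX' a h1 g1 e h2 g2 e'.
  rewrite -(fst_lin a c c') -(snd_lin a c c') in hc; exact: hc.
- move=> xi /cocycles0E[h1 h2 h3 h4].
  by have [s hs e] := corr0_to_F hX lc cc al be oX' h1 h3 h4; exists s => //; exact/cocyclesF.
- move=> xi /cocyclesE h.
  have [s hs e] := corr_to_F hX lc cc al be fG fL oX' h.
  by exists s => //; exact/cocyclesF.
- move=> s /cocyclesF hs; have [xi [h1 h2 h3] e] := corr0_to_E hX lc cc al be oX' hs.
  by exists ((xi, 0) : ambient (relative_dolbeault A p X') 0) => //; apply/cocycles0E.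
- move=> s /cocyclesF hs; have [xi [eta [h e]]] := corr_to_E hX lc cc al be Eecs_soft fL oX' hs.
  by exists ((xi, eta) : ambient (relative_dolbeault A p X') r.+1) => //; apply/cocyclesE.
- move=> xi s /cocycles0E[h1 h2 h3 h4] /cocyclesF hs e.
  have [e1 e2] := corr0_inj h1 h3 hs e.
  split=> /= h0; first by apply: e1; rewrite h0.
  by case: xi h2 {h1 h3 h4 e e1} e2 => x1 x2 /= -> e2; rewrite e2.
- move=> xi s /cocyclesE h /cocyclesF hs e; split.
    move=> /coboundariesE hc; apply/coboundariesF.
    exact: (corr_cobE hX lc cc fG fL oX' h hs e hc).
  move=> /coboundariesF hc; apply/coboundariesE.
  exact: (corr_cobF hX lc cc Eecs_soft fL oX' h hs e hc).
- by move=> s _ ->; exact: (etrans (pf0 (cm al 0) oT) (esym (pf0 (cm be 0) oT))).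
(* If [s] is the coboundary of [s'], then [- be s'] witnesses that 0 is related to [s]: it vanishes
   on [X'] together with [s']. *)
- move=> s _ /coboundariesF[s' [hs' rs'] ->].
  have e : prs X' (cm be r setT s') = 0 by rewrite (pf_rs _ oT oX' XT hs') rs' (pf0 _ oX').
  have p0 := pin0 (et L r) oT; have pb := pf_in (cm be r) oT hs'.
  have e3 : prs X' (0 - cm be r setT s') = 0.
    by rewrite (prsB oT oX' XT p0 pb) e (prs0 (et L r) oT oX' XT) subrr.
  have e4 := pfB (ed L r) oT p0 pb.
  have e5 : cm al r.+1 setT 0 = ed L r setT 0.
    exact: (etrans (pf0 (cm al r.+1) oT) (esym (pf0 (ed L r) oT))).
  exists (0 - cm be r setT s'); split; first exact: I.
    exact: (etrans e3 (esym (pf0 (cm al r) oX'))).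
  exact: (etrans (f_equal2 (fun u v => u - v) e5 (cm_d be oT hs')) (esym e4)).
Qed.

End Maps.

Lemma relative_dolbeault_iso q : exists Phi : set (ambient (relative_dolbeault A p X') q) ->
    set (ambient (relative_sections F X') q),
  coh_iso Phi /\ forall xi s, cocycles xi -> cocycles s ->
    (Phi (coh_class xi) = coh_class s <-> canonically_related X' xi s).
Proof.
have softG r : soft (et G r) by exact: pflabby_soft (@Gecs_flabby R n X A p F r).
have [al _] := chain_map_exists (@Lfr_injective R n X A p) Eecs_soft.
have [be _] := chain_map_exists (@Lfr_injective R n X A p) softG.
have [Phi [iso hPhi]] := coh_iso_rel al be q; exists Phi; split=> // xi s hxi hs.
by rewrite hPhi // rel_canonical.
Qed.

End Conclusion.

Theorem theorem7p4 (R : realType) (n : nat) (X : topologicalType)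
    (A : complex_atlas R n X) (hausdorffX : hausdorff_space X)
    (countableX : @second_countable X) (X' : set X) (openX' : open X')
    (p q : nat) (F : flabby_resolution A p) :
  exists Phi : set (ambient (relative_dolbeault A p X') q) ->
               set (ambient (relative_sections F X') q),
    coh_iso Phi /\
    forall (xi : ambient (relative_dolbeault A p X') q)
           (s : ambient (relative_sections F X') q),
      cocycles xi -> cocycles s ->
      (Phi (coh_class xi) = coh_class s <-> canonically_related X' xi s).
Proof. exact: relative_dolbeault_iso. Qed.
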